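(* Let $Q$ be a Dynkin quiver or an oriented cycle. Then the map $$\Psi\colon \mathbb{Q}\mathcal{M}(Q)\to \mathcal{H}_0(Q),\qquad \mathcal{A}\mapsto \sum_{[M]\in[\mathcal{A}]} u_{[M]},$$ from the monoid algebra over $\mathbb{Q}$ of the generic extension monoid $\mathcal M(Q)$ to the generic Hall algebra of $Q$ specialised at $q=0$, is an isomorphism of graded $\mathbb{Q}$-algebras.
   Context: Quivers are finite. A Dynkin quiver is one whose underlying graph is (a disjoint union of) simply-laced Dynkin diagrams $A_n,D_n,E_6,E_7,E_8$. An oriented cycle is a quiver $C_n$ ($n\ge 0$) with $n+1$ vertices arranged in a cycle and all arrows pointing in one direction. All representations are finite dimensional and nilpotent (i.e. have a filtration with subquotients among the simples $S_i$, $i\in Q_0$, concentrated at one vertex with all arrows acting as zero). Parametrisation: for such $Q$ the isomorphism classes of representations over any field are parametrised by a combinatorial set $\Sigma$ independent of the field. For $Q$ Dynkin, $\Sigma$ is the set of functions $\Delta_+\to\mathbb{N}$ on the positive roots (multiplicities of the indecomposables, by Gabriel's theorem); for $C_n$, $\Sigma$ is the set of tuples $(\pi^{(0)},\dots,\pi^{(n)})$ of partitions, the tuple corresponding to $\bigoplus_{i}\bigoplus_k S_i[\pi^{(i)}_k]$, where $S_i[l]$ is the unique indecomposable nilpotent representation of length $l$ with socle $S_i$. For $\alpha\in\Sigma$ and a field $K$ let $M(\alpha,K)$ be a representation of class $\alpha$. Hall algebra: for representations $M,N,X$ over a finite field put $F^X_{MN}=\#\{U\le X : U\cong N,\ X/U\cong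 M\}$. There are polynomials $f^{\gamma}_{\alpha\beta}\in\mathbb{Q}[q]$ (Hall polynomials) with $F^{M(\gamma,K)}_{M(\alpha,K)M(\beta,K)}=f^\gamma_{\alpha\beta}(|K|)$ for every finite field $K$. The generic Hall algebra $\mathcal{H}_q(Q)$ is the free $\mathbb{Q}[q]$-module with basis $u_\alpha$, $\alpha\in\Sigma$, and product $u_\alpha\diamond u_\beta=\sum_\gamma f^\gamma_{\alpha\beta}(q)u_\gamma$. $\mathcal{H}_0(Q)$ is the $\mathbb{Q}$-algebra with basis $u_\alpha$ ($\alpha\in\Sigma$) and structure constants $f^\gamma_{\alpha\beta}(0)$. One writes $u_{[M]}=u_\alpha$ if $M$ has class $\alpha$. It is graded by dimension vector. Generic extension monoid: fix an algebraically closed field $K$. For a dimension vector $\underline d$ let $\mathrm{Rep}(\underline d)=\bigoplus_{\alpha:i\to j}\mathrm{Hom}_K(K^{d_i},K^{d_j})$, with the conjugation action of $\mathrm{GL}_{\underline d}=\prod_i \mathrm{GL}(K^{d_i})$. As a set, $\mathcal{M}(Q)$ is the disjoint union over $\underline d$ of the sets of closed irreducible $\mathrm{GL}_{\underline d}$-stable subvarieties of $\mathrm{Rep}(\underline d)$ (consisting of nilpotent representations), with product $\mathcal{A}*\mathcal{B}=\{M : \text{there is a short exact sequence } 0\to B\to M\to A\to 0 \text{ with } A\in\mathcal{A}, B\in\mathcal{B}\}$; this is a monoid with unit $\mathrm{Rep}(\underline 0)$, graded by dimension vector. $[\mathcal{A}]$ denotes the set of isomorphism classes of representations in $\mathcal{A}$,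 regarded as a subset of $\Sigma$. *)

(* Defs.v *)
From HB Require Import structures.
From mathcomp Require Import all_boot all_order all_algebra finmap.
From mathcomp Require Import boolp classical_sets fsbigop.
From mathcomp Require Import mpoly monalg.

Set Implicit Arguments.
Unset Strict Implicit.
Unset Printing Implicit Defensive.

Import GRing.Theory.

Local Open Scope ring_scope.
Local Open Scope classical_set_scope.

Record quiver := Quiver {
  vert : finType;
  arrow : finType;
  src : arrow -> vert;
  tgt : arrow -> vert }.

(* [DynA n], [DynD n] are the diagrams A_(n+1), D_(n+4). *)
Inductive diagram := DynA of nat | DynD of nat | DynE6 | DynE7 | DynE8.

Definition diag_rank (D : diagram) : nat :=
  match D with
  | DynA n => n.+1 | DynD n => n.+4 | DynE6 => 6 | DynE7 => 7 | DynE8 => 8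
  end.

(* The vertices are 0, ..., m-1.  In types D and E the vertices 0, ..., m-2 form
   a path, and m-1 is joined to a branch vertex b of that path. *)
Definition diag_edge (D : diagram) (u v : nat) : bool :=
  let branched (m b : nat) :=
    ((v == u.+1) && (v < m.-1)%N) || ((u == b) && (v == m.-1)) in
  match D with
  | DynA n => v == u.+1
  | DynD n => branched n.+4 n.+1
  | DynE6 => branched 6%N 2%N
  | DynE7 => branched 7%N 2%N
  | DynE8 => branched 8%N 2%N
  end.

Definition diag_adj (D : diagram) (u v : nat) : bool :=
  diag_edge D u v || diag_edge D v u.

Definition edges_between (Q : quiver) (x y : vert Q) : {set arrow Q} :=
  [set a | ((src a == x) && (tgt a == y)) || ((src a == y) && (tgt a == x))]%SET.

(* The underlying multigraph is the disjoint union of the diagrams [D j]; the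
   case u = v excludes loops. *)
Definition is_dynkin (Q : quiver) : Prop :=
  exists (m : nat) (D : 'I_m -> diagram)
         (phi : {j : 'I_m & 'I_(diag_rank (D j))} -> vert Q),
    bijective phi /\
    forall u v, #|edges_between (phi u) (phi v)| =
      ((tag u == tag v) && diag_adj (D (tag u)) (tagged u) (tagged v)) :> nat.

Definition cyclic_quiver (n : nat) : quiver :=
  @Quiver 'I_n.+1 'I_n.+1 id (@ordS n.+1).

Definition dimvec (Q : quiver) := vert Q -> nat.
Definition dim0 (Q : quiver) : dimvec Q := fun _ => 0%N.
Definition dimD (Q : quiver) (d e : dimvec Q) : dimvec Q :=
  fun i => (d i + e i)%N.

(* Row vector convention: the arrow a acts by v |-> v *m M a. *)
Definition rep (Q : quiver) (K : fieldType) (d : dimvec Q) : Type :=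
  forall a : arrow Q, 'M[K]_(d (src a), d (tgt a)).

Definition packed_rep (Q : quiver) (K : fieldType) : Type :=
  {d : dimvec Q & rep K d}.

Section Representations.
Variables (Q : quiver) (K : fieldType).
Implicit Types d e : dimvec Q.

Definition is_hom d e (M : rep K d) (N : rep K e)
    (f : forall i, 'M[K]_(d i, e i)) : Prop :=
  forall a, M a *m f (tgt a) = f (src a) *m N a.

Definition iso d e (M : rep K d) (N : rep K e) : Prop :=
  exists (f : forall i, 'M[K]_(d i, e i)) (g : forall i, 'M[K]_(e i, d i)),
    [/\ is_hom M N f, is_hom N M g,
        forall i, f i *m g i = 1%:M & forall i, g i *m f i = 1%:M].

Definition injective_hom d e (M : rep K d) (N : rep K e)
    (f : forall i, 'M[K]_(d i, e i)) : Prop :=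
  is_hom M N f /\ forall i, row_free (f i).

Definition surjective_hom d e (M : rep K d) (N : rep K e)
    (f : forall i, 'M[K]_(d i, e i)) : Prop :=
  is_hom M N f /\ forall i, row_full (f i).

(* There is a short exact sequence 0 -> N -> X -> M -> 0. *)
Definition ses d e c (N : rep K d) (X : rep K e) (M : rep K c) : Prop :=
  exists (f : forall i, 'M[K]_(d i, e i)) (g : forall i, 'M[K]_(e i, c i)),
    [/\ injective_hom N X f, surjective_hom X M g &
        forall i, (f i == kermx (g i))%MS].

Definition rep0 : rep K (@dim0 Q) := fun a => 0.

Definition repD d e (M : rep K d) (N : rep K e) : rep K (dimD d e) :=
  fun a => block_mx (M a) 0 0 (N a).

Definition dsum (s : seq (packed_rep Q K)) : packed_rep Q K :=
  foldr (fun M N => existT (rep K) _ (repD (tagged M) (tagged N)))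
        (existT (rep K) _ rep0) s.

Definition iszero d (M : rep K d) : Prop := forall i, d i = 0%N.

Definition indecomposable d (M : rep K d) : Prop :=
  ~ iszero M /\
  forall e c (N : rep K e) (L : rep K c),
    iso M (repD N L) -> iszero N \/ iszero L.

Definition simple_rep (i : vert Q) : rep K (fun j => (j == i) : nat) :=
  fun a => 0.

(* M has a filtration with exactly l nonzero subquotients, all of the form
   S_i. *)
Inductive nilp_length : forall d, rep K d -> nat -> Prop :=
| NilpZero d (M : rep K d) : iszero M -> nilp_length M 0
| NilpStep d e (M : rep K d) (N : rep K e) i l :
    ses N M (simple_rep i) -> nilp_length N l -> nilp_length M l.+1.

Definition nilpotent d (M : rep K d) : Prop := exists l, nilp_length M l.

(* The sum of all simple subrepresentations of the nilpotent representation M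
   is isomorphic to S_i.  The simple nilpotent representations are the S_j. *)
Definition socle_is d (M : rep K d) (i : vert Q) : Prop :=
  exists f, injective_hom (simple_rep i) M f /\
    forall j g, injective_hom (simple_rep j) M g ->
      forall k, (g k <= f k)%MS.

End Representations.

(* [pclass M x]: the representation M has class x.  [pzero] is the class of the
   zero representation. *)
Record parametrisation (Q : quiver) := Parametrisation {
  psort :> choiceType;
  pdim : psort -> dimvec Q;
  pzero : psort;
  pclass : forall (K : fieldType) (d : dimvec Q), rep K d -> psort -> Prop }.

Arguments pclass {Q S K d} : rename.

Section Dynkin.
Variable Q : quiver.

Definition tits_form (b : {ffun vert Q -> nat}) : int :=
  \sum_i (b i)%:Z ^+ 2 - \sum_(a : arrow Q) (b (src a))%:Z * (b (tgt a))%:Z.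

(* For Q Dynkin, the roots are the integral vectors of Tits form 1. *)
Definition posroot := {b : {ffun vert Q -> nat} | tits_form b == 1}.

Definition root_dim (b : posroot) : dimvec Q := fun i => val b i.

(* For Q Dynkin there are only finitely many positive roots, so finite support
   is no restriction. *)
Definition dynkin_class := {fsfun posroot -> nat with 0%N}.

Definition dynkin_dim (alpha : dynkin_class) : dimvec Q :=
  fun i => (\sum_(b <- finsupp alpha) alpha b * root_dim b i)%N.

Definition dynkin_has_class (K : fieldType) (d : dimvec Q) (M : rep K d)
    (alpha : dynkin_class) : Prop :=
  exists N : forall b : posroot, rep K (root_dim b),
    (forall b, indecomposable (N b)) /\
    iso M (tagged (dsum (flatten
      [seq nseq (alpha b) (existT (rep K) _ (N b)) | b <- finsupp alpha]))).

Definition dynkin_param : parametrisation Q :=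
  @Parametrisation Q dynkin_class dynkin_dim [fsfun] dynkin_has_class.

End Dynkin.

Definition is_int_partition (p : seq nat) : bool :=
  sorted geq p && (0%N \notin p).

Definition int_partition := {p : seq nat | is_int_partition p}.

Definition empty_partition : int_partition :=
  exist (fun p => is_int_partition p) [::] isT.

Section Cycle.
Variable n : nat.

Definition cycle_class := {ffun 'I_n.+1 -> int_partition}.

(* As arrows go from j to j+1, the composition factors of S_i[l] are, from the
   socle upwards, S_i, S_(i-1), ..., S_(i-l+1), with indices modulo n+1. *)
Definition cycle_dim (pi : cycle_class) : dimvec (cyclic_quiver n) :=
  fun j : 'I_n.+1 =>
    (\sum_(i < n.+1) \sum_(l <- val (pi i))
       count (fun k => k + j == i %[mod n.+1]) (iota 0 l))%N.

(* M is isomorphic to S_i[l]. *)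
Definition is_string (K : fieldType) (M : packed_rep (cyclic_quiver n) K)
    (i : 'I_n.+1) (l : nat) : Prop :=
  [/\ indecomposable (tagged M), nilp_length (tagged M) l
    & @socle_is (cyclic_quiver n) K _ (tagged M) i].

Definition cycle_has_class (K : fieldType) (d : dimvec (cyclic_quiver n))
    (M : rep K d) (pi : cycle_class) : Prop :=
  exists N : 'I_n.+1 -> nat -> packed_rep (cyclic_quiver n) K,
    (forall i k, (k < size (val (pi i)))%N ->
       is_string (N i k) i (nth 0%N (val (pi i)) k)) /\
    iso M (tagged (dsum
      [seq N i k | i <- enum 'I_n.+1, k <- iota 0 (size (val (pi i)))])).

Definition cycle_param : parametrisation (cyclic_quiver n) :=
  @Parametrisation (cyclic_quiver n) cycle_class cycle_dim
    [ffun=> empty_partition] cycle_has_class.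

End Cycle.

Inductive dynkin_or_cycle : forall Q : quiver, parametrisation Q -> Prop :=
| DynkinCase Q : is_dynkin Q -> dynkin_or_cycle (dynkin_param Q)
| CycleCase n : dynkin_or_cycle (cycle_param n).

Section HallNumber.
Variables (Q : quiver) (K : finFieldType).

Definition vecfam (d : dimvec Q) := {dffun forall i, {set 'rV[K]_(d i)}}.

(* U is a subrepresentation of X isomorphic to N. *)
Definition is_sub_iso d e (X : rep K d) (U : vecfam d) (N : rep K e) : Prop :=
  exists f, injective_hom N X f /\
    forall i, U i = [set v | (v <= f i)%MS]%SET.

(* U is a subrepresentation of X with X / U isomorphic to M. *)
Definition is_quot_iso d e (X : rep K d) (U : vecfam d) (M : rep K e) : Prop :=
  exists g, surjective_hom X M g /\
    forall i, U i = [set v | v *m g i == 0]%SET.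

Definition hall_number c d e (M : rep K c) (N : rep K d) (X : rep K e) : nat :=
  #|[set U : vecfam e | `[< is_sub_iso X U N /\ is_quot_iso X U M >]]%SET|.

End HallNumber.

(* [f alpha beta gamma] is the Hall polynomial with upper index gamma.  These
   conditions determine f, as there are infinitely many finite fields. *)
Definition hall_polynomials (Q : quiver) (S : parametrisation Q)
    (f : S -> S -> S -> {poly rat}) : Prop :=
  forall (K : finFieldType) (alpha beta gamma : S) (c d e : dimvec Q)
         (M : rep K c) (N : rep K d) (X : rep K e),
    pclass M alpha -> pclass N beta -> pclass X gamma ->
    (hall_number M N X)%:R = (f alpha beta gamma).[#|K|%:R].

Section GenericExtensions.
Variables (Q : quiver) (K : fieldType).

Definition rep_index (d : dimvec Q) : finType :=
  {a : arrow Q & ('I_(d (src a)) * 'I_(d (tgt a)))%type}.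

Definition rep_coord (d : dimvec Q) (M : rep K d) (c : rep_index d) : K :=
  M (tag c) (tagged c).1 (tagged c).2.

Definition rep_eval (d : dimvec Q) (p : mpoly #|rep_index d| K) (M : rep K d) : K :=
  p.@[fun k => rep_coord M (enum_val k)].

Definition zclosed (d : dimvec Q) (Z : set (rep K d)) : Prop :=
  exists I : set (mpoly #|rep_index d| K),
    Z = [set M | forall p, I p -> rep_eval p M = 0].

Definition zirreducible (d : dimvec Q) (Z : set (rep K d)) : Prop :=
  Z !=set0 /\
  forall Z1 Z2, zclosed Z1 -> zclosed Z2 ->
    Z `<=` Z1 `|` Z2 -> Z `<=` Z1 \/ Z `<=` Z2.

Definition GLact (d : dimvec Q) (g : forall i, 'M[K]_(d i)) (M : rep K d) :
    rep K d :=
  fun a => g (src a) *m M a *m invmx (g (tgt a)).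

Definition GLstable (d : dimvec Q) (Z : set (rep K d)) : Prop :=
  forall g, (forall i, g i \in unitmx) -> forall M, Z M -> Z (GLact g M).

Record genvar := Genvar {
  gdim : dimvec Q;
  gset : set (rep K gdim);
  gset_closed : zclosed gset;
  gset_irreducible : zirreducible gset;
  gset_stable : GLstable gset;
  gset_nilpotent : forall M, gset M -> nilpotent M }.

Lemma genvar0_closed : zclosed [set: rep K (@dim0 Q)].
Proof. by exists set0; apply/seteqP; split=> M // _ p []. Qed.

Lemma genvar0_irreducible : zirreducible [set: rep K (@dim0 Q)].
Proof.
have rep0E (M : rep K (@dim0 Q)) : M = @rep0 Q K.
  apply: functional_extensionality_dep => a.
  by apply/matrixP => i; have := ltn_ord i.
split=> [|Z1 Z2 _ _ sZ]; first by exists (@rep0 Q K).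
by case: (sZ (@rep0 Q K) I) => Z0; [left|right] => M _; rewrite (rep0E M).
Qed.

Lemma genvar0_stable : GLstable [set: rep K (@dim0 Q)].
Proof. by []. Qed.

Lemma genvar0_nilpotent (M : rep K (@dim0 Q)) :
  [set: rep K (@dim0 Q)] M -> nilpotent M.
Proof. by move=> _; exists 0%N; exact: NilpZero. Qed.

Definition genvar0 : genvar :=
  Genvar genvar0_closed genvar0_irreducible genvar0_stable genvar0_nilpotent.

Definition ext_set (d e : dimvec Q) (A : set (rep K d)) (B : set (rep K e)) :
    set (rep K (dimD d e)) :=
  [set X | exists M N, [/\ A M, B N & ses N X M]].

Definition is_ext_product (A B C : genvar) : Prop :=
  existT (fun d => set (rep K d)) (gdim C) (@gset C) =
  existT (fun d => set (rep K d)) (dimD (gdim A) (gdim B))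
         (ext_set (@gset A) (@gset B)).

HB.instance Definition _ := gen_eqMixin genvar.
HB.instance Definition _ := gen_choiceMixin genvar.

(* The default value is irrelevant once [ext_closed] holds. *)
Definition ext_product (A B : genvar) : genvar :=
  xget genvar0 [set C | is_ext_product A B C].

Definition ext_closed : Prop :=
  forall A B : genvar, exists C : genvar, is_ext_product A B C.

End GenericExtensions.

Section BasedAlgebras.
Variable Q : quiver.

(* The bilinear map on the free module {malg rat[I]} with value [op a b] on the
   pair of basis elements a, b. *)
Definition bilin_ext (I : choiceType) (op : I -> I -> {malg rat[I]})
    (x y : {malg rat[I]}) : {malg rat[I]} :=
  \sum_(a <- msupp x) \sum_(b <- msupp y) (mcoeff a x * mcoeff b y) *: op a b.

Definition homogeneous (I : choiceType) (deg : I -> dimvec Q) (d : dimvec Q)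
    (x : {malg rat[I]}) : Prop :=
  forall a, a \in msupp x -> deg a = d.

Record graded_algebra (I : choiceType) (deg : I -> dimvec Q)
    (mul : {malg rat[I]} -> {malg rat[I]} -> {malg rat[I]})
    (one : {malg rat[I]}) : Prop := GradedAlgebra {
  ga_linl : forall z, linear (fun x => mul x z);
  ga_linr : forall z, linear (mul z);
  ga_mulA : associative mul;
  ga_mul1l : left_id one mul;
  ga_mul1r : right_id one mul;
  ga_deg1 : homogeneous deg (@dim0 Q) one;
  ga_degM : forall d e x y, homogeneous deg d x -> homogeneous deg e y ->
              homogeneous deg (dimD d e) (mul x y) }.

Record graded_algebra_iso (I J : choiceType)
    (degI : I -> dimvec Q) (degJ : J -> dimvec Q)
    (mulI : {malg rat[I]} -> {malg rat[I]} -> {malg rat[I]})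
    (mulJ : {malg rat[J]} -> {malg rat[J]} -> {malg rat[J]})
    (oneI : {malg rat[I]}) (oneJ : {malg rat[J]})
    (psi : {malg rat[I]} -> {malg rat[J]}) : Prop := GradedAlgebraIso {
  gai_linear : linear psi;
  gai_bij : bijective psi;
  gai_mul : {morph psi : x y / mulI x y >-> mulJ x y};
  gai_one : psi oneI = oneJ;
  gai_deg : forall d x, homogeneous degI d x <-> homogeneous degJ d (psi x) }.

End BasedAlgebras.

Section TwoAlgebras.
Variables (Q : quiver) (S : parametrisation Q) (K : fieldType).

Definition QM_mul : {malg rat[genvar Q K]} -> {malg rat[genvar Q K]} ->
    {malg rat[genvar Q K]} :=
  bilin_ext (fun A B => << ext_product A B >>).

Definition QM_one : {malg rat[genvar Q K]} := << genvar0 Q K >>.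

(* The sum is finite: Hall polynomials vanish unless the dimension vectors add
   up, and there are finitely many classes of each dimension vector. *)
Definition H0_mul (f : S -> S -> S -> {poly rat}) :
    {malg rat[S]} -> {malg rat[S]} -> {malg rat[S]} :=
  bilin_ext (fun alpha beta =>
    \sum_(gamma \in [set: S]) << (f alpha beta gamma).[0] *g gamma >>).

Definition H0_one : {malg rat[S]} := << pzero S >>.

Definition classes (A : genvar Q K) : set S :=
  [set gamma | exists M, @gset Q K A M /\ pclass M gamma].

Definition Psi (x : {malg rat[genvar Q K]}) : {malg rat[S]} :=
  \sum_(A <- msupp x) mcoeff A x *: \sum_(gamma \in classes A) (<< gamma >> : {malg rat[S]}).

End TwoAlgebras.

(* Main.v *)
From HB Require Import structures.
Require Import Defs.
From mathcomp Require Import all_boot all_order all_algebra all_field finmap.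
From mathcomp Require Import boolp classical_sets fsbigop.
From mathcomp Require Import mpoly monalg.
From mathcomp Require Import zify ring lra.

Set Implicit Arguments.
Unset Strict Implicit.
Unset Printing Implicit Defensive.

Import Order.TTheory GRing.Theory Num.Theory.
Local Open Scope ring_scope.

(* Words [w] in dimension vectors index the sets R_w of representations having a
   flag with subquotients of the prescribed dimension vectors; for the cyclic
   quiver the subquotients are moreover required to be semisimple.  These sets
   satisfy R_w * R_w' = R_(w ++ w').  A product of irreducible sets is
   irreducible: two of its members can be joined through the group and the
   extension space by a rational line.

   The heart of the proof is a numerical test t(w, alpha), independent of the
   field, such that M(alpha) lies in R_w iff t(w, alpha) holds, and such that
   over the field with p elements the number of w-flags of M(alpha) is congruent
   to t(w, alpha) modulo p.  An integer-valued polynomial congruent to the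
   constant t at all primes p takes the value t at 0, so the product
   u_(w_1) <> ... <> u_(w_n) in H_0 is the sum of the u_alpha with t(w, alpha).
   Each class alpha has a word om(alpha) for which R_om(alpha) contains alpha and
   otherwise only classes of larger height.  Hence the R_om(alpha) exhaust the
   monoid, by counting classes of a given dimension vector, and Psi is
   unitriangular.

   In the Dynkin case flags are transported along reflection functors at sinks:
   the number of flags modulo q is unchanged when the dimensions at the sink are
   replaced by the least possible ones, because modulo q only the subspace in the
   most special position of a Grassmannian contributes.  After finitely many
   reflections every representation is killed.  In the cyclic case the test
   follows the ranks of the paths, again replaced by their minimal values. *)

(** * Subquotients of stable families of subspaces *)

(** There is no field with zero elements, so the value of a Hall polynomial at 0 is not a count; it
    is reached through congruences at the prime fields, and for this the test must not depend on the
    field. Counting does not show that R_w is closed: for that the test is expressed by dimensions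
    of kernels, which are semicontinuous. Semisimple letters keep R_w nilpotent in the cyclic case;
    over a Dynkin quiver every representation is nilpotent and arbitrary letters are allowed. That
    products in the monoid are again closed is a consequence, drawn once every element is known to
    be some R_w. The parametrisation is also part of what is proved: Gabriel's theorem and the
    classification of strings hold over any field, and decompositions are unique because additive
    invariants, the dimensions of iterated reflections or the ranks of paths, separate multisets of
    indecomposables; the same invariants feed the test. To avoid new bases at each step of a flag,
    representations are handled as subquotients of families of subspaces in one ambient space. *)

Section LinearAlgebra.
Variable F : fieldType.
Implicit Types V W : vectType F.

Lemma lf0 V W (f : 'Hom(V, W)) : f 0 = 0.
Proof. exact: linear0. Qed.

Lemma lfD V W (f : 'Hom(V, W)) u v : f (u + v) = f u + f v.
Proof. exact: linearD. Qed.

Lemma lfB V W (f : 'Hom(V, W)) u v : f (u - v) = f u - f v.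
Proof. exact: linearB. Qed.

Lemma lfZ V W (f : 'Hom(V, W)) a v : f (a *: v) = a *: f v.
Proof. exact: linearZ. Qed.

Definition mxlf m n (M : 'M[F]_(m, n)) : 'Hom('rV[F]_m, 'rV[F]_n) :=
  linfun (mulmxr M).

Lemma mxlfE m n (M : 'M[F]_(m, n)) v : mxlf M v = v *m M.
Proof. by rewrite lfunE. Qed.

Lemma lin1_mxE m n (l : 'Hom('rV[F]_m, 'rV[F]_n)) v : v *m lin1_mx l = l v.
Proof. by rewrite mul_rV_lin1. Qed.

Lemma eq_mulrV m n (A B : 'M[F]_(m, n)) :
  (forall v : 'rV_m, v *m A = v *m B) -> A = B.
Proof. by move=> eqAB; apply/row_matrixP => i; rewrite !rowE. Qed.

Lemma mem_rowsp m n (M : 'M[F]_(m, n)) v :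
  (v \in (mxlf M @: fullv)%VS) = (v <= M)%MS.
Proof.
apply/memv_imgP/submxP => [[u _ ->]|[u ->]]; exists u; rewrite ?mxlfE //.
exact: memvf.
Qed.

(** Quotient spaces are never formed: a map out of a quotient of [U] is a factorisation through a
    map [h] with the right kernel on [U]. *)
Lemma lfactor V W1 W2 (h : 'Hom(V, W1)) (k : 'Hom(V, W2)) (U : {vspace V}) :
  (U :&: lker h <= lker k)%VS ->
  exists l : 'Hom(W1, W2), {in U, forall v, k v = l (h v)}.
Proof.
(* [s] is a linear section of [h] over [h(U)] with values in [U], so [v] and [s (h v)] differ by an
   element of the kernel of [h] in [U]. *)
move=> sUk; pose s := (projv U \o (h \o projv U)^-1)%VF.
exists (k \o s)%VF => v Uv; rewrite comp_lfunE.
have hs : h (s (h v)) = h v.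
  rewrite /s comp_lfunE -[h (projv U _)]comp_lfunE limg_lfunVK //.
  by apply/memv_imgP; exists v; rewrite ?memvf // comp_lfunE projv_id.
have : v - s (h v) \in (U :&: lker h)%VS.
  have sU : s (h v) \in U by rewrite /s comp_lfunE memv_proj.
  by rewrite memv_cap memv_ker lfB hs subrr eqxx andbT memvB.
by move/(subvP sUk); rewrite memv_ker lfB subr_eq0 => /eqP.
Qed.

Lemma dim_rV n : dim 'rV[F]_n = n.
Proof. exact: mul1n. Qed.

Definition rowcoord V n (X : n.-tuple V) (v : V) : 'rV[F]_n :=
  \row_i coord X i v.

Fact rowcoord_is_linear V n (X : n.-tuple V) : linear (rowcoord X).
Proof. by move=> a u v; apply/rowP => i; rewrite !mxE linearP. Qed.

HB.instance Definition _ V n (X : n.-tuple V) :=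
  GRing.isLinear.Build F V 'rV[F]_n _ (rowcoord X) (rowcoord_is_linear X).

(** Coordinates on the quotient of [U] by [W], read on a complement [C] of [W] in [U]; [qreal_ex]
    realises subquotients by such maps. *)
Lemma lcoord V (U W : {vspace V}) n : (W <= U)%VS ->
  \dim U = (\dim W + n)%N ->
  exists g : 'Hom(V, 'rV[F]_n), (g @: U = fullv)%VS /\ (U :&: lker g = W)%VS.
Proof.
move=> sWU dU; pose C := (U :\: W)%VS.
have /eqP dC : \dim C == n.
  by have := dimv_cap_compl U W; rewrite (capv_idPr sWU) dU => /addnI ->.
move: dC dU => <-{n} dU.
have CW : (C :&: W = 0)%VS by exact: capv_diff.
have CWU : (C + W = U)%VS by rewrite addv_diff; apply/addv_idPl.
pose g : 'Hom(V, 'rV[F]_(\dim C)) :=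
  (linfun (rowcoord (vbasis C)) \o daddv_pi C W)%VF.
have kg : (U :&: lker g = W)%VS.
  apply/eqP; rewrite eqEsubv; apply/andP; split; apply/subvP => v.
    rewrite memv_cap memv_ker comp_lfunE lfunE => /andP[Uv /eqP v0].
    have pv : daddv_pi C W v = 0.
      rewrite (coord_vbasis (memv_pi C W v)) big1 // => i _.
      by move/rowP/(_ i): v0; rewrite !mxE => ->; rewrite scale0r.
    rewrite -(daddv_pi_add CW (w := v)) ?CWU //.
    by rewrite pv add0r memv_pi.
  move=> Wv; rewrite memv_cap (subvP sWU) //= memv_ker comp_lfunE lfunE.
  suff -> : daddv_pi C W v = 0 by rewrite linear0.
  have := daddv_pi_add CW (w := v); rewrite CWU (subvP sWU) // => /(_ isT).
  rewrite [daddv_pi W C v]daddv_pi_id ?(capvC W) //.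
  by move/eqP; rewrite -[X in _ == X]add0r (inj_eq (addIr _)) => /eqP.
exists g; split=> //; apply/eqP; rewrite eqEdim subvf /= dimvf.
have := limg_ker_dim g U; rewrite kg dU => /addnI ->.
by rewrite dim_rV.
Qed.

End LinearAlgebra.

(** * Stable families of subspaces and their flags *)

Section Families.
Variables (I E : finType) (sr tg : E -> I) (F : fieldType) (V : vectType F).
Variable A : E -> 'End(V).
Implicit Types U W sp : {ffun I -> {vspace V}}.

(** Vertices and arrows are bare finite types, so that a reflection can change [sr] and [tg] alone.
    One ambient space serves all vertices; the spaces [U i] may overlap in it. *)
Definition stable U := [forall x, (A x @: U (sr x) <= U (tg x))%VS].

Lemma stableP U :
  reflect (forall x v, v \in U (sr x) -> A x v \in U (tg x)) (stable U).
Proof.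
apply: (iffP forallP) => [sU x v Uv|sU x].
  exact: (subvP (sU x)) (memv_img _ Uv).
by apply/subvP => _ /memv_imgP[v Uv ->]; exact: sU.
Qed.

Definition fle U W := [forall i, (U i <= W i)%VS].

Lemma fleP U W : reflect (forall i v, v \in U i -> v \in W i) (fle U W).
Proof. by apply: (iffP forallP) => UW i; apply/subvP/UW. Qed.

Lemma fle_refl U : fle U U. Proof. by apply/fleP. Qed.

Lemma fle_trans U1 U2 U3 : fle U1 U2 -> fle U2 U3 -> fle U1 U3.
Proof. by move/fleP=> h1 /fleP h2; apply/fleP => i v /h1/h2. Qed.

Lemma fle_anti U W : fle U W -> fle W U -> U = W.
Proof.
move/forallP=> UW /forallP WU; apply/ffunP => i; apply/eqP.
by rewrite eqEsubv UW WU.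
Qed.

Lemma fle_dim U W : fle U W -> (forall i, \dim (W i) <= \dim (U i))%N -> U = W.
Proof.
move/forallP=> UW dWU; apply/ffunP => i; apply/eqP.
by rewrite eqEdim UW dWU.
Qed.

Definition fam0 : {ffun I -> {vspace V}} := [ffun => 0%VS].

Lemma fam0_stable : stable fam0.
Proof.
by apply/stableP => x v; rewrite !ffunE !memv0 => /eqP->; rewrite lf0.
Qed.

Lemma fle0 U : fle fam0 U.
Proof. by apply/forallP => i; rewrite ffunE sub0v. Qed.

(* One step of a flag from [sp] to [U]; in the strict case the quotient is
   semisimple, all its arrows being zero. *)
Definition step (strict : bool) (d : I -> nat) sp U :=
  [&& stable U, fle U sp, [forall i, \dim (sp i) == (\dim (U i) + d i)%N]
    & strict ==> [forall x, (A x @: sp (sr x) <= U (tg x))%VS]].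

Fixpoint aflag strict (w : seq (I -> nat)) sp W : Prop :=
  match w with
  | [::] => sp = W
  | d :: w' => exists U, step strict d sp U /\ aflag strict w' U W
  end.

Lemma aflag_fle strict w sp W : aflag strict w sp W -> fle W sp.
Proof.
elim: w sp => [|d w IHw] sp /=; first by move->; exact: fle_refl.
by case=> U [/and4P[_ Usp _ _]] /IHw; move/fle_trans; apply.
Qed.

Lemma aflag_stable strict w sp W : stable sp -> aflag strict w sp W -> stable W.
Proof.
elim: w sp => [|d w IHw] sp ssp /=; first by move<-.
by case=> U [/and4P[sU _ _ _]] /IHw; apply.
Qed.

Lemma aflag_cat strict w1 w2 sp W : aflag strict (w1 ++ w2) sp W <->
  exists U, aflag strict w1 sp U /\ aflag strict w2 U W.
Proof.
elim: w1 sp => [|d w1 IHw] sp /=; first by split=> [|[U [->]]] //; exists sp.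
split=> [[U [sU /IHw[U2 [h1 h2]]]]|[U2 [[U [sU h1]] h2]]].
  by exists U2; split=> //; exists U.
by exists U; split=> //; apply/IHw; exists U2.
Qed.

End Families.

Arguments fam0 {I F V}.

(** * Finiteness of the set of subspaces over a finite field *)

Section FiniteSpaces.
Variables (F : finFieldType) (V : vectType F).

Definition vs2fmx (U : {vspace V}) : 'M[F]_(dim V) :=
  VectorInternalTheory.vs2mx U.

Lemma vs2fmxK : cancel vs2fmx VectorInternalTheory.mx2vs.
Proof. exact: VectorInternalTheory.vs2mxK. Qed.

HB.instance Definition _ := Countable.copy {vspace V} (can_type vs2fmxK).
HB.instance Definition _ : isFinite {vspace V} := CanIsFinite vs2fmxK.

End FiniteSpaces.

(** The enumerative counterpart of [aflag] with bottom [fam0]: one summand for each choice of the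
    next member. *)
Fixpoint nfl (I E : finType) (sr tg : E -> I) (F : finFieldType)
    (V : vectType F) (A : E -> 'End(V)) strict (w : seq (I -> nat))
    (sp : {ffun I -> {vspace V}}) : nat :=
  match w with
  | [::] => sp == fam0
  | d :: w' => \sum_(U | step sr tg A strict d sp U) nfl sr tg A strict w' U
  end.

(** * Representations as subquotients of stable families *)

Section Realise.
Variables (Q : quiver) (F : fieldType) (V : vectType F).
Variable A : arrow Q -> 'End(V).
Implicit Types U W sp : {ffun vert Q -> {vspace V}}.
Local Notation stab := (stable (@src Q) (@tgt Q) A).

Definition qrealg sp W (d : dimvec Q) (M : rep F d)
    (g : forall i, 'Hom(V, 'rV[F]_(d i))) : Prop :=
  [/\ forall i, (g i @: sp i = fullv)%VS,
      forall i, (sp i :&: lker (g i) = W i)%VS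
    & forall x v, v \in sp (src x) -> g (tgt x) (A x v) = g (src x) v *m M x].

(* [M] is isomorphic to the quotient [sp / W]. *)
Definition qreal sp W (d : dimvec Q) (M : rep F d) : Prop :=
  exists g, qrealg sp W M g.

Lemma qrealg_onto sp W d (M : rep F d) g i v : qrealg sp W M g ->
  exists2 u, u \in sp i & v = g i u.
Proof. by case=> on _ _; apply/memv_imgP; rewrite on memvf. Qed.

Lemma qrealg_ker sp W d (M : rep F d) g i u : qrealg sp W M g ->
  u \in sp i -> (g i u == 0) = (u \in W i).
Proof. by case=> _ <- _ spu; rewrite memv_cap spu memv_ker. Qed.

Lemma qreal_fle sp W d (M : rep F d) : qreal sp W M -> fle W sp.
Proof. by case=> g [_ k _]; apply/forallP => i; rewrite -k capvSl. Qed.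

Lemma qreal_dim sp W d (M : rep F d) i : qreal sp W M ->
  \dim (sp i) = (\dim (W i) + d i)%N.
Proof.
case=> g [on k _]; rewrite -(limg_ker_dim (g i) (sp i)) k on dimvf.
by rewrite dim_rV.
Qed.

Lemma qreal_ex sp W (d : dimvec Q) : stab sp -> stab W -> fle W sp ->
  (forall i, \dim (sp i) = (\dim (W i) + d i)%N) ->
  exists M : rep F d, qreal sp W M.
Proof.
move=> /stableP ssp /stableP sW Wsp dsp.
pose g i := projT1 (cid (lcoord (forallP Wsp i) (dsp i))).
have gP i : (g i @: sp i = fullv)%VS /\ (sp i :&: lker (g i) = W i)%VS.
  exact: (projT2 (cid (lcoord (forallP Wsp i) (dsp i)))).
have Hl x : exists l : 'Hom('rV[F]_(d (src x)), 'rV[F]_(d (tgt x))),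
    {in sp (src x), forall v, g (tgt x) (A x v) = l (g (src x) v)}.
  have [|l lP] := @lfactor _ _ _ _ (g (src x)) (g (tgt x) \o A x)%VF (sp (src x)).
    apply/subvP => v; rewrite (gP _).2 => Wv.
    rewrite memv_ker comp_lfunE -memv_ker.
    by have := sW x v Wv; rewrite -(gP _).2 memv_cap => /andP[].
  by exists l => v spv; rewrite -lP // comp_lfunE.
pose l x := projT1 (cid (Hl x)).
exists (fun x => lin1_mx (l x)), g; split=> [i|i|x v spv].
- by case: (gP i).
- by case: (gP i).
by rewrite lin1_mxE; exact: (projT2 (cid (Hl x))).
Qed.

(** The universal property of the quotient of [sp] by [W], expressed in the coordinates [g]. *)
Lemma qrealg_hom sp W d (M : rep F d) g e (N : rep F e)
    (h : forall i, 'Hom(V, 'rV[F]_(e i))) :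
  stab sp -> qrealg sp W M g -> (forall i, W i <= lker (h i))%VS ->
  (forall x v, v \in sp (src x) -> h (tgt x) (A x v) = h (src x) v *m N x) ->
  exists f : forall i, 'M[F]_(d i, e i), is_hom M N f /\
    forall i u, u \in sp i -> h i u = g i u *m f i.
Proof.
move=> /stableP ssp gP hW hA.
have Hl i : exists l : 'Hom('rV[F]_(d i), 'rV[F]_(e i)),
    {in sp i, forall v, h i v = l (g i v)}.
  by apply: lfactor; case: gP => _ -> _; exact: hW.
pose l i := projT1 (cid (Hl i)).
have lP i u : u \in sp i -> h i u = g i u *m lin1_mx (l i).
  by rewrite lin1_mxE; exact: (projT2 (cid (Hl i))).
exists (fun i => lin1_mx (l i)); split=> // x; apply: eq_mulrV => v.
have [u spu ->] := qrealg_onto v gP.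
rewrite !mulmxA -lP // -hA // lP; last exact: ssp.
by case: gP => _ _ ->.
Qed.

Lemma qreal_iso sp W d (M : rep F d) e (N : rep F e) :
  qreal sp W M -> iso M N -> qreal sp W N.
Proof.
case=> g gP [f [f' [fh _ ff' f'f]]].
exists (fun i => (mxlf (f i) \o g i)%VF); split=> [i|i|x v spv].
- apply/eqP; rewrite eqEsubv subvf; apply/subvP => v _.
  have [u spu uE] := qrealg_onto (v *m f' i) gP.
  apply/memv_imgP; exists u => //.
  by rewrite comp_lfunE mxlfE -uE -mulmxA f'f mulmx1.
- apply/eqP; rewrite eqEsubv; apply/andP; split; apply/subvP => v.
    rewrite memv_cap memv_ker comp_lfunE mxlfE => /andP[spv /eqP v0].
    rewrite -(qrealg_ker gP) //.
    by rewrite -[g i v]mulmx1 -ff' mulmxA v0 mul0mx.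
  move=> Wv; have spv : v \in sp i.
    by case: gP => _ k _; move: Wv; rewrite -k memv_cap => /andP[].
  rewrite memv_cap spv memv_ker comp_lfunE.
  by move: Wv; rewrite -(qrealg_ker gP) // => /eqP->; rewrite lf0 eqxx.
rewrite !comp_lfunE !mxlfE; case: gP => _ _ -> //.
by rewrite -!mulmxA fh.
Qed.

(** Both coordinate systems kill [W], so each descends through the other; since the coordinates are
    onto, the two descents are inverse to each other. *)
Lemma qreal_uniq sp W d (M : rep F d) e (N : rep F e) : stab sp ->
  qreal sp W M -> qreal sp W N -> iso M N.
Proof.
move=> ssp [g gP] [h hP].
have kg i : (W i <= lker (g i))%VS by case: gP => _ <- _; exact: capvSr.
have kh i : (W i <= lker (h i))%VS by case: hP => _ <- _; exact: capvSr.
have [_ _ gA] := gP; have [_ _ hA] := hP.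
have [f [fh fP]] := qrealg_hom ssp gP kh hA.
have [f' [f'h f'P]] := qrealg_hom ssp hP kg gA.
exists f, f'; split=> // i; apply: eq_mulrV => v; rewrite mulmx1 mulmxA.
  by have [u spu ->] := qrealg_onto v gP; rewrite -fP // -f'P.
by have [u spu ->] := qrealg_onto v hP; rewrite -f'P // -fP.
Qed.

(** Half of the correspondence theorem: the subrepresentation [g(U)] of the subquotient [X] is, as a
    representation, [U] modulo [W]. *)
Lemma qreal_sub sp W d (X : rep F d) g U e (N : rep F e) :
  qrealg sp W X g -> fle W U -> fle U sp -> stab U ->
  (exists f, injective_hom N X f /\
     forall i v, (v <= f i)%MS = (v \in g i @: U i)%VS) <-> qreal U W N.
Proof.
move=> gP /fleP WU /fleP Usp sU; split=> [[f [[fh fi] fU]]|[h hP]].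
  exists (fun i => (mxlf (pinvmx (f i)) \o g i)%VF).
  have gf i u : u \in U i -> (g i u <= f i)%MS.
    by move=> Uu; rewrite fU memv_img.
  split=> [i|i|x v Uv].
  - apply/eqP; rewrite eqEsubv subvf; apply/subvP => v _.
    have : (v *m f i <= f i)%MS by exact: submxMl.
    rewrite fU => /memv_imgP[u Uu vE]; apply/memv_imgP; exists u => //.
    rewrite comp_lfunE mxlfE -vE.
    by apply: (row_free_inj (fi i)); rewrite mulmxKpV // submxMl.
  - apply/eqP; rewrite eqEsubv; apply/andP; split; apply/subvP => v.
      rewrite memv_cap memv_ker comp_lfunE mxlfE => /andP[Uv /eqP v0].
      rewrite -(qrealg_ker gP) ?Usp //.
      by rewrite -(mulmxKpV (gf i v Uv)) v0 mul0mx.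
    move=> Wv; rewrite memv_cap WU //= memv_ker comp_lfunE.
    have /eqP-> : g i v == 0 by rewrite (qrealg_ker gP) ?Usp ?WU.
    by rewrite lf0.
  rewrite !comp_lfunE !mxlfE; apply: (row_free_inj (fi _)).
  rewrite mulmxKpV; last by apply: gf; move/stableP: sU; apply.
  case: gP => _ _ -> //; last exact: Usp.
  by rewrite -mulmxA fh mulmxA mulmxKpV // gf.
have [||f [fh fP]] := @qrealg_hom U W _ N h _ X g sU hP.
- by move=> i; case: gP => _ <- _; exact: capvSr.
- by case: gP => _ _ gA x v Uv; apply: gA; exact: Usp.
exists f; split.
  split=> // i; apply/inj_row_free => v v0.
  have [u Uu vE] := qrealg_onto v hP; move: v0; rewrite vE -fP // => /eqP.
  rewrite (qrealg_ker gP) ?Usp // -(qrealg_ker hP) // => /eqP //.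
move=> i v; apply/submxP/memv_imgP => [[D ->]|[u Uu ->]].
  by have [u Uu ->] := qrealg_onto D hP; exists u; rewrite // fP.
by exists (h i u); rewrite fP.
Qed.

Lemma qreal_quot sp W d (X : rep F d) g U e (M : rep F e) :
  stab sp -> qrealg sp W X g -> fle W U -> fle U sp ->
  (exists h, surjective_hom X M h /\
     forall i v, (v *m h i == 0) = (v \in g i @: U i)%VS) <-> qreal sp U M.
Proof.
move=> ssp gP /fleP WU /fleP Usp; split=> [[h [[hh hs] hU]]|[h hP]].
  exists (fun i => (mxlf (h i) \o g i)%VF); split=> [i|i|x v spv].
  - apply/eqP; rewrite eqEsubv subvf; apply/subvP => v _.
    have /submxP[D ->] := submx_full v (hs i).
    have [u spu ->] := qrealg_onto D gP.
    by apply/memv_imgP; exists u; rewrite // comp_lfunE mxlfE.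
  - apply/eqP; rewrite eqEsubv; apply/andP; split; apply/subvP => v.
      rewrite memv_cap memv_ker comp_lfunE mxlfE hU => /andP[spv].
      case/memv_imgP=> u Uu /eqP; rewrite -subr_eq0 -lfB.
      rewrite (qrealg_ker gP); last by rewrite memvB // Usp.
      by move=> /WU vu; rewrite -(subrK u v) memvD.
    move=> Uv; rewrite memv_cap Usp //= memv_ker comp_lfunE mxlfE hU.
    exact: memv_img.
  rewrite !comp_lfunE !mxlfE; case: gP => _ _ -> //.
  by rewrite -!mulmxA hh.
have [||f [fh fP]] := @qrealg_hom sp W _ X g _ M h ssp gP.
- move=> i; apply/subvP => v /WU; case: hP => _ <- _.
  by rewrite memv_cap => /andP[].
- by case: hP.
exists f; split.
  split=> // i; rewrite -sub1mx; apply/row_subP => j.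
  have [u spu ->] := qrealg_onto (row j 1%:M) hP.
  by rewrite fP // submxMl.
move=> i v; have [u spu ->] := qrealg_onto v gP.
rewrite -fP // (qrealg_ker hP) //; apply/idP/memv_imgP => [Uu|[u' Uu']].
  by exists u.
move/eqP; rewrite -subr_eq0 -lfB (qrealg_ker gP); last by rewrite memvB // Usp.
by move/WU => uu'; rewrite -(subrK u' u) memvD.
Qed.

Definition pullback sp d (g : forall i, 'Hom(V, 'rV[F]_(d i)))
    e (f : forall i, 'M[F]_(e i, d i)) : {ffun vert Q -> {vspace V}} :=
  [ffun i => (sp i :&: g i @^-1: (mxlf (f i) @: fullv))%VS].

Lemma mem_pullback sp d (g : forall i, 'Hom(V, 'rV[F]_(d i))) e
    (f : forall i, 'M[F]_(e i, d i)) i v :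
  (v \in pullback sp g f i) = (v \in sp i) && (g i v <= f i)%MS.
Proof. by rewrite ffunE memv_cap -memv_preim mem_rowsp. Qed.

Lemma pullbackP sp W d (X : rep F d) g e (N : rep F e) f :
  stab sp -> qrealg sp W X g -> is_hom N X f ->
  [/\ fle W (pullback sp g f), fle (pullback sp g f) sp, stab (pullback sp g f)
    & forall i v, (v <= f i)%MS = (v \in g i @: pullback sp g f i)%VS].
Proof.
move=> /stableP ssp gP fh; split.
- apply/fleP => i v Wv; rewrite mem_pullback; have spv : v \in sp i.
    by case: gP => _ k _; move: Wv; rewrite -k memv_cap => /andP[].
  by move: Wv; rewrite -(qrealg_ker gP) // => /eqP->; rewrite spv sub0mx.
- by apply/fleP => i v; rewrite mem_pullback => /andP[].
- apply/stableP => x v; rewrite !mem_pullback => /andP[spv].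
  case/submxP=> D vE; rewrite ssp //=; case: gP => _ _ -> //.
  by rewrite vE -mulmxA -fh mulmxA submxMl.
move=> i v; apply/idP/memv_imgP => [vf|[u]].
  have [u spu vE] := qrealg_onto v gP; exists u => //.
  by rewrite mem_pullback spu -vE.
by rewrite mem_pullback => /andP[_ uf] ->.
Qed.

(** The working form of extensions: a short exact sequence with middle term [X] is an intermediate
    stable family, so iterated extensions become flags. *)
Lemma ses_qreal sp W d (X : rep F d) e (N : rep F e) c (M : rep F c) :
  stab sp -> qreal sp W X ->
  ses N X M <-> exists U, [/\ fle W U, fle U sp, stab U, qreal U W N & qreal sp U M].
Proof.
move=> ssp [g gP]; split=> [[f [h [fi hs fk]]]|[U [WU Usp sU qN qM]]].
  have [WU Usp sU fU] := pullbackP ssp gP fi.1.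
  exists (pullback sp g f); split=> //.
    by apply/(qreal_sub _ gP) => //; exists f.
  apply/(qreal_quot _ ssp gP) => //; exists h; split=> // i v.
  rewrite -fU (eqmxP (fk i)); apply/eqP/idP => [v0|].
    by apply/sub_kermxP.
  by move/sub_kermxP.
have [f [fi fU]] := (qreal_sub N gP WU Usp sU).2 qN.
have [h [hs hU]] := (qreal_quot M ssp gP WU Usp).2 qM.
exists f, h; split=> // i.
have fk (v : 'rV[F]__) : (v <= f i)%MS = (v <= kermx (h i))%MS.
  by rewrite fU -hU; apply/eqP/sub_kermxP.
apply/andP; split; apply/row_subP => j; first by rewrite -fk row_sub.
by rewrite fk row_sub.
Qed.

End Realise.

(** * Direct sums *)

Section IsoBasics.
Variables (Q : quiver) (F : fieldType).

Lemma iso_refl d (M : rep F d) : @iso Q F d d M M.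
Proof.
exists (fun=> 1%:M), (fun=> 1%:M); split=> [x|x|i|i]; rewrite ?mulmx1 ?mul1mx //.
Qed.

Lemma iso_sym d e (M : rep F d) (N : rep F e) : @iso Q F d e M N -> iso N M.
Proof. by case=> f [g [fh gh fg gf]]; exists g, f; split. Qed.

Lemma is_hom_comp d e c (M : rep F d) (N : rep F e) (L : rep F c) f g :
  @is_hom Q F d e M N f -> is_hom N L g -> is_hom M L (fun i => f i *m g i).
Proof. by move=> fh gh x; rewrite mulmxA fh -mulmxA gh mulmxA. Qed.

Lemma iso_trans d e c (M : rep F d) (N : rep F e) (L : rep F c) :
  @iso Q F d e M N -> iso N L -> iso M L.
Proof.
case=> f [g [fh gh fg gf]] [f' [g' [fh' gh' fg' gf']]].
exists (fun i => f i *m f' i), (fun i => g' i *m g i).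
split=> [||i|i]; try exact: is_hom_comp.
  by rewrite mulmxA -(mulmxA (f i)) fg' mulmx1 fg.
by rewrite mulmxA -(mulmxA (g' i)) gf mulmx1 gf'.
Qed.

End IsoBasics.

Section CanonicalAmbient.
Variables (Q : quiver) (F : fieldType) (d : dimvec Q).

(** Any number at least as large as all [d i] would serve. Each vertex space is embedded in the
    first [d i] coordinates, so the images overlap. *)
Definition amb_dim := (\sum_i d i)%N.

Lemma amb_dim_ge i : (d i <= amb_dim)%N.
Proof. by rewrite /amb_dim (bigD1 i) //= leq_addr. Qed.

Definition amb_in i : 'M[F]_(d i, amb_dim) := pid_mx (d i).
Definition amb_out i : 'M[F]_(amb_dim, d i) := pid_mx (d i).

Lemma amb_inK i : amb_in i *m amb_out i = 1%:M.
Proof. by rewrite pid_mx_id ?amb_dim_ge // pid_mx_1. Qed.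

Definition amb_map (X : rep F d) x : 'End('rV[F]_amb_dim) :=
  mxlf (amb_out (src x) *m X x *m amb_in (tgt x)).

Definition amb_sp : {ffun vert Q -> {vspace 'rV[F]_amb_dim}} :=
  [ffun i => (mxlf (amb_in i) @: fullv)%VS].

Lemma amb_spP i v : reflect (exists u, v = u *m amb_in i) (v \in amb_sp i).
Proof. by rewrite ffunE mem_rowsp; exact: submxP. Qed.

Lemma amb_stable X : stable (@src Q) (@tgt Q) (amb_map X) amb_sp.
Proof.
apply/stableP => x v _; apply/amb_spP.
by rewrite mxlfE mulmxA; eexists.
Qed.

Lemma amb_realg X :
  qrealg (amb_map X) amb_sp fam0 X (fun i => mxlf (amb_out i)).
Proof.
split=> [i|i|x v].
- apply/eqP; rewrite eqEsubv subvf; apply/subvP => v _.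
  apply/memv_imgP; exists (v *m amb_in i); first by apply/amb_spP; exists v.
  by rewrite mxlfE -mulmxA amb_inK mulmx1.
- apply/eqP; rewrite [fam0 _]ffunE -subv0; apply/subvP => v.
  rewrite memv_cap memv_ker memv0 mxlfE => /andP[/amb_spP[u ->]].
  by rewrite -mulmxA amb_inK mulmx1 => /eqP->; rewrite mul0mx.
move=> _; rewrite !mxlfE !mulmxA -(mulmxA _ _ (amb_out (tgt x))).
by rewrite amb_inK mulmx1.
Qed.

Lemma amb_real X : qreal (amb_map X) amb_sp fam0 X.
Proof. by eexists; exact: amb_realg. Qed.

End CanonicalAmbient.

Section HallNumberE.
Variables (Q : quiver) (F : finFieldType) (V : vectType F).
Variable A : arrow Q -> 'End(V).

(** By the correspondence theorem subrepresentations of [X] are the families between [W] and [sp].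
    Hall numbers can thus be counted in any ambient space, in particular inside a longer chain. *)
Lemma hall_numberE (sp W : {ffun vert Q -> {vspace V}}) (c d e : dimvec Q)
    (M : rep F c) (N : rep F d) (X : rep F e) :
  stable (@src Q) (@tgt Q) A sp -> qreal A sp W X ->
  hall_number M N X =
  #|[set U : {ffun vert Q -> {vspace V}} |
      [&& stable (@src Q) (@tgt Q) A U, fle W U, fle U sp,
          `[< qreal A U W N >] & `[< qreal A sp U M >]]]%SET|.
Proof.
move=> ssp [g gP].
pose img (U : {ffun vert Q -> {vspace V}}) : vecfam F e :=
  [ffun i => [set v | v \in (g i @: U i)%VS]%SET].
rewrite -(card_in_imset (f := img)) => [|U U'].
  apply: eq_card => T; apply/idP/imsetP => [|[U]]; rewrite inE.
    move/asboolP=> [[f [fi fT]] [h [hs hT]]].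
    have [WU Usp sU fU] := pullbackP ssp gP fi.1.
    exists (pullback sp g f); last first.
      by apply/ffunP => i; rewrite ffunE fT; apply/setP => v; rewrite !inE fU.
    rewrite inE sU WU Usp /=; apply/andP; split; apply/asboolP.
      by apply/(qreal_sub _ gP) => //; exists f.
    apply/(qreal_quot _ ssp gP) => //; exists h; split=> // i v.
    rewrite -fU; have /setP/(_ v) := hT i.
    by rewrite fT !inE => ->.
  case/and5P=> sU WU Usp /asboolP qN /asboolP qM ->; rewrite inE; apply/asboolP.
  have [f [fi fU]] := (qreal_sub N gP WU Usp sU).2 qN.
  have [h [hs hU]] := (qreal_quot M ssp gP WU Usp).2 qM.
  split; [exists f|exists h]; split=> // i; apply/setP => v.
    by rewrite ffunE !inE fU.
  by rewrite ffunE !inE hU.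
rewrite !inE => /and5P[_ WU Usp _ _] /and5P[_ WU' Usp' _ _].
(* Injectivity: a family between [W] and [sp] is recovered from its image, since [g i] has kernel
   [W i] on [sp i]. *)
suff sub (U1 U2 : {ffun vert Q -> {vspace V}}) : fle U1 sp -> fle U2 sp ->
    fle W U2 -> img U1 = img U2 -> fle U1 U2.
  by move=> eqU; apply: fle_anti; apply: sub.
move=> /fleP U1sp /fleP U2sp /fleP WU2 /ffunP eqU; apply/fleP => i v U1v.
have /setP/(_ (g i v)) := eqU i; rewrite !ffunE !inE memv_img // => /esym.
case/memv_imgP=> u U2u /eqP; rewrite -subr_eq0 -lfB.
rewrite (qrealg_ker gP); last by apply: memvB; [exact: U1sp|exact: U2sp].
by move/WU2 => uv; rewrite -(subrK u v) memvD.
Qed.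

End HallNumberE.

(** * Internal direct sums and decompositions *)

Section DirectSums.
Variables (Q : quiver) (F : fieldType) (V : vectType F).
Variable A : arrow Q -> 'End(V).
Implicit Types U R sp : {ffun vert Q -> {vspace V}}.
Local Notation stab := (stable (@src Q) (@tgt Q) A).

Definition dsumf sp U R := [/\ stab U, stab R,
  forall i, (U i + R i = sp i)%VS & forall i, (U i :&: R i = 0)%VS].

Lemma dsumf_stable sp U R : dsumf sp U R -> stab sp.
Proof.
case=> /stableP sU /stableP sR addUR _; apply/stableP => x v.
rewrite -!addUR => /memv_addP[u Uu [r Rr ->]].
by rewrite lfD memv_add // ?sU ?sR.
Qed.

Lemma dsumf_sym sp U R : dsumf sp U R -> dsumf sp R U.
Proof. by case=> sU sR UR UR0; split=> // i; rewrite 1?addvC 1?capvC. Qed.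

Lemma dsumf_fle sp U R : dsumf sp U R -> fle U sp /\ fle R sp.
Proof.
by case=> _ _ UR _; split; apply/forallP => i; rewrite -UR (addvSl, addvSr).
Qed.

Lemma dsumf_dim sp U R i : dsumf sp U R ->
  \dim (sp i) = (\dim (U i) + \dim (R i))%N.
Proof. by case=> _ _ <- UR0; rewrite dimv_disjoint_sum. Qed.

Lemma dsumf0 sp : stab sp -> dsumf sp sp fam0.
Proof.
by move=> ssp; split=> // [|i|i]; rewrite ?fam0_stable // ffunE ?addv0 ?capv0.
Qed.

(** Regrouping brings a summand of the complement to the front; [adec_move] permutes summands by it,
    and [indec_summand] uses it to descend into a summand. *)
Lemma dsumf_assoc sp U R U1 R1 : dsumf sp U R -> dsumf R U1 R1 ->
  let R' := [ffun i => (U i + R1 i)%VS] in dsumf sp U1 R' /\ dsumf R' U R1.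
Proof.
move=> [sU sR UR UR0] [sU1 sR1 UR1 UR10] R'.
have dR' : dsumf R' U R1.
  split=> // i; first by rewrite ffunE.
  apply/eqP; rewrite -subv0 -(UR0 i) capvS // -UR1; exact: addvSr.
split=> //; split=> // [|i|i]; first exact: dsumf_stable dR'.
  by rewrite ffunE addvA (addvC (U1 i)) -addvA UR1 UR.
apply/eqP; rewrite ffunE -subv0; apply/subvP => v.
rewrite memv_cap => /andP[U1v /memv_addP[u Uu [r R1r vE]]].
have u0 : u = 0.
  apply/eqP; rewrite -memv0 -(UR0 i) memv_cap Uu /= -UR1.
  have -> : u = v - r by rewrite vE addrK.
  by rewrite memv_add // memvN.
by rewrite -(UR10 i) memv_cap U1v vE u0 add0r.
Qed.

Lemma fam0_dimP sp : reflect (forall i, \dim (sp i) = 0%N) (sp == fam0).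
Proof.
apply: (iffP eqP) => [-> i|sp0]; first by rewrite ffunE dimv0.
by apply/ffunP => i; rewrite ffunE; apply/eqP; rewrite -dimv_eq0 sp0.
Qed.

(** Internal and external direct sums agree: an external decomposition is pulled back to the kernels
    of its two projections, and an internal one glues two coordinate systems. *)
Lemma qreal_repD sp d (X : rep F d) e (N : rep F e) c (L : rep F c) :
  stab sp -> qreal A sp fam0 X ->
  iso X (repD N L) <->
  exists U R, [/\ dsumf sp U R, qreal A U fam0 N & qreal A R fam0 L].
Proof.
move=> ssp qX.
pose pl i : 'M[F]_(dimD e c i, e i) := col_mx 1%:M 0.
pose pr i : 'M[F]_(dimD e c i, c i) := col_mx 0 1%:M.
pose il i : 'M[F]_(e i, dimD e c i) := row_mx 1%:M 0.
pose ir i : 'M[F]_(c i, dimD e c i) := row_mx 0 1%:M.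
have plD x : repD N L x *m pl (tgt x) = pl (src x) *m N x.
  by rewrite mul_block_col mul_col_mx !mulmx1 !mulmx0 mul0mx mul1mx !addr0.
have prD x : repD N L x *m pr (tgt x) = pr (src x) *m L x.
  by rewrite mul_block_col mul_col_mx !mulmx1 !mulmx0 mul0mx mul1mx !add0r.
have ilD x : il (src x) *m repD N L x = N x *m il (tgt x).
  by rewrite mul_row_block mul_mx_row !(mul1mx, mul0mx, mulmx1, mulmx0) !(addr0, add0r).
have irD x : ir (src x) *m repD N L x = L x *m ir (tgt x).
  by rewrite mul_row_block mul_mx_row !(mul1mx, mul0mx, mulmx1, mulmx0) !(addr0, add0r).
have ll i : il i *m pl i = 1%:M by rewrite mul_row_col mul1mx mul0mx addr0.
have rr i : ir i *m pr i = 1%:M by rewrite mul_row_col mul1mx mul0mx add0r.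
have lr i : il i *m pr i = 0 by rewrite mul_row_col mul0mx mulmx0 addr0.
have rl i : ir i *m pl i = 0 by rewrite mul_row_col mul0mx mulmx0 addr0.
have sum1 i : pl i *m il i + pr i *m ir i = 1%:M.
  rewrite /pl /il /pr /ir !mul_col_row !(mul1mx, mul0mx, mulmx1, mulmx0) add_block_mx.
  by rewrite !(addr0, add0r) -scalar_mx_block.
split=> [isoX|[U [R [dUR [gU gUP] [gR gRP]]]]].
  have [g gP] := qreal_iso qX isoX; have [gon gk gA] := gP.
  pose U : {ffun vert Q -> {vspace V}} :=
    [ffun i => (sp i :&: lker (mxlf (pr i) \o g i))%VS].
  pose R : {ffun vert Q -> {vspace V}} :=
    [ffun i => (sp i :&: lker (mxlf (pl i) \o g i))%VS].
  have UE i v : v \in U i = (v \in sp i) && (g i v *m pr i == 0).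
    by rewrite ffunE memv_cap memv_ker comp_lfunE mxlfE.
  have RE i v : v \in R i = (v \in sp i) && (g i v *m pl i == 0).
    by rewrite ffunE memv_cap memv_ker comp_lfunE mxlfE.
  have g0 i v : v \in sp i -> g i v *m pl i = 0 -> g i v *m pr i = 0 -> v = 0.
    move=> spv l0 r0; apply/eqP; rewrite -memv0.
    have := qrealg_ker gP spv; rewrite ffunE => <-.
    by rewrite -[g i v]mulmx1 -sum1 mulmxDr !mulmxA l0 r0 !mul0mx addr0.
  have gonU i v : exists2 u, u \in U i & g i u *m pl i = v.
    have [u spu uE] := qrealg_onto (v *m il i) gP.
    exists u; rewrite ?UE -uE -mulmxA ?ll ?mulmx1 //.
    by rewrite spu lr mulmx0 eqxx.
  have gonR i v : exists2 u, u \in R i & g i u *m pr i = v.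
    have [u spu uE] := qrealg_onto (v *m ir i) gP.
    exists u; rewrite ?RE -uE -mulmxA ?rr ?mulmx1 //.
    by rewrite spu rl mulmx0 eqxx.
  have /stableP ssp' := ssp.
  exists U, R; split.
  - split=> [||i|i].
    + apply/stableP => x v; rewrite !UE => /andP[spv /eqP v0].
      by rewrite ssp' //= gA // -mulmxA prD mulmxA v0 mul0mx.
    + apply/stableP => x v; rewrite !RE => /andP[spv /eqP v0].
      by rewrite ssp' //= gA // -mulmxA plD mulmxA v0 mul0mx.
    + apply/eqP; rewrite eqEsubv subv_add !ffunE !capvSl /=.
      apply/subvP => v spv.
      have [u Uu uE] := gonU i (g i v *m pl i).
      have [r Rr rE] := gonR i (g i v *m pr i).
      move: (Uu) (Rr); rewrite UE RE => /andP[spu /eqP u0] /andP[spr /eqP r0].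
      suff /eqP : v - (u + r) = 0.
        by rewrite subr_eq0 => /eqP->; move: Uu Rr; rewrite !ffunE; exact: memv_add.
      apply: (g0 i); rewrite ?memvB ?memvD // lfB lfD mulmxBl mulmxDl.
        by rewrite uE r0 addr0 subrr.
      by rewrite rE u0 add0r subrr.
    apply/eqP; rewrite -subv0; apply/subvP => v.
    rewrite memv_cap UE RE memv0 => /andP[/andP[spv /eqP r0] /andP[_ /eqP l0]].
    by apply/eqP; exact: g0 l0 r0.
  - exists (fun i => (mxlf (pl i) \o g i)%VF); split=> [i|i|x v].
    + apply/eqP; rewrite eqEsubv subvf; apply/subvP => v _.
      have [u Uu uE] := gonU i v; apply/memv_imgP; exists u => //.
      by rewrite comp_lfunE mxlfE uE.
    + apply/eqP; rewrite [fam0 _]ffunE -subv0; apply/subvP => v.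
      rewrite memv_cap UE memv_ker memv0 comp_lfunE mxlfE.
      by case/andP=> /andP[spv /eqP r0] /eqP l0; rewrite (g0 i v).
    rewrite UE => /andP[spv _].
    by rewrite !comp_lfunE !mxlfE gA // -mulmxA plD mulmxA.
  exists (fun i => (mxlf (pr i) \o g i)%VF); split=> [i|i|x v].
  - apply/eqP; rewrite eqEsubv subvf; apply/subvP => v _.
    have [u Uu uE] := gonR i v; apply/memv_imgP; exists u => //.
    by rewrite comp_lfunE mxlfE uE.
  - apply/eqP; rewrite [fam0 _]ffunE -subv0; apply/subvP => v.
    rewrite memv_cap RE memv_ker memv0 comp_lfunE mxlfE.
    by case/andP=> /andP[spv /eqP l0] /eqP r0; rewrite (g0 i v).
  rewrite RE => /andP[spv _].
  by rewrite !comp_lfunE !mxlfE gA // -mulmxA prD mulmxA.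
have [sU sR UR UR0] := dUR.
apply: (qreal_uniq ssp qX).
(* The coordinates of the two summands are glued along the projections of the internal direct
   sum. *)
pose h i := ((mxlf (il i) \o gU i \o daddv_pi (U i) (R i)) +
             (mxlf (ir i) \o gR i \o daddv_pi (R i) (U i)))%VF.
have hE i u r : u \in U i -> r \in R i ->
    h i (u + r) = gU i u *m il i + gR i r *m ir i.
  move=> Uu Rr; have RU0 : (R i :&: U i = 0)%VS by rewrite capvC.
  have p0 : daddv_pi (U i) (R i) r = 0.
    apply/eqP; rewrite -(inj_eq (addIr (daddv_pi (R i) (U i) r))) add0r.
    rewrite daddv_pi_add // ?daddv_pi_id //.
    by apply: (subvP (addvSr _ _)).
  have q0 : daddv_pi (R i) (U i) u = 0.
    apply/eqP; rewrite -(inj_eq (addIr (daddv_pi (U i) (R i) u))) add0r.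
    rewrite daddv_pi_add // ?daddv_pi_id //.
    by apply: (subvP (addvSr _ _)).
  rewrite add_lfunE !comp_lfunE !lfD p0 q0 !daddv_pi_id // !lf0 addr0 add0r.
  by rewrite !mxlfE.
exists h; split=> [i|i|x v].
- apply/eqP; rewrite eqEsubv subvf; apply/subvP => v _.
  have [u Uu uE] := qrealg_onto (v *m pl i) gUP.
  have [r Rr rE] := qrealg_onto (v *m pr i) gRP.
  apply/memv_imgP; exists (u + r); first by rewrite -UR memv_add.
  by rewrite hE // -uE -rE -!mulmxA -mulmxDr sum1 mulmx1.
- apply/eqP; rewrite ffunE -subv0 -UR; apply/subvP => v.
  rewrite memv_cap => /andP[/memv_addP[u Uu [r Rr ->{v}]]].
  rewrite memv_ker hE // => /eqP h0.
  have /(congr1 (mulmxr (pl i))) := h0.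
  have /(congr1 (mulmxr (pr i))) := h0.
  rewrite /= !mulmxDl -!mulmxA ll rr lr rl !mulmx0 !mulmx1 add0r addr0 !mul0mx.
  move=> /eqP r0 /eqP u0; move: u0 r0.
  rewrite (qrealg_ker gUP) // (qrealg_ker gRP) // ffunE !memv0.
  by move=> /eqP-> /eqP->; rewrite addr0.
rewrite -UR => /memv_addP[u Uu [r Rr ->]].
move: sU sR => /stableP sU /stableP sR.
rewrite lfD !hE ?sU ?sR //; have [_ _ ->] := gUP; rewrite //.
have [_ _ ->] := gRP; rewrite // mulmxDl.
by rewrite -!mulmxA ilD irD.
Qed.

Fixpoint adec sp (Ms : seq (packed_rep Q F)) : Prop :=
  match Ms with
  | [::] => sp = fam0
  | M :: Ms' => exists U R,
      [/\ dsumf sp U R, qreal A U fam0 (tagged M) & adec R Ms']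
  end.

Lemma qreal_fam0 : qreal A fam0 fam0 (@rep0 Q F).
Proof.
exists (fun=> 0); split=> [i|i|x v]; last by rewrite !zero_lfunE mul0mx.
  by apply/vspaceP => v; rewrite [v]thinmx0 !mem0v.
by rewrite ffunE cap0v.
Qed.

Lemma qreal_self sp : stab sp ->
  exists M : rep F (fun i => \dim (sp i)), qreal A sp fam0 M.
Proof.
move=> ssp; apply: qreal_ex => //; first exact: fam0_stable.
  exact: fle0.
by move=> i; rewrite ffunE dimv0.
Qed.

Lemma adecP sp d (X : rep F d) Ms : stab sp -> qreal A sp fam0 X ->
  iso X (tagged (dsum Ms)) <-> adec sp Ms.
Proof.
elim: Ms sp d X => [|M Ms IH] sp d X ssp qX /=.
  split=> [isoX|sp0].
    apply/eqP/fam0_dimP => i; have := qreal_dim i (qreal_iso qX isoX).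
    by rewrite ffunE dimv0.
  apply: (qreal_uniq ssp qX); rewrite sp0; exact: qreal_fam0.
rewrite (qreal_repD _ _ ssp qX).
split=> [[U [R [dUR qU qR]]]|[U [R [dUR qU aR]]]]; exists U, R; split=> //.
  by apply/(IH _ _ _ _ qR); [case: dUR|exact: iso_refl].
have [_ sR _ _] := dUR; have [L qL] := qreal_self sR.
by apply: (qreal_iso qL); apply/(IH _ _ _ sR qL).
Qed.

Lemma adec_move sp s1 M s2 : adec sp (s1 ++ M :: s2) -> adec sp (M :: s1 ++ s2).
Proof.
elim: s1 sp => [|N s1 IH] sp //= [U [R [dUR qU /IH[U1 [R1 [dUR1 qU1 aR1]]]]]].
have [d1 d2] := dsumf_assoc dUR dUR1.
by exists U1, [ffun i => (U i + R1 i)%VS]; split=> //; exists U, R1.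
Qed.

Lemma adec_perm (T : eqType) (N : T -> packed_rep Q F) bs bs' sp :
  perm_eq bs bs' -> adec sp (map N bs) -> adec sp (map N bs').
Proof.
elim: bs' bs sp => [|b bs' IH] bs sp.
  by move=> /perm_size; case: bs.
move=> pbs; have b_in : b \in bs by rewrite (perm_mem pbs) mem_head.
have [s1 [s2 bsE]] : exists s1 s2, bs = s1 ++ b :: s2.
  by case/path.splitPr: b_in => s1 s2; exists s1, s2.
rewrite {}bsE in pbs *; rewrite map_cat /= => /adec_move.
rewrite -map_cat /= => -[U [R [dUR qU aR]]].
exists U, R; split=> //; apply: IH aR.
by rewrite -(perm_cons b) -(perm_catCA s1 [:: b]) /=.
Qed.

Lemma adec_iso (T : eqType) (N N' : T -> packed_rep Q F) bs sp :
  {in bs, forall b, iso (tagged (N b)) (tagged (N' b))} ->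
  adec sp (map N bs) -> adec sp (map N' bs).
Proof.
elim: bs sp => [|b bs IH] sp //= NN' [U [R [dUR qU aR]]].
exists U, R; split=> //; first by apply: (qreal_iso qU); apply: NN'; exact: mem_head.
by apply: IH aR => c cs; apply: NN'; rewrite inE cs orbT.
Qed.

Definition aindec sp := sp <> fam0 /\
  forall U R, dsumf sp U R -> U = fam0 \/ R = fam0.

Lemma iszero_qreal sp d (X : rep F d) : qreal A sp fam0 X ->
  iszero X <-> sp = fam0.
Proof.
move=> qX; split=> [X0|sp0 i].
  by apply/eqP/fam0_dimP => i; rewrite (qreal_dim i qX) ffunE dimv0 X0.
by have := qreal_dim i qX; rewrite sp0 ffunE dimv0.
Qed.

Lemma aindecP sp d (X : rep F d) : stab sp -> qreal A sp fam0 X ->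
  indecomposable X <-> aindec sp.
Proof.
move=> ssp qX; split=> [[nz ind]|[nz ind]]; split.
- by move/(iszero_qreal qX).
- move=> U R dUR; have [sU sR _ _] := dUR.
  have [N qN] := qreal_self sU; have [L qL] := qreal_self sR.
  have isoX : iso X (repD N L) by apply/(qreal_repD _ _ ssp qX); exists U, R.
  by case: (ind _ _ _ _ isoX) => [/(iszero_qreal qN)|/(iszero_qreal qL)]; [left|right].
- by move/(iszero_qreal qX).
move=> e c N L /(qreal_repD _ _ ssp qX)[U [R [dUR qU qR]]].
by case: (ind _ _ dUR) => [/(iszero_qreal qU)|/(iszero_qreal qR)]; [left|right].
Qed.

Definition tdim sp := (\sum_i \dim (sp i))%N.

Lemma tdim_gt0 sp : sp <> fam0 -> (0 < tdim sp)%N.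
Proof.
move=> nz; rewrite lt0n; apply/eqP => /eqP; rewrite sum_nat_eq0 => /forallP h.
by apply: nz; apply/eqP/fam0_dimP => i; apply/eqP; exact: h.
Qed.

Lemma dsumf_tdim sp U R : dsumf sp U R -> tdim sp = (tdim U + tdim R)%N.
Proof.
by move=> dUR; rewrite /tdim -big_split /=; apply: eq_bigr => i _; exact: dsumf_dim.
Qed.

Lemma indec_summand sp : stab sp -> sp <> fam0 ->
  exists U R, dsumf sp U R /\ aindec U.
Proof.
have [n] := ubnP (tdim sp); elim: n sp => // n IH sp le_n ssp nz.
have [ai|nai] := pselect (aindec sp).
  by exists sp, fam0; split=> //; exact: dsumf0.
have [U [R [dUR nzU nzR]]] : exists U R, [/\ dsumf sp U R, U <> fam0 & R <> fam0].
  apply: contrapT => h; apply: nai; split=> // U R dUR.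
  apply: contrapT => /not_orP[nzU nzR]; apply: h; by exists U, R.
have [sU _ _ _] := dUR.
have [|U1 [R1 [dU1 aU1]]] := IH U _ sU nzU.
  by have := tdim_gt0 nzR; rewrite (dsumf_tdim dUR) in le_n; lia.
have [d1 _] := dsumf_assoc (dsumf_sym dUR) dU1.
by exists U1, [ffun i => (R i + R1 i)%VS].
Qed.

(** [P] is a property inherited by direct summands, later nilpotency. Splitting off one
    indecomposable summand at a time ends because the total dimension drops. *)
Lemma adec_exists (T : eqType) (N : T -> packed_rep Q F)
    (P : {ffun vert Q -> {vspace V}} -> Prop) :
  (forall sp U R, P sp -> dsumf sp U R -> P U) ->
  (forall U, stab U -> P U -> aindec U ->
     exists b, qreal A U fam0 (tagged (N b))) ->
  forall sp, stab sp -> P sp -> exists bs, adec sp (map N bs).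
Proof.
move=> PU PN sp; have [n] := ubnP (tdim sp); elim: n sp => // n IH sp le_n ssp Psp.
have [->|/eqP nz] := eqVneq sp fam0; first by exists [::].
have [U [R [dUR aU]]] := indec_summand ssp nz; have [sU sR _ _] := dUR.
have [|bs abs] := IH R _ sR (PU _ _ _ Psp (dsumf_sym dUR)).
  by have := tdim_gt0 aU.1; rewrite (dsumf_tdim dUR) in le_n; lia.
have [b qb] := PN U sU (PU _ _ _ Psp dUR) aU.
by exists (b :: bs), U, R.
Qed.

End DirectSums.

(** * Nilpotent representations and flags *)

Section Nilpotency.
Variables (Q : quiver) (F : fieldType) (V : vectType F).
Variable A : arrow Q -> 'End(V).
Implicit Types U W sp : {ffun vert Q -> {vspace V}}.
Local Notation stab := (stable (@src Q) (@tgt Q) A).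

(** The image of the arrow ideal, which for a nilpotent representation is the radical. Stability of
    a family and vanishing of the arrows on a quotient both become inclusions of [radf]. *)
Definition radf sp : {ffun vert Q -> {vspace V}} :=
  [ffun i => (\sum_(x | tgt x == i) A x @: sp (src x))%VS].

Lemma radP sp U : reflect (forall x v, v \in sp (src x) -> A x v \in U (tgt x))
  (fle (radf sp) U).
Proof.
apply: (iffP (fleP _ _)) => [rU x v spv|h i v].
  apply: rU; rewrite ffunE; apply: (subvP (sumv_sup x _ (subvv _))) => //.
  exact: memv_img.
rewrite ffunE => /memv_sumP[vs vsP ->]; apply: memv_suml => x tx.
by have /memv_imgP[u spu ->] := vsP x tx; rewrite -(eqP tx); exact: h.
Qed.

Lemma rad_stable U : fle (radf U) U = stab U.
Proof. by apply/radP/stableP. Qed.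

Lemma rad_strict sp U :
  [forall x, (A x @: sp (src x) <= U (tgt x))%VS] = fle (radf sp) U.
Proof.
apply/forallP/radP => [h x v spv|h x].
  exact: (subvP (h x)) (memv_img _ spv).
by apply/subvP => _ /memv_imgP[v spv ->]; exact: h.
Qed.

Lemma rad_mono U sp : fle U sp -> fle (radf U) (radf sp).
Proof.
move=> /fleP Usp; apply/radP => x v Uv; move/radP: (fle_refl (radf sp)); apply.
exact: Usp.
Qed.

Definition nilA sp W := exists n, fle (iter n radf sp) W.

Lemma iter_rad_mono n U sp : fle U sp -> fle (iter n radf U) (iter n radf sp).
Proof. by move=> Usp; elim: n => //= n IH; exact: rad_mono. Qed.

Lemma nilA_sub sp U W : fle U sp -> nilA sp W -> nilA U W.
Proof.
by move=> Usp [n h]; exists n; apply: fle_trans h; exact: iter_rad_mono.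
Qed.

Lemma nilA_quot sp U W : fle W U -> nilA sp W -> nilA sp U.
Proof. by move=> WU [n h]; exists n; apply: fle_trans WU. Qed.

Lemma nilA_ext sp U W : nilA sp U -> nilA U W -> nilA sp W.
Proof.
move=> [n hn] [m hm]; exists (m + n)%N; rewrite iterD.
by apply: fle_trans hm; exact: iter_rad_mono.
Qed.

Lemma qreal_zero sp U d (M : rep F d) : stab sp -> qreal A sp U M ->
  (forall x, M x = 0) <-> fle (radf sp) U.
Proof.
move=> /stableP ssp [g gP]; have [_ _ gA] := gP; split=> [M0|/radP rU x].
  apply/radP => x v spv.
  by rewrite -(qrealg_ker gP) ?ssp // gA // M0 mulmx0.
apply: eq_mulrV => v; rewrite mulmx0; have [u spu ->] := qrealg_onto v gP.
by rewrite -gA //; apply/eqP; rewrite (qrealg_ker gP) ?ssp ?rU.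
Qed.

Lemma hyperplane (W U : {vspace V}) : (W <= U)%VS -> W != U ->
  exists H : {vspace V}, [/\ (W <= H)%VS, (H <= U)%VS & \dim U = (\dim H).+1].
Proof.
move=> WU nWU; have /subvPn[v Uv Wv] : ~~ (U <= W)%VS.
  by apply: contra nWU => UW; rewrite eqEsubv WU.
(* Adding to [W] a complement of [W + <[v]>] in [U] misses only the line of [v]. *)
pose C := (U :\: (W + <[v]>))%VS.
have v0 : v != 0 by apply: contraNneq Wv => ->; rewrite mem0v.
have WvU : (W + <[v]> <= U)%VS by rewrite subv_add WU -memvE.
have Wv0 : (W :&: <[v]> = 0)%VS.
  apply/eqP; rewrite -subv0; apply/subvP => u; rewrite memv_cap.
  case/andP=> Wu /vlineP[k uE]; rewrite memv0 uE; move: Wu; rewrite uE.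
  have [->|k0 /(memvZ k^-1)] := eqVneq k 0; first by rewrite scale0r.
  by rewrite scalerA mulVf // scale1r (negPf Wv).
have CW : (C :&: (W + <[v]>) = 0)%VS by exact: capv_diff.
have dU : \dim U = (\dim C + (\dim W).+1)%N.
  rewrite -(dimv_cap_compl U (W + <[v]>)) (capv_idPr WvU) addnC.
  by rewrite (dimv_disjoint_sum Wv0) dim_vline v0 addn1.
exists (W + C)%VS; split; rewrite ?addvSl // ?subv_add ?WU ?diffvSl //.
rewrite dU dimv_disjoint_sum ?addnS ?(addnC (\dim C)) //.
by apply/eqP; rewrite capvC -subv0 -CW capvS // addvSl.
Qed.

Definition upd sp i (H : {vspace V}) : {ffun vert Q -> {vspace V}} :=
  [ffun j => if j == i then H else sp j].

(** For the converse a subfamily with simple quotient must be found: the radical together with [W]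
    is proper by Nakayama's argument, and any hyperplane above it at one vertex gives a stable
    family. *)
Lemma nilpotentP sp W d (X : rep F d) : stab sp -> stab W ->
  qreal A sp W X -> nilpotent X <-> nilA sp W.
Proof.
move=> ssp sW qX; split=> [[l nl]|[n nn]].
  elim: nl sp qX ssp => {d X l} [d X X0|d e X N i l sesX _ IH] sp qX ssp.
    exists 0%N; rewrite /= (fle_dim (qreal_fle qX)) ?fle_refl // => i.
    by rewrite (qreal_dim i qX) X0 addn0.
  have [U [WU Usp sU qN qS]] := (ses_qreal _ _ ssp qX).1 sesX.
  apply: nilA_ext (IH U qN sU); exists 1%N => /=.
  by apply/(qreal_zero ssp qS).
have [m] := ubnP (\sum_i \dim (sp i))%N.
elim: m sp d X ssp qX nn => // m IH sp d X ssp qX nn le_m.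
have Wsp := qreal_fle qX.
have [eqsW|/eqP nsW] := eqVneq sp W.
  exists 0%N; apply: NilpZero => i; have := qreal_dim i qX.
  by rewrite eqsW -[LHS]addn0 => /addnI.
pose T : {ffun vert Q -> {vspace V}} := [ffun i => (radf sp i + W i)%VS].
have rsp : fle (radf sp) sp by rewrite rad_stable.
have Tsp : fle T sp.
  by apply/forallP => i; rewrite ffunE subv_add (forallP rsp) (forallP Wsp).
have nT : T <> sp.
  (* Nakayama: if the radical and [W] span [sp], then so do every power of the radical and [W], and
     nilpotency leaves [W] alone. *)
  move=> TE; have spn k : fle sp [ffun i => (iter k radf sp i + W i)%VS].
    elim: k => [|k IHk] /=; first by apply/forallP => i; rewrite ffunE addvSl.
    set Tk := [ffun _ => _]; suff rTk : fle (radf sp) Tk.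
      apply/forallP => i; have -> : sp i = T i by rewrite TE.
      by rewrite ffunE subv_add (forallP rTk) [Tk i]ffunE addvSr.
    apply/radP => x v /(fleP _ _ IHk).
    rewrite ffunE => /memv_addP[u nu [w Ww ->]].
    rewrite [Tk _]ffunE lfD memv_add //.
      by move/radP: (fle_refl (radf (iter k radf sp))); apply.
    by move/stableP: sW; apply.
  apply: nsW; apply: fle_anti => //; apply: fle_trans (spn n) _.
  by apply/forallP => i; rewrite ffunE subv_add (forallP nn) subvv.
have [i nTi] : exists i, T i != sp i.
  apply: contrapT => h; apply: nT; apply/ffunP => i; apply/eqP.
  by apply/negbNE/negP => nTi; apply: h; exists i.
have [H [TH Hsp dH]] := hyperplane (forallP Tsp i) nTi.
pose U := upd sp i H.
have UE j : U j = if j == i then H else sp j by rewrite ffunE.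
have Usp : fle U sp by apply/forallP => j; rewrite UE; case: eqP => [->|].
have TU : fle T U by apply/forallP => j; rewrite UE; case: eqP => [->|_]; rewrite ?(forallP Tsp).
have rU : fle (radf sp) U.
  by apply: fle_trans TU; apply/forallP => j; rewrite [T j]ffunE addvSl.
have WU : fle W U.
  by apply: fle_trans TU; apply/forallP => j; rewrite [T j]ffunE addvSr.
have sU : stab U by rewrite -rad_stable; apply: fle_trans rU; exact: rad_mono.
have [|S qS] := @qreal_ex _ _ _ _ sp U (fun j => (j == i) : nat) ssp sU Usp.
  by move=> j; rewrite UE; case: eqP => [->|]; rewrite ?addn1 ?addn0.
have SE : S = @simple_rep Q F i.
  by apply: functional_extensionality_dep => x; exact: (qreal_zero ssp qS).2 rU x.
have dU j : \dim (U j) = (\dim (W j) + (\dim (U j) - \dim (W j)))%N.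
  by rewrite subnKC // dimvS // (forallP WU).
have [N qN] := qreal_ex sU sW WU dU.
have [||l nl] := IH U _ N sU qN.
- exact: fle_trans (iter_rad_mono _ Usp) nn.
- move: le_m; rewrite ltnS; apply: leq_trans.
  rewrite (bigD1 i) //= [X in (_ <= X)%N](bigD1 i) //= UE eqxx dH addSn ltnS.
  rewrite leq_add2l; apply: leq_sum => j /negPf nji; by rewrite UE nji.
exists l.+1; apply: (NilpStep (i := i) _ nl); apply/(ses_qreal _ _ ssp qX).
by exists U; split=> //; move: qS; rewrite SE.
Qed.

Lemma aflag_nilA w sp W : aflag (@src Q) (@tgt Q) A true w sp W -> nilA sp W.
Proof.
elim: w sp => [|d w IH] sp /=; first by move=> ->; exists 0%N; exact: fle_refl.
case=> U [/and4P[_ _ _]]; rewrite rad_strict => rU /IH; apply: nilA_ext.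
by exists 1%N.
Qed.

End Nilpotency.

(** * The sets R_w and their description by flags *)

Section Words.
Variables (Q : quiver) (K : fieldType) (strict : bool).

Definition wdim (w : seq (dimvec Q)) : dimvec Q := foldr (@dimD Q) (@dim0 Q) w.

Definition Gset (d : dimvec Q) : set (rep K d) := [set M : rep K d | strict -> forall x, M x = 0]%classic.

Fixpoint Rset (w : seq (dimvec Q)) : set (rep K (wdim w)) :=
  match w with
  | [::] => [set: _]%classic
  | d :: w' => ext_set (@Gset d) (@Rset w')
  end.

Lemma Rset_flag (V : vectType K) (A : arrow Q -> 'End(V)) w sp W
    (X : rep K (wdim w)) :
  stable (@src Q) (@tgt Q) A sp -> stable (@src Q) (@tgt Q) A W ->
  qreal A sp W X ->
  Rset X <-> aflag (@src Q) (@tgt Q) A strict w sp W.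
Proof.
elim: w sp X => [|d w IH] sp X ssp sW qX /=.
  split=> // _; apply/esym/fle_dim; first exact: qreal_fle qX.
  by move=> i; rewrite (qreal_dim i qX) addn0.
split=> [[M [N [GM RN /(ses_qreal _ _ ssp qX)[U [WU Usp sU qN qM]]]]]|].
  exists U; split; last by apply/(IH _ N).
  apply/and4P; split=> //.
    by apply/forallP => i; rewrite (qreal_dim i qM).
  rewrite rad_strict; apply/implyP => /GM; exact: (qreal_zero ssp qM).1.
case=> U [/and4P[sU Usp /forallP dU strU] aU].
have WU := aflag_fle aU.
have [|M qM] := @qreal_ex _ _ _ A sp U d ssp sU Usp.
  by move=> i; apply/eqP; exact: dU.
have [|N qN] := @qreal_ex _ _ _ A U W (wdim w) sU sW WU.
  move=> i; have := qreal_dim i qX; rewrite (eqP (dU i)) => /eqP.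
  by rewrite /= /dimD addnA addnAC eqn_add2r => /eqP.
exists M, N; split.
- move=> str; apply/(qreal_zero ssp qM).2; move: strU; by rewrite str rad_strict.
- exact/(IH _ _ sU sW qN).
by apply/(ses_qreal _ _ ssp qX); exists U.
Qed.

Lemma Rset_iso w (X Y : rep K (wdim w)) : Rset X -> iso X Y -> Rset Y.
Proof.
have sX := amb_stable X; have qX := amb_real X.
have s0 := fam0_stable (@src Q) (@tgt Q) (amb_map X).
move=> RX isoXY; apply/(Rset_flag sX s0 (qreal_iso qX isoXY)).
exact/(Rset_flag sX s0 qX).
Qed.

(** The dimension vectors of [w1 ++ w2] and of a product agree only propositionally. [iso] makes
    sense across different dimension vectors, so testing on isomorphic pairs avoids a transport. *)
Lemma eq_packed_set (d d' : dimvec Q) (Z : set (rep K d)) (Z' : set (rep K d')) :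
  d = d' -> (forall X X', iso X X' -> Z X <-> Z' X') ->
  existT (fun d : dimvec Q => set (rep K d)) d Z = existT (fun d : dimvec Q => set (rep K d)) d' Z'.
Proof.
move=> dd'; move: dd' Z' => <- Z' ZZ'; congr existT; apply/funext => X.
by apply/propext; apply: ZZ'; exact: iso_refl.
Qed.

Lemma wdim_cat w1 w2 : wdim (w1 ++ w2) = dimD (wdim w1) (wdim w2).
Proof.
elim: w1 => [|d w1 /= ->]; apply/funext => i; rewrite /dimD //= ?addnA //.
Qed.

Lemma Rset_cat w1 w2 :
  existT (fun d : dimvec Q => set (rep K d)) (wdim (w1 ++ w2)) (@Rset (w1 ++ w2)) =
  existT (fun d : dimvec Q => set (rep K d)) _ (ext_set (@Rset w1) (@Rset w2)).
Proof.
apply: eq_packed_set => [|X X' isoXX']; first exact: wdim_cat.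
have sX := amb_stable X; have qX := amb_real X.
have s0 := fam0_stable (@src Q) (@tgt Q) (amb_map X).
rewrite (Rset_flag sX s0 qX); have qX' := qreal_iso qX isoXX'.
split=> [/aflag_cat[U [a1 a2]]|[M [N [RM RN /(ses_qreal _ _ sX qX')[U]]]]]; last first.
  case=> _ Usp sU qN qM; apply/aflag_cat; exists U.
  split; first exact/(Rset_flag sX sU qM).
  exact/(Rset_flag sU s0 qN).
have sU := aflag_stable sX a1; have Usp := aflag_fle a1.
have wd i w sp W : aflag (@src Q) (@tgt Q) (amb_map X) strict w sp W ->
    \dim (sp i) = (\dim (W i) + wdim w i)%N.
  elim: w sp => [|d w IH] sp /=; first by move=> ->; rewrite addn0.
  case=> U' [/and4P[_ _ /forallP/(_ i)/eqP-> _] /IH ->].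
  by rewrite /dimD -addnA [(d i + _)%N]addnC.
have [M qM] := qreal_ex sX sU Usp (fun i => wd i _ _ _ a1).
have [N qN] := qreal_ex sU s0 (fle0 U) (fun i => wd i _ _ _ a2).
exists M, N; split.
- exact/(Rset_flag sX sU qM).
- exact/(Rset_flag sU s0 qN).
by apply/(ses_qreal _ _ sX qX'); exists U; split=> //; exact: fle0.
Qed.

End Words.

(** * Irreducibility of sets of extensions *)

Section FunctionAlgebra.
Variables (T : Type) (K : fieldType) (P : (T -> K) -> Prop).

(** Two instances matter: polynomial functions on a representation space, [polyfn], and rational
    functions of a line parameter, [ratfn]. *)
Definition funalg := [/\ forall c, P (fun=> c),
  forall f g, P f -> P g -> P (fun t => f t + g t)
  & forall f g, P f -> P g -> P (fun t => f t * g t)].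

Hypothesis PA : funalg.

Lemma funalg_sum (I : Type) (r : seq I) (Q : pred I) (f : I -> T -> K) :
  (forall i, P (f i)) -> P (fun t => \sum_(i <- r | Q i) f i t).
Proof.
case: PA => Pc Pd Pm Pf; elim: r => [|i r IH].
  by under eq_fun do rewrite big_nil.
under eq_fun do rewrite big_cons; case: (Q i) => //; exact: Pd.
Qed.

Lemma funalg_prod (I : Type) (r : seq I) (Q : pred I) (f : I -> T -> K) :
  (forall i, P (f i)) -> P (fun t => \prod_(i <- r | Q i) f i t).
Proof.
case: PA => Pc Pd Pm Pf; elim: r => [|i r IH].
  by under eq_fun do rewrite big_nil.
under eq_fun do rewrite big_cons; case: (Q i) => //; exact: Pm.
Qed.

Lemma funalg_exp f n : P f -> P (fun t => f t ^+ n).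
Proof.
case: PA => Pc Pd Pm Pf; elim: n => [|n IH].
  by under eq_fun do rewrite expr0.
by under eq_fun do rewrite exprS; exact: Pm.
Qed.

Lemma funalg_meval n (p : mpoly n K) (u : 'I_n -> T -> K) :
  (forall i, P (u i)) -> P (fun t => p.@[fun i => u i t]).
Proof.
case: PA => Pc Pd Pm Pu; under eq_fun do rewrite mevalE.
apply: funalg_sum => m; apply: Pm => //.
by apply: funalg_prod => i; exact: funalg_exp.
Qed.

Definition funmx m n (X : T -> 'M[K]_(m, n)) := forall i j, P (fun t => X t i j).

Lemma funmx_const m n (M : 'M[K]_(m, n)) : funmx (fun=> M).
Proof. by case: PA => Pc _ _ i j; exact: Pc. Qed.

Lemma funmx_mul m n r (X : T -> 'M[K]_(m, n)) (Y : T -> 'M[K]_(n, r)) :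
  funmx X -> funmx Y -> funmx (fun t => X t *m Y t).
Proof.
case: PA => Pc Pd Pm PX PY i j; under eq_fun do rewrite mxE.
by apply: funalg_sum => k; exact: Pm.
Qed.

Lemma funmx_block m1 m2 n1 n2 (X1 : T -> 'M[K]_(m1, n1)) (X2 : T -> 'M[K]_(m1, n2))
  (X3 : T -> 'M[K]_(m2, n1)) (X4 : T -> 'M[K]_(m2, n2)) :
  funmx X1 -> funmx X2 -> funmx X3 -> funmx X4 ->
  funmx (fun t => block_mx (X1 t) (X2 t) (X3 t) (X4 t)).
Proof.
move=> P1 P2 P3 P4 i j; under eq_fun do rewrite mxE.
case: (split i) => k; under eq_fun do rewrite mxE.
  by case: (split j).
by case: (split j).
Qed.

Lemma funmx_det n (X : T -> 'M[K]_n) : funmx X -> P (fun t => \det (X t)).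
Proof.
case: PA => Pc Pd Pm PX; rewrite /determinant; apply: funalg_sum => s.
by apply: Pm => //; exact: funalg_prod.
Qed.

End FunctionAlgebra.

(** * The Zariski topology on representation spaces *)

Section Zariski.
Variables (Q : quiver) (K : fieldType).
Implicit Types d e : dimvec Q.

Definition polyfn d (f : rep K d -> K) :=
  exists p : mpoly #|rep_index d| K, forall M, f M = rep_eval p M.

Lemma polyfn_alg d : funalg (@polyfn d).
Proof.
split=> [c|f g [p pP] [q qP]|f g [p pP] [q qP]].
- by exists (mpolyC _ c) => M; rewrite /rep_eval mevalC.
- by exists (p + q) => M; rewrite pP qP /rep_eval mevalD.
by exists (p * q) => M; rewrite pP qP /rep_eval mevalM.
Qed.

Lemma polyfn_entry d (a : arrow Q) : funmx (@polyfn d) (fun M => M a).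
Proof.
move=> i j; pose c : rep_index d := Tagged (fun a : arrow Q => ('I_(d (src a)) * 'I_(d (tgt a)))%type) (i, j).
exists 'X_(enum_rank c) => M; by rewrite /rep_eval mevalXU /rep_coord enum_rankK.
Qed.

Lemma zclosed_fun d (Z : set (rep K d)) (I : Type) (f : I -> rep K d -> K) :
  (forall i, polyfn (f i)) -> (forall M, Z M <-> forall i, f i M = 0) -> zclosed Z.
Proof.
move=> pf ZP; exists [set p | exists i, forall M, f i M = rep_eval p M]%classic.
apply/seteqP; split=> M /= => [/ZP fM p [i <-] //|h].
by apply/ZP => i; have [p pP] := pf i; rewrite pP; apply: h; exists i.
Qed.

Lemma zclosedI d (I : Type) (Z : I -> set (rep K d)) :
  (forall i, zclosed (Z i)) -> zclosed [set M | forall i, Z i M]%classic.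
Proof.
move=> cZ; pose J := {i : I & {p | projT1 (cid (cZ i)) p}}.
apply: (@zclosed_fun _ _ J (fun j M => rep_eval (sval (tagged j)) M)).
  by move=> j; exists (sval (tagged j)).
move=> M; split=> /= [ZM [i [p pP]] /=|h i].
  by move: (ZM i); rewrite {1}(projT2 (cid (cZ i))); apply.
rewrite (projT2 (cid (cZ i))) => p pI.
exact: (h (existT (fun i => {p | projT1 (cid (cZ i)) p}) i (exist _ p pI))).
Qed.

Lemma zclosedU d (Z1 Z2 : set (rep K d)) :
  zclosed Z1 -> zclosed Z2 -> zclosed (Z1 `|` Z2)%classic.
Proof.
move=> [I1 ->] [I2 ->].
apply: (@zclosed_fun _ _ ({p | I1 p} * {p | I2 p})
   (fun j M => rep_eval (sval j.1) M * rep_eval (sval j.2) M)).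
  by case=> [[p ?] [q ?]]; exists (p * q) => M; rewrite /rep_eval mevalM.
move=> M; split=> [[h [[p pI] [q qI]]|h [[p pI] [q qI]]]|h] /=.
- by rewrite h // mul0r.
- by rewrite (h q) // mulr0.
have [h1|/existsNP[p /not_implyP[pI /eqP np]]] :=
  pselect (forall p, I1 p -> rep_eval p M = 0); [by left|right => q qI].
have /eqP := h (exist _ p pI, exist _ q qI); rewrite mulf_eq0 (negPf np) /=.
by move/eqP.
Qed.

Lemma zclosed0 d : zclosed (set0 : set (rep K d)).
Proof.
apply: (@zclosed_fun _ _ unit (fun _ _ => 1)) => [_|M].
  by exists 1 => M; rewrite /rep_eval meval1.
by split=> // /(_ tt)/eqP; rewrite oner_eq0.
Qed.

Lemma zclosedT d : zclosed (setT : set (rep K d)).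
Proof. by apply: (@zclosed_fun _ _ void (fun _ _ => 1)) => [[]|M]. Qed.

Lemma zclosed_preim d e (Z : set (rep K e)) (u : rep K d -> rep K e) :
  (forall a, funmx (@polyfn d) (fun M => u M a)) ->
  zclosed Z -> zclosed [set M | Z (u M)]%classic.
Proof.
move=> pu [I ->].
apply: (@zclosed_fun _ _ {p | I p} (fun j M => rep_eval (sval j) (u M))).
  move=> [p pI] /=.
  have [] := @funalg_meval _ _ _ (polyfn_alg d) _ p
    (fun k M => rep_coord (u M) (enum_val k)); last by move=> q qP; exists q.
  by move=> k; exact: pu.
move=> M; split=> [h [p pI]|h p pI]; first exact: h.
exact: (h (exist _ p pI)).
Qed.

Definition clO d (O : set (rep K d)) : set (rep K d) :=
  [set M | forall p, (forall X, O X -> rep_eval p X = 0) -> rep_eval p M = 0]%classic.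

Lemma clO_closed d (O : set (rep K d)) : zclosed (clO O).
Proof. by exists [set p | forall X, O X -> rep_eval p X = 0]%classic. Qed.

Lemma clO_min d (O Z : set (rep K d)) : zclosed Z ->
  (O `<=` Z -> clO O `<=` Z)%classic.
Proof. by move=> [I ->] OZ M OM p pI; apply: OM => X /OZ; apply. Qed.

Lemma sub_clO d (O : set (rep K d)) : (O `<=` clO O)%classic.
Proof. by move=> M OM p; apply. Qed.

Lemma zirr_cover d (Z : set (rep K d)) (T : eqType) (s : seq T)
    (C : T -> set (rep K d)) : zirreducible Z -> (forall t, zclosed (C t)) ->
  (forall M, Z M -> exists2 t, t \in s & C t M) ->
  exists2 t, t \in s & (Z `<=` C t)%classic.
Proof.
move=> [[M0 ZM0] irr] cC; elim: s => [|t s IH] Zs; first by have [] := Zs _ ZM0.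
pose C' : set (rep K d) := [set M | exists2 t, t \in s & C t M]%classic.
have cC' : zclosed C'.
  rewrite {}/C'; elim: (s) => [|u r IHr].
    suff -> : [set M | exists2 t, t \in [::] & C t M]%classic = set0.
      exact: zclosed0.
    by apply/seteqP; split=> M //= [].
  suff -> : ([set M | exists2 t, t \in u :: r & C t M] =
             C u `|` [set M | exists2 t, t \in r & C t M])%classic.
    exact: zclosedU.
  apply/seteqP; split=> M /=.
    by case=> v; rewrite inE => /predU1P[->|vr Cv]; [left|right; exists v].
  case=> [Cu|[v vr Cv]]; first by exists u; rewrite ?mem_head.
  by exists v; rewrite // inE vr orbT.
have [|Zt|ZC'] := irr (C t) C' (cC t) cC'.
- move=> M /Zs[u]; rewrite inE => /predU1P[->|us Cu]; first by left.
  by right; exists u.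
- by exists t; rewrite ?mem_head.
have [u us uP] := IH ZC'; by exists u; rewrite // inE us orbT.
Qed.

End Zariski.

Section Orbits.
Variables (Q : quiver) (K : fieldType).

Lemma iso_GLact (d : dimvec Q) (M N : rep K d) : iso M N <->
  exists g : forall i, 'M[K]_(d i), (forall i, g i \in unitmx) /\ M = GLact g N.
Proof.
split=> [[f [g [fh gh fg gf]]]|[g [gu ->]]].
  have fu i : f i \in unitmx by have [] := mulmx1_unit (fg i).
  exists f; split=> //; apply: functional_extensionality_dep => a.
  by rewrite /GLact -fh mulmxK.
exists g, (fun i => invmx (g i)); split=> [a|a|i|i].
- by rewrite /GLact mulmxKV.
- by rewrite /GLact !mulmxA mulVmx // mul1mx.
- exact: mulmxV.
exact: mulVmx.
Qed.

Lemma iso_stable (d : dimvec Q) (Z : set (rep K d)) : GLstable Z <->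
  forall M N, Z M -> iso M N -> Z N.
Proof.
split=> [sZ M N ZM /iso_sym/iso_GLact[g [gu ->]]|h g gu M ZM]; first exact: sZ.
by apply: h ZM _; apply: iso_sym; apply/iso_GLact; exists g.
Qed.

End Orbits.

Section ExtIrreducible.
Variables (Q : quiver) (K : fieldType).
Hypothesis Kinf : forall P : {poly K}, (forall t, P.[t] = 0) -> P = 0.

Section Rational.
Variable D : {poly K}.

(** Regular functions on the part of the affine line where [D] does not vanish; the power of [D]
    clears the denominators. *)
Definition ratfn (f : K -> K) := exists (P : {poly K}) (n : nat),
  forall t, D.[t] != 0 -> P.[t] = D.[t] ^+ n * f t.

Lemma ratfn_alg : funalg ratfn.
Proof.
split=> [c|f g [P [n Pf]] [R [m Rg]]|f g [P [n Pf]] [R [m Rg]]].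
- by exists c%:P, 0%N => t _; rewrite hornerC mul1r.
- exists (D ^+ m * P + D ^+ n * R), (n + m)%N => t Dt.
  rewrite !hornerE Pf // Rg // exprD mulrDr !mulrA; congr (_ * _ + _).
  by rewrite mulrC.
exists (P * R), (n + m)%N => t Dt.
by rewrite hornerE Pf // Rg // exprD mulrACA.
Qed.

End Rational.

(** The line without the zeros of [D] is irreducible: without a common point of nonvanishing, the
    product of the two numerators and [D] would be the zero polynomial. The points 0 and 1 witness
    that no factor is zero. *)
Lemma ratfn_line (f1 f2 : K -> K) (D : {poly K}) :
  D.[0] != 0 -> D.[1] != 0 -> ratfn D f1 -> ratfn D f2 -> f1 0 != 0 ->
  f2 1 != 0 -> exists t, [/\ D.[t] != 0, f1 t != 0 & f2 t != 0].
Proof.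
move=> D0 D1 [P1 [n1 P1f]] [P2 [n2 P2f]] nf1 nf2.
apply: contrapT => h.
have : P1 * P2 * D = 0.
  apply: Kinf => t; rewrite !hornerE.
  have [->|Dt] := eqVneq D.[t] 0; first by rewrite mulr0.
  have [f1t|f1t] := eqVneq (f1 t) 0; first by rewrite P1f // f1t mulr0 !mul0r.
  have [f2t|f2t] := eqVneq (f2 t) 0; first by rewrite (P2f t) // f2t !mulr0 mul0r.
  by case: h; exists t.
move/eqP; rewrite !mulf_eq0 => /orP[/orP[]|] /eqP P0.
- have := P1f 0 D0; rewrite P0 horner0 => /esym/eqP.
  by rewrite mulf_eq0 expf_eq0 (negPf D0) andbF (negPf nf1).
- have := P2f 1 D1; rewrite P0 horner0 => /esym/eqP.
  by rewrite mulf_eq0 expf_eq0 (negPf D1) andbF (negPf nf2).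
by rewrite P0 horner0 eqxx in D0.
Qed.

Definition linemx m n (X Y : 'M[K]_(m, n)) t : 'M[K]_(m, n) := X + t *: (Y - X).

Lemma linemx0 m n (X Y : 'M[K]_(m, n)) : linemx X Y 0 = X.
Proof. by rewrite /linemx scale0r addr0. Qed.

Lemma linemx1 m n (X Y : 'M[K]_(m, n)) : linemx X Y 1 = Y.
Proof. by rewrite /linemx scale1r addrC subrK. Qed.

Definition linep m n (X Y : 'M[K]_(m, n)) : 'M[{poly K}]_(m, n) :=
  \matrix_(i, j) ((X i j)%:P + 'X * (Y i j - X i j)%:P).

Lemma linepE m n (X Y : 'M[K]_(m, n)) t :
  map_mx (horner_eval t) (linep X Y) = linemx X Y t.
Proof. by apply/matrixP => i j; rewrite !mxE /horner_eval !hornerE. Qed.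

Lemma linemx_rat D m n (X Y : 'M[K]_(m, n)) : funmx (ratfn D) (linemx X Y).
Proof.
move=> i j; exists (linep X Y i j), 0%N => t _.
by rewrite mul1r -linepE [RHS]mxE.
Qed.

Lemma invmx_adj n (L : 'M[K]_n) :
  L \in unitmx -> invmx L = (\det L)^-1 *: \adj L.
Proof. by rewrite /invmx => ->. Qed.

Section LineGL.
Variables (d : dimvec Q) (g1 g2 : forall i, 'M[K]_(d i)).

Definition lineD : {poly K} := \prod_i \det (linep (g1 i) (g2 i)).

Lemma lineDE t : lineD.[t] = \prod_i \det (linemx (g1 i) (g2 i) t).
Proof.
rewrite horner_prod; apply: eq_bigr => i _.
by rewrite -linepE det_map_mx.
Qed.

Lemma lineD_unit t : lineD.[t] != 0 <->
  forall i, linemx (g1 i) (g2 i) t \in unitmx.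
Proof.
rewrite lineDE; split=> [/prodf_neq0 h i|h].
  by rewrite unitmxE unitfE h.
by apply/prodf_neq0 => i _; rewrite -unitfE -unitmxE.
Qed.

Lemma lineinv_rat i :
  funmx (ratfn lineD) (fun t => invmx (linemx (g1 i) (g2 i) t)).
Proof.
move=> j k; pose G i := linep (g1 i) (g2 i).
(* Cramer's rule at the vertex [i]; the other determinants complete the denominator to [lineD]. *)
exists ((\adj (G i)) j k * \prod_(i' | i' != i) \det (G i')), 1%N => t Dt.
have /lineD_unit/(_ i) gu := Dt.
rewrite hornerM horner_prod expr1 lineDE [X in _ = X * _](bigD1 i) //=.
rewrite (invmx_adj gu) [X in _ = _ * X]mxE.
have d0 : \det (linemx (g1 i) (g2 i) t) != 0 by rewrite -unitfE -unitmxE.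
rewrite mulrACA [X in _ = X * _]mulfV // mul1r mulrC; congr (_ * _).
  by apply: eq_bigr => i' _; rewrite -linepE det_map_mx.
by rewrite -linepE -map_mx_adj [RHS]mxE.
Qed.

End LineGL.

Definition blk d e (M : rep K d) (h : forall a : arrow Q, 'M[K]_(d (src a), e (tgt a)))
    (N : rep K e) : rep K (dimD d e) :=
  fun a => block_mx (M a) (h a) 0 (N a).

(** In a basis adapted to the sequence an extension is block triangular. The extension set is
    thereby parametrised by a group element, an off-diagonal block and the two given sets. *)
Lemma ext_setP d e (A : set (rep K d)) (B : set (rep K e)) X : ext_set A B X <->
  exists g h M N, [/\ forall i, g i \in unitmx, A M, B N & X = GLact g (blk M h N)].
Proof.
split=> [[M [N [AM BN [f [p [[fh fi] [ph ps] kp]]]]]]|[g [h [M [N [gu AM BN ->]]]]]].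
  have [s sp] : exists s : forall i, 'M[K]_(d i, dimD d e i),
      forall i, s i *m p i = 1%:M.
    by exists (fun i => pinvmx (p i)) => i; exact: mulVpmx.
  have fp i : f i *m p i = 0 by apply/sub_kermxP; have /andP[] := kp i.
  pose G i : 'M[K]_(dimD d e i) := col_mx (s i) (f i).
  have Gu i : G i \in unitmx.
    rewrite -row_free_unit; apply/inj_row_free => v.
    rewrite -[v]hsubmxK mul_row_col => v0.
    have l0 : lsubmx v = 0.
      have -> : lsubmx v = (lsubmx v *m s i + rsubmx v *m f i) *m p i.
        by rewrite mulmxDl -!mulmxA sp fp mulmx1 mulmx0 addr0.
      by rewrite v0 mul0mx.
    have r0 : rsubmx v = 0.
      by apply: (row_free_inj (fi i)); rewrite mul0mx -v0 l0 mul0mx add0r.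
    by rewrite l0 r0 row_mx0.
  (* The section [s] fails to be a homomorphism by a map into the kernel, and that map is the
     off-diagonal block. *)
  have Hh a : exists h : 'M[K]_(d (src a), e (tgt a)),
      s (src a) *m X a = M a *m s (tgt a) + h *m f (tgt a).
    have : (s (src a) *m X a - M a *m s (tgt a) <= f (tgt a))%MS.
      rewrite (eqmxP (kp _)); apply/sub_kermxP.
      by rewrite mulmxBl -!mulmxA ph sp mulmx1 mulmxA sp mul1mx subrr.
    by case/submxP=> h hE; exists h; rewrite -hE addrC subrK.
  pose h a := projT1 (cid (Hh a)).
  exists (fun i => invmx (G i)), h, M, N; split=> // [i|]; first by rewrite unitmx_inv.
  apply: functional_extensionality_dep => a; rewrite /GLact invmxK.
  rewrite -mulmxA; suff -> : blk M h N a *m G (tgt a) = G (src a) *m X a.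
    by rewrite mulKmx.
  rewrite mul_block_col mul_col_mx mul0mx add0r; congr col_mx; last exact: fh.
  by rewrite (projT2 (cid (Hh a))).
exists M, N; split=> //.
exists (fun i => row_mx 0 1%:M *m invmx (g i)), (fun i => g i *m col_mx 1%:M 0).
split.
- split=> [a|i]; last first.
    apply/row_freeP; exists (g i *m col_mx 0 1%:M).
    by rewrite mulmxA mulmxKV // mul_row_col mul0mx mul1mx add0r.
  rewrite /GLact !mulmxA mulmxKV // /blk mul_row_block.
  by rewrite !(mul0mx, mul1mx, add0r, addr0) mul_mx_row mulmx1 mulmx0.
- split=> [a|i]; last first.
    apply/row_fullP; exists (row_mx 1%:M 0 *m invmx (g i)).
    by rewrite mulmxA mulmxKV // mul_row_col mul1mx mul0mx addr0.
  rewrite /GLact !mulmxA mulmxKV // -!mulmxA /blk mul_block_col mul_col_mx.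
  by rewrite !(mul0mx, mul1mx, mulmx0, mulmx1, add0r, addr0).
move=> i; apply/andP; split.
  apply/sub_kermxP; rewrite mulmxA mulmxKV // mul_row_col.
  by rewrite mulmx0 mul0mx addr0.
apply/row_subP => j; set v := row j _.
have : v *m (g i *m col_mx 1%:M 0) = 0 by apply/sub_kermxP; exact: row_sub.
rewrite mulmxA -[v *m g i]hsubmxK mul_row_col mulmx1 mulmx0 addr0 => l0.
apply/submxP; exists (rsubmx (v *m g i)); rewrite mulmxA mul_mx_row mulmx0 mulmx1.
have -> : row_mx 0 (rsubmx (v *m g i)) = v *m g i by rewrite -[RHS]hsubmxK l0.
exact: (esym (mulmxK (gu i) v)).
Qed.

Lemma GLact_poly (e d : dimvec Q) (g : forall i, 'M[K]_(d i)) (u : rep K e -> rep K d) :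
  (forall a, funmx (@polyfn Q K e) (fun M => u M a)) ->
  forall a, funmx (@polyfn Q K e) (fun M => GLact g (u M) a).
Proof.
move=> pu a; have PA := polyfn_alg K e.
by apply: funmx_mul => //; [apply: funmx_mul => //|]; exact: funmx_const.
Qed.

(** For a fixed group element and block, the image of [A] and [B] lies in [Z1] or in [Z2]. If
    neither contained everything, witnesses of the two failures could be joined by a line in these
    parameters, and at a suitable point of it both failures would persist. *)
Lemma ext_set_irreducible (d e : dimvec Q) (A : set (rep K d)) (B : set (rep K e)) :
  zirreducible A -> zirreducible B -> zirreducible (ext_set A B).
Proof.
move=> [[M0 AM0] irrA] [[N0 BN0] irrB]; split=> [|Z1 Z2 cZ1 cZ2 sZ].
  exists (GLact (fun i => 1%:M) (blk M0 (fun a => 0) N0)); apply/ext_setP.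
  by exists (fun i => 1%:M), (fun a => 0), M0, N0; split=> // i; exact: unitmx1.
pose psi g h M N := GLact g (@blk d e M h N).
have PA f := polyfn_alg K f.
have cM Z g h N : zclosed Z -> zclosed [set M | Z (psi g h M N)]%classic.
  apply: zclosed_preim; apply: GLact_poly => a; apply: funmx_block => //;
    by [exact: polyfn_entry|exact: funmx_const].
have cN Z g h M : zclosed Z -> zclosed [set N | Z (psi g h M N)]%classic.
  apply: zclosed_preim; apply: GLact_poly => a; apply: funmx_block => //;
    by [exact: polyfn_entry|exact: funmx_const].
pose AB Z g h := forall M N, A M -> B N -> Z (psi g h M N).
(* A product of irreducible sets is irreducible: the points [N] whose whole slice over [A] lies in
   [Z] form a closed set [BZ Z], and the two sets so obtained cover [B]. *)
have ABor g h : (forall i, g i \in unitmx) -> AB Z1 g h \/ AB Z2 g h.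
  move=> gu; pose BZ Z : set (rep K e) := [set N | forall M : {M | A M}, Z (psi g h (sval M) N)]%classic.
  have cBZ Z : zclosed Z -> zclosed (BZ Z) by move=> cZ; apply: zclosedI => M; exact: cN.
  have [N BN|BZ1|BZ2] := irrB _ _ (cBZ _ cZ1) (cBZ _ cZ2).
  - have [M AM|AZ|AZ] := irrA _ _ (cM Z1 g h N cZ1) (cM Z2 g h N cZ2).
    + by apply: sZ; apply/ext_setP; exists g, h, M, N.
    + by left=> -[M AM] /=; exact: AZ.
    by right=> -[M AM] /=; exact: AZ.
  - by left=> M N AM BN; exact: (BZ1 N BN (exist _ M AM)).
  by right=> M N AM BN; exact: (BZ2 N BN (exist _ M AM)).
apply: contrapT => /not_orP[nZ1 nZ2].
have wit Z (cZ : zclosed Z) : ~ (ext_set A B `<=` Z)%classic ->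
    exists g h M N p, [/\ forall i, g i \in unitmx, A M, B N,
      forall X, Z X -> rep_eval p X = 0 & rep_eval p (psi g h M N) != 0].
  move=> nZ; have [X /not_implyP[/ext_setP[g [h [M [N [gu AM BN ->]]]]]]] := (existsNP _).2 nZ.
  case: cZ => I ->{Z nZ} /existsNP[p /not_implyP[Ip /eqP np]].
  by exists g, h, M, N, p; split=> // Y; exact.
have [g1 [h1 [M1 [N1 [p1 [gu1 AM1 BN1 pZ1 np1]]]]]] := wit _ cZ1 nZ1.
have [g2 [h2 [M2 [N2 [p2 [gu2 AM2 BN2 pZ2 np2]]]]]] := wit _ cZ2 nZ2.
pose D := lineD g1 g2.
pose gt t i := linemx (g1 i) (g2 i) t; pose ht t a := linemx (h1 a) (h2 a) t.
have g0E : gt 0 = g1 by apply: functional_extensionality_dep => i; exact: linemx0.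
have h0E : ht 0 = h1 by apply: functional_extensionality_dep => i; exact: linemx0.
have g1E : gt 1 = g2 by apply: functional_extensionality_dep => i; exact: linemx1.
have h1E : ht 1 = h2 by apply: functional_extensionality_dep => i; exact: linemx1.
have RA := ratfn_alg D.
have rat M N p : ratfn D (fun t => rep_eval p (psi (gt t) (ht t) M N)).
  apply: (funalg_meval RA) => k; rewrite /rep_coord /psi /GLact.
  apply: funmx_mul => //; last exact: lineinv_rat.
  apply: funmx_mul => //; first exact: linemx_rat.
  by apply: funmx_block => //; try exact: funmx_const; exact: linemx_rat.
have [||||t [/lineD_unit gut n1 n2]] := @ratfn_line _ _ D _ _ (rat M1 N1 p1) (rat M2 N2 p2).
- by apply/lineD_unit => i; rewrite linemx0.
- by apply/lineD_unit => i; rewrite linemx1.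
- by rewrite g0E h0E.
- by rewrite g1E h1E.
by case: (ABor _ (ht t) gut) => h; [move: n1; rewrite pZ1|move: n2; rewrite pZ2];
  rewrite ?eqxx //; apply: h.
Qed.

Lemma Gset_irreducible strict (d : dimvec Q) : zirreducible (@Gset Q K strict d).
Proof.
split=> [|Z1 Z2 cZ1 cZ2 sZ]; first by exists (fun=> 0).
case: strict sZ => sZ.
  have GE M : @Gset Q K true d M -> M = fun=> 0.
    by move=> GM; apply: functional_extensionality_dep => a; exact: GM.
  by case: (sZ (fun=> 0)) => // Z0; [left|right] => M /GE ->.
apply: contrapT => /not_orP[nZ1 nZ2].
have wit Z (cZ : zclosed Z) : ~ (@Gset Q K false d `<=` Z)%classic ->
    exists M p, (forall X, Z X -> rep_eval p X = 0) /\ rep_eval p M != 0.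
  move=> nZ; have [M /not_implyP[_]] := (existsNP _).2 nZ.
  case: cZ => I ->{Z nZ} /existsNP[p /not_implyP[Ip /eqP np]].
  by exists M, p; split=> // Y; exact.
have [M1 [p1 [pZ1 np1]]] := wit _ cZ1 nZ1.
have [M2 [p2 [pZ2 np2]]] := wit _ cZ2 nZ2.
pose Mt t : rep K d := fun a => linemx (M1 a) (M2 a) t.
have M0E : Mt 0 = M1 by apply: functional_extensionality_dep => i; exact: linemx0.
have M1E : Mt 1 = M2 by apply: functional_extensionality_dep => i; exact: linemx1.
have RA := ratfn_alg 1.
have rat p : ratfn 1 (fun t => rep_eval p (Mt t)).
  by apply: (funalg_meval RA) => k; exact: linemx_rat.
have [||||t [_ n1 n2]] := ratfn_line _ _ (rat p1) (rat p2).
- by rewrite hornerE oner_eq0.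
- by rewrite hornerE oner_eq0.
- by rewrite M0E.
- by rewrite M1E.
by case: (sZ (Mt t)) => // h; [move: n1; rewrite pZ1|move: n2; rewrite pZ2];
  rewrite ?eqxx.
Qed.

Lemma Rset_irreducible strict w : zirreducible (@Rset Q K strict w).
Proof.
elim: w => [|d w IH] /=; first exact: genvar0_irreducible.
by apply: ext_set_irreducible => //; exact: Gset_irreducible.
Qed.

End ExtIrreducible.

(** * Polynomials and their values at the primes *)

Section PrimeValues.

Lemma many_primes n : exists s : seq nat, [/\ uniq s, all prime s & size s = n].
Proof.
elim: n => [|n [s [us ps sn]]]; first by exists [::].
have [p lt_p pp] := prime_above (\max_(i <- s) i).
exists (p :: s); split; rewrite /= ?pp ?us ?sn ?andbT //.
apply/negP => ps'; move: lt_p; rewrite ltnNge => /negP; apply.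
by rewrite (big_rem p) //= leq_maxl.
Qed.

Lemma poly_eq_primes (P R : {poly rat}) :
  (forall p, prime p -> P.[p%:R] = R.[p%:R]) -> P = R.
Proof.
move=> PR; apply/eqP; rewrite -subr_eq0; apply/negPn/negP => nz.
have [s [us ps sn]] := many_primes (size (P - R)).
have := max_poly_roots nz (rs := [seq i%:R | i <- s]).
rewrite size_map sn ltnn => h; suff: false by []. apply: h.
  apply/allP => _ /mapP[i si ->]; rewrite /root !hornerE PR ?subrr //.
  exact: (allP ps).
rewrite map_inj_uniq // => i j /eqP; rewrite eqr_nat => /eqP //.
Qed.

(** Clearing denominators by [a] gives an integral polynomial [q], and q(p) is congruent to q(0)
    modulo p. Hence q(0) - a t is divisible by every prime and vanishes. *)
Lemma poly_value0 (P : {poly rat}) (t : nat) :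
  (forall p, prime p -> exists2 m : nat, P.[p%:R] = m%:R & m = t %[mod p]) ->
  P.[0] = t%:R.
Proof.
move=> Pt; have [q [a a0 PE]] := rat_poly_scale P.
have aP x : a%:~R * P.[x%:~R] = (q.[x])%:~R.
  rewrite PE hornerZ mulrA mulfV ?intr_eq0 // mul1r.
  by rewrite (horner_map intr).
have dq (p : nat) : prime p -> (p %| q.[0] - a * t%:Z)%Z.
  move=> pp; have [m Pm mt] := Pt p pp.
  have qp : q.[p%:Z] = a * m%:Z.
    apply/eqP; rewrite -(eqr_int rat) -aP intrM; apply/eqP; congr (_ * _).
    by rewrite -pmulrn Pm pmulrn.
  have d1 : (p %| q.[p%:Z] - q.[0])%Z.
    have /factor_theorem[r rE] : root (q - q.[0]%:P) 0.
      by rewrite /root !hornerE subrr.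
    have -> : q.[p%:Z] - q.[0] = (q - q.[0]%:P).[p%:Z] by rewrite !hornerE.
    by rewrite rE !hornerE dvdz_mull // dvdzz.
  have d2 : (p %| a * m%:Z - a * t%:Z)%Z.
    rewrite -mulrBr dvdz_mull // -eqz_mod_dvd; apply/eqP.
    by rewrite !modz_nat mt.
  have -> : q.[0] - a * t%:Z = (a * m%:Z - a * t%:Z) - (q.[p%:Z] - q.[0]).
    by rewrite qp; ring.
  exact: rpredB.
have q0 : q.[0] = a * t%:Z.
  apply/eqP; rewrite -subr_eq0; apply/negPn/negP => nz.
  have [p lt_p pp] := prime_above (absz (q.[0] - a * t%:Z)%R).
  move: (dq p pp); rewrite /dvdz /= => /dvdn_leq; rewrite absz_gt0 => /(_ nz).
  by rewrite leqNgt lt_p.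
have := aP 0; rewrite q0 intrM -[t%:~R]pmulrn => /mulfI; apply.
by rewrite intr_eq0.
Qed.

End PrimeValues.

(** * Linear and bilinear extension from a basis *)

Section LinearExtension.
Variables (I : choiceType) (M : lmodType rat).
Implicit Types x y : {malg rat[I]}.

Lemma supp_sum (r : seq I) x (g : I -> M) : uniq r ->
  (forall a, a \in msupp x -> a \in r) ->
  \sum_(a <- msupp x) mcoeff a x *: g a = \sum_(a <- r) mcoeff a x *: g a.
Proof.
move=> ur xr; rewrite [RHS](bigID (mem (msupp x))) /=.
rewrite [X in _ + X]big1 ?addr0; last first.
  by move=> a /mcoeff_outdom->; rewrite scale0r.
rewrite -[RHS]big_filter; apply: perm_big; apply: uniq_perm.
- exact: fset_uniq.
- exact: filter_uniq.
by move=> a; rewrite mem_filter; apply/idP/andP => [h|[]//]; split=> //; exact: xr.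
Qed.

Definition lin_ext (g : I -> M) x : M := \sum_(a <- msupp x) mcoeff a x *: g a.

Lemma lin_ext_linear g : linear (lin_ext g).
Proof.
move=> c x y; pose r : seq I := undup (msupp (c *: x + y) ++ msupp x ++ msupp y).
have h z : {subset msupp z <= r} -> lin_ext g z = \sum_(a <- r) mcoeff a z *: g a.
  by move=> zr; apply: supp_sum => //; exact: undup_uniq.
rewrite !h; first last.
- by move=> a; rewrite mem_undup !mem_cat => ->.
- by move=> a; rewrite mem_undup !mem_cat => ->; rewrite orbT.
- by move=> a; rewrite mem_undup !mem_cat => ->; rewrite !orbT.
rewrite scaler_sumr -big_split; apply: eq_bigr => a _ /=.
by rewrite mcoeffD mcoeffZ scalerDl scalerA.
Qed.

Lemma lin_extU g a : lin_ext g << a >> = g a.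
Proof.
by rewrite /lin_ext msuppU oner_eq0 big_seq_fset1 mcoeffUU scale1r.
Qed.

Lemma malgZU (a : I) (c : rat) : << c *g a >> = c *: << a >> :> {malg rat[I]}.
Proof. by apply/malgP => b; rewrite mcoeffZ !mcoeffU mulrnAr mulr1. Qed.

Lemma linear_eq (f g : {malg rat[I]} -> M) : linear f -> linear g ->
  (forall a, f << a >> = g << a >>) -> f =1 g.
Proof.
move=> lf lg fg x; rewrite [x]monalgE.
have l0 h : linear h -> h 0 = 0 :> M.
  by move=> lh; have := lh (-1) 0 0; rewrite scaler0 addr0 scaleN1r addNr.
elim: (enum_fset (msupp x)) => [|a s IH]; first by rewrite !big_nil !l0.
by rewrite !big_cons malgZU lf lg IH fg.
Qed.

End LinearExtension.

Section BilinearExtension.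
Variables (Q : quiver) (I : choiceType) (deg : I -> dimvec Q).
Variables (op : I -> I -> {malg rat[I]}) (e : I).

Lemma bilin_extE x y :
  bilin_ext op x y = lin_ext (fun a => lin_ext (op a) y) x.
Proof.
apply: eq_bigr => a _; rewrite scaler_sumr; apply: eq_bigr => b _.
by rewrite scalerA.
Qed.

Lemma bilin_ext_linl z : linear (fun x => bilin_ext op x z).
Proof. by move=> c x y; rewrite !bilin_extE lin_ext_linear. Qed.

Lemma bilin_ext_linr z : linear (bilin_ext op z).
Proof.
move=> c x y; rewrite !bilin_extE /lin_ext scaler_sumr -big_split.
apply: eq_bigr => a _ /=; rewrite scalerA mulrC -scalerA -scalerDr.
by congr (_ *: _); exact: lin_ext_linear.
Qed.

Lemma bilin_extUU a b : bilin_ext op << a >> << b >> = op a b.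
Proof. by rewrite bilin_extE !lin_extU. Qed.

Lemma mcoeff_bilin (x y : {malg rat[I]}) (r s : seq I) k :
  uniq r -> uniq s -> {subset msupp x <= r} -> {subset msupp y <= s} ->
  mcoeff k (bilin_ext op x y) =
  \sum_(a <- r) \sum_(b <- s) mcoeff a x * mcoeff b y * mcoeff k (op a b).
Proof.
move=> ur us xr ys; rewrite bilin_extE /lin_ext (supp_sum _ ur xr) raddf_sum.
apply: eq_bigr => a _ /=; rewrite (supp_sum _ us ys) mcoeffZ raddf_sum mulr_sumr.
by apply: eq_bigr => b _ /=; rewrite mcoeffZ mulrA.
Qed.

Lemma linear_comp_in (M N L : lmodType rat) (f : M -> N) (g : N -> L) :
  linear f -> linear g -> linear (fun x => g (f x)).
Proof. by move=> lf lg c x y; rewrite lf lg. Qed.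

Hypothesis assoc : forall a b c,
  bilin_ext op (op a b) << c >> = bilin_ext op << a >> (op b c).
Hypothesis unitl : forall a, op e a = << a >>.
Hypothesis unitr : forall a, op a e = << a >>.
Hypothesis deg1 : deg e = @dim0 Q.
Hypothesis degM : forall a b, homogeneous deg (dimD (deg a) (deg b)) (op a b).

Lemma bilin_ext_graded : graded_algebra deg (bilin_ext op) << e >>.
Proof.
split.
- exact: bilin_ext_linl.
- exact: bilin_ext_linr.
- move=> x y z.
  apply: (linear_eq (f := fun x => bilin_ext op x (bilin_ext op y z))
           (g := fun x => bilin_ext op (bilin_ext op x y) z)) x => [||a].
  + exact: bilin_ext_linl.
  + exact: linear_comp_in (bilin_ext_linl y) (bilin_ext_linl z).
  apply: (linear_eq (f := fun y => bilin_ext op << a >> (bilin_ext op y z))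
           (g := fun y => bilin_ext op (bilin_ext op << a >> y) z)) y => [||b].
  + exact: linear_comp_in (bilin_ext_linl z) (bilin_ext_linr _).
  + exact: linear_comp_in (bilin_ext_linr _) (bilin_ext_linl z).
  apply: (linear_eq (f := fun z => bilin_ext op << a >> (bilin_ext op << b >> z))
           (g := fun z => bilin_ext op (bilin_ext op << a >> << b >>) z)) z => [||c].
  + exact: linear_comp_in (bilin_ext_linr _) (bilin_ext_linr _).
  + exact: bilin_ext_linr.
  by rewrite !bilin_extUU assoc.
- move=> x; apply: (linear_eq (g := id)) x => //; first exact: bilin_ext_linr.
  by move=> a; rewrite bilin_extUU unitl.
- move=> x; apply: (linear_eq (f := fun x => bilin_ext op x << e >>) (g := id)) x => //.
    exact: bilin_ext_linl.
  by move=> a; rewrite bilin_extUU unitr.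
- by move=> a; rewrite msuppU oner_eq0 inE => /eqP->.
move=> d d' x y hx hy k; rewrite -mcoeff_neq0.
rewrite (mcoeff_bilin k (fset_uniq (msupp x)) (fset_uniq (msupp y))) // => nz.
apply: contrapT => kd; move/eqP: nz; apply.
rewrite big_seq big1 // => a ax; rewrite big_seq big1 // => b bx.
suff /eqP-> : mcoeff k (op a b) == 0 by rewrite mulr0.
rewrite mcoeff_eq0; apply/negP => /degM kE; apply: kd.
by rewrite kE (hx a) // (hy b).
Qed.

End BilinearExtension.

(** The interface between the two families of quivers and the common argument. The test [t] mentions
    no field: [hc_flag] compares it with flags over every field, [hc_count] with their number over
    prime fields. The height in [hc_word] orders the basis in which [Psi] is unitriangular. *)
Record hall_case (Q : quiver) (S : parametrisation Q) (strict : bool)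
    (t : seq (dimvec Q) -> S -> bool) : Prop := HallCase {
  hc_dim : forall (F : fieldType) d (M : rep F d) (g : S), pclass M g -> d = pdim g;
  hc_ex : forall (F : fieldType) (g : S), exists d (M : rep F d), pclass M g;
  hc_iso : forall (F : fieldType) d e (M : rep F d) (N : rep F e) (g g' : S),
    pclass M g -> pclass N g' -> (iso M N <-> g = g');
  hc_class : forall (F : fieldType) d (M : rep F d),
    nilpotent M -> exists g : S, pclass M g;
  hc_nil : forall (F : fieldType) d (M : rep F d) (g : S), pclass M g -> nilpotent M;
  hc_zero : forall (F : fieldType), pclass (@rep0 Q F) (pzero S);
  hc_fin : forall d, exists s : seq S, forall g : S, pdim g = d -> g \in s;
  hc_flag : forall (F : fieldType) (V : vectType F) (A : arrow Q -> 'End(V)) sp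
      d (X : rep F d) (g : S) w,
    stable (@src Q) (@tgt Q) A sp -> qreal A sp fam0 X -> pclass X g ->
    aflag (@src Q) (@tgt Q) A strict w sp fam0 <-> t w g;
  hc_count : forall p, prime p -> forall (V : vectType 'F_p)
      (A : arrow Q -> 'End(V)) sp d (X : rep 'F_p d) (g : S) w,
    stable (@src Q) (@tgt Q) A sp -> qreal A sp fam0 X -> pclass X g ->
    nfl (@src Q) (@tgt Q) A strict w sp = t w g %[mod p];
  hc_word : exists (om : S -> seq (dimvec Q)) (h : S -> nat), forall a,
    t (om a) a /\ forall b, t (om a) b -> b <> a -> (h a < h b)%N;
  hc_closed : forall (F : fieldType) w, zclosed (@Rset Q F strict w);
  hc_nilw : forall (F : fieldType) w (X : rep F (wdim w)),
    @Rset Q F strict w X -> nilpotent X }.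

(** * Products in the Hall algebra *)

Section AmbientClasses.
Variables (Q : quiver) (S : parametrisation Q) (strict : bool).
Variable t : seq (dimvec Q) -> S -> bool.
Hypothesis HC : hall_case strict t.

Section Field.
Variables (F : fieldType) (V : vectType F) (A : arrow Q -> 'End(V)).
Implicit Types U W sp : {ffun vert Q -> {vspace V}}.
Local Notation stab := (stable (@src Q) (@tgt Q) A).

Definition qc sp W (g : S) :=
  exists d (M : rep F d), qreal A sp W M /\ pclass M g.

Lemma qc_dim sp W g i : qc sp W g -> \dim (sp i) = (\dim (W i) + pdim g i)%N.
Proof.
by case=> d [M [qM cM]]; rewrite (qreal_dim i qM) (hc_dim HC cM).
Qed.

Lemma qc_fle sp W g : qc sp W g -> fle W sp.
Proof. by case=> d [M [qM _]]; exact: qreal_fle qM. Qed.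

Lemma qc_real sp W g d (M : rep F d) : stab sp -> qc sp W g ->
  qreal A sp W M <-> pclass M g.
Proof.
move=> ssp [e [N [qN cN]]]; split=> [qM|cM]; last first.
  by apply: qreal_iso qN _; apply/(hc_iso HC cN cM).
have isoMN := qreal_uniq ssp qM qN.
have nN := hc_nil HC cN.
have [g' cM] : exists g' : S, pclass M g'.
  apply: (hc_class HC); have sN := amb_stable N; have qN' := amb_real N.
  have s0 := fam0_stable (@src Q) (@tgt Q) (amb_map N).
  apply/(nilpotentP sN s0 (qreal_iso qN' (iso_sym isoMN))).
  exact/(nilpotentP sN s0 qN').
by rewrite -((hc_iso HC cM cN).1 isoMN).
Qed.

Lemma qc_uniq sp W g g' : stab sp -> qc sp W g -> qc sp W g' -> g = g'.
Proof.
move=> ssp [d [M [qM cM]]] [e [N [qN cN]]].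
by apply/(hc_iso HC cM cN); exact: qreal_uniq qM qN.
Qed.

Lemma qc_nil sp W g : stab sp -> stab W -> qc sp W g -> nilA A sp W.
Proof.
move=> ssp sW [d [M [qM cM]]]; apply/(nilpotentP ssp sW qM).
exact: (hc_nil HC cM).
Qed.

Lemma qc_ex sp W : stab sp -> stab W -> fle W sp -> nilA A sp W ->
  exists g, qc sp W g.
Proof.
move=> ssp sW Wsp nsp.
have [|M qM] := @qreal_ex _ _ _ A sp W (fun i => \dim (sp i) - \dim (W i))%N ssp sW Wsp.
  by move=> i; rewrite subnKC // dimvS // (forallP Wsp).
have [|g cM] := hc_class HC (M := M).
  exact/(nilpotentP ssp sW qM).
by exists g, _, M.
Qed.

Lemma aflag_dim w sp W i : aflag (@src Q) (@tgt Q) A strict w sp W ->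
  \dim (sp i) = (\dim (W i) + wdim w i)%N.
Proof.
elim: w sp => [|d w IH] sp /=; first by move=> ->; rewrite addn0.
case=> U' [/and4P[_ _ /forallP/(_ i)/eqP-> _] /IH ->].
by rewrite /dimD -addnA [(d i + _)%N]addnC.
Qed.

End Field.

Lemma t_dim w g : t w g -> pdim g = wdim w.
Proof.
have [d [X cX]] := hc_ex HC rat g.
move/(hc_flag HC w (amb_stable X) (amb_real X) cX) => aX.
apply/funext => i; have := aflag_dim i aX.
by rewrite (qreal_dim i (amb_real X)) !ffunE dimv0 (hc_dim HC cX) !add0n.
Qed.

Lemma Rset_t (F : fieldType) w (X : rep F (wdim w)) g : pclass X g ->
  @Rset Q F strict w X <-> t w g.
Proof.
move=> cX; have s0 := fam0_stable (@src Q) (@tgt Q) (amb_map X).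
rewrite (Rset_flag _ (amb_stable X) s0 (amb_real X)).
exact: (hc_flag HC w (amb_stable X) (amb_real X) cX).
Qed.

(** [hc_flag] speaks of flags down to 0. Membership in [Rset] depends only on the subquotient, which
    carries the test to an arbitrary bottom [W]. *)
Lemma aflag_t (F : fieldType) (V : vectType F) (A : arrow Q -> 'End(V)) sp W g w :
  stable (@src Q) (@tgt Q) A sp -> stable (@src Q) (@tgt Q) A W ->
  qc A sp W g -> aflag (@src Q) (@tgt Q) A strict w sp W <-> t w g.
Proof.
move=> ssp sW qg.
have [wd|nwd] := pselect (pdim g = wdim w); last first.
  split=> [aw|/t_dim //]; case: nwd; apply/funext => i.
  by have := aflag_dim i aw; rewrite (qc_dim i qg) => /addnI.
have [X qX] : exists X : rep F (wdim w), qreal A sp W X.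
  apply: qreal_ex => // [|i]; first exact: qc_fle qg.
  by rewrite (qc_dim i qg) wd.
rewrite -(Rset_flag _ ssp sW qX); apply: Rset_t.
exact/(qc_real _ ssp qg).
Qed.

Lemma qc_zero (F : fieldType) (V : vectType F) (A : arrow Q -> 'End(V)) sp :
  stable (@src Q) (@tgt Q) A sp -> qc A sp sp (pzero S).
Proof.
move=> ssp; exists _, (@rep0 Q F); split; last exact: hc_zero HC F.
exists (fun=> 0); split=> [i|i|x v]; last by rewrite !zero_lfunE mul0mx.
  by apply/vspaceP => v; rewrite [v]thinmx0 !mem0v.
by apply/capv_idPl/subvP => v _; rewrite memv_ker zero_lfunE.
Qed.

Definition degs d := undup [seq g <- projT1 (cid (hc_fin HC d)) | `[< pdim g = d >]].

Lemma mem_degs d g : (g \in degs d) = `[< pdim g = d >].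
Proof.
rewrite mem_undup mem_filter; case: asboolP => //= gd.
exact: (projT2 (cid (hc_fin HC d))) gd.
Qed.

Lemma degs_uniq d : uniq (degs d). Proof. exact: undup_uniq. Qed.

Section HallPolynomials.
Variable f : S -> S -> S -> {poly rat}.
Hypothesis Hf : hall_polynomials f.

(** The ambient family is arbitrary, so that Hall numbers for different pieces of one chain can be
    counted side by side. Prime fields suffice because a polynomial is determined by its values at
    the primes. *)
Lemma hall_count p (V : vectType 'F_p) (A : arrow Q -> 'End(V)) sp W a b g :
  prime p -> stable (@src Q) (@tgt Q) A sp -> qc A sp W g ->
  (f a b g).[p%:R] =
    (\sum_(U | stable (@src Q) (@tgt Q) A U) (`[< qc A U W b >] && `[< qc A sp U a >] : nat))%:R.
Proof.
move=> pp ssp [e [X [qX cX]]].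
have [c [M cM]] := hc_ex HC 'F_p a; have [d [N cN]] := hc_ex HC 'F_p b.
have := Hf cM cN cX; rewrite card_Fp // => <-; congr _%:R.
rewrite (hall_numberE _ _ ssp qX) -sum1_card big_mkcond [RHS]big_mkcond /=.
apply: eq_bigr => U _; rewrite inE; have [sU|//] := boolP (stable _ _ _ _).
have qN : qreal A U W N <-> qc A U W b.
  by split=> [h|h]; [exists d, N|apply/(qc_real _ sU h)].
have qM : qreal A sp U M <-> qc A sp U a.
  by split=> [h|h]; [exists c, M|apply/(qc_real _ ssp h)].
have -> : `[< qc A U W b >] = `[< qreal A U W N >] by apply: asbool_equiv_eq; split=> /qN.
have -> : `[< qc A sp U a >] = `[< qreal A sp U M >] by apply: asbool_equiv_eq; split=> /qM.
have [qNU|] := asboolP (qreal A U W N); last by rewrite !andbF.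
have [qMU|] := asboolP (qreal A sp U M); last by rewrite !andbF.
by rewrite (qreal_fle qNU) (qreal_fle qMU).
Qed.

Lemma class_rep p g : prime p -> exists (V : vectType 'F_p) (A : arrow Q -> 'End(V)) sp,
  stable (@src Q) (@tgt Q) A sp /\ qc A sp fam0 g.
Proof.
move=> pp; have [d [X cX]] := hc_ex HC 'F_p g.
exists _, (amb_map X), (amb_sp _ d); split; first exact: amb_stable.
by exists d, X; split=> //; exact: amb_real.
Qed.

Lemma hall_deg a b g : pdim g <> dimD (pdim a) (pdim b) -> f a b g = 0.
Proof.
move=> ng; apply: poly_eq_primes => p pp; rewrite horner0.
have [V [A [sp [ssp qg]]]] := class_rep g pp.
rewrite (hall_count a b pp ssp qg) big1 // => U _.
apply/eqP; rewrite eqb0; apply/negP => /andP[/asboolP qb /asboolP qa].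
apply: ng; apply/funext => i; have := qc_dim i qg.
rewrite (qc_dim i qa) (qc_dim i qb) ffunE dimv0 !add0n => <-.
by rewrite addnC.
Qed.

(** At a prime both sides count the chains of stable families [W] in [U] in [sp] whose successive
    quotients from the bottom have classes c, b and a. They are grouped by the class of [sp] modulo
    [W] on one side, by the class of [U] on the other. *)
Lemma hall_assoc a b c g :
  \sum_(m <- degs (dimD (pdim a) (pdim b))) f a b m * f m c g =
  \sum_(n <- degs (dimD (pdim b) (pdim c))) f b c n * f a n g.
Proof.
apply: poly_eq_primes => p pp; rewrite !horner_sum.
have [V [A [sp [ssp qg]]]] := class_rep g pp.
have s0 := fam0_stable (@src Q) (@tgt Q) A.
have nsp := qc_nil ssp s0 qg.
pose st := stable (@src Q) (@tgt Q) A.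
transitivity ((\sum_(W | st W) \sum_(U | st U)
  ([&& `[< qc A W fam0 c >], `[< qc A U W b >] & `[< qc A sp U a >]] : nat))%:R : rat).
- under [LHS]eq_bigr => m _ do rewrite hornerM (hall_count m c pp ssp qg) natr_sum mulr_sumr.
  rewrite exchange_big [RHS]natr_sum; apply: eq_bigr => W sW.
  have [qcW|nqc] := asboolP (qc A W fam0 c); last first.
    rewrite [LHS]big1 => [|m _] /=; last by rewrite mulr0.
    by rewrite big1.
  have [Wsp|nWsp] := boolP (fle W sp); last first.
    rewrite [LHS]big1 => [|m _] /=; last first.
      by case: asboolP => [/qc_fle|]; rewrite ?(negPf nWsp) ?mulr0.
    rewrite big1 // => U _; apply/eqP; rewrite eqb0; apply: contra nWsp.
    by move=> /andP[/asboolP/qc_fle h /asboolP/qc_fle]; exact: fle_trans.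
  have nW : nilA A sp W by apply: nilA_quot nsp; exact: fle0.
  have [m qm] := qc_ex ssp sW Wsp nW.
  have [md|nmd] := boolP (m \in degs (dimD (pdim a) (pdim b))).
    rewrite (bigD1_seq m) ?degs_uniq //= big1 => [|m' nm'].
      rewrite (asboolT qm) mulr1 addr0 (hall_count a b pp ssp qm).
      by [].
    case: asboolP => [qm'|]; last by rewrite mulr0.
    by rewrite (qc_uniq ssp qm qm') eqxx in nm'.
  (* A class outside the list has the wrong dimension vector, so [f a b m] vanishes and this [W]
     contributes to neither side. *)
  have h0 : f a b m = 0.
    by apply: hall_deg => /asboolP; rewrite -mem_degs (negPf nmd).
  have := hall_count a b pp ssp qm; rewrite h0 horner0 => /esym ->.
  rewrite big_seq big1 // => m' dm'; case: asboolP => [qm'|]; last by rewrite mulr0.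
  by rewrite (qc_uniq ssp qm qm') dm' in nmd.
apply/esym; rewrite [X in _ = X%:R]exchange_big /=.
under [LHS]eq_bigr => m _ do rewrite hornerM (hall_count a m pp ssp qg) natr_sum mulr_sumr.
rewrite exchange_big [RHS]natr_sum; apply: eq_bigr => U sU.
have [qcU|nqc] := asboolP (qc A sp U a); last first.
  rewrite [LHS]big1 => [|m _] /=; last by rewrite andbF mulr0.
  by rewrite big1 // => W _; rewrite !andbF.
have Usp := qc_fle qcU.
have nU : nilA A U fam0 by exact: nilA_sub nsp.
have [n qn] := qc_ex sU s0 (fle0 U) nU.
have -> : (\sum_(W | st W) [&& `[< qc A W fam0 c >], `[< qc A U W b >] & true])%N =
          (\sum_(W | st W) (`[< qc A W fam0 c >] && `[< qc A U W b >]))%N.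
  by apply: eq_bigr => W _; rewrite andbT.
have [nd|nnd] := boolP (n \in degs (dimD (pdim b) (pdim c))).
  rewrite (bigD1_seq n) ?degs_uniq //= big1 => [|n' nn'].
    by rewrite (asboolT qn) mulr1 addr0 (hall_count b c pp sU qn).
  case: asboolP => [qn'|]; last by rewrite mulr0.
  by rewrite (qc_uniq sU qn qn') eqxx in nn'.
have h0 : f b c n = 0.
  by apply: hall_deg => /asboolP; rewrite -mem_degs (negPf nnd).
have := hall_count b c pp sU qn; rewrite h0 horner0 => <-.
rewrite big_seq big1 // => n' dn'; case: asboolP => [qn'|]; last by rewrite mulr0.
by rewrite (qc_uniq sU qn qn') dn' in nnd.
Qed.

Lemma hall_unitl b g : f (pzero S) b g = (b == g)%:R.
Proof.
apply: poly_eq_primes => p pp.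
have [V [A [sp [ssp qg]]]] := class_rep g pp.
rewrite (hall_count _ _ pp ssp qg) (bigD1 sp) //= big1 => [|U /andP[sU nU]].
  rewrite (asboolT (qc_zero ssp)) andbT addn0.
  have [->|nbg] := eqVneq b g; first by rewrite asboolT // hornerC.
  rewrite asboolF ?horner0 // => qb; move/eqP: nbg; apply.
  exact: qc_uniq ssp qb qg.
apply/eqP; rewrite eqb0; apply: contra nU => /andP[_ /asboolP q0].
apply/eqP; apply: fle_dim; first exact: qc_fle q0.
by move=> i; rewrite (qc_dim i q0) -(hc_dim HC (hc_zero HC 'F_p)) addn0.
Qed.

Lemma hall_unitr a g : f a (pzero S) g = (a == g)%:R.
Proof.
apply: poly_eq_primes => p pp.
have [V [A [sp [ssp qg]]]] := class_rep g pp.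
have s0 := fam0_stable (@src Q) (@tgt Q) A.
rewrite (hall_count _ _ pp ssp qg) (bigD1 fam0) //= big1 => [|U /andP[sU nU]].
  rewrite (asboolT (qc_zero s0)) addn0 /=.
  have [->|nag] := eqVneq a g; first by rewrite asboolT // hornerC.
  rewrite asboolF ?horner0 // => qa; move/eqP: nag; apply.
  exact: qc_uniq ssp qa qg.
apply/eqP; rewrite eqb0; apply: contra nU => /andP[/asboolP q0 _].
apply/fam0_dimP => i; rewrite (qc_dim i q0) -(hc_dim HC (hc_zero HC 'F_p)).
by rewrite ffunE dimv0.
Qed.

(** Here the specialisation at 0 is computed. The value at p counts the first steps [U] of a flag
    weighted by the test on [U]; [hc_count], applied to [sp] and to each [U], identifies this modulo
    p with the test on [g]. *)
Lemma hall_word d w g : pdim g = dimD d (wdim w) ->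
  \sum_(a <- degs d | t [:: d] a) \sum_(b <- degs (wdim w) | t w b) (f a b g).[0] =
  (t (d :: w) g)%:R.
Proof.
move=> gd.
have E q : \sum_(a <- degs d | t [:: d] a) \sum_(b <- degs (wdim w) | t w b) (f a b g).[q] =
    (\sum_(a <- degs d | t [:: d] a) \sum_(b <- degs (wdim w) | t w b) f a b g).[q].
  by rewrite horner_sum; apply: eq_bigr => a _; rewrite horner_sum.
rewrite E; apply: poly_value0 => p pp; rewrite -E.
have [V [A [sp [ssp qg]]]] := class_rep g pp.
have s0 := fam0_stable (@src Q) (@tgt Q) A.
have nsp := qc_nil ssp s0 qg.
pose st := stable (@src Q) (@tgt Q) A.
(* The value at p: the first steps [U], each with the indicator that its class passes the test for
   [w]. *)
exists (\sum_(U | step (@src Q) (@tgt Q) A strict d sp U)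
   \sum_(b <- degs (wdim w) | t w b) (`[< qc A U fam0 b >] : nat))%N.
  under [LHS]eq_bigr => a _.
    under eq_bigr => b _ do rewrite (hall_count a b pp ssp qg) natr_sum.
    rewrite exchange_big; over.
  rewrite [RHS]natr_sum exchange_big [RHS]big_mkcond [LHS]big_mkcond; apply: eq_bigr => U _ /=.
  have [sU|nsU] := boolP (stable _ _ _ _); last first.
    by rewrite ifN // /step (negPf nsU).
  have stepP : step (@src Q) (@tgt Q) A strict d sp U <-> exists2 a, t [:: d] a & qc A sp U a.
    split=> [sUd|[a ta qa]].
      have /and4P[_ Usp _ _] := sUd.
      have [a qa] := qc_ex ssp sU Usp (nilA_quot (fle0 U) nsp).
      by exists a => //; apply/(aflag_t _ ssp sU qa); exists U.
    by have /(aflag_t _ ssp sU qa)[U' [? <-]] := ta.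
  have [/stepP[a ta qa]|nstep] := boolP (step _ _ _ _ _ _ _).
    have da : a \in degs d.
      by rewrite mem_degs; apply/asboolP; rewrite (t_dim ta); apply/funext => i; exact: addn0.
    rewrite -big_filter (bigD1_seq a) /= ?filter_uniq ?degs_uniq ?mem_filter ?ta //.
    rewrite [X in _ + X]big1 ?addr0 => [|a' na'].
      rewrite natr_sum; apply: eq_bigr => b _; by rewrite (asboolT qa) andbT.
    rewrite big1 // => b _; rewrite [asbool (qc A sp U a')]asboolF ?andbF // => qa'.
    by rewrite (qc_uniq ssp qa qa') eqxx in na'.
  rewrite big1 // => a ta; rewrite big1 // => b _.
  rewrite [asbool (qc A sp U a)]asboolF ?andbF // => qa; move/negP: nstep; apply.
  by apply/stepP; exists a.
have [e [X [qX cX]]] := qg.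
rewrite -(hc_count HC pp (d :: w) ssp qX cX) /=.
elim/big_ind2: _ => // [x1 x2 y1 y2 hx hy|U].
  by rewrite -modnDm hx hy modnDm.
move=> /and4P[sU Usp /forallP dU _].
have [b qb] := qc_ex sU s0 (fle0 U) (nilA_sub Usp nsp).
have [e' [N [qN cN]]] := qb.
rewrite (hc_count HC pp w sU qN cN).
have db : b \in degs (wdim w).
  rewrite mem_degs; apply/asboolP/funext => i; apply/eqP.
  rewrite -(eqn_add2l (d i)) -/(dimD d (wdim w) i) -gd.
  have := qc_dim i qg; rewrite ffunE dimv0 add0n => <-.
  by rewrite (eqP (dU i)) (qc_dim i qb) ffunE dimv0 add0n addnC.
congr (_ %% _)%N; rewrite big_mkcond (bigD1_seq b) ?degs_uniq //= big1 => [|b' nb'].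
  by rewrite (asboolT qb) addn0; case: (t w b).
by case: ifP => // _; rewrite asboolF // => qb'; rewrite (qc_uniq sU qb qb') eqxx in nb'.
Qed.

End HallPolynomials.

End AmbientClasses.

(** * The isomorphism from a flag test *)

(** A nonconstant [P] vanishing everywhere would leave [P + 1] without roots. *)
Lemma closed_poly0 (K : closedFieldType) (P : {poly K}) :
  (forall t, P.[t] = 0) -> P = 0.
Proof.
move=> P0; apply/eqP/negPn/negP => nz.
have sP : (1 < size P)%N.
  rewrite ltnNge; apply/negP => /size1_polyC PE.
  by move: nz (P0 0); rewrite PE hornerC polyC_eq0 => /eqP.
have /closed_rootP[x] : size (P + 1) != 1%N.
  by rewrite size_polyDl ?size_poly1 //; case: (size P) sP => [|[|]].
by rewrite /root hornerD P0 add0r hornerC oner_eq0.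
Qed.

(** The products and [Psi] are sums over possibly infinite sets of classes; a list [r] bounding the
    support reduces them to ordinary sums. *)
Lemma mcoeff_fsbig (I : choiceType) (A : set I) (r : seq I) (c : I -> rat) b :
  uniq r -> (forall i, A i -> c i != 0 -> i \in r) ->
  mcoeff b (\sum_(i \in A) (<< c i *g i >> : {malg rat[I]})) =
  if `[< A b >] then c b else 0.
Proof.
move=> ur Ar; rewrite (fsbigE [seq i <- r | `[< A i >]]) ?filter_uniq //; first last.
- move=> i Ai; rewrite mem_filter (asboolT Ai) /= => ir.
  apply/eqP; rewrite monalgU_eq0; apply: contraNT ir; exact: Ar.
- by move=> i /=; rewrite mem_filter => /andP[/asboolP].
rewrite raddf_sum /= big_mkcond; set r' := [seq _ <- _ | _].
have Fi i : i != b -> (if i \in A then mcoeff b << c i *g i >> else 0) = 0.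
  by move=> ib; rewrite mcoeffU (negPf ib) mulr0n if_same.
have [br|nbr] := boolP (b \in r').
  rewrite (bigD1_seq b) ?filter_uniq //= big1 // addr0 mcoeffUU.
  by move: br; rewrite mem_filter => /andP[/asboolP Ab _]; rewrite mem_set // asboolT.
rewrite big_seq big1 => [|i ir']; last by apply: Fi; apply: contraNneq nbr => <-.
case: asboolP => // Ab; apply/esym/eqP; apply: contraNT nbr => cb.
by rewrite mem_filter asboolT //= Ar.
Qed.

Section HallCase.
Variables (Q : quiver) (S : parametrisation Q) (strict : bool).
Variable t : seq (dimvec Q) -> S -> bool.
Hypothesis HC : hall_case strict t.
Variables (K : closedFieldType) (f : S -> S -> S -> {poly rat}).
Hypothesis Hf : hall_polynomials f.

Lemma Rset_stable w : GLstable (@Rset Q K strict w).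
Proof. by apply/iso_stable => M N; exact: Rset_iso. Qed.

Definition gw w : genvar Q K :=
  Genvar (hc_closed HC K w) (Rset_irreducible (@closed_poly0 K) strict w)
    (@Rset_stable w) (@hc_nilw _ _ _ _ HC K w).

Definition gpack (A : genvar Q K) :=
  existT (fun d : dimvec Q => set (rep K d)) (gdim A) (@gset _ _ A).

Lemma gpack_inj : injective gpack.
Proof.
case=> [d Z c i s n] [d' Z' c' i' s' n']; rewrite /gpack /= => e.
have dd' : d = d' := congr1 (@projT1 _ _) e.
move: dd' Z' c' i' s' n' e => <- Z' c' i' s' n' e.
have ZZ' : Z = Z'.
  have := projT2_eq e; rewrite (Prop_irrelevance (projT1_eq e) erefl) /=.
  exact.
move: c' i' s' n' {e}; rewrite -{}ZZ' => c' i' s' n'.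
congr Genvar; exact: Prop_irrelevance.
Qed.

Lemma is_ext_gw w1 w2 : is_ext_product (gw w1) (gw w2) (gw (w1 ++ w2)).
Proof. exact: Rset_cat. Qed.

(** [ext_product] chooses a witness. A [genvar] is determined by its packed set, so the choice can
    only be the concatenated word. *)
Lemma ext_product_gw w1 w2 : ext_product (gw w1) (gw w2) = gw (w1 ++ w2).
Proof.
have ex : (exists C, [set C | is_ext_product (gw w1) (gw w2) C] C)%classic.
  by exists (gw (w1 ++ w2)); exact: is_ext_gw.
apply: gpack_inj; exact: etrans (xgetPex (genvar0 Q K) ex) (esym (is_ext_gw w1 w2)).
Qed.

Lemma gw0 : gw [::] = genvar0 Q K.
Proof. by apply: gpack_inj. Qed.

Lemma classes_gw w g : classes (gw w) g <-> t w g.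
Proof.
split=> [[M [RM cM]]|tw]; first exact/(Rset_t HC cM).
have [d [M cM]] := hc_ex HC K g.
have dw : d = wdim w by rewrite (hc_dim HC cM); exact: (t_dim HC tw).
by move: dw M cM => -> M cM; exists M; split=> //; apply/(Rset_t HC cM).
Qed.

Lemma class_stable (d : dimvec Q) (Z : set (rep K d)) (M N : rep K d) (g : S) : GLstable Z ->
  Z M -> pclass M g -> pclass N g -> Z N.
Proof.
by move=> /iso_stable sZ ZM cM cN; apply: sZ ZM _; apply/(hc_iso HC cM cN).
Qed.

(** Finitely many classes have the dimension vector of [A], and the closures of those meeting [A]
    cover it; irreducibility leaves a single closure. *)
Lemma dense_class (A : genvar Q K) : exists g : S, classes A g /\
  (@gset _ _ A `<=` clO [set X | pclass X g])%classic.
Proof.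
pose C (g : S) : set (rep K (gdim A)) :=
  if `[< classes A g >] then clO [set X | pclass X g]%classic else set0.
have [||g _ gA] := zirr_cover (gset_irreducible A) (C := C) (s := degs HC (gdim A)).
- by move=> g; rewrite /C; case: ifP => _; [exact: clO_closed|exact: zclosed0].
- move=> M AM; have [g cM] := hc_class HC (gset_nilpotent AM).
  exists g; first by rewrite mem_degs; apply/asboolP; rewrite (hc_dim HC cM).
  rewrite /C asboolT; last by exists M.
  by apply: sub_clO.
exists g; move: gA; rewrite /C; case: asboolP => // _ A0.
by have [[M AM] _] := gset_irreducible A; have := A0 M AM.
Qed.

Definition dense A := projT1 (cid (dense_class A)).

Lemma denseP A : classes A (dense A) /\
  (@gset _ _ A `<=` clO [set X | pclass X (dense A)])%classic.
Proof. exact: projT2 (cid (dense_class A)). Qed.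

Lemma classes_dim (A : genvar Q K) (g : S) : classes A g -> pdim g = gdim A.
Proof. by case=> M [_ cM]; rewrite (hc_dim HC cM). Qed.

(** A closed stable set that contains the dense class of [A] contains [A]; two sets with the same
    dense class therefore contain each other. *)
Lemma dense_inj : injective dense.
Proof.
suff sub (A B : genvar Q K) : gdim A = gdim B -> dense A = dense B ->
    forall M : rep K (gdim A), forall N : rep K (gdim B), iso M N ->
      gset M -> gset N.
  move=> A B eAB.
  have dd : gdim A = gdim B.
    by rewrite -(classes_dim (denseP A).1) eAB (classes_dim (denseP B).1).
  apply: gpack_inj; apply: eq_packed_set => // M N isoMN; split.
    exact: sub isoMN.
  by apply: sub (iso_sym isoMN).
move=> dd eAB M N isoMN AM.
have [cA AO] := denseP A; have [[X [BX cX]] _] := denseP B.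
move: (@gset_closed _ _ B) (@gset_stable _ _ B) X BX cX N isoMN.
move: (@gset _ _ B); rewrite -eAB -dd => Z cZ sZ X ZX cX N isoMN.
have AZ : (@gset _ _ A `<=` Z)%classic.
  apply: subset_trans AO _; apply: clO_min => // Y cY.
  exact: class_stable sZ ZX cX cY.
by move/iso_stable: sZ => sZ; apply: sZ isoMN; exact: AZ.
Qed.

(** A pigeonhole argument replaces a geometric description of the monoid: sending [a] to the dense
    class of [gw (om a)] is an injective self-map of the finite set of classes of one dimension
    vector, so every dense class is attained. *)
Lemma gw_surj : exists om : S -> seq (dimvec Q), (forall A, exists a, A = gw (om a)) /\
  exists h : S -> nat, forall a, t (om a) a /\
    forall b, t (om a) b -> b <> a -> (h a < h b)%N.
Proof.
have [om [h omP]] := hc_word HC; exists om; split; last by exists h.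
move=> A; pose d := gdim A; pose phi a := dense (gw (om a)).
have omd a : wdim (om a) = pdim a by rewrite (t_dim HC (omP a).1).
(* Two equal sets contain each other's distinguished class, and the height would have to increase
   both ways. *)
have phi_inj : injective phi.
  move=> a b /dense_inj eab.
  have tab : t (om a) b by apply/classes_gw; rewrite eab; apply/classes_gw; case: (omP b).
  have tba : t (om b) a by apply/classes_gw; rewrite -eab; apply/classes_gw; case: (omP a).
  apply: contrapT => nab.
  have h1 := (omP a).2 b tab (fun e => nab (esym e)).
  by have := (omP b).2 a tba nab; lia.
have phi_deg a : pdim (phi a) = pdim a.
  by rewrite (classes_dim (denseP (gw (om a))).1) -omd.
have [|||_ eqi] := @uniq_min_size _ (map phi (degs HC d)) (degs HC d).
- by rewrite map_inj_uniq ?degs_uniq.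
- move=> _ /mapP[a da ->]; move: da; rewrite !mem_degs phi_deg //.
- by rewrite size_map.
have /mapP[a _ aE] : dense A \in map phi (degs HC d).
  by rewrite eqi mem_degs; apply/asboolP; exact: classes_dim (denseP A).1.
by exists a; exact: dense_inj.
Qed.

Local Notation opH := (fun a b : S => \sum_(g \in [set: S]) << (f a b g).[0] *g g >> : {malg rat[S]}).
Local Notation opM := (fun A B : genvar Q K => << ext_product A B >> : {malg rat[genvar Q K]}).

Lemma mcoeff_opH a b g : mcoeff g (opH a b) = (f a b g).[0].
Proof.
rewrite (@mcoeff_fsbig _ _ (degs HC (dimD (pdim a) (pdim b)))) ?degs_uniq //.
  by rewrite asboolT.
move=> i _ nz; rewrite mem_degs; apply/asboolP; apply: contrapT => di.
by move: nz; rewrite (hall_deg HC Hf di) horner0 eqxx.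
Qed.

Lemma supp_opH a b : {subset msupp (opH a b) <= degs HC (dimD (pdim a) (pdim b))}.
Proof.
move=> g; rewrite -mcoeff_neq0 mcoeff_opH mem_degs => nz.
apply/asboolP; apply: contrapT => di.
by move: nz; rewrite (hall_deg HC Hf di) horner0 eqxx.
Qed.

Lemma H0_graded : graded_algebra (@pdim Q S) (H0_mul f) (H0_one S).
Proof.
apply: bilin_ext_graded => [a b c|a|a||a b g].
- apply/malgP => g.
  rewrite (@mcoeff_bilin _ _ _ _ _ [:: c] _ (degs_uniq HC _) _ (@supp_opH a b)) //; last first.
    by move=> ?; rewrite msuppU oner_eq0 !inE.
  rewrite (@mcoeff_bilin _ _ _ _ [:: a] _ _ _ (degs_uniq HC _) _ (@supp_opH b c)) //; last first.
    by move=> ?; rewrite msuppU oner_eq0 !inE.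
  rewrite big_seq1; have := congr1 (fun P => P.[0]) (hall_assoc HC Hf a b c g).
  rewrite !horner_sum => e.
  transitivity (\sum_(i <- degs HC (dimD (pdim a) (pdim b))) (f a b i * f i c g).[0]).
    apply: eq_bigr => m _; rewrite big_seq1 mcoeffUU mulr1 !mcoeff_opH.
    by rewrite hornerM.
  rewrite {}e; apply: eq_bigr => n _; rewrite mcoeffUU mul1r !mcoeff_opH.
  by rewrite hornerM.
- apply/malgP => g; rewrite mcoeff_opH (hall_unitl HC Hf) mcoeffU.
  by case: (a == g); rewrite ?hornerC ?horner0.
- apply/malgP => g; rewrite mcoeff_opH (hall_unitr HC Hf) mcoeffU.
  by case: (a == g); rewrite ?hornerC ?horner0.
- by rewrite -(hc_dim HC (hc_zero HC rat)).
by move/supp_opH; rewrite mem_degs => /asboolP.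
Qed.

Lemma QM_graded : graded_algebra (@gdim Q K) (@QM_mul Q K) (QM_one Q K).
Proof.
have [om [sur _]] := gw_surj.
apply: bilin_ext_graded => [A B C|A|A||A B g].
- rewrite !bilin_extUU; have [a ->] := sur A; have [b ->] := sur B.
  by have [c ->] := sur C; rewrite !ext_product_gw catA.
- by have [a ->] := sur A; rewrite -gw0 ext_product_gw.
- by have [a ->] := sur A; rewrite -gw0 ext_product_gw cats0.
- by [].
rewrite msuppU oner_eq0 inE => /eqP->.
have [a ->] := sur A; have [b ->] := sur B.
by rewrite ext_product_gw /= wdim_cat.
Qed.

Definition psi (A : genvar Q K) : {malg rat[S]} :=
  \sum_(g \in classes A) (<< g >> : {malg rat[S]}).

Lemma mcoeff_psi A g : mcoeff g (psi A) = (`[< classes A g >])%:R.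
Proof.
rewrite /psi (@mcoeff_fsbig _ _ (degs HC (gdim A))) ?degs_uniq //.
  by case: asboolP.
by move=> i ci _; rewrite mem_degs; apply/asboolP; exact: classes_dim.
Qed.

Lemma mcoeff_psi_gw w g : mcoeff g (psi (gw w)) = (t w g)%:R.
Proof.
rewrite mcoeff_psi (_ : `[< classes (gw w) g >] = t w g) //.
by apply/asboolP/idP => [/classes_gw|tw] //; exact/classes_gw.
Qed.

Lemma supp_psi_gw w : {subset msupp (psi (gw w)) <= degs HC (wdim w)}.
Proof.
move=> g; rewrite -mcoeff_neq0 mcoeff_psi_gw mem_degs pnatr_eq0 eqb0 negbK => tw.
by apply/asboolP; exact: (t_dim HC tw).
Qed.

Lemma psi_step d w : H0_mul f (psi (gw [:: d])) (psi (gw w)) = psi (gw (d :: w)).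
Proof.
apply/malgP => g; rewrite mcoeff_psi_gw.
have d0 : wdim [:: d] = d by apply/funext => i; exact: addn0.
rewrite (mcoeff_bilin _ _ (degs_uniq HC d) (degs_uniq HC (wdim w)) _ (@supp_psi_gw w)); last first.
  by move=> a /supp_psi_gw; rewrite d0.
have [gd|ngd] := pselect (pdim g = dimD d (wdim w)); last first.
  rewrite (_ : t _ _ = false); last by apply/negP => /(t_dim HC).
  rewrite big_seq big1 // => a; rewrite mem_degs => /asboolP da.
  rewrite big_seq big1 // => b; rewrite mem_degs => /asboolP db.
  by rewrite mcoeff_opH (hall_deg HC Hf) ?horner0 ?mulr0 // da db.
rewrite -(hall_word HC Hf gd) [RHS]big_mkcond; apply: eq_bigr => a _.
rewrite mcoeff_psi_gw [X in if _ then X else _]big_mkcond /=.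
case: (t [:: d] a); last by rewrite big1 // => b _; rewrite !mul0r.
apply: eq_bigr => b _; rewrite mcoeff_psi_gw mcoeff_opH mul1r.
by case: (t w b); rewrite ?mul1r ?mul0r.
Qed.

Lemma psi_gw0 : psi (gw [::]) = H0_one S.
Proof.
apply/malgP => g; rewrite mcoeff_psi_gw mcoeffU.
have [d [X cX]] := hc_ex HC rat g.
have -> : t [::] g = (pzero S == g).
  have e := @hc_flag _ _ _ _ HC _ _ _ _ _ X g [::] (amb_stable X) (amb_real X) cX.
  apply/idP/eqP => [/e /= sp0|zg].
    apply/(hc_iso HC (hc_zero HC rat) cX); apply: iso_sym.
    have q0 := @qreal_fam0 Q rat _ (amb_map X); have := amb_real X.
    by rewrite {1}sp0 => qX; exact: (qreal_uniq (fam0_stable _ _ _) qX q0).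
  apply/e => /=; apply/eqP/fam0_dimP => i.
  by rewrite (qreal_dim i (amb_real X)) (hc_dim HC cX) -zg
     -(hc_dim HC (hc_zero HC rat)) ffunE dimv0.
by case: (_ == _).
Qed.

Lemma psi_cat w1 w2 : H0_mul f (psi (gw w1)) (psi (gw w2)) = psi (gw (w1 ++ w2)).
Proof.
have [_ _ mA m1 _ _ _] := H0_graded.
elim: w1 => [|d w1 IH]; first by rewrite psi_gw0 m1.
by rewrite -psi_step -mA IH psi_step.
Qed.

Lemma Psi_lin x : @Psi Q S K x = lin_ext psi x.
Proof. by []. Qed.

Lemma Psi_linear : linear (@Psi Q S K).
Proof. exact: lin_ext_linear. Qed.

Lemma PsiU A : @Psi Q S K << A >> = psi A.
Proof. exact: lin_extU. Qed.

Lemma Psi_mul : {morph (@Psi Q S K) : x y / QM_mul x y >-> H0_mul f x y}.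
Proof.
have [om [sur _]] := gw_surj => x y.
apply: (linear_eq (f := fun x => @Psi Q S K (QM_mul x y))
          (g := fun x => H0_mul f (@Psi Q S K x) (@Psi Q S K y))) x => [||A].
- exact: linear_comp_in (bilin_ext_linl _ y) Psi_linear.
- exact: linear_comp_in Psi_linear (bilin_ext_linl _ _).
apply: (linear_eq (f := fun y => @Psi Q S K (QM_mul << A >> y))
          (g := fun y => H0_mul f (@Psi Q S K << A >>) (@Psi Q S K y))) y => [||B].
- exact: linear_comp_in (bilin_ext_linr _ _) Psi_linear.
- exact: linear_comp_in Psi_linear (bilin_ext_linr _ _).
rewrite /QM_mul bilin_extUU !PsiU; have [a ->] := sur A; have [b ->] := sur B.
by rewrite ext_product_gw psi_cat.
Qed.

Lemma mcoeff_Psi x g :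
  mcoeff g (@Psi Q S K x) = \sum_(A <- msupp x) mcoeff A x * (`[< classes A g >])%:R.
Proof.
rewrite Psi_lin raddf_sum; apply: eq_bigr => A _ /=.
by rewrite mcoeffZ mcoeff_psi.
Qed.

(** Among the words in the support take one whose class [a] has least height: no other element of
    the support can contribute to the coefficient at [a]. *)
Lemma Psi_ker x : @Psi Q S K x = 0 -> x = 0.
Proof.
have [om [sur [h omP]]] := gw_surj => x0.
apply: contrapT => nz; have [A0 A0x] : exists A0, A0 \in msupp x.
  apply: contrapT => no; apply: nz; apply/malgP => A; rewrite mcoeff0.
  by apply: mcoeff_outdom; apply/negP => Ax; apply: no; exists A.
pose P n := `[< exists a, gw (om a) \in msupp x /\ h a = n >].
have exP : exists n, P n.
  by have [a aE] := sur A0; exists (h a); apply/asboolP; exists a; rewrite -aE.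
case: (ex_minnP exP) => n /asboolP[a [ax <-]] minn.
have := mcoeff_Psi x a; rewrite x0 mcoeff0 (big_fsetD1 _ ax) /=.
rewrite asboolT; last by apply/classes_gw; case: (omP a).
rewrite big_seq big1 => [|B]; last first.
  rewrite !inE => /andP[Ba Bx]; have [b bE] := sur B.
  rewrite asboolF ?mulr0 // bE => /classes_gw tba.
  have [eab|/eqP nab] := eqVneq a b; first by rewrite bE eab eqxx in Ba.
  have lt := (omP b).2 a tba nab; have : P (h b).
    by apply/asboolP; exists b; rewrite -bE.
  by move/minn; lia.
rewrite addr0 mulr1 => /esym/eqP; rewrite mcoeff_eq0 => /negP; exact.
Qed.

(** Back substitution from the top: [gw (om a)] maps to the basis element of [a] plus basis elements
    of larger height, which are reached first. *)
Lemma Psi_surj y : exists x, @Psi Q S K x = y.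
Proof.
have [om [sur [h omP]]] := gw_surj.
have l0 : @Psi Q S K 0 = 0.
  by rewrite Psi_lin /lin_ext msupp0 big_seq_fset0.
have lin := Psi_linear.
suff base a : exists x, @Psi Q S K x = << a >>.
  rewrite [y]monalgE; elim: (enum_fset (msupp y)) => [|a s [x xE]].
    by exists 0; rewrite big_nil.
  have [z zE] := base a; exists (mcoeff a y *: z + x).
  by rewrite big_cons malgZU lin zE xE.
(* A crude bound for the heights within one degree, which makes the downward induction finite. *)
pose bnd := (\sum_(b <- degs HC (pdim a)) h b)%N.
have hb b : b \in degs HC (pdim a) -> (h b <= bnd)%N.
  by move=> db; rewrite /bnd (big_rem b) //= leq_addr.
move: {-1}(pdim a) (erefl (pdim a)) @bnd hb => d da bnd hb.
have [n] := ubnP (bnd - h a)%N; elim: n a da => // n IH a da le_n.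
pose r := [seq b <- degs HC d | t (om a) b && (b != a)].
have rP b : b \in r -> exists x, @Psi Q S K x = << b >>.
  rewrite mem_filter => /andP[/andP[tab /eqP nb] db].
  have lt := (omP a).2 b tab nb; apply: (IH b) => //.
    by move: db; rewrite mem_degs => /asboolP.
  by have := hb b db; move: le_n; lia.
have [z zE] : exists z, @Psi Q S K z = \sum_(b <- r) << b >>.
  elim: (r) rP => [|b s IHs] sP; first by exists 0; rewrite big_nil.
  have [x xE] := sP b (mem_head _ _).
  have [|z zE] := IHs; first by move=> c cs; apply: sP; rewrite inE cs orbT.
  by exists (1 *: x + z); rewrite lin xE zE scale1r big_cons.
exists ((-1) *: z + << gw (om a) >>); rewrite lin zE PsiU scaleN1r.
apply/malgP => g; rewrite mcoeffD mcoeffN mcoeff_psi_gw mcoeffU raddf_sum /=.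
have -> : \sum_(b <- r) mcoeff g (<< b >> : {malg rat[S]}) = (g \in r)%:R.
  under eq_bigr do rewrite mcoeffU.
  have [gr|ngr] := boolP (g \in r).
    rewrite (bigD1_seq g) ?filter_uniq ?degs_uniq //= eqxx big1 ?addr0 // => b /negPf->.
    by rewrite mulr0n.
  rewrite big_seq big1 // => b br; case: eqP => // e; by rewrite -e br in ngr.
rewrite mem_filter mem_degs; have [tag|ntag] := boolP (t (om a) g).
  rewrite asboolT ?andbT; last first.
    by rewrite (t_dim HC tag) -(t_dim HC (omP a).1).
  by rewrite eq_sym; case: (a == g) => /=; rewrite ?oppr0 ?add0r ?addNr.
rewrite oppr0 addr0; case: eqP => // ag; by rewrite -ag (omP a).1 in ntag.
Qed.

Lemma Psi_deg d x : homogeneous (@gdim Q K) d x <-> homogeneous (@pdim Q S) d (@Psi Q S K x).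
Proof.
split=> hx.
  move=> g; rewrite -mcoeff_neq0 mcoeff_Psi => nz.
  have [A [Ax cA]] : exists A, A \in msupp x /\ classes A g.
    apply: contrapT => no; move/eqP: nz; apply; rewrite big_seq big1 // => A Ax.
    by rewrite asboolF ?mulr0 // => cA; apply: no; exists A.
  by rewrite (classes_dim cA) (hx A).
(* [y] collects the terms of [x] of the wrong degree. Its image vanishes degree by degree, so
   injectivity gives [y = 0]. *)
pose y : {malg rat[genvar Q K]} := \sum_(A <- msupp x | gdim A != d) << mcoeff A x *g A >>.
have yE A : mcoeff A y = if gdim A != d then mcoeff A x else 0.
  rewrite raddf_sum /=; under eq_bigr do rewrite mcoeffU.
  have [Ax|nAx] := boolP (A \in msupp x); last first.
    rewrite (mcoeff_outdom nAx) if_same big_seq_cond big1 // => B /andP[Bx _].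
    by case: eqP => // BA; rewrite BA (negPf nAx) in Bx.
  rewrite big_mkcond (big_fsetD1 _ Ax) /= eqxx mulr1n big_seq big1 ?addr0 // => B.
  by rewrite !inE => /andP[/negPf-> _]; rewrite if_same.
suff y0 : y = 0.
  move=> A Ax; apply/eqP; apply: contraTT Ax => nd; rewrite -mcoeff_eq0.
  by have := yE A; rewrite nd y0 mcoeff0 => <-.
apply: Psi_ker; apply/malgP => g; rewrite mcoeff0 Psi_lin /lin_ext.
rewrite (supp_sum (r := msupp x)) ?fset_uniq //; last first.
  by move=> A; rewrite -!mcoeff_neq0 yE; case: ifP; rewrite ?eqxx.
rewrite raddf_sum /=; have [gd|ngd] := pselect (pdim g = d).
  rewrite big1 // => A _; rewrite mcoeffZ mcoeff_psi yE; case: eqP => /= [_|nd].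
    by rewrite mul0r.
  by rewrite asboolF ?mulr0 // => cA; apply: nd; rewrite -(classes_dim cA).
have : mcoeff g (@Psi Q S K x) = 0.
  by apply/eqP; rewrite mcoeff_eq0; apply/negP => /hx.
rewrite mcoeff_Psi => e; rewrite -[RHS]e; apply: eq_bigr => A _.
rewrite mcoeffZ mcoeff_psi yE; have [cA|_] := asboolP (classes A g); last by rewrite !mulr0.
case: eqP => //= gA; by case: ngd; rewrite (classes_dim cA).
Qed.

Theorem hall_case_theorem :
  [/\ ext_closed Q K,
      graded_algebra (@gdim Q K) (@QM_mul Q K) (QM_one Q K),
      graded_algebra (@pdim Q S) (H0_mul f) (H0_one S)
    & graded_algebra_iso (@gdim Q K) (@pdim Q S) (@QM_mul Q K) (H0_mul f)
        (QM_one Q K) (H0_one S) (@Psi Q S K)].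
Proof.
have [om [sur _]] := gw_surj.
split; [|exact: QM_graded|exact: H0_graded|split].
- move=> A B; have [a ->] := sur A; have [b ->] := sur B.
  by exists (gw (om a ++ om b)); exact: is_ext_gw.
- exact: Psi_linear.
- pose g y := projT1 (cid (Psi_surj y)).
  have gK : cancel g (@Psi Q S K) by move=> y; exact: projT2 (cid (Psi_surj y)).
  exists g => // x; apply/eqP; rewrite -subr_eq0; apply/eqP/Psi_ker.
  have := Psi_linear (-1) x (g (@Psi Q S K x)).
  by rewrite gK !scaleN1r addNr addrC.
- exact: Psi_mul.
- by rewrite /QM_one PsiU -gw0 psi_gw0.
exact: Psi_deg.
Qed.

End HallCase.

(** * Counting subspaces modulo q *)

Section GrassmannCount.
Variables (F : finFieldType) (V : vectType F).
Implicit Types I H W U C : {vspace V}.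
Local Notation q := #|F|.
Local Notation fV := (finvect_type V).

Lemma card_fvspace U : #|[pred v : fV | v \in U]| = (q ^ \dim U)%N.
Proof.
pose rV2V (c : 'rV[F]_(\dim U)) : fV := \sum_i c 0 i *: (vbasis U)`_i.
have rV2V_inj : injective rV2V.
  have freeU : free (vbasis U) := basis_free (vbasisP U).
  apply: (can_inj (g := rowcoord (vbasis U))) => c.
  by apply/rowP => i; rewrite mxE coord_sum_free.
rewrite -[\dim U]mul1n -card_mx -(card_imset _ rV2V_inj).
apply: eq_card => v; rewrite inE; apply/idP/imsetP => [Uv|[c _ ->]].
  exists (rowcoord (vbasis U) v) => //; rewrite {1}(coord_vbasis Uv).
  by apply: eq_bigr => i _; rewrite mxE.
by apply: memv_suml => i _; rewrite memvZ // vbasis_mem // mem_nth // size_tuple.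
Qed.

Lemma hyperplane_split H W w0 v : (H <= W)%VS -> \dim W = (\dim H).+1 ->
  w0 \in W -> w0 \notin H -> v \in W -> exists c, v - c *: w0 \in H.
Proof.
move=> HW dW Ww0 Hw0 Wv.
have n0 : w0 != 0 by apply: contraNneq Hw0 => ->; rewrite mem0v.
have HW0 : (H + <[w0]> <= W)%VS by rewrite subv_add HW -memvE Ww0.
have H0 : (H :&: <[w0]> = 0)%VS.
  apply/eqP; rewrite -subv0; apply/subvP => u; rewrite memv_cap.
  case/andP=> Hu /vlineP[k uE]; rewrite memv0 uE; move: Hu; rewrite uE.
  have [->|k0 /(memvZ k^-1)] := eqVneq k 0; first by rewrite scale0r.
  by rewrite scalerA mulVf // scale1r (negPf Hw0).
have : v \in (H + <[w0]>)%VS.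
  have /eqP-> : (H + <[w0]>)%VS == W; last by [].
  by rewrite eqEdim HW0 dW dimv_disjoint_sum // dim_vline n0 /= addn1.
by case/memv_addP=> h Hh [_ /vlineP[c ->] ->]; exists c; rewrite addrK.
Qed.

(** Fix [w0] in [W] outside [H]. A member of the fibre meets the affine hyperplane [w0 + H] in a
    coset of [U'], and each point of that hyperplane lies in exactly one member. A nonempty fibre
    thus has q to the power dim H - dim U' elements, and dim U' < dim H because D <= dim H. *)
Lemma grass_fiber I H W U' D : (I <= H)%VS -> (H <= W)%VS -> \dim W = (\dim H).+1 ->
  (D <= \dim H)%N ->
  (q %| #|[pred U : {vspace V} | [&& (I <= U)%VS, (U <= W)%VS, \dim U == D,
      ~~ (U <= H)%VS & (U :&: H)%VS == U']]|)%N.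
Proof.
move=> IH HW dW leD; set fib := [pred U | _].
have [U1 fU1|fib0] := pickP fib; last by rewrite (eq_card0 fib0) dvdn0.
have /and5P[IU1 U1W /eqP dU1 nU1H /eqP U1H] := fU1.
have /subvPn[w0 U1w0 Hw0] := nU1H.
have Ww0 : w0 \in W by exact: subvP U1W _ U1w0.
have dU' U : U \in fib -> \dim U = (\dim U').+1.
  case/and5P=> _ UW _ nUH /eqP <-; have /subvPn[u Uu Hu] := nUH.
  have n0 : u != 0 by apply: contraNneq Hu => ->; rewrite mem0v.
  apply/eqP; rewrite eqn_leq; apply/andP; split; last first.
    rewrite ltn_neqAle (dimv_leqif_sup (capvSl U H)) dimvS ?capvSl // andbT.
    by rewrite subv_cap subvv.
  have := dimv_sum_cap U H; have : (\dim (U + H) <= \dim W)%N.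
    by rewrite dimvS // subv_add UW HW.
  by rewrite dW; lia.
have D' : D = (\dim U').+1 by rewrite -dU1 dU'.
have IU' : (I <= U')%VS by rewrite -U1H subv_cap IU1.
have U'H : (U' <= H)%VS by rewrite -U1H capvSr.
have U'W : (U' <= W)%VS by exact: subv_trans HW.
pose cos (U : {vspace V}) := #|[pred h : fV | (h \in H) && (w0 + h \in U)]|.
have cosE U : U \in fib -> cos U = (q ^ \dim U')%N.
  move=> fU; have /and5P[_ UW _ nUH /eqP UH] := fU.
  have /subvPn[u Uu Hu] := nUH.
  have [c Hc] := hyperplane_split HW dW Ww0 Hw0 (subvP UW _ Uu).
  have c0 : c != 0.
    by apply: contraNneq Hu => c0; move: Hc; rewrite c0 scale0r subr0.
  pose h1 : V := c^-1 *: u - w0.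
  have Hh1 : h1 \in H.
    have -> : h1 = c^-1 *: (u - c *: w0) by rewrite scalerBr scalerA mulVf ?scale1r.
    by rewrite memvZ.
  have Uh1 : w0 + h1 \in U by rewrite addrC subrK memvZ.
  rewrite -card_fvspace /cos.
  have inj : injective (fun h : fV => (h1 : fV) + h) by exact: addrI.
  rewrite -[RHS](card_imset _ inj); apply: eq_card => h; rewrite inE.
  apply/idP/imsetP => [/andP[Hh Uh]|[v U'v ->]].
    exists (- (h1 : fV) + h); last by rewrite addNKr.
    rewrite inE -UH; suff : (h : V) - h1 \in (U :&: H)%VS by rewrite addrC.
    have hH : (h : V) - h1 \in H by exact: memvB.
    rewrite memv_cap hH andbT.
    have e (a b z : V) : a - b = (z + a) - (z + b).
      by rewrite opprD addrACA subrr add0r.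
    by rewrite (e _ _ w0); exact: memvB.
  have : (v : V) \in (U :&: H)%VS by rewrite UH.
  rewrite memv_cap => /andP[Uv Hv].
  by apply/andP; split; [exact: (memvD Hh1 Hv)|rewrite addrA; exact: (memvD Uh1 Uv)].
have sumcos : (\sum_(U in fib) cos U = q ^ \dim H)%N.
  rewrite -card_fvspace -sum1_card.
  under eq_bigr do rewrite /cos -sum1_card.
  rewrite (exchange_big_dep (fun h : fV => h \in H)) /=; last by move=> U h _ /andP[].
  apply: eq_bigr => h Hh; rewrite sum1_card.
  (* The unique member of the fibre through the point [w0 + h]. *)
  pose U0 := (U' + <[(w0 + h : V)]>)%VS.
  have w0h : w0 + h \notin H.
    by apply: contra Hw0 => Hwh; rewrite -(addrK (h : V) w0) memvB.
  have w0h0 : w0 + h != 0 by apply: contraNneq w0h => ->; rewrite mem0v.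
  have cap0 : (U' :&: <[(w0 + h : V)]> = 0)%VS.
    apply/eqP; rewrite -subv0; apply/subvP => u; rewrite memv_cap.
    case/andP=> U'u /vlineP[k uE]; rewrite memv0 uE.
    have [->|k0] := eqVneq k 0; first by rewrite scale0r.
    move: (memvZ k^-1 (subvP U'H _ U'u)).
    by rewrite uE scalerA mulVf // scale1r (negPf w0h).
  have dU0 : \dim U0 = D.
    by rewrite /U0 dimv_disjoint_sum // dim_vline w0h0 /= addn1.
  have U0W : (U0 <= W)%VS.
    by rewrite subv_add U'W -memvE memvD // (subvP HW).
  have U'U0 : (U' <= U0)%VS by exact: addvSl.
  have wU0 : w0 + h \in U0 by rewrite (subvP (addvSr _ _)) // memv_line.
  have nU0 : ~~ (U0 <= H)%VS by apply: contra w0h => /subvP; apply.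
  have U0H : (U0 :&: H)%VS == U'.
    have le : (U' <= U0 :&: H)%VS by rewrite subv_cap U'U0.
    rewrite eq_sym eqEdim le /= -ltnS -D' -dU0 ltn_neqAle dimvS ?capvSl // andbT.
    by rewrite (dimv_leqif_sup (capvSl U0 H)) subv_cap subvv.
  rewrite (eq_card (B := pred1 U0)) ?card1 // => U; rewrite !inE.
  apply/idP/eqP => [/andP[fU /andP[_ wU]]|->]; last first.
    have fU0 : U0 \in fib.
      by apply/and5P; split=> //; [exact: subv_trans U'U0|apply/eqP].
    by apply/andP; split; [exact: fU0|apply/andP; split].
  have /and5P[_ UW /eqP dU _ /eqP UH] := fU.
  apply/esym/eqP; rewrite eqEdim dU dU0 leqnn andbT subv_add -memvE wU andbT.
  by rewrite -UH capvSl.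
have q1 : (1 < q)%N by exact: finNzRing_gt1.
have : (#|fib| * q ^ \dim U' = q ^ \dim H)%N.
  rewrite -sumcos -sum_nat_const; apply: eq_bigr => U fU; exact/esym/cosE.
have lt : (\dim U' < \dim H)%N by rewrite -D'.
rewrite -(subnK lt) addnS -addSn expnD => /eqP.
by rewrite eqn_pmul2r ?expn_gt0 ?(ltnW q1) // => /eqP->; rewrite expnS dvdn_mulr.
Qed.

(* Subspaces not contained in the hyperplane [H] come in families whose size is
   divisible by [q], one family for each intersection with [H]. *)
Lemma grass_step I H W D (g : {vspace V} -> nat) :
  (I <= H)%VS -> (H <= W)%VS -> \dim W = (\dim H).+1 -> (D <= \dim H)%N ->
  (forall U U', (I <= U)%VS -> (U <= W)%VS -> (I <= U')%VS -> (U' <= W)%VS ->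
     \dim U = D -> \dim U' = D -> ~~ (U <= H)%VS -> ~~ (U' <= H)%VS ->
     (U :&: H = U' :&: H)%VS -> g U = g U') ->
  \sum_(U | [&& (I <= U)%VS, (U <= W)%VS & \dim U == D]) g U =
  \sum_(U | [&& (I <= U)%VS, (U <= H)%VS & \dim U == D]) g U %[mod q].
Proof.
move=> IH HW dW leD gE.
rewrite (bigID (fun U => (U <= H)%VS)) /= -modnDm.
set s2 := (X in (_ + X %% _)%N); have -> : (s2 %% q = 0)%N; last first.
  rewrite addn0 modn_mod; congr (_ %% _)%N; apply: eq_bigl => U.
  have [UH|] := boolP (U <= H)%VS; last by rewrite !andbF.
  by rewrite (subv_trans UH HW) andbT.
apply/eqP; rewrite -/(dvdn _ _) /s2.
rewrite (partition_big (fun U => (U :&: H)%VS) xpredT) //=.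
apply: dvdn_sum => U' _.
pose P (U : {vspace V}) := ([&& (I <= U)%VS, (U <= W)%VS & \dim U == D] &&
  ~~ (U <= H)%VS) && ((U :&: H)%VS == U').
rewrite (eq_bigl P) //.
have [U1 PU1|P0] := pickP P; last by rewrite big_pred0.
rewrite (eq_bigr (fun=> g U1)) => [|U PU].
  rewrite sum_nat_const dvdn_mulr //.
  have := grass_fiber U' IH HW dW leD; congr (_ %| _)%N.
  by apply: eq_card => U; rewrite !unfold_in /P -!andbA.
move: PU PU1; rewrite /P => /andP[/andP[/and3P[IU UW /eqP dU] nU] /eqP UH].
move=> /andP[/andP[/and3P[IU1 U1W /eqP dU1] nU1] /eqP U1H].
by apply: gE => //; rewrite UH U1H.
Qed.

End GrassmannCount.

(** * Subspaces adapted to a chain *)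

Section AdaptedSubspace.
Variables (F : fieldType) (V : vectType F).
Implicit Types I H W U C : {vspace V}.

Definition compv U C := (U <= C)%VS || (C <= U)%VS.

(* [Cs] is a chain; a hyperplane of [W] can be chosen to be comparable with all
   its members. *)
Lemma adapted_hyperplane I W (Cs : seq {vspace V}) :
  (I <= W)%VS -> (\dim I < \dim W)%N -> {in Cs, forall C, (I <= C)%VS} ->
  {in Cs &, forall C C', compv C C'} -> {in Cs, forall C, compv W C} ->
  exists H, [/\ (I <= H)%VS, (H <= W)%VS, \dim W = (\dim H).+1 &
    {in Cs, forall C, (W <= C)%VS || (C <= H)%VS}].
Proof.
move=> IW ltIW IC cC cW.
(* Any hyperplane above [T] works once each member of the chain contains [W] or lies in [T]; the
   induction takes for [T] the largest member not containing [W], or [I]. *)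
suff [T [IT TW nTW TI TC]] : exists T, [/\ (I <= T)%VS, (T <= W)%VS, T != W,
    T = I \/ T \in Cs & {in Cs, forall C, (W <= C)%VS || (C <= T)%VS}].
  have [H [TH HW dW]] := hyperplane TW nTW; exists H; split=> //.
    exact: subv_trans TH.
  by move=> C /TC/orP[->//|CT]; rewrite (subv_trans CT TH) orbT.
elim: Cs IC cC cW => [|C Cs IHC] IC cC cW.
  exists I; split=> //; last by left.
  by apply: contraTneq ltIW => ->; rewrite ltnn.
have [|||T [IT TW nTW TI TC]] := IHC.
- by move=> C' C's; apply: IC; rewrite inE C's orbT.
- by move=> C1 C2 h1 h2; apply: cC; rewrite inE ?h1 ?h2 orbT.
- by move=> C' C's; apply: cW; rewrite inE C's orbT.
have keep : (W <= C)%VS || (C <= T)%VS -> exists T, [/\ (I <= T)%VS, (T <= W)%VS, T != W,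
    T = I \/ T \in C :: Cs & {in C :: Cs, forall C, (W <= C)%VS || (C <= T)%VS}].
  move=> WCT; exists T; split=> //; last by move=> C'; rewrite inE => /predU1P[->|/TC].
  by case: TI => [->|Ts]; [left|right; rewrite inE Ts orbT].
have [/keep //|] := boolP ((W <= C)%VS || (C <= T)%VS).
rewrite negb_or => /andP[nWC nCT].
have CW : (C <= W)%VS by have := cW C (mem_head _ _); rewrite /compv (negPf nWC).
have TleC : (T <= C)%VS.
  case: TI => [->|Ts]; first by apply: IC; exact: mem_head.
  have := cC C T (mem_head _ _); rewrite inE Ts orbT => /(_ isT).
  by rewrite /compv (negPf nCT).
exists C; split=> //.
- by apply: IC; exact: mem_head.
- by apply: contraNneq nWC => ->.
- by right; exact: mem_head.
move=> C'; rewrite inE => /predU1P[->|/TC/orP[->//|C'T]]; first by rewrite subvv orbT.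
by rewrite (subv_trans C'T TleC) orbT.
Qed.

Lemma adapted_subspace I W D (Cs : seq {vspace V}) :
  (I <= W)%VS -> (\dim I <= D)%N -> (D <= \dim W)%N ->
  {in Cs, forall C, (I <= C)%VS} -> {in Cs &, forall C C', compv C C'} ->
  {in Cs, forall C, compv W C} ->
  exists U, [/\ (I <= U)%VS, (U <= W)%VS, \dim U = D & {in Cs, forall C, compv U C}].
Proof.
move=> IW ID DW IC cC; have [n] := ubnP (\dim W - D)%N.
elim: n W IW DW => // n IHn W IW DW le_n cW.
have [eD|nD] := eqVneq (\dim W) D; first by exists W.
have ltD : (D < \dim W)%N by rewrite ltn_neqAle eq_sym nD.
have [|H [IH HW dW HC]] := adapted_hyperplane IW _ IC cC cW; first exact: leq_ltn_trans ltD.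
have cH : {in Cs, forall C, compv H C}.
  by move=> C /HC/orP[/(subv_trans HW)|]; rewrite /compv => ->; rewrite ?orbT.
have [||U [IU UH dU cU]] := IHn H IH _ _ cH; try by rewrite dW in ltD le_n; lia.
by exists U; split=> //; exact: subv_trans HW.
Qed.

End AdaptedSubspace.

(* Modulo [q], a weighted count of the subspaces between [I] and [W] only sees
   the subspace in the most special position with respect to the chain. *)
Lemma grass_adapted (F : finFieldType) (V : vectType F) (I W : {vspace V}) D
    (Cs : seq {vspace V}) (g : {vspace V} -> nat) :
  (I <= W)%VS -> (\dim I <= D)%N -> (D <= \dim W)%N ->
  {in Cs, forall C, (I <= C)%VS} -> {in Cs &, forall C C', compv C C'} ->
  {in Cs, forall C, compv W C} ->
  (forall U U', (I <= U)%VS -> (U <= W)%VS -> (I <= U')%VS -> (U' <= W)%VS ->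
     \dim U = D -> \dim U' = D ->
     {in Cs, forall C, \dim (U :&: C) = \dim (U' :&: C)} -> g U = g U') ->
  exists U, [/\ (I <= U)%VS, (U <= W)%VS, \dim U = D, {in Cs, forall C, compv U C} &
    \sum_(U | [&& (I <= U)%VS, (U <= W)%VS & \dim U == D]) g U = g U %[mod #|F|]].
Proof.
move=> IW ID DW IC cC; have [n] := ubnP (\dim W - D)%N.
elim: n W IW DW => // n IHn W IW DW le_n cW gE.
have [eD|nD] := eqVneq (\dim W) D.
  exists W; split=> //; rewrite (eq_bigl (pred1 W)) ?big_pred1_eq // => U.
  apply/and3P/eqP => [[IU UW /eqP dU]|->]; last by split=> //; apply/eqP.
  by apply/eqP; rewrite eqEdim UW dU eD /=.
have ltD : (D < \dim W)%N by rewrite ltn_neqAle eq_sym nD.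
have [|H [IH HW dW HC]] := adapted_hyperplane IW _ IC cC cW; first exact: leq_ltn_trans ltD.
have cH : {in Cs, forall C, compv H C}.
  by move=> C /HC/orP[/(subv_trans HW)|]; rewrite /compv => ->; rewrite ?orbT.
have [|||U [IU UH dU cU sumU]] := IHn H IH _ _ cH; try by rewrite dW in ltD le_n; lia.
  move=> U U' IU UH IU' U'H; apply: gE => //; exact: subv_trans HW.
exists U; split=> //; first exact: subv_trans HW.
(* Each [C] contains [W] or lies in [H], so the dimension of [U :&: C] depends only on the dimension
   of [U] and on [U :&: H]. *)
rewrite -sumU; apply: grass_step => //; first by rewrite dW in ltD.
move=> U1 U2 IU1 UW1 IU2 UW2 dU1 dU2 _ _ eqH; apply: gE => // C /HC/orP[WC|CH].
  by rewrite !(capv_idPl _) ?dU1 ?dU2 //; exact: subv_trans WC.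
have capH U' : (U' :&: C = U' :&: H :&: C)%VS by rewrite -capvA (capv_idPr CH).
by rewrite capH eqH -capH.
Qed.

(** * Closed conditions and Krull-Schmidt classes *)

Section PolynomialFamilies.
Variables (Q : quiver) (K : fieldType) (d : dimvec Q).
Local Notation rp := (@rep Q K d).
Local Notation polyfn := (@polyfn Q K d).
Import VectorInternalTheory.

Definition vpoly (V : vectType K) (u : rp -> V) := funmx polyfn (fun X => v2r (u X)).

Definition lfpoly (V W : vectType K) (f : rp -> 'Hom(V, W)) :=
  forall v, vpoly (fun X => f X v).

Lemma vpoly_const (V : vectType K) (v : V) : vpoly (fun=> v).
Proof. exact: (funmx_const (polyfn_alg K d)). Qed.

Lemma vpoly_add (V : vectType K) (u v : rp -> V) :
  vpoly u -> vpoly v -> vpoly (fun X => u X + v X).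
Proof.
move=> pu pv i j; have [_ pd _] := polyfn_alg K d.
by under eq_fun do rewrite linearD mxE; exact: pd.
Qed.

Lemma vpoly_scale (V : vectType K) (c : rp -> K) (u : rp -> V) :
  polyfn c -> vpoly u -> vpoly (fun X => c X *: u X).
Proof.
move=> pc pu i j; have [_ _ pm] := polyfn_alg K d.
by under eq_fun do rewrite linearZ mxE; exact: pm.
Qed.

Lemma vpoly_sum (V : vectType K) (I : Type) (r : seq I) (P : pred I) (u : I -> rp -> V) :
  (forall i, vpoly (u i)) -> vpoly (fun X => \sum_(i <- r | P i) u i X).
Proof.
move=> pu; elim: r => [|i r IH].
  by under eq_fun do rewrite big_nil; exact: vpoly_const.
by under eq_fun do rewrite big_cons; case: (P i) => //; exact: vpoly_add.
Qed.

Lemma vpoly_app (V W : vectType K) (f : rp -> 'Hom(V, W)) (u : rp -> V) :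
  lfpoly f -> vpoly u -> vpoly (fun X => f X (u X)).
Proof.
move=> pf pu.
have uE X : f X (u X) = \sum_j v2r (u X) 0 j *: f X (r2v (delta_mx 0 j)).
  rewrite -[u X in LHS]v2rK [v2r (u X) in LHS]row_sum_delta !linear_sum.
  by apply: eq_bigr => j _; rewrite !linearZ.
under eq_fun do rewrite uE; apply: vpoly_sum => j.
by apply: vpoly_scale; [exact: pu|exact: pf].
Qed.

Lemma lfpoly_const (V W : vectType K) (f : 'Hom(V, W)) : lfpoly (fun=> f).
Proof. by move=> v; exact: vpoly_const. Qed.

Lemma lfpoly_comp (V W U : vectType K) (g : rp -> 'Hom(W, U)) (f : rp -> 'Hom(V, W)) :
  lfpoly g -> lfpoly f -> lfpoly (fun X => g X \o f X)%VF.
Proof.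
by move=> pg pf v; under eq_fun do rewrite comp_lfunE; exact: vpoly_app.
Qed.

Lemma lfpoly_sum (V W : vectType K) (I : Type) (r : seq I) (P : pred I)
    (f : I -> rp -> 'Hom(V, W)) :
  (forall i, lfpoly (f i)) -> lfpoly (fun X => \sum_(i <- r | P i) f i X).
Proof.
move=> pf v; under eq_fun do rewrite sum_lfunE.
by apply: vpoly_sum => i; exact: pf.
Qed.

Lemma lfpoly_mxlf m n (M : rp -> 'M[K]_(m, n)) :
  funmx polyfn M -> lfpoly (fun X => mxlf (M X)).
Proof.
move=> pM v i j.
have PA := polyfn_alg K d.
have pvM : funmx polyfn (fun X => v *m M X) by apply: funmx_mul => //; exact: funmx_const.
have E X : v2r (mxlf (M X) v) i j = \sum_k (v *m M X) 0 k * v2r (delta_mx 0 k : 'rV[K]_n) i j.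
  rewrite mxlfE {1}[v *m M X]row_sum_delta linear_sum summxE.
  by apply: eq_bigr => k _; rewrite linearZ mxE.
under eq_fun do rewrite E; apply: (funalg_sum PA) => k.
by case: PA => pc _ pm; apply: pm; [exact: pvM|exact: pc].
Qed.

(** Determinants after multiplication by all constant [P] and [R] play the role of minors; Gaussian
    elimination supplies a pair that detects a rank above [r]. *)
Lemma zclosed_rank m n (M : rp -> 'M[K]_(m, n)) r : funmx polyfn M ->
  zclosed [set X | (\rank (M X) <= r)%N]%classic.
Proof.
move=> pM; have PA := polyfn_alg K d.
apply: (@zclosed_fun _ _ _ _ ('M[K]_(r.+1, m) * 'M[K]_(n, r.+1))
  (fun PR X => \det (PR.1 *m M X *m PR.2))) => [[P R]|X] /=.
  apply: (funmx_det PA); apply: (funmx_mul PA); last exact: funmx_const.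
  by apply: (funmx_mul PA) => //; exact: funmx_const.
split=> [rM [P R] /=|h].
  apply/eqP/negPn/negP => dn; move: (rM).
  have : \rank (P *m M X *m R) = r.+1 by apply: mxrank_unit; rewrite unitmxE unitfE.
  have := leq_trans (mxrankM_maxl (P *m M X) R) (mxrankM_maxr P (M X)); lia.
rewrite leqNgt; apply/negP => lt.
pose P : 'M[K]_(r.+1, m) := pid_mx r.+1 *m invmx (col_ebase (M X)).
pose R : 'M[K]_(n, r.+1) := invmx (row_ebase (M X)) *m pid_mx r.+1.
have := h (P, R); rewrite /=.
have lm := leq_trans lt (rank_leq_row (M X)).
have ln := leq_trans lt (rank_leq_col (M X)).
have ME : M X = col_ebase (M X) *m pid_mx (\rank (M X)) *m row_ebase (M X).
  by rewrite mulmx_ebase.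
have -> : P *m M X *m R = 1%:M.
  rewrite [X in P *m X]ME /P /R !mulmxA mulmxKV ?col_ebase_unit //.
  rewrite mulmxK ?row_ebase_unit // !mul_pid_mx -pid_mx_1; congr pid_mx.
  by clear -lm ln lt; lia.
by rewrite det1 => /eqP; rewrite oner_eq0.
Qed.

Lemma f2mx_entry (V W : vectType K) (f : 'Hom(V, W)) i j :
  f2mx f i j = v2r (f (r2v (delta_mx 0 i))) 0 j.
Proof. by rewrite unlock /= !r2vK -rowE mxE. Qed.

Lemma dim_lker (V W : vectType K) (f : 'Hom(V, W)) :
  \dim (lker f) = (dim V - \rank (f2mx f))%N.
Proof. by rewrite /dimv /lker mx2vsK mxrank_ker. Qed.

(* Families of subspaces that are kernels of polynomial families of linear
   maps; their dimension is upper semicontinuous. *)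
Definition kerfam (V : vectType K) (S : rp -> {vspace V}) :=
  exists (W : vectType K) (f : rp -> 'Hom(V, W)),
    lfpoly f /\ forall X v, (v \in S X) = (f X v == 0).

Lemma zclosed_kerfam (V : vectType K) (S : rp -> {vspace V}) m : kerfam S ->
  zclosed [set X | (m <= \dim (S X))%N]%classic.
Proof.
move=> [W [f [pf SE]]].
have -> : [set X | (m <= \dim (S X))%N]%classic =
    if (m <= dim V)%N then [set X | (\rank (f2mx (f X)) <= dim V - m)%N]%classic
    else set0.
  apply/seteqP; split=> X; have SX : S X = lker (f X).
  - by apply/vspaceP => v; rewrite SE memv_ker.
  - rewrite /= SX dim_lker; have := rank_leq_row (f2mx (f X)).
    by case: ifP => /=; lia.
  - by apply/vspaceP => v; rewrite SE memv_ker.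
  rewrite /= SX dim_lker; case: ifP => //=; have := rank_leq_row (f2mx (f X)); lia.
case: ifP => _; last exact: zclosed0.
apply: zclosed_rank => i j; under eq_fun do rewrite f2mx_entry.
exact: pf.
Qed.

Lemma kerfam_eq (V : vectType K) (S S' : rp -> {vspace V}) :
  kerfam S -> (forall X v, (v \in S' X) = (v \in S X)) -> kerfam S'.
Proof. by move=> [W [f [pf SE]]] E; exists W, f; split=> // X v; rewrite E. Qed.

Lemma kerfam_full (V : vectType K) : kerfam (fun=> fullv : {vspace V}).
Proof.
exists V, (fun=> 0); split=> [|X v]; first exact: lfpoly_const.
by rewrite memvf zero_lfunE eqxx.
Qed.

Lemma kerfam_lker (V W : vectType K) (f : rp -> 'Hom(V, W)) :
  lfpoly f -> kerfam (fun X => lker (f X)).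
Proof. by move=> pf; exists W, f; split=> // X v; rewrite memv_ker. Qed.

Lemma kerfam_preim (V W : vectType K) (f : rp -> 'Hom(V, W)) (S : rp -> {vspace W}) :
  lfpoly f -> kerfam S -> kerfam (fun X => f X @^-1: S X)%VS.
Proof.
move=> pf [U [g [pg SE]]]; exists U, (fun X => g X \o f X)%VF.
by split=> [|X v]; [exact: lfpoly_comp|rewrite -memv_preim SE comp_lfunE].
Qed.

Lemma kerfam_cap (V : vectType K) (S1 S2 : rp -> {vspace V}) :
  kerfam S1 -> kerfam S2 -> kerfam (fun X => S1 X :&: S2 X)%VS.
Proof.
move=> [W1 [f1 [p1 S1E]]] [W2 [f2 [p2 S2E]]].
exists 'rV[K]_(dim W1 + dim W2), (fun X =>
  (mxlf (row_mx 1%:M 0) \o (linfun v2r \o f1 X)) +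
  (mxlf (row_mx 0 1%:M) \o (linfun v2r \o f2 X)))%VF; split.
  move=> v; under eq_fun do rewrite add_lfunE !comp_lfunE.
  by apply: vpoly_add; (apply: vpoly_app; first exact: lfpoly_const);
    (apply: vpoly_app; first exact: lfpoly_const); [exact: p1|exact: p2].
move=> X v; rewrite memv_cap S1E S2E add_lfunE !comp_lfunE !mxlfE !lfunE /=.
rewrite !mul_mx_row !mulmx1 !mulmx0 add_row_mx addr0 add0r -[0 in RHS]row_mx0.
apply/andP/eqP => [[/eqP -> /eqP ->]|/eq_row_mx[h1 h2]]; first by rewrite !linear0.
by split; apply/eqP/v2r_inj; rewrite linear0.
Qed.

Lemma kerfam_bigcap (V : vectType K) (I : Type) (r : seq I) (P : pred I)
    (S : I -> rp -> {vspace V}) : (forall i, kerfam (S i)) ->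
  kerfam (fun X => \bigcap_(i <- r | P i) S i X)%VS.
Proof.
move=> kS; elim: r => [|i r IH].
  by apply: kerfam_eq (kerfam_full V) _ => X v; rewrite big_nil.
case Pi: (P i); last by apply: kerfam_eq IH _ => X v; rewrite big_cons Pi.
by apply: kerfam_eq (kerfam_cap (kS i) IH) _ => X v; rewrite big_cons Pi.
Qed.

End PolynomialFamilies.

(** * Krull-Schmidt from additive invariants *)

Section ListClasses.
Variables (Q : quiver) (T : eqType) (good : forall F : fieldType, T -> packed_rep Q F -> Prop).
Variables (J : Type) (d0 : T -> J -> nat).
Variable inv : forall (F : fieldType) (V : vectType F), (arrow Q -> 'End(V)) ->
  {ffun vert Q -> {vspace V}} -> J -> nat.
Arguments inv {F V}.
Local Notation stab := (stable (@src Q) (@tgt Q)).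

Hypothesis good_iso : forall (F : fieldType) b (M N : packed_rep Q F),
  good b M -> good b N -> iso (tagged M) (tagged N).
Hypothesis good_ex : forall (F : fieldType) b, exists M : packed_rep Q F, good b M.
Hypothesis good_ind : forall (F : fieldType) (V : vectType F) (A : arrow Q -> 'End(V)) U,
  stab A U -> nilA A U fam0 -> aindec A U ->
  exists b M, good b M /\ qreal A U fam0 (tagged M).
Hypothesis good_inv : forall (F : fieldType) (V : vectType F) (A : arrow Q -> 'End(V)) U
    b (M : packed_rep Q F) j,
  stab A U -> good b M -> qreal A U fam0 (tagged M) -> inv A U j = d0 b j.
Hypothesis inv_add : forall (F : fieldType) (V : vectType F) (A : arrow Q -> 'End(V)) sp U R j,
  dsumf A sp U R -> inv A sp j = (inv A U j + inv A R j)%N.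
Hypothesis inv0 : forall (F : fieldType) (V : vectType F) (A : arrow Q -> 'End(V)) j,
  inv A fam0 j = 0%N.
Hypothesis d0_inj : forall bs bs' : seq T,
  (forall j, \sum_(b <- bs) d0 b j = \sum_(b <- bs') d0 b j)%N -> perm_eq bs bs'.

(** [T] labels the indecomposables; isomorphism classes are multisets of labels, written as
    lists. *)
Definition lcl (F : fieldType) d (M : rep F d) (bs : seq T) :=
  exists N : T -> packed_rep Q F, {in bs, forall b, good b (N b)} /\
    iso M (tagged (dsum (map N bs))).

Lemma lcl_inv (F : fieldType) (V : vectType F) (A : arrow Q -> 'End(V)) sp d
    (M : rep F d) bs j : stab A sp -> qreal A sp fam0 M -> lcl M bs ->
  inv A sp j = (\sum_(b <- bs) d0 b j)%N.
Proof.
move=> ssp qM [N [gN /(adecP _ ssp qM) ad]].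
elim: bs sp gN ad {qM} ssp => [|b bs IH] sp gN /=; first by move=> -> _; rewrite inv0 big_nil.
case=> U [R [dUR qU aR]] _; have [sU sR _ _] := dUR.
rewrite big_cons (inv_add _ dUR) (good_inv _ sU (gN b (mem_head _ _)) qU).
by rewrite (IH R) // => c cs; apply: gN; rewrite inE cs orbT.
Qed.

Lemma lcl_amb (F : fieldType) d (M : rep F d) bs j : lcl M bs ->
  inv (amb_map M) (amb_sp _ d) j = (\sum_(b <- bs) d0 b j)%N.
Proof. by apply: lcl_inv; [exact: amb_stable|exact: amb_real]. Qed.

Lemma lcl_perm (F : fieldType) d (M : rep F d) bs bs' :
  perm_eq bs bs' -> lcl M bs -> lcl M bs'.
Proof.
move=> pb [N [gN isoM]]; exists N; split.
  by move=> b; rewrite -(perm_mem pb); exact: gN.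
apply/(adecP _ (amb_stable M) (amb_real M)); apply: adec_perm pb _.
exact/(adecP _ (amb_stable M) (amb_real M)).
Qed.

Lemma lcl_iso_closed (F : fieldType) d e (M : rep F d) (N : rep F e) bs :
  iso M N -> lcl N bs -> lcl M bs.
Proof. by move=> isoMN [R [gR isoN]]; exists R; split=> //; exact: iso_trans isoN. Qed.

(** The invariants [inv] are additive and separate multisets of labels by [d0_inj]. This gives
    uniqueness of decompositions without local endomorphism rings. *)
Lemma lcl_iso (F : fieldType) d e (M : rep F d) (N : rep F e) bs bs' :
  lcl M bs -> lcl N bs' -> iso M N <-> perm_eq bs bs'.
Proof.
move=> lM lN; split=> [isoMN|pb].
  apply: d0_inj => j; rewrite -(lcl_amb j lM).
  by rewrite (lcl_amb j (lcl_iso_closed isoMN lN)).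
have [R [gR isoM]] := lcl_perm pb lM; have [R' [gR' isoN]] := lN.
apply: iso_trans isoM _; apply: iso_sym; apply: iso_trans isoN _.
have sX := amb_stable (tagged (dsum (map R' bs'))).
have qX := amb_real (tagged (dsum (map R' bs'))).
apply/(adecP _ sX qX); apply: (@adec_iso _ _ _ _ _ R').
  by move=> b bb; apply: good_iso; [exact: gR'|exact: gR].
by apply/(adecP _ sX qX); exact: iso_refl.
Qed.

Lemma lcl_ex (F : fieldType) bs : exists d (M : rep F d), lcl M bs.
Proof.
pose N b := projT1 (cid (good_ex F b)).
exists _, (tagged (dsum (map N bs))), N; split; last exact: iso_refl.
by move=> b _; exact: (projT2 (cid (good_ex F b))).
Qed.

Lemma lcl_class (F : fieldType) d (M : rep F d) : nilpotent M -> exists bs, lcl M bs.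
Proof.
have sX := amb_stable M; have qX := amb_real M.
have s0 := fam0_stable (@src Q) (@tgt Q) (amb_map M).
move/(nilpotentP sX s0 qX) => nM.
pose N b := projT1 (cid (good_ex F b)).
have gN b : good b (N b) by exact: (projT2 (cid (good_ex F b))).
have [||bs ab] := @adec_exists _ _ _ (amb_map M) _ N
    (fun U => nilA (amb_map M) U fam0) _ _ _ sX nM.
- by move=> sp U R nsp /dsumf_fle[Usp _]; exact: nilA_sub nsp.
- move=> U sU nU aU; have [b [L [gL qL]]] := good_ind sU nU aU; exists b.
  by apply: qreal_iso qL _; exact: good_iso gL (gN b).
by exists bs, N; split=> //; apply/(adecP _ sX qX).
Qed.

End ListClasses.

(** * Positive definiteness of the Tits form *)

Section PositiveDefinite.
Implicit Types (w : nat -> rat) (S g h : (nat -> rat) -> rat).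

(** Positive definiteness in quantitative form: the constant later bounds the coordinates of roots
    and of their orbits under reflections. *)
Definition bdd S g := exists2 B, 0 < B & forall w, g w ^+ 2 <= B * S w.

Lemma bdd_lin S g h c : bdd S g -> bdd S h -> bdd S (fun w => g w + c * h w).
Proof.
move=> [B B0 gB] [B' B'0 hB']; exists (2 * B + 2 * c ^+ 2 * B') => [|w].
  apply: ltr_wpDr; last by rewrite mulr_gt0.
  by apply: mulr_ge0; [rewrite mulr_ge0 ?sqr_ge0|exact: ltW].
have le1 : (g w + c * h w) ^+ 2 <= 2 * g w ^+ 2 + 2 * c ^+ 2 * h w ^+ 2.
  rewrite -subr_ge0; have -> : 2 * g w ^+ 2 + 2 * c ^+ 2 * h w ^+ 2 - (g w + c * h w) ^+ 2
    = (g w - c * h w) ^+ 2 by ring.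
  exact: sqr_ge0.
have le2 := ler_wpM2l (sqr_ge0 c) (hB' w).
have le3 := gB w.
apply: le_trans le1 _.
have -> : (2 * B + 2 * c ^+ 2 * B') * S w = 2 * (B * S w) + 2 * (c ^+ 2 * (B' * S w)) by ring.
lra.
Qed.

Lemma bdd_sq S g c : 0 < c -> (forall w, c * g w ^+ 2 <= S w) -> bdd S g.
Proof.
move=> c0 h; exists c^-1 => [|w]; first by rewrite invr_gt0.
rewrite mulrC ler_pdivlMr // mulrC; exact: h.
Qed.

Lemma bdd_ext S g h : (forall w, g w = h w) -> bdd S g -> bdd S h.
Proof. by move=> E [B B0 gB]; exists B => // w; rewrite -E. Qed.

Definition arm m w := \sum_(k < m) (w k ^+ 2 - w k * w k.+1).

(** The ratios that arise when squares are completed successively along a path, starting from its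
    free end; [armsq] is the resulting sum of squares. *)
Definition armc (k : nat) : rat := k.+1%:R / k.+2%:R.

Definition armsq m w := \sum_(k < m) (2 * armc k)^-1 * (w k - armc k * w k.+1) ^+ 2.

Lemma armc_gt0 k : 0 < armc k.
Proof. by rewrite divr_gt0 ?ltr0n. Qed.

Lemma armE m w : arm m w = armsq m w - m%:R / (2 * m.+1%:R) * w m ^+ 2.
Proof.
rewrite /arm /armsq; elim: m => [|m IH]; first by rewrite !big_ord0 !mul0r subr0.
rewrite !big_ord_recr /= IH /armc.
have h1 : (m.+1%:R : rat) != 0 by rewrite pnatr_eq0.
have h2 : (m.+2%:R : rat) != 0 by rewrite pnatr_eq0.
have E1 : m.+1%:R = m%:R + 1 :> rat by rewrite natr1.
have E2 : m.+2%:R = m%:R + 2 :> rat by rewrite -[2]/(1 + 1) addrA !natr1.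
by move: h1 h2; rewrite E2 E1 => h1 h2; field; rewrite h1 h2.
Qed.

Lemma armsq_ge0 m w : 0 <= armsq m w.
Proof.
apply: sumr_ge0 => k _; apply: mulr_ge0; last exact: sqr_ge0.
by rewrite invr_ge0 mulr_ge0 ?ltW ?armc_gt0.
Qed.

(** Back substitution along the arm: each coordinate is one of the completed linear forms plus a
    multiple of the next coordinate. *)
Lemma bdd_arm S m (u : (nat -> rat) -> nat -> rat) :
  (forall w, armsq m (u w) <= S w) -> bdd S (fun w => u w m) ->
  forall k, (k <= m)%N -> bdd S (fun w => u w k).
Proof.
move=> le bm k km; rewrite -(subKn km); elim: (m - k)%N (leq_subr k m) => [|j IH] jm.
  by rewrite subn0.
have ltj : (m - j.+1 < m)%N by lia.
have E : (m - j = (m - j.+1).+1)%N by lia.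
have {}IH : bdd S (fun w => u w (m - j.+1).+1) by rewrite -E; apply: IH; lia.
move: (m - j.+1)%N ltj IH => l lm bl {E}.
have bg : bdd S (fun w => u w l - armc l * u w l.+1).
  apply: (@bdd_sq _ _ (2 * armc l)^-1) => [|w].
    by rewrite invr_gt0 mulr_gt0 ?armc_gt0.
  apply: le_trans (le w); rewrite /armsq (bigD1 (Ordinal lm)) //= lerDl.
  apply: sumr_ge0 => i _; apply: mulr_ge0; last exact: sqr_ge0.
  by rewrite invr_ge0 mulr_ge0 ?ltW ?armc_gt0.
by apply: bdd_ext (bdd_lin (armc l) bg bl) => w; rewrite subrK.
Qed.

Lemma arm_split b r w : arm (b + r) w + w (b + r)%N ^+ 2 =
  arm b w + w b ^+ 2 + arm r (fun j => w (b + r - j)%N).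
Proof.
elim: r => [|r IH]; first by rewrite addn0 [arm 0 _]big_ord0 addr0.
have -> : arm (b + r.+1) w = arm (b + r) w + (w (b + r)%N ^+ 2 - w (b + r)%N * w (b + r).+1).
  by rewrite addnS /arm big_ord_recr.
have -> : arm r.+1 (fun j => w (b + r.+1 - j)%N) =
  w (b + r).+1 ^+ 2 - w (b + r).+1 * w (b + r)%N + arm r (fun j => w (b + r - j)%N).
  rewrite /arm big_ord_recl /=; congr (_ + _); last first.
    by apply: eq_bigr => j _; rewrite /bump /= add1n addnS !subSS.
  by rewrite subn0 subn1 addnS.
by rewrite addnS; move: IH; lra.
Qed.

Lemma sum_pick m c (f : nat -> rat) :
  \sum_(l < m) (l == c :> nat)%:R * f l = if (c < m)%N then f c else 0.
Proof.
case: ltnP => [cm|mc].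
  rewrite (bigD1 (Ordinal cm)) //= eqxx mul1r big1 ?addr0 // => l.
  by rewrite -val_eqE /= => /negPf ->; rewrite mul0r.
rewrite big1 // => l _; have := ltn_ord l; case: eqP => [->|_ _]; first by lia.
by rewrite mul0r.
Qed.

Definition qdiag D w : rat := \sum_(k < diag_rank D) w k ^+ 2 -
  \sum_(k < diag_rank D) \sum_(l < diag_rank D) (diag_edge D k l)%:R * (w k * w l).

Lemma qdiagA n w : qdiag (DynA n) w = arm n w + w n ^+ 2.
Proof.
rewrite /qdiag /arm /=.
under [X in _ - X]eq_bigr => k _ do rewrite (sum_pick _ k.+1 (fun l => w k * w l)).
rewrite !big_ord_recr /= ltnn addr0 sumrB -!addrA; congr (_ + _); rewrite addrC; congr (_ + _).
by congr (- _); apply: eq_bigr => k _; rewrite ltnS ltn_ord.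
Qed.

Definition branch_form m b w : rat := \sum_(k < m) w k ^+ 2 -
  \sum_(k < m) \sum_(l < m)
    (((l == k.+1 :> nat) && (l < m.-1)%N) || ((k == b :> nat) && (l == m.-1 :> nat)))%:R
    * (w k * w l).

Lemma branch_formE m b w : (b <= m)%N -> branch_form m.+2 b w =
  arm m w + w m ^+ 2 + (w m.+1 ^+ 2 - w b * w m.+1).
Proof.
move=> bm; rewrite /branch_form.
have -> : \sum_(k < m.+2) \sum_(l < m.+2)
    (((l == k.+1 :> nat) && (l < m.+1)%N) || ((k == b :> nat) && (l == m.+1 :> nat)))%:R
    * (w k * w l) = \sum_(k < m) w k * w k.+1 + w b * w m.+1.
  transitivity (\sum_(k < m.+2) ((if (k < m)%N then w k * w k.+1 else 0) +
     (k == b :> nat)%:R * (w k * w m.+1))).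
    apply: eq_bigr => k _.
    transitivity (\sum_(l < m.+2) ((l == k.+1 :> nat)%:R * ((l < m.+1)%:R * (w k * w l))
       + (l == m.+1 :> nat)%:R * ((k == b :> nat)%:R * (w k * w l)))).
      apply: eq_bigr => l _; have : ~~ ((l < m.+1)%N && (l == m.+1 :> nat)) by lia.
      case: (l == k.+1 :> nat); case: (l < m.+1)%N; case: (k == b :> nat);
        by case: (l == m.+1 :> nat) => //= _; rewrite ?mul1r ?mul0r ?addr0 ?add0r.
    rewrite big_split /= (sum_pick _ k.+1 (fun l => (l < m.+1)%:R * (w k * w l))).
    rewrite (sum_pick _ m.+1 (fun l => (k == b :> nat)%:R * (w k * w l))) ltnSn.
    congr (_ + _); rewrite !ltnS; case: (ltnP k m) => km; last by rewrite mul0r if_same.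
    by rewrite (ltnW km) mul1r.
  rewrite big_split /= (sum_pick _ b (fun k => w k * w m.+1)) ltnS leqW //.
  rewrite !big_ord_recr /= ltnn ltnNge leqnSn /= !addr0; congr (_ + _).
  by apply: eq_bigr => k _; rewrite ltn_ord.
rewrite !big_ord_recr /= /arm sumrB; ring.
Qed.

(** [kap] is the coefficient left at the branch vertex when squares are completed along the three
    arms; the arm of length one turns 1 into 3/4. Its positivity is the classical inequality 1/(b+1)
    + 1/(r+1) + 1/2 > 1. *)
Lemma branch_bdd b r k :
  let kap : rat := 3 / 4 - b%:R / (2 * b.+1%:R) - r%:R / (2 * r.+1%:R) in
  0 < kap -> (k < (b + r).+2)%N -> bdd (branch_form (b + r).+2 b) (fun w => w k).
Proof.
move=> kap kap0 km; set S := branch_form _ _.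
have SE w : S w = armsq b w + armsq r (fun j => w (b + r - j)%N) +
    (w (b + r).+1 - 2^-1 * w b) ^+ 2 + kap * w b ^+ 2.
  rewrite /S branch_formE ?leq_addr // arm_split !armE addnK /kap; field.
  by rewrite ![1 + _]addrC !natr1 !pnatr_eq0.
have bb : bdd S (fun w => w b).
  apply: (bdd_sq kap0) => w; rewrite SE lerDr !addr_ge0 ?armsq_ge0 ?sqr_ge0 //.
clearbody kap S.
have kge w : 0 <= kap * w b ^+ 2 by apply: mulr_ge0; [exact: ltW|exact: sqr_ge0].
have [kb|bk] := leqP k b.
  apply: (@bdd_arm S b (fun w => w)) => // w; rewrite SE -!addrA lerDl.
  by rewrite !addr_ge0 ?armsq_ge0 ?sqr_ge0 ?kge.
have [->|nk] := eqVneq k (b + r).+1.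
  have bz : bdd S (fun w => w (b + r).+1 - 2^-1 * w b).
    apply: (@bdd_sq _ _ 1) => // w; rewrite mul1r SE -addrA addrCA lerDl.
    by rewrite !addr_ge0 ?armsq_ge0 ?sqr_ge0 ?kge.
  by apply: bdd_ext (bdd_lin 2^-1 bz bb) => w; rewrite subrK.
have -> : k = (b + r - (b + r - k))%N by lia.
apply: (@bdd_arm S r (fun w j => w (b + r - j)%N)) => [w||]; last by lia.
  rewrite SE -!addrA addrCA lerDl; apply: addr_ge0; first exact: armsq_ge0.
  by apply: addr_ge0; [exact: sqr_ge0|exact: kge].
by rewrite addnK.
Qed.

Lemma qdiag_bdd D k : (k < diag_rank D)%N -> bdd (qdiag D) (fun w => w k).
Proof.
case: D => [n|n|||] /= km.
- have SE w : qdiag (DynA n) w = armsq n w + (1 - n%:R / (2 * n.+1%:R)) * w n ^+ 2.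
    by rewrite qdiagA armE; ring.
  have c0 : 0 < 1 - n%:R / (2 * n.+1%:R) :> rat.
    rewrite subr_gt0 ltr_pdivrMr ?mulr_gt0 ?ltr0n // mul1r -natrM ltr_nat; lia.
  apply: (@bdd_arm _ n (fun w => w)) => // [w|].
    by rewrite SE lerDl mulr_ge0 ?sqr_ge0 // ltW.
  by apply: (bdd_sq c0) => w; rewrite SE lerDr armsq_ge0.
- have -> : qdiag (DynD n) = branch_form (n.+1 + 1).+2 n.+1.
    by rewrite /qdiag /branch_form addn1.
  apply: branch_bdd; last by rewrite addn1.
  have -> : 3 / 4 - n.+1%:R / (2 * n.+2%:R) - 1%:R / (2 * 2%:R) = (2 * n.+2%:R)^-1 :> rat.
    by field; rewrite ?[2 + _]addrC ?[1 + _]addrC -?[2]/(1 + 1) ?addrA !natr1 pnatr_eq0.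
  by rewrite invr_gt0 mulr_gt0 ?ltr0n.
- rewrite (_ : qdiag DynE6 = branch_form (2 + 2).+2 2) //.
  by apply: branch_bdd; [lra|exact: km].
- rewrite (_ : qdiag DynE7 = branch_form (2 + 3).+2 2) //.
  by apply: branch_bdd; [lra|exact: km].
- rewrite (_ : qdiag DynE8 = branch_form (2 + 4).+2 2) //.
  by apply: branch_bdd; [lra|exact: km].
Qed.

End PositiveDefinite.

Definition tq (I E : finType) (sr tg : E -> I) (v : I -> int) : int :=
  \sum_i v i ^+ 2 - \sum_x v (sr x) * v (tg x).

(** The Tits form is the sum of the forms of the components, and one integer dominates the finitely
    many bounds for single coordinates. *)
Lemma dynkin_pdb (Q : quiver) : is_dynkin Q ->
  exists B : nat, forall (v : vert Q -> int) i, v i ^+ 2 <= B%:Z * tq (@src Q) (@tgt Q) v.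
Proof.
move=> [m [D [phi [bphi eE]]]].
have [psi phiK psiK] := bphi.
pose w (v : vert Q -> int) j k : rat :=
  if insub k is Some k' then (v (phi (Tagged (fun j => 'I_(diag_rank (D j))) (k' : 'I_(diag_rank (D j))))))%:~R else 0.
have wE v (j : 'I_m) (k : 'I_(diag_rank (D j))) :
    w v j k = (v (phi (Tagged (fun j => 'I_(diag_rank (D j))) k)))%:~R.
  by rewrite /w valK.
have noloop (x : arrow Q) : src x != tgt x.
  apply/eqP => st; have := eE (psi (src x)) (psi (src x)); rewrite psiK /diag_adj.
  have -> : diag_edge (D (tag (psi (src x)))) (tagged (psi (src x))) (tagged (psi (src x))) = false.
    case: (D _) (tagged _) => [n|n|||] k /=; have := ltn_ord k; rewrite /=; lia.
  rewrite andbF => /eqP; rewrite cards_eq0 => /eqP/setP/(_ x).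
  by rewrite !inE -st eqxx.
have qE v : (tq (@src Q) (@tgt Q) v)%:~R = \sum_j qdiag (D j) (w v j).
  have -> : \sum_j qdiag (D j) (w v j) =
    \sum_j \sum_(k < diag_rank (D j)) w v j k ^+ 2 -
    \sum_j \sum_(k < diag_rank (D j)) \sum_(l < diag_rank (D j))
       (diag_edge (D j) k l)%:R * (w v j k * w v j l) by rewrite -sumrB.
  rewrite /tq rmorphB /=; congr (_ - _).
    rewrite rmorph_sum (reindex phi) /=; last by exists psi => ? _.
    rewrite (sig_big_dep _ _ (fun j (k : 'I_(diag_rank (D j))) => w v j k ^+ 2)) /=.
    by apply: eq_bigr => -[j k] _; rewrite /= wE rmorphXn.
  (* Twice the form is a sum over ordered pairs of vertices; there the orientation disappears and
     the hypothesis on [edges_between] applies. *)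
  have two0 : (2 : rat) != 0 by [].
  apply: (mulfI two0).
  transitivity (\sum_(p : {j : 'I_m & 'I_(diag_rank (D j))})
    \sum_(p' : {j : 'I_m & 'I_(diag_rank (D j))})
      #|edges_between (phi p) (phi p')|%:R * ((v (phi p))%:~R * (v (phi p'))%:~R) : rat).
    transitivity (\sum_y \sum_z #|edges_between (y : vert Q) z|%:R * ((v y)%:~R * (v z)%:~R) : rat).
      transitivity (\sum_y \sum_z \sum_x (x \in edges_between y z)%:R * ((v y)%:~R * (v z)%:~R) : rat).
        under [RHS]eq_bigr => y _ do rewrite exchange_big.
        rewrite exchange_big /= rmorph_sum mulr_sumr; apply: eq_bigr => x _.
        have nts : tgt x != src x by rewrite eq_sym.
        rewrite (bigD1 (src x)) //= (bigD1 (tgt x) nts) /=.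
        rewrite (bigD1 (tgt x)) //= [X in _ + (X + _)](bigD1 (src x)) //=.
        rewrite !inE !eqxx orbT /= !big1 ?addr0.
        - rewrite rmorphM /=; ring.
        - move=> y /andP[/negPf ys /negPf yt]; rewrite big1 // => z _.
          by rewrite inE ![_ == y]eq_sym ys yt ?andbF /= mul0r.
        - move=> z /negPf zs; rewrite inE eqxx [src x == z]eq_sym zs ?andbF ?orbF.
          by rewrite (negPf (noloop x)) mul0r.
        - move=> z /negPf zt; rewrite inE eqxx [tgt x == z]eq_sym zt.
          by rewrite [tgt x == _]eq_sym (negPf (noloop x)) ?andbF mul0r.
      apply: eq_bigr => y _; apply: eq_bigr => z _; rewrite -mulr_suml; congr (_ * _).
      by rewrite -sum1_card natr_sum [RHS]big_mkcond /=; apply: eq_bigr => x _; case: ifP.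
    rewrite (reindex phi) /=; last by exists psi => ? _.
    by apply: eq_bigr => p _; rewrite (reindex phi) //=; exists psi => ? _.
  rewrite mulr_sumr.
  rewrite (eq_bigr (fun j => \sum_(k < diag_rank (D j)) \sum_(l < diag_rank (D j))
     (diag_adj (D j) k l)%:R * (w v j k * w v j l))); last first.
    move=> j _; rewrite mulr_natl mulr2n [in X in _ + X]exchange_big /= -big_split /=.
    apply: eq_bigr => k _; rewrite -big_split /=; apply: eq_bigr => l _.
    rewrite [w v j l * _]mulrC -mulrDl -natrD; congr (_%:R * _); rewrite /diag_adj.
    have : ~~ (diag_edge (D j) k l && diag_edge (D j) l k).
      case: (D j) k l => [n|n|||] k l /=; move: (ltn_ord k) (ltn_ord l); rewrite /=; lia.
    by case: (diag_edge _ k l) (diag_edge _ l k) => [] [].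
  rewrite (sig_big_dep _ _ (fun j (k : 'I_(diag_rank (D j))) => \sum_(l < diag_rank (D j))
     (diag_adj (D j) k l)%:R * (w v j k * w v j l))) /=.
  apply: eq_bigr => -[j k] _ /=.
  rewrite (bigID (fun p' : {j : 'I_m & 'I_(diag_rank (D j))} => tag p' == j)) /=.
  rewrite [X in _ + X]big1 ?addr0; last first.
    by move=> p' /negPf nt; rewrite eE /= eq_sym nt mul0r.
  rewrite (reindex_onto (fun l : 'I_(diag_rank (D j)) => Tagged (fun j => 'I_(diag_rank (D j))) l)
     (fun p' => untag k id p')) /=; last first.
    by move=> [j' l] /= /eqP ej; move: l; rewrite ej => l; rewrite untagE.
  rewrite (eq_bigl xpredT); last by move=> l; rewrite /= eqxx untagE eqxx.
  by apply: eq_bigr => l _; rewrite eE /= eqxx /= !wE.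
have Bp (p : {j : 'I_m & 'I_(diag_rank (D j))}) :
    exists B, 0 <= B /\ forall w, w (tagged p : nat) ^+ 2 <= B * qdiag (D (tag p)) w.
  by have [B B0 hB] := qdiag_bdd (ltn_ord (tagged p)); exists B; split=> //; exact: ltW.
have [Bf hBf] := boolp.choice Bp.
have q0 D' w' : 0 <= qdiag D' w'.
  have D0 : (0 < diag_rank D')%N by case: D'.
  have [B B0 hB] := qdiag_bdd D0.
  by rewrite -(pmulr_rge0 _ B0); apply: le_trans (hB w'); exact: sqr_ge0.
have [B hB] : exists B : nat, \sum_p Bf p <= B%:R.
  have S0 : 0 <= \sum_p Bf p by apply: sumr_ge0 => p _; have [] := hBf p.
  by exists (Num.bound (\sum_p Bf p)); exact/ltW/archi_boundP.
exists B => v i.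
have [p ->] : exists p, i = phi p by exists (psi i); rewrite psiK.
rewrite -(ler_int rat) rmorphXn [in leRHS]rmorphM /= qE.
have [B0 hp] := hBf p; case: p B0 hp => j k B0 /(_ (w v j)); rewrite /= wE => /le_trans; apply.
apply: ler_pM => //; last by rewrite (bigD1 j) //= lerDl sumr_ge0.
apply: le_trans hB; rewrite (bigD1 (Tagged (fun j => 'I_(diag_rank (D j))) k)) //= lerDl.
by apply: sumr_ge0 => p _; have [] := hBf p.
Qed.

(** * Reflections of dimension vectors *)

Section Reflections.
Variables (I E : finType).
Implicit Types (sr tg : E -> I) (a : I) (s L : seq I).

Definition flip_s sr tg a : E -> I := fun x => if tg x == a then a else sr x.
Definition flip_t sr tg a : E -> I := fun x => if tg x == a then sr x else tg x.

Definition sink sr a := [forall x, sr x != a].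

Fixpoint adm sr tg s : bool :=
  if s is a :: s' then sink sr a && adm (flip_s sr tg a) (flip_t sr tg a) s' else true.

(** The subtraction is truncated: the simple root at a sink goes to 0, just as the reflection
    functor kills the simple representation there. [zs] is the genuine reflection. *)
Definition rs sr tg a (v : I -> nat) : I -> nat := fun i =>
  if i == a then (\sum_(x | tg x == a) v (sr x) - v a)%N else v i.

Fixpoint rss sr tg s v : I -> nat :=
  if s is a :: s' then rss (flip_s sr tg a) (flip_t sr tg a) s' (rs sr tg a v) else v.

Definition nb sr tg a (v : I -> int) : int :=
  \sum_x ((tg x == a)%:R * v (sr x) + (sr x == a)%:R * v (tg x)).

Definition zs sr tg a (v : I -> int) : I -> int := fun i =>
  if i == a then nb sr tg a v - v a else v i.

Definition zss sr tg s v := foldl (fun v a => zs sr tg a v) v s.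

Definition zv (v : I -> nat) : I -> int := fun i => (v i)%:Z.

Definition pdb sr tg (B : nat) := forall (v : I -> int) i, v i ^+ 2 <= B%:Z * tq sr tg v.

Lemma nb_flip sr tg a b v : nb (flip_s sr tg a) (flip_t sr tg a) b v = nb sr tg b v.
Proof.
apply: eq_bigr => x _; rewrite /flip_s /flip_t.
by case: (eqVneq (tg x) a) => [->|//]; rewrite addrC.
Qed.

Lemma tq_flip sr tg a v : tq (flip_s sr tg a) (flip_t sr tg a) v = tq sr tg v.
Proof.
rewrite /tq; congr (_ - _); apply: eq_bigr => x _; rewrite /flip_s /flip_t.
by case: (eqVneq (tg x) a) => [->|//]; rewrite mulrC.
Qed.

Lemma tq_op sr tg v : tq tg sr v = tq sr tg v.
Proof. by rewrite /tq; congr (_ - _); apply: eq_bigr => x _; rewrite mulrC. Qed.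

Lemma pdb_flip sr tg a B : pdb sr tg B -> pdb (flip_s sr tg a) (flip_t sr tg a) B.
Proof. by move=> h v i; rewrite tq_flip. Qed.

Lemma pdb_op sr tg B : pdb sr tg B -> pdb tg sr B.
Proof. by move=> h v i; rewrite tq_op. Qed.

Section Fixed.
Variables (sr tg : E -> I) (B : nat).
Hypothesis pB : pdb sr tg B.

Lemma tq_ge0 v : 0 <= tq sr tg v.
Proof.
have [i _|I0] := pickP (@predT I); last first.
  by rewrite /tq !big1 // => [x|i]; [have := I0 (sr x)|have := I0 i].
have B0 : (0 < B)%N.
  by have := pB (fun=> 1) i; rewrite expr1n; case: (B) => //; rewrite mul0r.
by rewrite -(pmulr_rge0 (x := B%:Z)) //; apply: le_trans (pB v i); exact: sqr_ge0.
Qed.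

Lemma tq_eq0 v i : tq sr tg v = 0 -> v i = 0.
Proof.
move=> q0; have := pB v i; rewrite q0 mulr0 => h; apply/eqP.
by rewrite -sqrf_eq0 eq_le h sqr_ge0.
Qed.

(** Otherwise every vertex of [S] emits an arrow inside [S], and the Tits form of the indicator of
    [S] is at most 0. Acyclicity thus comes from positive definiteness and not from the shape of the
    diagrams. *)
Lemma dead_end (S : {set I}) : S != finset.set0 ->
  exists2 b, b \in S & forall x, sr x = b -> tg x \notin S.
Proof.
move=> /set0Pn[b0 Sb0]; apply: contrapT => nS.
have h b : b \in S -> exists x, (sr x == b) && (tg x \in S).
  move=> Sb; apply: contrapT => nx; apply: nS; exists b => // x sx.
  by apply/negP => tS; apply: nx; exists x; rewrite sx eqxx.
pose v i : int := (i \in S)%:R.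
have := pB v b0; rewrite /v Sb0 expr1n; apply/negP; rewrite -ltNge.
apply: (@le_lt_trans _ _ 0) => //; apply: mulr_ge0_le0 => //; rewrite subr_le0.
rewrite (partition_big sr xpredT) //=; apply: ler_sum => b _.
case: (boolP (b \in S)) => Sb; last first.
  rewrite expr0n /=; apply: sumr_ge0 => x /eqP ->; by rewrite (negPf Sb) mul0r.
have [x /andP[/eqP sx tx]] := h b Sb.
rewrite (bigD1 x) /=; last by rewrite sx.
rewrite sx Sb tx mulr1 expr1n lerDl; apply: sumr_ge0 => y _.
by rewrite -natrM.
Qed.

Lemma noloop x : sr x != tg x.
Proof.
apply/eqP => st; have [|b] := @dead_end [set sr x]%SET; first by apply/set0Pn; exists (sr x); rewrite inE.
by rewrite inE => /eqP -> /(_ x erefl); rewrite inE st eqxx.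
Qed.

Fixpoint topo s : bool := if s is a :: s' then
  [forall x, (sr x == a) ==> (tg x \notin a :: s')] && topo s' else true.

Lemma topo_exists : exists L, [/\ uniq L, forall i, i \in L & topo L].
Proof.
suff [L [uL L1 tL]] : exists L, [/\ uniq L, forall i, (i \in L) = (i \in [set: I]%SET) & topo L].
  by exists L; split=> // i; rewrite L1 inE.
have [n] := ubnP #|[set: I]%SET|; elim: n [set: I]%SET => // n IH S le.
have [->|S0] := eqVneq S finset.set0; first by exists [::]; split=> // i; rewrite in_nil finset.in_set0.
have [b Sb bP] := dead_end S0.
have [|s [us sS ts]] := IH (S :\ b)%SET; first by rewrite (cardsD1 b S) Sb in le.
exists (b :: s); split=> [|i|] /=.
- by rewrite sS !inE eqxx us.
- by rewrite inE sS !inE; case: eqVneq => // ->.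
- rewrite ts andbT; apply/forallP => x; apply/implyP => /eqP/bP; apply: contra.
  by rewrite inE sS !inE; case: eqVneq => // -> .
Qed.

Lemma topo_index L x : topo L -> sr x \in L -> (index (tg x) L < index (sr x) L)%N ||
  (tg x \notin L).
Proof.
elim: L => //= a s IH /andP[/forallP/(_ x) h ts]; rewrite !inE.
move: h; case: (eqVneq (sr x) a) => [->|na] /=; first by move=> h _; rewrite h ?orbT.
by move=> _ sx; case: (eqVneq (tg x) a) => //= nt; rewrite ltnS; exact: IH.
Qed.

Lemma height_exists : exists rho : I -> nat, forall x, (rho (tg x) < rho (sr x))%N.
Proof.
have [L [_ L1 tL]] := topo_exists; exists (index^~ L) => x.
by have := topo_index tL (L1 (sr x)); rewrite L1 orbF.
Qed.

Lemma tq_add v a c :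
  tq sr tg (fun i => v i + (i == a)%:R * c) = tq sr tg v + c * (2 * v a + c - nb sr tg a v).
Proof.
rewrite /tq.
have -> : \sum_i (v i + (i == a)%:R * c) ^+ 2 = \sum_i v i ^+ 2 + c * (2 * v a + c).
  rewrite (bigD1 a) //= [in RHS](bigD1 a) //= eqxx mul1r.
  rewrite [in LHS](eq_bigr (fun i => v i ^+ 2)); last by move=> i /negPf ->; rewrite mul0r addr0.
  by rewrite /=; ring.
have -> : \sum_x (v (sr x) + (sr x == a)%:R * c) * (v (tg x) + (tg x == a)%:R * c) =
    \sum_x v (sr x) * v (tg x) + c * nb sr tg a v.
  rewrite /nb mulr_sumr -big_split /=; apply: eq_bigr => x _.
  have : ~~ ((sr x == a) && (tg x == a)).
    by apply/negP => /andP[/eqP <- /eqP e]; have := noloop x; rewrite e eqxx.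
  by case: (sr x == a); case: (tg x == a) => //= _; ring.
by rewrite /=; ring.
Qed.

Lemma tq_zs a v : tq sr tg (zs sr tg a v) = tq sr tg v.
Proof.
have -> : zs sr tg a v = fun i => v i + (i == a)%:R * (nb sr tg a v - 2 * v a).
  apply/funext => i; rewrite /zs; case: eqVneq => [->|_]; last by rewrite mul0r addr0.
  by rewrite mul1r; ring.
by rewrite tq_add; ring.
Qed.

Lemma tq_zss s v : tq sr tg (zss sr tg s v) = tq sr tg v.
Proof. by elim: s v => //= a s IH v; rewrite IH tq_zs. Qed.

Lemma zsK a : involutive (zs sr tg a).
Proof.
move=> v; apply/funext => i; rewrite {1}/zs; case: eqVneq => [->|ni].
  have -> : nb sr tg a (zs sr tg a v) = nb sr tg a v.
    apply: eq_bigr => x _; rewrite /zs; have := noloop x.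
    case: (eqVneq (tg x) a) => [->|]; case: (eqVneq (sr x) a) => // _ _;
      by rewrite ?mul0r ?mul1r.
  by rewrite /zs eqxx opprB addrCA subrr addr0.
by rewrite /zs (negPf ni).
Qed.

Lemma zss_inj s : injective (zss sr tg s).
Proof. by elim: s => //= a s IH u v /IH /(can_inj (zsK a)). Qed.

Lemma zss_sum s (J : Type) (r : seq J) (f : J -> I -> int) :
  zss sr tg s (fun i => \sum_(j <- r) f j i) = fun i => \sum_(j <- r) zss sr tg s (f j) i.
Proof.
elim: s f => //= a s IH f; rewrite -IH; congr zss; apply/funext => i; rewrite /zs.
case: eqVneq => // _; rewrite sumrB; congr (_ - _); rewrite /nb exchange_big /=.
by apply: eq_bigr => x _; rewrite big_split /= !mulr_sumr.
Qed.

Lemma zss_fix s y : uniq s -> zss sr tg s y = y -> {in s, forall a, zs sr tg a y = y}.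
Proof.
elim: s => //= a s IH /andP[nas us] fy.
(* The vertices are distinct, so only the first reflection changes the coordinate at [a]. *)
have out w : zss sr tg s w a = w a.
  elim: s nas {IH us fy} w => //= b s IH; rewrite inE negb_or => /andP[nab nas] w.
  by rewrite IH // /zs (negPf nab).
have fa : zs sr tg a y = y.
  apply/funext => i; rewrite {1}/zs; case: eqVneq => // ->.
  have := out (zs sr tg a y); rewrite (_ : zss sr tg s (zs sr tg a y) = y) //.
  by rewrite /zs eqxx => <-.
have fy' : zss sr tg s y = y by have : zss sr tg s (zs sr tg a y) = y := fy; rewrite fa.
by move=> b; rewrite inE => /predU1P[->//|]; exact: IH.
Qed.

(* A vector fixed by the Coxeter element [zss L] is fixed by all simple
   reflections, hence orthogonal to all simple roots. *)
Lemma coxeter_fix L y : uniq L -> (forall i, i \in L) -> zss sr tg L y = y ->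
  forall i, y i = 0.
Proof.
move=> uL L1 fy i; apply: tq_eq0.
have h a : nb sr tg a y = 2 * y a.
  have := congr1 (@^~ a) (zss_fix uL fy (L1 a)); rewrite /= /zs eqxx => /eqP.
  by rewrite subr_eq => /eqP ->; ring.
have : \sum_a y a * nb sr tg a y = 2 * \sum_x y (sr x) * y (tg x).
  under eq_bigr => a _ do rewrite mulr_sumr.
  rewrite exchange_big mulr_sumr /=; apply: eq_bigr => x _.
  have pick b (c : int) : \sum_a y a * ((b == a)%:R * c) = y b * c.
    rewrite (bigD1 b) //= eqxx mul1r big1 ?addr0 // => a /negPf.
    by rewrite eq_sym => ->; rewrite mul0r mulr0.
  under eq_bigr => a _ do rewrite mulrDr.
  by rewrite big_split /= !pick; ring.
under eq_bigr => a _ do rewrite h mulrCA.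
rewrite -mulr_sumr => /mulfI e; rewrite /tq.
under eq_bigr => a _ do rewrite expr2.
by rewrite e ?subrr.
Qed.

Lemma zss_nseq L k v : zss sr tg (flatten (nseq k L)) v = iter k (zss sr tg L) v.
Proof. by elim: k v => //= k IH v; rewrite /zss foldl_cat -/(zss _ _ _ _) IH -iterSr. Qed.

(** If the orbit of [v] under the Coxeter element stayed nonnegative, it would be periodic, since
    the invariant form bounds all coordinates. The sum over a period is then fixed, hence 0 by
    [coxeter_fix], although its coordinate at [i0] is positive. *)
Lemma coxeter_neg L v : uniq L -> (forall i, i \in L) ->
  (exists i, v i != 0) -> (forall i, 0 <= v i) ->
  exists k i, zss sr tg (flatten (nseq k L)) v i < 0.
Proof.
move=> uL L1 [i0 v0] vge; apply: contrapT => nneg.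
pose c k := zss sr tg (flatten (nseq k L)) v.
have cge k i : 0 <= c k i.
  by rewrite leNgt; apply/negP => lt; apply: nneg; exists k, i.
pose N := absz (B%:Z * tq sr tg v).
have cle k i : (`|c k i| <= N)%N.
  have := pB (c k) i; rewrite /c tq_zss -/(c k) => h.
  have : (absz (c k i ^+ 2) <= N)%N.
    rewrite -lez_nat !abszE ger0_norm ?sqr_ge0 // ger0_norm //.
    by apply: mulr_ge0 => //; exact: tq_ge0.
  by rewrite abszX; apply: leq_trans; case: (`|c k i|)%N => // m; rewrite expnS leq_pmulr // expn_gt0.
pose f (k : 'I_(#|{: {ffun I -> 'I_N.+1}}|.+1)) : {ffun I -> 'I_N.+1} := [ffun i => inord `|c k i|%N].
have /injectivePn[k [k' nkk' ff]] : ~~ injectiveb f.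
  by apply/negP => /injectiveP/leq_card; rewrite card_ord ltnn.
have cc : c k = c k'.
  apply/funext => i; have := congr1 (fun g : {ffun _ -> _} => val (g i)) ff.
  rewrite /= !ffunE !inordK ?ltnS ?cle // => e.
  by rewrite -[c k i]gez0_abs ?cge // e gez0_abs.
wlog lt : k k' nkk' cc {ff} / (k < k')%N.
  by move=> W; case: (ltngtP k k') => [|lt|/val_inj e]; [exact: W|apply: (W k' k) => //; rewrite eq_sym|case/eqP: nkk'].
pose h := (k' - k)%N.
have h0 : (0 < h)%N by rewrite subn_gt0.
have per : c h = v.
  have inj : forall m, injective (iter m (zss sr tg L)).
    by elim=> //= m IH u w /(@zss_inj L)/IH.
  have e : iter k (zss sr tg L) v = iter k' (zss sr tg L) v by rewrite -!zss_nseq; exact: cc.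
  by apply: (inj k); rewrite e /c zss_nseq -iterD subnKC // ltnW.
pose y i := \sum_(0 <= j < h) c j i.
have y0 : forall i, y i = 0.
  apply: (coxeter_fix uL L1); rewrite /y zss_sum; apply/funext => i.
  have cS j : zss sr tg L (c j) = c j.+1 by rewrite /c !zss_nseq.
  under eq_bigr => j _ do rewrite cS.
  move: h0 per; case: (h) => // m _ per.
  by rewrite big_nat_recr // big_nat_recl //= per addrC.
have : y i0 != 0; last by rewrite y0 eqxx.
rewrite /y; move: h0; case: (h) => // m _; rewrite big_nat_recl //.
rewrite gt_eqF // ltr_wpDr ?sumr_ge0 // lt_neqAle cge andbT eq_sym; exact: v0.
Qed.

(* The orientation in which the sinks outside [s] have already been flipped. *)
Definition osr s x := if (tg x \notin s) && (sr x \in s) then tg x else sr x.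
Definition otg s x := if (tg x \notin s) && (sr x \in s) then sr x else tg x.

(** A round through all vertices, sinks first, reverses every arrow twice and restores the
    orientation, so it can be followed by any admissible sequence. *)
Lemma adm_topo L s : uniq L -> (forall i, i \in L) -> topo L ->
  adm sr tg s -> adm sr tg (L ++ s).
Proof.
move=> uL L1 tL as_.
(* The intermediate orientation [osr], [otg] is the original one both before and after the round. *)
have EL : osr L = sr /\ otg L = tg by split; apply/funext => x; rewrite /osr /otg L1.
have E0 : osr [::] = sr /\ otg [::] = tg by split; apply/funext => x; rewrite /osr /otg.
rewrite -{1}EL.1 -{1}EL.2.
have as0 : adm (osr [::]) (otg [::]) s by rewrite E0.1 E0.2.
have cL x : tg x \in L -> sr x \in L by rewrite !L1.
elim: L uL tL cL {L1 EL} => //= a l IH /andP[nal ul] /andP[/forallP ta tl] cl.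
have cl' x : tg x \in l -> sr x \in l.
  move=> tx; have := cl x; rewrite !inE tx orbT => /(_ isT).
  by case: eqVneq => // e _; have := ta x; rewrite e eqxx inE tx orbT.
apply/andP; split.
  apply/forallP => x; rewrite /osr !inE; have := ta x; rewrite !inE.
  case: (eqVneq (sr x) a) => [->|nsa] /=; last by case: ifP => // /andP[/norP[]].
  by move=> nt; rewrite nt /=; case/norP: nt.

have e1 : flip_s (osr (a :: l)) (otg (a :: l)) a = osr l.
  apply/funext => x; rewrite /flip_s /osr /otg !inE; have := ta x; have := cl x; rewrite !inE.
  case: (eqVneq (sr x) a) => [->|nsa] /=.
    by move=> _ nt; rewrite nt /= eqxx (negPf nal) andbF.
  move=> csx _; move: csx; case: (eqVneq (tg x) a) => [->|nta] /=.
    by move=> /(_ isT) ->; rewrite nal /= ?eqxx.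
  by move=> _; case: (tg x \in l); case: (sr x \in l); rewrite /= ?(negPf nsa) ?(negPf nta).
have e2 : flip_t (osr (a :: l)) (otg (a :: l)) a = otg l.
  apply/funext => x; rewrite /flip_t /osr /otg !inE; have := ta x; have := cl x; rewrite !inE.
  case: (eqVneq (sr x) a) => [->|nsa] /=.
    by move=> _ nt; rewrite nt /= eqxx (negPf nal) andbF.
  move=> csx _; move: csx; case: (eqVneq (tg x) a) => [->|nta] /=.
    by move=> /(_ isT) ->; rewrite nal /= ?eqxx.
  by move=> _; case: (tg x \in l); case: (sr x \in l); rewrite /= ?(negPf nsa) ?(negPf nta).
by rewrite e1 e2; exact: IH.
Qed.

End Fixed.

Lemma rs0 sr tg a : rs sr tg a (fun=> 0%N) = fun=> 0%N.
Proof. by apply/funext => i; rewrite /rs big1 // if_same. Qed.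

Lemma rss0 sr tg s : rss sr tg s (fun=> 0%N) = fun=> 0%N.
Proof. by elim: s sr tg => //= a s IH sr tg; rewrite rs0 IH. Qed.

Lemma rss_cat sr tg s1 s2 v : (forall i, rss sr tg s1 v i = 0%N) ->
  forall i, rss sr tg (s1 ++ s2) v i = 0%N.
Proof.
elim: s1 sr tg v => [|a s1 IH] sr tg v /= h.
  by rewrite (_ : v = fun=> 0%N) ?rss0 //; exact/funext.
exact: IH.
Qed.

Lemma sink_nb sr tg a v : sink sr a -> nb sr tg a (zv v) = (\sum_(x | tg x == a) v (sr x))%N%:Z.
Proof.
move=> /forallP sa; rewrite (big_morph Posz PoszD (erefl 0%:Z)) /nb [RHS]big_mkcond /=; apply: eq_bigr => x _.
by rewrite (negPf (sa x)) mul0r addr0; case: ifP; rewrite ?mul1r ?mul0r.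
Qed.

(** Split off the coordinate at [a]: the form of [v] is that of the remainder plus [v a] times a
    positive integer. The value 1 leaves only [v a = 1] and remainder 0. *)
Lemma simple_root sr tg B a v : pdb sr tg B -> sink sr a -> tq sr tg (zv v) = 1 ->
  (\sum_(x | tg x == a) v (sr x) < v a)%N -> v = fun i => (i == a) : nat.
Proof.
move=> pB sa q1 lt.
pose r i := if i == a then 0%N else v i.
have vE : zv v = fun i => zv r i + (i == a)%:R * (v a)%:Z.
  by apply/funext => i; rewrite /zv /r; case: eqVneq => [->|_]; rewrite ?mul1r ?mul0r ?addr0 ?add0r.
have nbr : nb sr tg a (zv r) = (\sum_(x | tg x == a) v (sr x))%N%:Z.
  rewrite sink_nb //; congr Posz; apply: eq_bigr => x _; rewrite /r.
  by move/forallP: sa => /(_ x)/negPf ->.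
have q1' := tq_add pB (zv r) a (v a)%:Z.
have ra : zv r a = 0 by rewrite /zv /r eqxx.
rewrite -vE q1 nbr ra mulr0 add0r in q1'.
have r0 := tq_ge0 pB (zv r).
have d1 : 1 <= (v a)%:Z - (\sum_(x | tg x == a) v (sr x))%N%:Z by lia.
have v1 : 1 <= (v a)%:Z by lia.
have p1 := mulr_ege1 v1 d1.
have p2 : (v a)%:Z <= (v a)%:Z * ((v a)%:Z - (\sum_(x | tg x == a) v (sr x))%N%:Z).
  by apply: ler_peMr => //; lia.
have qr : tq sr tg (zv r) = 0 by lia.
have va1 : v a = 1%N by lia.
apply/funext => i; have := tq_eq0 pB i qr; rewrite /zv /r.
by case: eqVneq => [->|_ [->]].
Qed.

Lemma zv_rs sr tg a v : sink sr a -> (v a <= \sum_(x | tg x == a) v (sr x))%N ->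
  zv (rs sr tg a v) = zs sr tg a (zv v).
Proof.
move=> sa le; apply/funext => i; rewrite /zv /rs /zs; case: eqVneq => // _.
by rewrite (sink_nb _ _ sa) subzn.
Qed.

Lemma zss_flip sr tg a s v : zss (flip_s sr tg a) (flip_t sr tg a) s v = zss sr tg s v.
Proof.
elim: s v => //= b s IH v; rewrite IH; congr zss; apply/funext => i.
by rewrite /zs nb_flip.
Qed.

(** Truncation takes effect only at a simple root, which it sends to 0; until then truncated and
    genuine reflections agree. *)
Lemma rss_root sr tg B s v : pdb sr tg B -> adm sr tg s -> tq sr tg (zv v) = 1 ->
  (forall i, rss sr tg s v i = 0%N) \/ zv (rss sr tg s v) = zss sr tg s (zv v).
Proof.
elim: s sr tg v => [|a s IH] sr tg v pB /=; first by right.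
move=> /andP[sa as_] q1; case: (leqP (v a) (\sum_(x | tg x == a) v (sr x))) => le.
  have e := zv_rs sa le.
  have [|h|h] := IH _ _ (rs sr tg a v) (pdb_flip a pB) as_; first by rewrite tq_flip e (tq_zs pB).
    by left.
  by right; rewrite h zss_flip e.
left; have -> : rs sr tg a v = fun=> 0%N; last by rewrite rss0.
apply/funext => i; rewrite /rs; case: eqVneq => [_|/negPf ni].
  by apply/eqP; rewrite subn_eq0 ltnW.
by rewrite (simple_root pB sa q1 le) ni.
Qed.

Lemma root_bound sr tg B v i : pdb sr tg B -> tq sr tg (zv v) = 1 -> (v i <= B)%N.
Proof.
move=> pB q1; have := pB (zv v) i; rewrite q1 mulr1 /zv => h.
by move: h; rewrite expr2; case: (v i) => // m h; nia.
Qed.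

Lemma negative_sequence sr tg B v : pdb sr tg B -> (exists i, v i != 0%N) ->
  exists s, adm sr tg s /\ exists i, zss sr tg s (zv v) i < 0.
Proof.
move=> pB [i0 v0]; have [L [uL L1 tL]] := topo_exists pB.
have admk k : adm sr tg (flatten (nseq k L)) by elim: k => //= k; exact: (adm_topo uL L1 tL).
have [||k [i neg]] := coxeter_neg pB (v := zv v) uL L1; [by exists i0|by []|].
by exists (flatten (nseq k L)); split=> //; exists i.
Qed.

(** For each root some number of rounds makes the genuine reflections negative, so the truncated
    ones must have reached 0. Roots have coordinates at most [B], and one number of rounds serves
    all of them. *)
Lemma killing_sequence sr tg B : pdb sr tg B -> exists s, adm sr tg s /\
  forall v, tq sr tg (zv v) = 1 -> forall i, rss sr tg s v i = 0%N.
Proof.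
move=> pB; have [L [uL L1 tL]] := topo_exists pB.
have admk k : adm sr tg (flatten (nseq k L)) by elim: k => //= k; exact: (adm_topo uL L1 tL).
have kill v : tq sr tg (zv v) = 1 -> exists k, forall i, rss sr tg (flatten (nseq k L)) v i = 0%N.
  move=> q1; have [||k [i neg]] := coxeter_neg pB (v := zv v) uL L1.
  - apply: contrapT => nv; move: q1; rewrite /tq !big1 // => [x|i] _.
      by have /eqP -> : zv v (sr x) == 0 by apply/negPn/negP => h; apply: nv; exists (sr x).
    by have /eqP -> : zv v i == 0 by apply/negPn/negP => h; apply: nv; exists i.
  - by [].
  exists k; have [//|e] := rss_root pB (admk k) q1.
  by move: neg; rewrite -e.
pose fn (g : {ffun I -> 'I_B.+1}) : I -> nat := fun i => g i.
have kill' g : exists k, tq sr tg (zv (fn g)) = 1 ->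
    forall i, rss sr tg (flatten (nseq k L)) (fn g) i = 0%N.
  have [q1|nq] := pselect (tq sr tg (zv (fn g)) = 1); last by exists 0%N.
  by have [k hk] := kill _ q1; exists k.
have [K hK] := boolp.choice kill'.
exists (flatten (nseq (\max_g K g) L)); split=> // v q1.
pose g : {ffun I -> 'I_B.+1} := [ffun i => inord (v i)].
have gv : fn g = v.
  by apply/funext => i; rewrite /fn ffunE inordK // ltnS (root_bound i pB q1).
have := hK g; rewrite gv => /(_ q1) h.
rewrite -(subnKC (leq_bigmax (F := K) g)) nseqD flatten_cat.
exact: rss_cat.
Qed.

End Reflections.

(** * Reflection functors *)

Section FfunMaps.
Variables (F : fieldType) (V : vectType F) (O : finType).

Definition ffcoord (o : O) (f : {ffun O -> V}) : V := f o.

Fact ffcoord_is_linear o : linear (ffcoord o).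
Proof. by move=> c f g; rewrite /ffcoord !ffunE. Qed.

HB.instance Definition _ o := GRing.isLinear.Build F {ffun O -> V} V _ (ffcoord o)
  (ffcoord_is_linear o).

Definition ffinj (o : O) (v : V) : {ffun O -> V} := [ffun o' => if o' == o then v else 0].

Fact ffinj_is_linear o : linear (ffinj o).
Proof.
move=> c u v; apply/ffunP => o'; rewrite !ffunE; case: eqP => // _.
by rewrite scaler0 addr0.
Qed.

HB.instance Definition _ o := GRing.isLinear.Build F V {ffun O -> V} _ (ffinj o)
  (ffinj_is_linear o).

Definition cmp o : 'Hom({ffun O -> V}, V) := linfun (ffcoord o).
Definition inj o : 'Hom(V, {ffun O -> V}) := linfun (ffinj o).

Lemma cmpE o f : cmp o f = f o. Proof. by rewrite lfunE. Qed.

Lemma injE o v o' : inj o v o' = if o' == o then v else 0.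
Proof. by rewrite lfunE /= ffunE. Qed.

Lemma cmp_inj o v : cmp o (inj o v) = v. Proof. by rewrite cmpE injE eqxx. Qed.

End FfunMaps.

(** * Reflection of families at a sink *)

Section AmbientReflection.
Variables (I E : finType) (sr tg : E -> I) (a : I).
Variables (F : fieldType) (V : vectType F) (A : E -> 'End(V)).
Local Notation V' := {ffun option E -> V}.
Local Notation sr' := (flip_s sr tg a).
Local Notation tg' := (flip_t sr tg a).
Local Notation QQ := (@Quiver I E sr tg).
Local Notation QQ' := (@Quiver I E (flip_s sr tg a) (flip_t sr tg a)).
Implicit Types (sp U R W : {ffun I -> {vspace V}}).

(** The new ambient space has one copy of [V] per arrow and an extra copy [None]. Away from [a] the
    old space sits in [None]; at [a] the copy [Some x] of each arrow into [a] carries the space at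
    its source. *)
Definition tsp sp i (o : option E) : {vspace V} :=
  if o is Some x then if (i == a) && (tg x == a) then sp (sr x) else 0%VS
  else if i == a then 0%VS else sp i.

Definition sumA : 'Hom(V', V) := (\sum_(x | tg x == a) (A x \o cmp V (Some x)))%VF.

Definition psp sp i : {vspace V'} := (\bigcap_(o : option E) (cmp V o @^-1: tsp sp i o))%VS.

(** The Bernstein-Gelfand-Ponomarev functor: at [a] it is the kernel of the summation map from the
    sources of the incoming arrows. *)
Definition refl sp : {ffun I -> {vspace V'}} :=
  [ffun i => (psp sp i :&: (if i == a then lker sumA else fullv))%VS].

Definition reflA (x : E) : 'End(V') :=
  if tg x == a then (inj V None \o cmp V (Some x))%VF
  else (inj V None \o (A x \o cmp V None))%VF.

Definition img sp : {vspace V} := (\sum_(x | tg x == a) A x @: sp (sr x))%VS.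

Lemma sumAE (v : V') : sumA v = \sum_(x | tg x == a) A x (v (Some x)).
Proof. by rewrite sum_lfunE; apply: eq_bigr => x _; rewrite comp_lfunE cmpE. Qed.

Lemma mem_psp sp i (v : V') : reflect (forall o, v o \in tsp sp i o) (v \in psp sp i).
Proof.
rewrite memvE; apply: (iffP subv_bigcapP) => h o; last first.
  by move=> _; rewrite -memvE -memv_preim cmpE.
by have := h o isT; rewrite -memvE -memv_preim cmpE.
Qed.

Lemma mem_refl sp i (v : V') : (v \in refl sp i) =
  (v \in psp sp i) && ((i == a) ==> (sumA v == 0)).
Proof. by rewrite ffunE memv_cap; case: eqP => _; rewrite ?memv_ker ?memvf. Qed.

Lemma mem_psp_some sp (v : V') x : v \in psp sp a -> tg x = a -> v (Some x) \in sp (sr x).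
Proof. by move=> /mem_psp/(_ (Some x)) h tx; move: h; rewrite /tsp tx !eqxx. Qed.

Lemma psp_intro sp (v : V') : v None = 0 ->
  (forall x, tg x = a -> v (Some x) \in sp (sr x)) ->
  (forall x, tg x != a -> v (Some x) = 0) -> v \in psp sp a.
Proof.
move=> v0 va vn; apply/mem_psp => -[x|] /=; rewrite eqxx /=; last by rewrite v0 mem0v.
by case: (eqVneq (tg x) a) => [/va//|/vn ->]; rewrite ?mem0v.
Qed.

Lemma psp_ext sp (v w : V') : v \in psp sp a -> w \in psp sp a ->
  (forall x, tg x = a -> v (Some x) = w (Some x)) -> v = w.
Proof.
move=> /mem_psp pv /mem_psp pw h; apply/ffunP => -[x|]; last first.
  by have := pv None; have := pw None; rewrite /= eqxx !memv0 => /eqP -> /eqP ->.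
case: (eqVneq (tg x) a) => [/h//|/negPf nt].
by have := pv (Some x); have := pw (Some x); rewrite /= nt andbF !memv0 => /eqP -> /eqP ->.
Qed.

Lemma refl_psp sp i (v : V') : v \in refl sp i -> v \in psp sp i.
Proof. by rewrite mem_refl => /andP[]. Qed.

Lemma refl_ker sp (v : V') : v \in refl sp a -> sumA v = 0.
Proof. by rewrite mem_refl eqxx => /andP[_ /eqP]. Qed.

Lemma refl_intro sp (v : V') : v \in psp sp a -> sumA v = 0 -> v \in refl sp a.
Proof. by rewrite mem_refl => -> ->; rewrite !eqxx. Qed.

Lemma refl_in sp i u : i != a -> (inj V None u \in refl sp i) = (u \in sp i).
Proof.
move=> /negPf ia; rewrite mem_refl ia andbT; apply/mem_psp/idP => [/(_ None)|ui [x|]] /=.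
- by rewrite ia injE eqxx.
- by rewrite ia injE mem0v.
- by rewrite ia injE eqxx.
Qed.

Lemma refl_out sp i (v : V') : i != a -> v \in refl sp i -> v = inj V None (v None).
Proof.
move=> /negPf ia; rewrite mem_refl ia andbT => /mem_psp h; apply/ffunP => -[x|]; rewrite injE //=.
by have := h (Some x); rewrite /= ia memv0 => /eqP.
Qed.

Lemma refl_outP sp i (v : V') : i != a -> v \in refl sp i ->
  exists2 u, u \in sp i & v = inj V None u.
Proof.
move=> ia vi; have e := refl_out ia vi.
by exists (v None) => //; rewrite -(refl_in _ _ ia) -e.
Qed.

Lemma psp_mono U W i : fle U W -> (psp U i <= psp W i)%VS.
Proof.
move=> /fleP UW; apply/subvP => v /mem_psp h; apply/mem_psp => o; move: (h o).
rewrite /tsp; case: o => [x|]; case: ifP => // _; exact: UW.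
Qed.

Lemma refl_mono U W : fle U W -> fle (refl U) (refl W).
Proof.
move=> UW; apply/fleP => i v; rewrite !mem_refl => /andP[pv ->]; rewrite andbT.
exact: (subvP (psp_mono i UW)).
Qed.

Lemma refl_fam0 : refl fam0 = fam0.
Proof.
apply: fle_anti; last exact: fle0.
apply/fleP => i v /refl_psp/mem_psp h; rewrite ffunE memv0; apply/eqP/ffunP => o.
rewrite ffunE; apply/eqP; rewrite -memv0; have := h o.
by rewrite /tsp; case: o => [x|]; case: ifP => _ //; rewrite ffunE.
Qed.

Lemma sumA_psp sp : (sumA @: psp sp a)%VS = img sp.
Proof.
apply/eqP; rewrite eqEsubv; apply/andP; split; apply/subvP => z.
  move=> /memv_imgP[v pv ->]; rewrite sumAE; apply: memv_sumr => x /eqP tx.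
  by rewrite memv_img // (mem_psp_some pv tx).
move=> /memv_sumP[f fP ->]; apply: memv_suml => x tx.
have /memv_imgP[u ux ->] := fP x tx.
apply/memv_imgP; exists (inj V (Some x) u).
  apply: psp_intro => [|y ty|y ty]; rewrite injE //.
    by case: eqP => [[->]//|_]; rewrite mem0v.
  by case: eqP => // -[e]; move: ty; rewrite e tx.
rewrite sumAE (bigD1 x) //= injE eqxx big1 ?addr0 // => y /andP[_ /negPf yx].
by rewrite injE -[Some y == _]/(y == x) yx lf0.
Qed.

Lemma img_mono U W : fle U W -> (img U <= img W)%VS.
Proof. by move=> UW; rewrite -!sumA_psp limgS // psp_mono. Qed.

Lemma img_stable sp : stable sr tg A sp -> (img sp <= sp a)%VS.
Proof.
move=> /stableP ssp; apply/subv_sumP => x /eqP tx; apply/subvP => z /memv_imgP[u ux ->].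
by rewrite -tx ssp.
Qed.

Lemma dim_psp sp : \dim (psp sp a) = (\sum_(x | tg x == a) \dim (sp (sr x)))%N.
Proof.
have -> : psp sp a = (\sum_(x | tg x == a) inj V (Some x) @: sp (sr x))%VS.
  apply/eqP; rewrite eqEsubv; apply/andP; split; apply/subvP => v.
    move=> pv; have -> : v = \sum_(x | tg x == a) inj V (Some x) (v (Some x)).
      apply: (psp_ext pv) => [|y ty].
        apply: psp_intro => [|y ty|y ty]; rewrite sum_ffunE.
        - by rewrite big1 // => x _; rewrite injE.
        - apply: memv_suml => x tx; rewrite injE; case: eqP => [[->]|_]; last exact: mem0v.
          by apply: mem_psp_some pv _; exact/eqP.
        - rewrite big1 // => x tx; rewrite injE; case: eqP => // -[e].
          by move: ty; rewrite e tx.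
      rewrite sum_ffunE (bigD1 y) /=; last exact/eqP.
      rewrite injE eqxx big1 ?addr0 // => x /andP[_ xy].
      by rewrite injE -[Some y == _]/(y == x) eq_sym (negPf xy).
    by apply: memv_sumr => x /eqP tx; rewrite memv_img // (mem_psp_some pv tx).
  move=> /memv_sumP[f fP ->]; apply: memv_suml => x tx.
  have /memv_imgP[u ux ->] := fP x tx.
  apply: psp_intro => [|y ty|y ty]; rewrite injE //.
    by case: eqP => [[->]//|_]; rewrite mem0v.
  by case: eqP => // -[e]; move: ty; rewrite e tx.
have /directvP -> : directv (\sum_(x | tg x == a) inj V (Some x) @: sp (sr x))%VS.
  apply/directv_sum_independent => us usP us0 x tx.
  have /memv_imgP[u ux uE] := usP x tx.
  have := congr1 (fun f : V' => f (Some x)) us0; rewrite sum_ffunE ffunE (bigD1 x) //= big1.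
    by rewrite addr0 uE injE eqxx => ->; rewrite lf0.
  move=> y /andP[ty yx]; have /memv_imgP[w _ ->] := usP y ty.
  by rewrite injE -[Some x == _]/(x == y) eq_sym (negPf yx).
apply: eq_bigr => x _; apply: limg_dim_eq; apply/eqP; rewrite -subv0; apply/subvP => u.
rewrite memv_cap memv_ker memv0 => /andP[_ /eqP/(congr1 (fun f : V' => f (Some x)))].
by rewrite injE eqxx ffunE => ->.
Qed.

Lemma dim_refl sp : (\dim (refl sp a) + \dim (img sp) =
  \sum_(x | tg x == a) \dim (sp (sr x)))%N.
Proof. by rewrite -dim_psp -sumA_psp ffunE eqxx limg_ker_dim. Qed.

Lemma dim_refl_out sp i : i != a -> \dim (refl sp i) = \dim (sp i).
Proof.
move=> ia; have -> : refl sp i = (inj V None @: sp i)%VS.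
  apply/vspaceP => v; apply/idP/memv_imgP => [/(refl_outP ia)[u]|[u ui ->]]; first by exists u.
  by rewrite refl_in.
apply: limg_dim_eq; apply/eqP; rewrite -subv0; apply/subvP => u.
by rewrite memv_cap memv_ker memv0 => /andP[_ /eqP/(congr1 (cmp V None))]; rewrite cmp_inj lf0 => ->.
Qed.

Hypothesis sa : sink sr a.

Lemma sr_neq x : sr x != a. Proof. exact: (forallP sa). Qed.

Lemma refl_stable sp : stable sr tg A sp -> stable sr' tg' reflA (refl sp).
Proof.
move=> /stableP ssp; apply/stableP => x v; rewrite /flip_s /flip_t /reflA.
case: (eqVneq (tg x) a) => [tx|nx] vi; rewrite !comp_lfunE !cmpE.
  by rewrite refl_in ?sr_neq //; exact: mem_psp_some (refl_psp vi) tx.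
have [u ui ->] := refl_outP (sr_neq x) vi.
by rewrite injE eqxx refl_in // ssp.
Qed.

Lemma tsp_add sp U R i o : (forall i, U i + R i = sp i)%VS ->
  (tsp U i o + tsp R i o = tsp sp i o)%VS.
Proof. by move=> UR; rewrite /tsp; case: o => [x|]; case: ifP; rewrite ?addv0. Qed.

Lemma tsp_cap U R i o : (forall i, U i :&: R i = 0)%VS ->
  (tsp U i o :&: tsp R i o = 0)%VS.
Proof. by move=> UR; rewrite /tsp; case: o => [x|]; case: ifP; rewrite ?capv0. Qed.

Lemma psp_cap0 U R i (v : V') : (forall i, U i :&: R i = 0)%VS ->
  v \in psp U i -> v \in psp R i -> v = 0.
Proof.
move=> UR /mem_psp vU /mem_psp vR; apply/ffunP => o; rewrite ffunE; apply/eqP.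
by rewrite -memv0 -(tsp_cap i o UR) memv_cap vU vR.
Qed.

Lemma sumA_in U (v : V') : stable sr tg A U -> v \in psp U a -> sumA v \in U a.
Proof.
by move=> sU pv; apply: (subvP (img_stable sU)); rewrite -sumA_psp memv_img.
Qed.

Lemma refl_dsumf sp U R : @dsumf QQ F V A sp U R -> @dsumf QQ' F V' reflA (refl sp) (refl U) (refl R).
Proof.
move=> d; have [sU sR UR UR0] := d; have [Usp Rsp] := dsumf_fle d.
split=> [||i|i]; try exact: refl_stable.
  apply/eqP; rewrite eqEsubv; apply/andP; split.
    by rewrite subv_add !(forallP (refl_mono _)).
  apply/subvP => v vi; have [ia|ia] := eqVneq i a; last first.
    have [u ui ->] := refl_outP ia vi; move: ui; rewrite -UR => /memv_addP[u1 h1 [u2 h2 ->]].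
    by rewrite lfD memv_add // refl_in.
  subst i.
  have /boolp.choice[f fP] : forall o, exists p : V * V,
      [/\ p.1 \in tsp U a o, p.2 \in tsp R a o & v o = p.1 + p.2].
    move=> o; have /mem_psp/(_ o) := refl_psp vi; rewrite -(tsp_add a o UR).
    by case/memv_addP=> u1 h1 [u2 h2 e]; exists (u1, u2).
  pose p : V' := [ffun o => (f o).1]; pose r : V' := [ffun o => (f o).2].
  have vE : v = p + r by apply/ffunP => o; rewrite !ffunE; have [] := fP o.
  have pp : p \in psp U a by apply/mem_psp => o; rewrite ffunE; have [] := fP o.
  have pr : r \in psp R a by apply/mem_psp => o; rewrite ffunE; have [] := fP o.
  (* The two partial sums lie in the independent spaces [U a] and [R a] and add up to 0. Both
     vanish, and the kernel splits. *)
  have e0 := refl_ker vi; rewrite vE lfD in e0.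
  have p0 : sumA p = 0.
    apply/eqP; rewrite -memv0 -(UR0 a) memv_cap (sumA_in sU pp) /=.
    have -> : sumA p = - sumA r by apply/eqP; rewrite -addr_eq0 e0.
    by rewrite memvN (sumA_in sR pr).
  rewrite vE memv_add ?refl_intro //; by rewrite p0 add0r in e0.
apply/eqP; rewrite -subv0; apply/subvP => v; rewrite memv_cap memv0.
by case/andP=> /refl_psp vU /refl_psp vR; apply/eqP; exact: psp_cap0 vU vR.
Qed.

(** The way back from the reflected family; at [a] it takes the smallest space that stability
    permits. *)
Definition low (U' : {ffun I -> {vspace V'}}) : {ffun I -> {vspace V}} :=
  [ffun i => if i == a then (\sum_(x | tg x == a) A x @: (cmp V None @: U' (sr x)))%VS
             else (cmp V None @: U' i)%VS].

Lemma mem_low sp (U' : {ffun I -> {vspace V'}}) i u : i != a -> fle U' (refl sp) ->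
  (u \in low U' i) = (inj V None u \in U' i).
Proof.
move=> ia /fleP U'sp; rewrite ffunE (negPf ia); apply/memv_imgP/idP => [[v vi ->]|ui].
  by rewrite cmpE -(refl_out ia (U'sp _ _ vi)).
by exists (inj V None u); rewrite // cmp_inj.
Qed.

Lemma low_img (U' : {ffun I -> {vspace V'}}) : low U' a = img (low U').
Proof.
rewrite {1}/low ffunE eqxx; apply: eq_bigr => x _.
by rewrite ffunE (negPf (sr_neq x)).
Qed.

Lemma psp_low sp (U' : {ffun I -> {vspace V'}}) v : fle U' (refl sp) -> stable sr' tg' reflA U' -> v \in U' a ->
  v \in psp (low U') a.
Proof.
move=> U'sp /stableP sU va; have pv := refl_psp (fleP _ _ U'sp _ _ va).
have /mem_psp h := pv.
apply: psp_intro => [|x tx|x tx].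
- by have := h None; rewrite /= eqxx memv0 => /eqP.
- rewrite (mem_low _ (sr_neq x) U'sp); have := sU x v.
  by rewrite /flip_s /flip_t tx eqxx /reflA tx eqxx comp_lfunE cmpE; apply.
- by have := h (Some x); rewrite /= (negPf tx) andbF memv0 => /eqP.
Qed.

Lemma low_stable sp (U' : {ffun I -> {vspace V'}}) : fle U' (refl sp) -> stable sr' tg' reflA U' -> stable sr tg A (low U').
Proof.
move=> U'sp sU'; apply/stableP => x v; case: (eqVneq (tg x) a) => [tx|nt] vx.
  by rewrite tx low_img memvE (sumv_sup x) ?tx // -memvE memv_img.
rewrite (mem_low _ nt U'sp); rewrite (mem_low _ (sr_neq x) U'sp) in vx.
move/stableP: sU' => /(_ x (inj V None v)).
by rewrite /flip_s /flip_t /reflA (negPf nt) !comp_lfunE cmp_inj; apply.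
Qed.

Lemma low_fam0 sp (U' : {ffun I -> {vspace V'}}) : fle U' (refl sp) -> stable sr' tg' reflA U' -> low U' = fam0 -> U' = fam0.
Proof.
move=> U'sp sU' U0; apply: fle_anti; last exact: fle0.
apply/fleP => i v vi; rewrite ffunE memv0.
case: (eqVneq i a) => [ia|ia]; last first.
  have [u _ vE] := refl_outP ia (fleP _ _ U'sp _ _ vi).
  by move: vi; rewrite vE -(mem_low _ ia U'sp) U0 ffunE memv0 => /eqP ->; rewrite lf0.
subst i; have := psp_low U'sp sU' vi; rewrite U0 => pv.
by apply/eqP; apply: (@psp_cap0 fam0 fam0 a) => // i; rewrite ffunE cap0v.
Qed.

Lemma low_dsumf sp (U' R' : {ffun I -> {vspace V'}}) : stable sr tg A sp -> img sp = sp a ->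
  @dsumf QQ' F V' reflA (refl sp) U' R' -> @dsumf QQ F V A sp (low U') (low R').
Proof.
move=> ssp full d; have [sU sR UR UR0] := d; have [Usp Rsp] := dsumf_fle d.
have URo i : i != a -> (low U' i + low R' i = sp i)%VS.
  move=> ia; rewrite !ffunE (negPf ia) -limgD UR; apply/vspaceP => u.
  apply/memv_imgP/idP => [[v vi ->]|ui]; first by rewrite cmpE -(refl_in _ _ ia) -(refl_out ia vi).
  by exists (inj V None u); rewrite ?refl_in ?cmp_inj.
have cap_out i : i != a -> (low U' i :&: low R' i = 0)%VS.
  move=> ia; apply/eqP; rewrite -subv0; apply/subvP => u.
  rewrite memv_cap (mem_low _ ia Usp) (mem_low _ ia Rsp) -memv_cap UR0 !memv0.
  by move/eqP/(congr1 (cmp V None)); rewrite cmp_inj lf0 => ->.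
have pcap v : v \in psp (low U') a -> v \in psp (low R') a -> v = 0.
  move=> vU vR; apply: (psp_ext vU); first exact: mem0v.
  move=> x tx; rewrite ffunE; apply/eqP; rewrite -memv0 -(cap_out _ (sr_neq x)) memv_cap.
  by rewrite (mem_psp_some vU tx) (mem_psp_some vR tx).
split=> [||i|i]; [exact: low_stable Usp sU|exact: low_stable Rsp sR| |].
  have [->|ia] := eqVneq i a; last exact: URo.
  rewrite !low_img -full /img -big_split /=; apply: eq_bigr => x _.
  by rewrite -limgD URo ?sr_neq.
have [->|ia] := eqVneq i a; last exact: cap_out.
apply/eqP; rewrite -subv0; apply/subvP => z; rewrite memv_cap memv0 !low_img -!sumA_psp.
case/andP=> /memv_imgP[p pU zE] /memv_imgP[r rR zE'].
have lU : fle (low U') sp.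
  apply/forallP => j; have [->|ja] := eqVneq j a; last by rewrite -(URo _ ja) addvSl.
  rewrite low_img -full; apply/subv_sumP => x tx; rewrite (sumv_sup x) // limgS //.
  by rewrite -(URo _ (sr_neq x)) addvSl.
have lR : fle (low R') sp.
  apply/forallP => j; have [->|ja] := eqVneq j a; last by rewrite -(URo _ ja) addvSr.
  rewrite low_img -full; apply/subv_sumP => x tx; rewrite (sumv_sup x) // limgS //.
  by rewrite -(URo _ (sr_neq x)) addvSr.
(* Two preimages of [z] differ by an element of the kernel; splitting that element along [U'] and
   [R'] shows that [p] itself lies in the kernel. *)
have : p - r \in refl sp a.
  apply: refl_intro; last by rewrite lfB -zE -zE' subrr.
  by apply: memvB; [exact: (subvP (psp_mono a lU))|exact: (subvP (psp_mono a lR))].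
rewrite -UR => /memv_addP[k1 k1U [k2 k2R e]].
have pk1 := psp_low Usp sU k1U; have pk2 := psp_low Rsp sR k2R.
have pE : p = k1 + k2 + r by rewrite -e subrK.
have e1 : p - k1 = r + k2 by rewrite pE addrAC [k1 + k2]addrC addrK addrC.
have p1 : p = k1.
  by apply/eqP; rewrite -subr_eq0; apply/eqP/pcap; rewrite ?e1 ?(memvD rR) // -e1 memvB.
by rewrite zE p1 (refl_ker (fleP _ _ Usp _ _ k1U)).
Qed.

(* A simple summand at the sink [a] splits off unless the arrows into [a] are
   jointly onto. *)
Lemma aindec_refl sp : stable sr tg A sp -> @aindec QQ F V A sp ->
  (forall i, \dim (sp i) = (i == a)) \/
  img sp = sp a /\ @aindec QQ' F V' reflA (refl sp).
Proof.
move=> ssp [nz ind]; have is_ := img_stable ssp.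
have [full|nfull] := eqVneq (img sp) (sp a).
  right; split=> //; split=> [r0|U' R' d].
    apply: nz; have s0 i : i != a -> sp i = 0%VS.
      by move=> ia; apply/eqP; rewrite -dimv_eq0 -(dim_refl_out _ ia) r0 ffunE dimv0.
    apply/ffunP => i; rewrite ffunE; have [->|/s0//] := eqVneq i a.
    rewrite -full /img big1 // => x _; by rewrite s0 ?sr_neq // limg0.
  have [sU sR _ _] := d; have [Usp Rsp] := dsumf_fle d.
  have [h|h] := ind _ _ (low_dsumf ssp full d); [left|right].
    exact: low_fam0 Usp sU h.
  exact: low_fam0 Rsp sR h.
(* A complement of the image at the sink is a direct summand, so indecomposability concentrates [sp]
   at [a]; splitting off a line there gives dimension one. *)
left; pose C := (sp a :\: img sp)%VS.
pose U : {ffun I -> {vspace V}} := [ffun i => if i == a then img sp else sp i].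
pose R : {ffun I -> {vspace V}} := [ffun i => if i == a then C else 0%VS].
have sU : stable sr tg A U.
  apply/stableP => x v; rewrite !ffunE (negPf (sr_neq x)) => vx.
  case: eqP => [tx|_]; last by move/stableP: ssp; apply.
  by rewrite memvE (sumv_sup x) ?tx // -memvE memv_img.
have sR C' : stable sr tg A [ffun i => if i == a then C' else 0%VS].
  by apply/stableP => x v; rewrite !ffunE (negPf (sr_neq x)) memv0 => /eqP ->; rewrite lf0 mem0v.
have CE : (img sp + C = sp a)%VS.
  by rewrite addvC /C -[X in (_ + X)%VS](capv_idPl is_) capvC addv_diff_cap.
have C0 : (img sp :&: C = 0)%VS.
  apply/eqP; rewrite -subv0; apply/subvP => v; rewrite memv_cap => /andP[vi vC].
  by rewrite -(capv_diff (sp a) (img sp)) memv_cap vC.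
have d : @dsumf QQ F V A sp U R.
  split=> // [|i|i]; first exact: sR.
    by rewrite !ffunE; case: eqP => [->|]; rewrite ?addv0.
  by rewrite !ffunE; case: eqP => _; rewrite ?capv0.
have [U0|R0] := ind _ _ d; last first.
  case/eqP: nfull; rewrite -CE; have := congr1 (fun f : {ffun _ -> _} => f a) R0.
  by rewrite !ffunE eqxx => ->; rewrite addv0.
have Ui i := congr1 (fun f : {ffun I -> {vspace V}} => f i) U0.
have out i : i != a -> sp i = 0%VS by move=> ia; have := Ui i; rewrite !ffunE (negPf ia).
have I0 : img sp = 0%VS by have := Ui a; rewrite !ffunE eqxx.
move=> i; have [->|/out ->] := eqVneq i a; last by rewrite dimv0.
have sp0 : sp a != 0%VS by rewrite -I0 eq_sym.
have /subvPn[v va v0] : ~~ (sp a <= 0)%VS by rewrite subv0.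
have nv : <[v]>%VS != 0%VS by rewrite -subv0 -memvE.
pose D := (sp a :\: <[v]>)%VS.
have vsp : (<[v]> <= sp a)%VS by rewrite -memvE.
have d2 : @dsumf QQ F V A sp [ffun i => if i == a then <[v]>%VS else 0%VS]
     [ffun i => if i == a then D else 0%VS].
  split; try exact: sR.
    move=> j; rewrite !ffunE; case: eqVneq => [->|/out ->]; last by rewrite addv0.
    by rewrite addvC /D -[X in (_ + X)%VS](capv_idPl vsp) capvC addv_diff_cap.
  move=> j; rewrite !ffunE; case: eqP => _; last by rewrite cap0v.
  by rewrite /D capvC; apply/eqP; rewrite -subv0 capv_diff.
have [h|h] := ind _ _ d2; have := congr1 (fun f : {ffun I -> {vspace V}} => f a) h.
  by rewrite !ffunE eqxx => e; rewrite e eqxx in nv.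
rewrite !ffunE eqxx => D0; have := addv_diff_cap (sp a) <[v]>; rewrite -/D D0 add0v.
rewrite (capv_idPr vsp) => <-; by rewrite dim_vline; move: v0; rewrite memv0 => ->.
Qed.

End AmbientReflection.

(** * Gabriel's theorem *)

Section AmbientIsomorphism.
Variables (I E : finType) (F : fieldType).

(** Isomorphism of families in different ambient spaces. Reflections enlarge the ambient space, so
    two representations cannot stay inside a common one. *)
Definition aiso (sr tg : E -> I) (V1 V2 : vectType F) (A1 : E -> 'End(V1)) (A2 : E -> 'End(V2))
    (sp1 : {ffun I -> {vspace V1}}) (sp2 : {ffun I -> {vspace V2}}) :=
  exists h : I -> 'Hom(V1, V2), [/\ forall i, (h i @: sp1 i = sp2 i)%VS,
    forall i v, v \in sp1 i -> h i v = 0 -> v = 0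
    & forall x v, v \in sp1 (sr x) -> h (tg x) (A1 x v) = A2 x (h (sr x) v)].

Lemma aiso_qreal sr tg (V1 V2 : vectType F) (A1 : E -> 'End(V1)) (A2 : E -> 'End(V2))
    (sp1 : {ffun I -> {vspace V1}}) (sp2 : {ffun I -> {vspace V2}}) (d : dimvec (@Quiver I E sr tg)) (N : @rep (@Quiver I E sr tg) F d) :
  aiso sr tg A1 A2 sp1 sp2 ->
  @qreal (@Quiver I E sr tg) F V2 A2 sp2 fam0 d N -> @qreal (@Quiver I E sr tg) F V1 A1 sp1 fam0 d N.
Proof.
move=> [h [hi hk hA]] [g [gi gk gA]]; exists (fun i => g i \o h i)%VF; split=> [i|i|x v vx].
- by rewrite limg_comp hi gi.
- apply/vspaceP => v; rewrite ffunE memv0 memv_cap memv_ker comp_lfunE.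
  apply/andP/eqP => [[vi g0]|->]; last by rewrite mem0v !lf0.
  apply: hk (vi) _; apply/eqP; rewrite -memv0.
  have := gk i; rewrite ffunE => <-; rewrite memv_cap memv_ker g0 andbT -hi.
  exact: memv_img.
- rewrite !comp_lfunE hA // gA //=; have := hi (sr x) => /= <-; exact: memv_img.
Qed.

Lemma line_iso (V1 V2 : vectType F) (U1 : {vspace V1}) (U2 : {vspace V2}) n :
  \dim U1 = n -> \dim U2 = n ->
  exists l : 'Hom(V1, V2), (l @: U1 = U2)%VS /\ forall v, v \in U1 -> l v = 0 -> v = 0.
Proof.
move=> d1 d2.
have [|g1 [i1 k1]] := lcoord (sub0v U1) (n := n); first by rewrite dimv0.
have [|g2 [i2 k2]] := lcoord (sub0v U2) (n := n); first by rewrite dimv0.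
have [|l lP] := @lfactor _ _ _ _ g2 \1%VF U2; first by rewrite k2 sub0v.
exists (l \o g1)%VF; split.
  rewrite limg_comp i1 -i2; apply/vspaceP => v; apply/memv_imgP/idP => [[w /memv_imgP[u u2 ->] ->]|v2].
    by have := lP u u2; rewrite id_lfunE => <-.
  by exists (g2 v); [exact: memv_img|rewrite -lP // id_lfunE].
move=> v v1; rewrite comp_lfunE => l0.
have : g1 v \in (g2 @: U2)%VS by rewrite i2 memvf.
move=> /memv_imgP[u u2 e]; have := lP u u2; rewrite id_lfunE -e l0 => u0.
by apply/eqP; rewrite -memv0 -k1 memv_cap v1 memv_ker e u0 lf0 eqxx.
Qed.

Lemma simple_aiso sr tg a (V1 V2 : vectType F) (A1 : E -> 'End(V1)) (A2 : E -> 'End(V2))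
    (sp1 : {ffun I -> {vspace V1}}) (sp2 : {ffun I -> {vspace V2}}) :
  sink sr a -> (forall i, \dim (sp1 i) = (i == a)) -> (forall i, \dim (sp2 i) = (i == a)) ->
  aiso sr tg A1 A2 sp1 sp2.
Proof.
move=> sa d1 d2.
have /boolp.choice[h hP] : forall i, exists l : 'Hom(V1, V2),
    (l @: sp1 i = sp2 i)%VS /\ forall v, v \in sp1 i -> l v = 0 -> v = 0.
  by move=> i; exact: line_iso (d1 i) (d2 i).
exists h; split=> [i|i|x v]; try by have [] := hP i.
have /eqP := d1 (sr x); rewrite (negPf (forallP sa x)) dimv_eq0 => /eqP ->.
by rewrite memv0 => /eqP ->; rewrite !lf0.
Qed.

(** When the incoming arrows are jointly onto, the space at [a] is the quotient of [psp] by the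
    reflected space. The isomorphism acts on [psp] componentwise as [Phi], which on the kernel is
    the given map, and so it descends. *)
Lemma aiso_lift sr tg a (V1 V2 : vectType F) (A1 : E -> 'End(V1)) (A2 : E -> 'End(V2))
    (sp1 : {ffun I -> {vspace V1}}) (sp2 : {ffun I -> {vspace V2}}) :
  sink sr a -> stable sr tg A1 sp1 -> stable sr tg A2 sp2 ->
  img sr tg a A1 sp1 = sp1 a -> img sr tg a A2 sp2 = sp2 a ->
  aiso (flip_s sr tg a) (flip_t sr tg a) (reflA tg a A1) (reflA tg a A2)
    (refl sr tg a A1 sp1) (refl sr tg a A2 sp2) ->
  aiso sr tg A1 A2 sp1 sp2.
Proof.
move=> sa s1 s2 f1 f2 [h' [hi hk hA]].
have sn x : sr x != a by exact: (forallP sa).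
pose hh i : 'Hom(V1, V2) := (cmp V2 None \o (h' i \o inj V1 None))%VF.
have hhE i v : i != a -> v \in sp1 i -> h' i (inj V1 None v) = inj V2 None (hh i v).
  move=> ia vi; rewrite !comp_lfunE cmpE; apply: (refl_out (sr := sr) (tg := tg) (a := a) (A := A2) (sp := sp2) ia).
  by rewrite -hi memv_img // refl_in.
have hhk i v : i != a -> v \in sp1 i -> hh i v = 0 -> v = 0.
  move=> ia vi h0; have hin : inj V1 None v \in refl sr tg a A1 sp1 i by rewrite refl_in.
  have h00 : h' i (inj V1 None v) = 0 by rewrite hhE // h0 lf0.
  by have /(congr1 (cmp V1 None)) := hk i _ hin h00; rewrite cmp_inj lf0.
have hhi i : i != a -> (hh i @: sp1 i = sp2 i)%VS.
  move=> ia; apply/vspaceP => w; apply/memv_imgP/idP => [[v vi ->]|wi].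
    by rewrite -(refl_in sr tg A2 _ _ ia) -hhE // -hi memv_img // refl_in.
  have : inj V2 None w \in refl sr tg a A2 sp2 i by rewrite refl_in.
  rewrite -hi => /memv_imgP[v' vi']; have [v vi ->] := refl_outP ia vi'.
  rewrite hhE // => /(congr1 (cmp V2 None)); rewrite !cmp_inj => ->; by exists v.
clearbody hh.
pose Phi : 'Hom({ffun option E -> V1}, {ffun option E -> V2}) :=
  (\sum_(x | tg x == a) (inj V2 (Some x) \o (hh (sr x) \o cmp V1 (Some x))))%VF.
have PhiE (v : {ffun option E -> V1}) x : tg x = a -> Phi v (Some x) = hh (sr x) (v (Some x)).
  move=> tx; rewrite sum_lfunE sum_ffunE (bigD1 x) /=; last exact/eqP.
  rewrite !comp_lfunE cmpE injE eqxx big1 ?addr0 // => y /andP[_ yx].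
  by rewrite !comp_lfunE injE -[Some x == _]/(x == y) eq_sym (negPf yx).
have PhiP (v : {ffun option E -> V1}) : v \in psp sr tg a sp1 a -> Phi v \in psp sr tg a sp2 a.
  move=> pv; rewrite sum_lfunE; apply: memv_suml => x /eqP tx; rewrite !comp_lfunE cmpE.
  apply: psp_intro => [|y ty|y ty]; rewrite injE //.
    case: eqP => [[->]|_]; last exact: mem0v.
    by rewrite -hhi // memv_img // (mem_psp_some pv tx).
  by case: eqP => // -[e]; move: ty; rewrite e tx eqxx.
have PhiK (v : {ffun option E -> V1}) : v \in refl sr tg a A1 sp1 a -> Phi v = h' a v.
  move=> va; have pv := refl_psp va.
  have h2 : h' a v \in refl sr tg a A2 sp2 a by rewrite -hi memv_img.
  apply: (psp_ext (PhiP _ pv) (refl_psp h2)) => x tx; rewrite PhiE //.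
  have := hA x v; rewrite /flip_s /flip_t /reflA tx eqxx => /(_ va).
  rewrite !comp_lfunE !cmpE hhE // ?(mem_psp_some pv tx) //.
  by move/(congr1 (cmp V2 None)); rewrite !cmp_inj.
have [l lP] : exists l : 'Hom(V1, V2), {in psp sr tg a sp1 a, forall v,
    (sumA tg a A2 \o Phi)%VF v = l (sumA tg a A1 v)}.
  apply: lfactor; apply/subvP => v; rewrite memv_cap !memv_ker => /andP[pv /eqP v0].
  have va : v \in refl sr tg a A1 sp1 a by exact: refl_intro.
  rewrite comp_lfunE PhiK //; apply/eqP; apply: (@refl_ker _ _ sr tg a _ _ A2 sp2).
  by rewrite -hi memv_img.
have PhiI : (Phi @: psp sr tg a sp1 a = psp sr tg a sp2 a)%VS.
  apply/vspaceP => w; apply/memv_imgP/idP => [[v pv ->]|pw]; first exact: PhiP.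
  have /boolp.choice[f fP] : forall x, exists u, tg x = a -> u \in sp1 (sr x) /\ w (Some x) = hh (sr x) u.
    move=> x; have [tx|nx] := eqVneq (tg x) a; last by exists 0 => e; rewrite e eqxx in nx.
    by have := mem_psp_some pw tx; rewrite -hhi // => /memv_imgP[u]; exists u.
  pose v : {ffun option E -> V1} := [ffun o => if o is Some x then if tg x == a then f x else 0 else 0].
  have pv : v \in psp sr tg a sp1 a.
    apply: psp_intro => [|x tx|x tx]; rewrite ffunE //; last by rewrite (negPf tx).
    by rewrite tx eqxx; have [] := fP x tx.
  exists v => //; apply: (psp_ext pw (PhiP _ pv)) => x tx.
  by rewrite PhiE // ffunE tx eqxx; have [] := fP x tx.
exists (fun i => if i == a then l else hh i); split=> [i|i v|x v vx].
- case: eqVneq => [->|]; last exact: hhi.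
  suff : ((l \o sumA tg a A1) @: psp sr tg a sp1 a = (sumA tg a A2 \o Phi) @: psp sr tg a sp1 a)%VS.
    by rewrite !limg_comp PhiI !sumA_psp f1 f2.
  apply/vspaceP => w.
  have e v : v \in psp sr tg a sp1 a -> (l \o sumA tg a A1)%VF v = (sumA tg a A2 \o Phi)%VF v.
    by move=> pv; rewrite lP // comp_lfunE.
  apply/memv_imgP/memv_imgP => -[v pv wE]; exists v => //.
    by rewrite wE; exact: e.
  by rewrite wE; exact: esym (e v pv).
- case: eqVneq => [->|]; last exact: hhk.
  rewrite -f1 -sumA_psp => /memv_imgP[p pp ->]; rewrite -lP // comp_lfunE => s0.
  have : Phi p \in refl sr tg a A2 sp2 a by apply: refl_intro; first exact: PhiP.
  rewrite -hi => /memv_imgP[k ka]; rewrite -PhiK // => e.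
  have -> : p = k; last exact: refl_ker ka.
  apply: (psp_ext pp (refl_psp ka)) => x tx; apply/eqP; rewrite -subr_eq0; apply/eqP.
  have pk := refl_psp ka.
  apply: (hhk (sr x)) => //.
    by apply: memvB; [exact: mem_psp_some pp tx|exact: mem_psp_some pk tx].
  rewrite lfB -!PhiE // e; exact: subrr.
- rewrite (negPf (sn x)); case: eqVneq => [tx|nx].
    have pv : inj V1 (Some x) v \in psp sr tg a sp1 a.
      apply: psp_intro => [|y ty|y ty]; rewrite injE //.
        by case: eqP => [[->]//|_]; rewrite mem0v.
      by case: eqP => // -[e]; move: ty; rewrite e tx eqxx.
    have E1 : sumA tg a A1 (inj V1 (Some x) v) = A1 x v.
      rewrite sumAE (bigD1 x) /=; last exact/eqP.
      rewrite injE eqxx big1 ?addr0 // => y /andP[_ yx].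
      by rewrite injE -[Some y == _]/(y == x) (negPf yx) lf0.
    rewrite -E1 -lP // comp_lfunE sumAE (bigD1 x) /=; last exact/eqP.
    rewrite PhiE // injE eqxx big1 ?addr0 // => y /andP[/eqP ty yx].
    by rewrite PhiE // injE -[Some y == _]/(y == x) (negPf yx) !lf0.
  have := hA x (inj V1 None v); rewrite /flip_s /flip_t /reflA (negPf nx) refl_in // => /(_ vx).
  have tv : A1 x v \in sp1 (tg x) by move/stableP: s1; apply.
  rewrite !comp_lfunE !cmp_inj (hhE _ _ nx tv) (hhE _ _ (sn x) vx) cmp_inj.
  by move/(congr1 (cmp V2 None)); rewrite !cmp_inj.
Qed.

End AmbientIsomorphism.

Section Gabriel.
Variables (I E : finType) (F : fieldType).

Definition dimf (V : vectType F) (sp : {ffun I -> {vspace V}}) : I -> nat := fun i => \dim (sp i).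

Lemma dimf_eq0 (V : vectType F) (sp : {ffun I -> {vspace V}}) :
  (forall i, \dim (sp i) = 0%N) -> sp = fam0.
Proof. by move=> h; apply/ffunP => i; rewrite ffunE; apply/eqP; rewrite -dimv_eq0 h. Qed.

Lemma dimf_dsumf sr tg (V : vectType F) (A : E -> 'End(V)) (sp U R : {ffun I -> {vspace V}}) i :
  @dsumf (@Quiver I E sr tg) F V A sp U R -> dimf sp i = (dimf U i + dimf R i)%N.
Proof. by move=> d; exact: (dsumf_dim (i : vert (@Quiver I E sr tg)) d). Qed.

Lemma dimf_refl sr tg a (V : vectType F) (A : E -> 'End(V))
    (sp : {ffun I -> {vspace V}}) : stable sr tg A sp ->
  img sr tg a A sp = sp a ->
  dimf (refl sr tg a A sp) = rs sr tg a (dimf sp) /\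
  (dimf sp a <= \sum_(x | tg x == a) dimf sp (sr x))%N.
Proof.
move=> ssp full; have := dim_refl sr tg a A sp; rewrite full => e.
split; last by rewrite -e leq_addl.
apply/funext => i; rewrite /rs; case: eqVneq => [->|ia]; last by rewrite /dimf dim_refl_out.
by rewrite /dimf -e addnK.
Qed.

Lemma dimf_refl_simple sr tg a (V : vectType F) (A : E -> 'End(V))
    (sp : {ffun I -> {vspace V}}) : sink sr a ->
  (forall i, \dim (sp i) = (i == a)) -> refl sr tg a A sp = fam0.
Proof.
move=> sa d; apply: dimf_eq0 => i; have [->|ia] := eqVneq i a; last first.
  by rewrite dim_refl_out // d (negPf ia).
have := dim_refl sr tg a A sp; rewrite big1 => [|x _]; last by rewrite d (negPf (forallP sa x)).
by move/eqP; rewrite addn_eq0 => /andP[/eqP].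
Qed.

Lemma tq_simple sr tg B a : pdb sr tg B -> tq (I := I) (E := E) sr tg (zv (fun i => (i == a) : nat)) = 1.
Proof.
move=> pB; have -> : zv (fun i => (i == a) : nat) = fun i => (fun=> 0) i + (i == a)%:R * 1.
  by apply/funext => i; rewrite /zv add0r mulr1; case: eqP.
rewrite (tq_add pB) /tq /nb !big1 => [|x _|x _|x _]; by rewrite ?mulr0 ?expr0n ?addr0.
Qed.

(** Dimension vectors are never negative, so along a sequence that makes the integral reflections
    negative the family must become simple at the current sink. The form is invariant and has the
    value 1 there. *)
Lemma indecomposable_root sr tg B (V : vectType F) (A : E -> 'End(V))
    (sp : {ffun I -> {vspace V}}) : pdb sr tg B ->
  stable sr tg A sp -> @aindec (@Quiver I E sr tg) F V A sp -> tq sr tg (zv (dimf sp)) = 1.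
Proof.
move=> pB ssp ai.
have [|s [as_ [i neg]]] := negative_sequence (v := dimf sp) pB.
  apply: contrapT => n0; case: ai => nz _; apply: nz; apply: dimf_eq0 => i.
  by apply/eqP/negPn/negP => di; apply: n0; exists i.
elim: s sr tg V A sp pB ssp ai as_ neg => [|a s IH] sr tg V A sp pB ssp ai //= /andP[sa as_] neg.
have [d|[full ai']] := aindec_refl sa ssp ai.
  by rewrite -(tq_simple a pB); congr (tq _ _ (zv _)); apply/funext => j; exact: d.
have [dE le] := dimf_refl ssp full.
have zE := zv_rs sa le; rewrite -dE in zE.
have := IH _ _ _ _ _ (pdb_flip a pB) (refl_stable sa ssp) ai' as_.
by rewrite zss_flip zE tq_flip (tq_zs pB); apply.
Qed.

(** Both families are reflected in parallel until one is simple at the current sink; the common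
    dimension vector makes the other one simple too, and the isomorphism is lifted back. *)
Lemma indecomposable_unique s sr tg B (V1 V2 : vectType F) (A1 : E -> 'End(V1)) (A2 : E -> 'End(V2))
    (sp1 : {ffun I -> {vspace V1}}) (sp2 : {ffun I -> {vspace V2}}) : pdb sr tg B -> adm sr tg s ->
  stable sr tg A1 sp1 -> stable sr tg A2 sp2 ->
  @aindec (@Quiver I E sr tg) F V1 A1 sp1 -> @aindec (@Quiver I E sr tg) F V2 A2 sp2 ->
  dimf sp1 = dimf sp2 -> (forall i, rss sr tg s (dimf sp1) i = 0%N) ->
  aiso sr tg A1 A2 sp1 sp2.
Proof.
elim: s sr tg V1 V2 A1 A2 sp1 sp2 => [|a s IH] sr tg V1 V2 A1 A2 sp1 sp2 pB /=.
  by move=> _ _ _ [nz _] _ _ d0; case: nz; exact: dimf_eq0.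
move=> /andP[sa as_] s1 s2 i1 i2 d12 k.
have [d1|[f1 i1']] := aindec_refl sa s1 i1.
  have d1' (i : I) : \dim (sp1 i) = (i == a) := d1 i.
  by apply: (@simple_aiso _ _ _ sr tg a) => // i; rewrite -d1'; exact: (congr1 (@^~ i) (esym d12)).
have [d2|[f2 i2']] := aindec_refl sa s2 i2.
  have d2' (i : I) : \dim (sp2 i) = (i == a) := d2 i.
  by apply: (@simple_aiso _ _ _ sr tg a) => // i; rewrite -d2'; exact: (congr1 (@^~ i) d12).
apply: (aiso_lift sa s1 s2 f1 f2).
apply: (IH _ _ _ _ _ _ _ _ (pdb_flip a pB) as_ (refl_stable sa s1) (refl_stable sa s2) i1' i2').
  by rewrite (dimf_refl s1 f1).1 (dimf_refl s2 f2).1 d12.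
by rewrite (dimf_refl s1 f1).1.
Qed.

Lemma simple_exists sr tg a : exists (V : vectType F) (A : E -> 'End(V)) (sp : {ffun I -> {vspace V}}),
  [/\ stable sr tg A sp, @aindec (@Quiver I E sr tg) F V A sp &
      dimf sp = fun i => (i == a) : nat].
Proof.
pose sp : {ffun I -> {vspace 'rV[F]_1}} := [ffun i => if i == a then fullv else 0%VS].
have dE : dimf sp = fun i => (i == a) : nat.
  by apply/funext => i; rewrite /dimf ffunE; case: eqP; rewrite ?dimv0 // dimvf dim_rV.
exists 'rV[F]_1, (fun=> 0), sp; split=> //.
  by apply/stableP => x v _; rewrite zero_lfunE mem0v.
split=> [sp0|U R d].
  by have := congr1 (@^~ a) dE; rewrite /dimf sp0 ffunE dimv0 eqxx.
have dd i : (dimf U i + dimf R i = (i == a))%N by rewrite -[LHS](dimf_dsumf i d) dE.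
have := dd a; rewrite eqxx => da.
have [U0|Ua] := posnP (dimf U a); [left|right]; apply: dimf_eq0 => i.
  by change (dimf U i = 0%N); have := dd i; have [->|_] := eqVneq i a; lia.
by change (dimf R i = 0%N); have := dd i; have [->|_] := eqVneq i a; lia.
Qed.

(** A source of the quiver is a sink of the opposite one, so [v] is reflected there numerically.
    After the flip [b] is a sink, and the sink functor itself carries the constructed family
    back. *)
Lemma indecomposable_exists s sr tg B v : pdb sr tg B -> adm tg sr s -> tq sr tg (zv v) = 1 ->
  (forall i, rss tg sr s v i = 0%N) ->
  exists (V : vectType F) (A : E -> 'End(V)) (sp : {ffun I -> {vspace V}}),
  [/\ stable sr tg A sp, @aindec (@Quiver I E sr tg) F V A sp & dimf sp = v].
Proof.
elim: s sr tg v => [|b s IH] sr tg v pB /=.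
  by move=> _ q1 v0; move: q1; rewrite /tq !big1 // => x _; rewrite /zv !v0.
move=> /andP[sb as_] q1 k; have pO := pdb_op pB.
have q1' : tq tg sr (zv v) = 1 by rewrite tq_op.
case: (leqP (v b) (\sum_(x | sr x == b) v (tg x))) => le; last first.
  by rewrite (simple_root pO sb q1' le); exact: simple_exists.
have zE := zv_rs sb le.
have pF : pdb (flip_t tg sr b) (flip_s tg sr b) B by apply: pdb_op; exact: pdb_flip.
have [|V [A [sp [ssp ai dE]]]] := IH _ _ (rs tg sr b v) pF as_ _ k.
  by rewrite tq_op tq_flip zE (tq_zs pO).
have sk : sink (flip_t tg sr b) b.
  apply/forallP => x; rewrite /flip_t; case: (eqVneq (sr x) b) => [<-|//].
  by rewrite eq_sym; exact: (noloop pB).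
have tb x : tg x != b by exact: (forallP sb).
have vb : v b = (\sum_(x | flip_s tg sr b x == b) rs tg sr b v (flip_t tg sr b x) - rs tg sr b v b)%N.
  rewrite {2}/rs eqxx (eq_big (fun x => sr x == b) (fun x => v (tg x))).
  - by rewrite subKn.
  - by move=> x; rewrite /flip_s; case: (eqVneq (sr x) b) => _; rewrite ?eqxx ?(negPf (tb x)).
  - by move=> x; rewrite /flip_s /flip_t /rs; case: (eqVneq (sr x) b) => _;
      rewrite ?eqxx ?(negPf (tb x)).
have Es : flip_s (flip_t tg sr b) (flip_s tg sr b) b = sr.
  apply/funext => x; rewrite /flip_s /flip_t; case: (eqVneq (sr x) b) => [->|_]; first by rewrite eqxx.
  by rewrite (negPf (tb x)).
have Et : flip_t (flip_t tg sr b) (flip_s tg sr b) b = tg.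
  apply/funext => x; rewrite /flip_s /flip_t; case: (eqVneq (sr x) b) => [_|_]; first by rewrite eqxx.
  by rewrite (negPf (tb x)).
(* The simple case is contradictory: were the reflected vector the simple root at [b], then [v]
   would vanish at [b] and at its neighbours, and so would the reflected coordinate at [b]. *)
have [d|[full ai']] := aindec_refl sk ssp ai.
  have re i : rs tg sr b v i = (i == b) by rewrite -dE; exact: d.
  have := re b; rewrite /rs eqxx => e1; move: vb; rewrite big1 ?sub0n; last first.
    by move=> x fx; rewrite re; move/eqP: fx => fx; rewrite (negPf (forallP sk x)).
  move=> vb0; move: e1; rewrite vb0 subn0 big1 // => x sx.
  have := re (tg x); by rewrite /rs (negPf (tb x)).
have [dE' _] := dimf_refl ssp full.
have := refl_stable sk ssp; move: ai' dE'; rewrite Es Et => ai' dE' ss.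
exists _, (reflA (flip_s tg sr b) b A), (refl (flip_t tg sr b) (flip_s tg sr b) b A sp).
split; [exact: ss|exact: ai'|rewrite dE' dE].
apply/funext => i; rewrite {1}/rs; case: eqVneq => [->|/negPf ib]; first by rewrite -vb.
by rewrite /rs ib.
Qed.

(** The dimension vectors of the successive reflections. They are additive, and along a killing
    sequence they separate isomorphism classes. *)
Fixpoint rinv sr tg s (V : vectType F) (A : E -> 'End(V)) (sp : {ffun I -> {vspace V}}) k : I -> nat :=
  match s, k with
  | a :: s', k'.+1 => rinv (flip_s sr tg a) (flip_t sr tg a) s' (reflA tg a A) (refl sr tg a A sp) k'
  | _, _ => dimf sp
  end.

Lemma inv_fam0 s sr tg (V : vectType F) (A : E -> 'End(V)) k i : rinv sr tg s A fam0 k i = 0%N.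
Proof.
elim: s sr tg V A k => [|a s IH] sr tg V A [|k] /=; rewrite ?refl_fam0 ?IH //;
  by rewrite /dimf ffunE dimv0.
Qed.

Lemma inv_dsumf s sr tg (V : vectType F) (A : E -> 'End(V))
    (sp U R : {ffun I -> {vspace V}}) k i : adm sr tg s ->
  @dsumf (@Quiver I E sr tg) F V A sp U R ->
  rinv sr tg s A sp k i = (rinv sr tg s A U k i + rinv sr tg s A R k i)%N.
Proof.
elim: s sr tg V A sp U R k => [|a s IH] sr tg V A sp U R [|k] /=;
  try by move=> _; exact: dimf_dsumf.
by move=> /andP[sa as_] d; apply: IH as_ _; exact: refl_dsumf.
Qed.

End Gabriel.

Fixpoint vinv (I E : finType) (sr tg : E -> I) s (v : I -> nat) k : I -> nat :=
  match s, k with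
  | a :: s', k'.+1 => vinv (flip_s sr tg a) (flip_t sr tg a) s' (rs sr tg a v) k'
  | _, _ => v
  end.

Lemma vinv0 (I E : finType) (sr tg : E -> I) s k i : vinv sr tg s (fun=> 0%N) k i = 0%N.
Proof. by elim: s sr tg k => [|a s IH] sr tg [|k] //=; rewrite rs0 IH. Qed.

Lemma rs_simple (I E : finType) (sr tg : E -> I) a : sink sr a ->
  rs sr tg a (fun i => (i == a) : nat) = fun=> 0%N.
Proof.
move=> sa; apply/funext => i; rewrite /rs; case: eqP => // _.
by rewrite big1 // => x _; rewrite (negPf (forallP sa x)).
Qed.

Lemma inv_aindec (I E : finType) (F : fieldType) s sr tg (V : vectType F) (A : E -> 'End(V))
    (sp : {ffun I -> {vspace V}}) k i :
  adm sr tg s -> stable sr tg A sp -> @aindec (@Quiver I E sr tg) F V A sp ->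
  rinv sr tg s A sp k i = vinv sr tg s (dimf sp) k i.
Proof.
elim: s sr tg V A sp k => [|a s IH] sr tg V A sp [|k] //= /andP[sa as_] ssp ai.
have [d|[full ai']] := aindec_refl sa ssp ai.
  rewrite dimf_refl_simple // inv_fam0.
  have -> : dimf sp = fun i => (i == a) : nat by apply/funext => j; exact: d.
  by rewrite rs_simple // vinv0.
by rewrite IH // ?(dimf_refl ssp full).1 //; exact: refl_stable.
Qed.

(* The roots that become simple at the first reflection are counted by the
   failure of the reflection formula; the others are treated recursively. *)
Lemma vinv_inj (I E : finType) (T : eqType) s sr tg B (f : T -> I -> nat) bs bs' :
  pdb (E := E) sr tg B -> adm sr tg s ->
  {in bs ++ bs', forall b, tq sr tg (zv (f b)) = 1} ->
  {in bs ++ bs' &, injective f} ->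
  {in bs ++ bs', forall b i, rss sr tg s (f b) i = 0%N} ->
  (forall k i, \sum_(b <- bs) vinv sr tg s (f b) k i = \sum_(b <- bs') vinv sr tg s (f b) k i)%N ->
  perm_eq bs bs'.
Proof.
elim: s sr tg f bs bs' => [|a s IH] sr tg f bs bs' pB.
  move=> _ q1 _ kl _; have h b : b \in bs ++ bs' -> False.
    move=> bb; have k0 i : f b i = 0%N := kl b bb i.
    by have := q1 b bb; rewrite /tq !big1 // => x _; rewrite /zv !k0.
  case: bs h {q1 kl} => [|b bs] h; last by case: (h b); rewrite mem_head.
  by case: bs' h => [//|b bs'] h; case: (h b); rewrite mem_head.
move=> /= /andP[sa as_] q1 fi kl hs.
pose P b := [forall i, f b i == (i == a)].
have PE b : P b -> f b = fun i => (i == a) : nat.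
  by move=> /forallP h; apply/funext => i; apply/eqP.
have nP b : b \in bs ++ bs' -> ~~ P b -> (f b a <= \sum_(x | tg x == a) f b (sr x))%N.
  move=> bb; rewrite leqNgt; apply: contra => lt; apply/forallP => i.
  by rewrite (simple_root pB sa (q1 b bb) lt).
(* For roots other than the simple one at [a] the reflection formula balances the two sides; the
   simple one is truncated and accounts for the term [count P r]. *)
have cnt r : {subset r <= bs ++ bs'} -> (count P r + \sum_(b <- r) \sum_(x | tg x == a) f b (sr x) =
    \sum_(b <- r) f b a + \sum_(b <- r) rs sr tg a (f b) a)%N.
  move=> rs_; elim: r rs_ => [|b r IHr] rs_; first by rewrite !big_nil.
  rewrite !big_cons /=; have bb := rs_ b (mem_head _ _).
  have -> : rs sr tg a (f b) a = (\sum_(x | tg x == a) f b (sr x) - f b a)%N by rewrite /rs eqxx.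
  have := IHr (fun c cr => rs_ c (@mem_behead _ (b :: r) c cr)); case: (boolP (P b)) => [/PE e|/(nP b bb)]; last by lia.
  have fa : f b a = 1%N by rewrite e eqxx.
  have s0 : (\sum_(x | tg x == a) f b (sr x) = 0)%N.
    by rewrite big1 // => x _; rewrite e (negPf (forallP sa x)).
  by rewrite s0 fa; lia.
have h0 i : (\sum_(b <- bs) f b i = \sum_(b <- bs') f b i)%N := hs 0%N i.
have h1 k i : (\sum_(b <- bs) vinv (flip_s sr tg a) (flip_t sr tg a) s (rs sr tg a (f b)) k i =
   \sum_(b <- bs') vinv (flip_s sr tg a) (flip_t sr tg a) s (rs sr tg a (f b)) k i)%N := hs k.+1 i.
have sl : {subset bs <= bs ++ bs'} by move=> b h; rewrite mem_cat h.
have sr_ : {subset bs' <= bs ++ bs'} by move=> b h; rewrite mem_cat h orbT.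
have cE : count P bs = count P bs'.
  have c1 := cnt bs sl; have c2 := cnt bs' sr_.
  have hx : (\sum_(b <- bs) \sum_(x | tg x == a) f b (sr x) =
             \sum_(b <- bs') \sum_(x | tg x == a) f b (sr x))%N.
    by rewrite exchange_big [RHS]exchange_big; apply: eq_bigr => x _; exact: h0.
  have hr := h1 0%N a; rewrite h0 hx in c1.
  have hr' : (\sum_(b <- bs) rs sr tg a (f b) a = \sum_(b <- bs') rs sr tg a (f b) a)%N.
    by case: (s) hr.
  by rewrite hr' in c1; lia.
have sub r c : c \in filter (predC P) r -> c \in r /\ ~~ P c by rewrite mem_filter /= => /andP[].
have zE b : b \in bs ++ bs' -> ~~ P b -> zv (rs sr tg a (f b)) = zs sr tg a (zv (f b)).
  by move=> bb nb; rewrite zv_rs // nP.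
have memf c : c \in filter (predC P) bs ++ filter (predC P) bs' -> c \in bs ++ bs' /\ ~~ P c.
  by rewrite !mem_cat !mem_filter -andb_orr => /andP[].
have pn : perm_eq (filter (predC P) bs) (filter (predC P) bs').
  apply: (IH _ _ (fun b => rs sr tg a (f b)) _ _ (pdb_flip a pB) as_).
  - by move=> b /memf[bb nb]; rewrite tq_flip zE // (tq_zs pB); exact: q1.
  - move=> b c /memf[bb nb] /memf[cb nc] e; apply: fi => //.
    have : zv (f b) = zv (f c).
      by apply: (can_inj (zsK pB a)); rewrite -!zE // e.
    by move=> e'; apply/funext => i; have := congr1 (@^~ i) e'; case.
  - by move=> b /memf[bb _] i; exact: kl.
  - move=> k i; rewrite !big_filter.
    have drop r : (\sum_(b <- r | ~~ P b) vinv (flip_s sr tg a) (flip_t sr tg a) s (rs sr tg a (f b)) k i =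
        \sum_(b <- r) vinv (flip_s sr tg a) (flip_t sr tg a) s (rs sr tg a (f b)) k i)%N.
      rewrite [RHS](bigID P) /= [X in _ = (X + _)%N]big1 ?add0n // => b /PE ->.
      by rewrite rs_simple // vinv0.
    by rewrite !drop.
have pk : perm_eq (filter P bs) (filter P bs').
  have eqPP b c : b \in bs ++ bs' -> c \in bs ++ bs' -> P b -> P c -> b = c.
    by move=> bb cb /PE eb /PE ec; apply: fi; rewrite // eb ec.
  have cst r : {subset r <= bs ++ bs'} -> forall c, c \in bs ++ bs' -> P c ->
      filter P r = nseq (count P r) c.
    move=> rs_ c cb Pc; rewrite -size_filter; apply/all_pred1P/allP => b.
    rewrite mem_filter => /andP[Pb br]; by rewrite /= (eqPP _ _ (rs_ _ br) cb Pb Pc).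
  case: (boolP (has P bs)) => [/hasP[c cb Pc]|nh].
    have cc : c \in bs ++ bs' by rewrite mem_cat cb.
    by rewrite (cst bs _ c) // ?(cst bs' _ c) ?cE // => b h; rewrite mem_cat h ?orbT.
  have : count P bs' = 0%N by rewrite -cE; apply/eqP; rewrite -leqn0 leqNgt -has_count.
  move=> c0; have c0' : count P bs = 0%N by rewrite cE.
  by move: c0 c0'; rewrite -!size_filter => /size0nil -> /size0nil ->.
have split r : perm_eq r (filter P r ++ filter (predC P) r).
  by rewrite perm_sym; apply/permPl; exact: perm_filterC.
apply: perm_trans (split bs) _; rewrite perm_sym; apply: perm_trans (split bs') _.
by rewrite perm_sym perm_cat.
Qed.

(** * Reflections of flags *)

Section Chains.
Variables (I E : finType) (sr tg : E -> I).
Implicit Types (d v : I -> nat) (D : seq (I -> nat)).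

Fixpoint ach (F : fieldType) (V : vectType F) (A : E -> 'End(V)) D
    (sp : {ffun I -> {vspace V}}) : Prop :=
  if D is d :: D' then exists U : {ffun I -> {vspace V}},
    [/\ fle U sp, stable sr tg A U, forall i, \dim (U i) = d i & ach A D' U]
  else True.

Fixpoint cnt (F : finFieldType) (V : vectType F) (A : E -> 'End(V)) D
    (sp : {ffun I -> {vspace V}}) : nat :=
  if D is d :: D' then
    \sum_(U : {ffun I -> {vspace V}} | [&& fle U sp, stable sr tg A U & [forall i, \dim (U i) == d i]])
      cnt A D' U
  else 1.

Variable a : I.

(* [D] lists the dimension vectors of the members of a flag; at the sink [a] the
   reflected members receive the least dimension compatible with inclusion. *)
Fixpoint Dref D : seq (I -> nat) :=
  if D is d :: D' then
    (fun i => if i == a then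
       maxn (\sum_(x | tg x == a) d (sr x) - d a) (head (fun=> 0%N) (Dref D') a)
     else d i) :: Dref D'
  else [::].

Fixpoint dec n D : bool := if D is d :: D' then (d a <= n)%N && dec (d a) D' else true.

Lemma dec_Dref D : dec (head (fun=> 0%N) (Dref D) a) (Dref D).
Proof.
elim: D => //= d D IH; rewrite leqnn /= eqxx; case: (Dref D) IH => //= d' D' /andP[_ h].
by rewrite leq_maxr.
Qed.

End Chains.

Section ChainReflection.
Variables (I E : finType) (sr tg : E -> I) (a : I) (F : fieldType) (V : vectType F).
Variables (A : E -> 'End(V)).
Local Notation V' := {ffun option E -> V}.
Local Notation sr' := (flip_s sr tg a).
Local Notation tg' := (flip_t sr tg a).
Local Notation rf := (refl sr tg a A).
Hypothesis sa : sink sr a.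
Implicit Types (D : seq (I -> nat)).

Lemma refl_off (U W : {ffun I -> {vspace V}}) : (forall i, i != a -> (U i <= W i)%VS) ->
  (rf U a <= rf W a)%VS.
Proof.
move=> UW; apply/subvP => v va; apply: refl_intro; last exact: refl_ker va.
have pv := refl_psp va; have /mem_psp h := pv.
apply: psp_intro => [|x tx|x /negPf nt].
- by have := h None; rewrite /= eqxx memv0 => /eqP.
- by apply: (subvP (UW _ (sr_neq sa x))); exact: mem_psp_some pv tx.
- by have := h (Some x); rewrite /= nt andbF memv0 => /eqP.
Qed.

Lemma low_refl (sp : {ffun I -> {vspace V}}) (U' : {ffun I -> {vspace V'}}) :
  fle U' (rf sp) -> stable sr' tg' (reflA tg a A) U' ->
  fle U' (rf (low sr tg a A U')).
Proof.
move=> U'sp sU'; apply/fleP => i v vi; have [ia|ia] := eqVneq i a; last first.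
  have [u _ vE] := refl_outP ia (fleP _ _ U'sp _ _ vi).
  by rewrite vE refl_in // (mem_low _ ia U'sp) -vE.
subst i; apply: refl_intro; first exact: psp_low U'sp sU' vi.
exact: refl_ker (fleP _ _ U'sp _ _ vi).
Qed.

Lemma dim_low (sp : {ffun I -> {vspace V}}) (U' : {ffun I -> {vspace V'}}) i :
  i != a -> fle U' (rf sp) -> \dim (low sr tg a A U' i) = \dim (U' i).
Proof.
move=> ia U'sp; rewrite ffunE (negPf ia); apply: limg_dim_eq; apply/eqP; rewrite -subv0.
apply/subvP => v; rewrite memv_cap memv_ker memv0 => /andP[vi].
by rewrite (refl_out ia (fleP _ _ U'sp _ _ vi)) cmp_inj => /eqP ->; rewrite lf0.
Qed.

(** In the reflected orientation [a] is a source, so a member can be shrunk at [a] without losing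
    stability. It is shrunk to the least dimension that still leaves room for the next member. *)
Lemma ach_refl D (sp : {ffun I -> {vspace V}}) : stable sr tg A sp -> ach sr tg A D sp ->
  dec a (\dim (sp a)) D /\ ach sr' tg' (reflA tg a A) (Dref sr tg a D) (rf sp).
Proof.
elim: D sp => //= d D IH sp ssp [U [Usp sU dU /(IH _ sU)[decD aD]]].
rewrite -(dU a) dimvS ?(forallP Usp) //=; split=> //.
have dref := dim_refl sr tg a A U.
have dsum : (\sum_(x | tg x == a) \dim (U (sr x)) = \sum_(x | tg x == a) d (sr x))%N.
  by apply: eq_bigr => x _; rewrite dU.
have dimg := dimvS (img_stable a sU); rewrite dU in dimg.
pose N := maxn (\sum_(x | tg x == a) d (sr x) - d a) (head (fun=> 0%N) (Dref sr tg a D) a).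
have [T TU] : exists T : {vspace V'},
       ((T <= rf U a)%VS /\ (if Dref sr tg a D is d2 :: D2 then exists U2 : {ffun I -> {vspace V'}},
       [/\ fle U2 (rf U), stable sr' tg' (reflA tg a A) U2, forall i, \dim (U2 i) = d2 i,
         ach sr' tg' (reflA tg a A) D2 U2 & (U2 a <= T)%VS] else True)) /\ \dim T = N.
  have drefN : (\sum_(x | tg x == a) d (sr x) - d a <= \dim (rf U a))%N by lia.
  rewrite /N; case: (Dref sr tg a D) aD => [_|d2 D2 [U2 [U2U sU2 dU2 aU2]]] /=.
    have [||||||T [_ TU dT _]] := @adapted_subspace F _ 0%VS (rf U a)
        (\sum_(x | tg x == a) d (sr x) - d a) [::]; rewrite ?sub0v ?dimv0 //.
    by exists T; rewrite maxn0.
  have le2 := dimvS (forallP U2U a); rewrite dU2 in le2.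
  have [||||||T [UT TU dT _]] := @adapted_subspace F _ (U2 a) (rf U a)
      (maxn (\sum_(x | tg x == a) d (sr x) - d a) (d2 a)) [::] => //.
  - exact: (forallP U2U).
  - by rewrite dU2 leq_maxr.
  - by rewrite geq_max le2 andbT; exact: drefN.
  by exists T; split=> //; split=> //; exists U2.
have TU' := TU.1.1.
pose S : {ffun I -> {vspace V'}} := [ffun i => if i == a then T else rf U i].
have SE i : S i = if i == a then T else rf U i by rewrite ffunE.
exists S; split=> [||i|].
- apply/fleP => i v; rewrite SE; case: (eqVneq i a) => [->|_] vi.
    by apply: (fleP _ _ (refl_mono sr tg a A Usp)); exact: (subvP TU').
  exact: (fleP _ _ (refl_mono sr tg a A Usp)).
- have /stableP sr_ := refl_stable sa sU; apply/stableP => x v; rewrite !SE.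
  have := sr_ x v; rewrite /flip_s /flip_t; case: (eqVneq (tg x) a) => [_|/negPf nt] h.
    by rewrite eqxx (negPf (sr_neq sa x)) => vT; apply: h; exact: (subvP TU').
  by rewrite nt (negPf (sr_neq sa x)).
- rewrite SE /=; case: (eqVneq i a) => [_|ia]; last by rewrite dim_refl_out // dU.
  by rewrite dU; exact: TU.2.
case: (Dref sr tg a D) TU.1.2 => //= d2 D2 [U2 [U2U sU2 dU2 aU2 U2T]]; exists U2; split=> //.
by apply/fleP => i v vi; rewrite SE; case: (eqVneq i a) vi => [->|_]; [exact: (subvP U2T)|exact: (fleP _ _ U2U)].
Qed.

(** At the sink a member may be enlarged inside [sp a]; rank-nullity shows that the image in [low]
    fits into the prescribed dimension. *)
Lemma ach_unrefl D (sp : {ffun I -> {vspace V}}) (S' : {ffun I -> {vspace V'}}) :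
  stable sr tg A sp -> fle S' (rf sp) -> dec a (\dim (sp a)) D ->
  ach sr' tg' (reflA tg a A) (Dref sr tg a D) S' -> ach sr tg A D sp.
Proof.
elim: D sp S' => //= d D IH sp S' ssp S'sp /andP[da decD] [U' [U'S sU' dU' aU']].
have U'sp := fle_trans U'S S'sp.
pose L := low sr tg a A U'.
have Ldim i : i != a -> \dim (L i) = d i.
  by move=> ia; rewrite (dim_low ia U'sp) dU' (negPf ia).
have Lsp : fle L sp.
  apply/fleP => i u ui; have [ia|ia] := eqVneq i a; last first.
    by rewrite -(refl_in sr tg A _ _ ia) (fleP _ _ U'sp) // -(mem_low _ ia U'sp).
  move: ui; rewrite ia /L low_img //; apply: (subvP (subv_trans _ (img_stable a ssp))).
  apply/subv_sumP => x tx; apply: (subv_trans _ (sumv_sup x tx (subvv _))); apply: limgS.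
  apply/subvP => w; rewrite (mem_low _ (sr_neq sa x) U'sp) => wi.
  by rewrite -(refl_in sr tg A _ _ (sr_neq sa x)) (fleP _ _ U'sp).
have dimg : (\dim (img sr tg a A L) <= d a)%N.
  have dref := dim_refl sr tg a A L.
  have := dimvS (forallP (low_refl U'sp sU') a); rewrite dU' eqxx -/L.
  have : (\sum_(x | tg x == a) \dim (L (sr x)) = \sum_(x | tg x == a) d (sr x))%N.
    by apply: eq_bigr => x _; rewrite Ldim ?sr_neq.
  by lia.
have [||||||W [LW Wsp dW _]] := @adapted_subspace F _ (img sr tg a A L) (sp a) (d a) [::] => //.
  exact: subv_trans (img_mono _ _ _ _ Lsp) (img_stable a ssp).
pose U : {ffun I -> {vspace V}} := [ffun i => if i == a then W else L i].
have sU : stable sr tg A U.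
  have /stableP sL := low_stable sa U'sp sU'.
  apply/stableP => x v; rewrite [U (sr x)]ffunE [U (tg x)]ffunE (negPf (sr_neq sa x)) => vx.
  case: eqP => [tx|_]; last exact: sL.
  by apply: (subvP LW); rewrite memvE (sumv_sup x) ?tx // -memvE memv_img.
exists U; split=> // [|i|].
- apply/fleP => i v; rewrite ffunE; case: eqP => [->|_]; first exact: (subvP Wsp).
  exact: (fleP _ _ Lsp).
- by rewrite ffunE; case: eqP => [->|/eqP ia]; rewrite ?Ldim.
apply: (IH U U') => //; last by rewrite ffunE eqxx dW.
apply/fleP => i v vi; have [ia|ia] := eqVneq i a; last first.
  have vr := fleP _ _ (low_refl U'sp sU') _ _ vi.
  have [u ui ->] := refl_outP ia vr; rewrite refl_in // ffunE (negPf ia); exact: ui.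
subst i; apply: (subvP (refl_off (U := L) _)) => [j ja|].
  by rewrite [U j]ffunE (negPf ja).
exact: (fleP _ _ (low_refl U'sp sU')).
Qed.

Lemma ach_reflP D (sp : {ffun I -> {vspace V}}) : stable sr tg A sp ->
  ach sr tg A D sp <->
  dec a (\dim (sp a)) D /\ ach sr' tg' (reflA tg a A) (Dref sr tg a D) (rf sp).
Proof.
move=> ssp; split=> [|[dD]]; first exact: ach_refl.
exact: ach_unrefl ssp (fle_refl _) dD.
Qed.

End ChainReflection.

Lemma eq_sum_mod q (T : finType) (P : pred T) (f g : T -> nat) :
  (forall i, P i -> f i = g i %[mod q]) ->
  \sum_(i | P i) f i = \sum_(i | P i) g i %[mod q].
Proof.
move=> fg; rewrite -modn_summ -[RHS]modn_summ; congr (_ %% q)%N.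
by apply: eq_bigr => i /fg.
Qed.

Lemma eq_sum_mod_seq q (T : eqType) (r : seq T) (f g : T -> nat) :
  {in r, forall i, f i = g i %[mod q]} ->
  \sum_(i <- r) f i = \sum_(i <- r) g i %[mod q].
Proof.
move=> fg; rewrite -modn_summ -[RHS]modn_summ; congr (_ %% q)%N.
by apply: eq_big_seq => i /fg.
Qed.

(** * Counting chains modulo q under a reflection *)

Section ChainCount.
Variables (I E : finType) (sr tg : E -> I) (a : I) (F : finFieldType) (V : vectType F).
Variables (A : E -> 'End(V)).
Local Notation V' := {ffun option E -> V}.
Local Notation sr' := (flip_s sr tg a).
Local Notation tg' := (flip_t sr tg a).
Local Notation rf := (refl sr tg a A).
Local Notation q := #|F|.
Hypothesis sa : sink sr a.
Implicit Types (D : seq (I -> nat)) (O U sp : {ffun I -> {vspace V}}).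

Definition offst O := [forall x, (tg x != a) ==> (A x @: O (sr x) <= O (tg x))%VS].

Definition pO (d : I -> nat) O U := [&& fle U O, U a == 0%VS, offst U
  & [forall i, (i != a) ==> (\dim (U i) == d i)]].

(** Away from [a] a reflection changes nothing, so both counts are fibred over the chains of parts
    away from [a]. [condA] and [condB] record the fibres modulo q on the two sides. *)
Fixpoint ochains D O : seq (seq {ffun I -> {vspace V}}) :=
  if D is d :: D' then
    flatten [seq [seq U :: c | c <- ochains D' U] | U <- enum (pO d O)]
  else [:: [::]].

Lemma sum_ochains d D O (G : seq {ffun I -> {vspace V}} -> nat) :
  (\sum_(c <- ochains (d :: D) O) G c =
   \sum_(U | pO d O U) \sum_(c <- ochains D U) G (U :: c))%N.
Proof.
rewrite /= big_flatten big_map big_enum /=.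
by apply: eq_bigr => U _; rewrite big_map.
Qed.

Lemma mem_ochains d D O c : c \in ochains (d :: D) O ->
  exists U c', [/\ c = U :: c', pO d O U & c' \in ochains D U].
Proof.
move=> /flattenP[s /mapP[U]]; rewrite mem_enum => UO -> /mapP[c' c'U ->].
by exists U, c'.
Qed.

Lemma ochains_Dref D O : ochains (Dref sr tg a D) O = ochains D O.
Proof.
elim: D O => //= d D IH O; congr flatten.
have -> : enum (pO (fun i => if i == a then maxn (\sum_(x | tg x == a) d (sr x) - d a)
    (head (fun=> 0%N) (Dref sr tg a D) a) else d i) O) = enum (pO d O).
  apply: eq_enum => U; rewrite !unfold_in /pO; do 3!congr (_ && _).
  by apply: eq_forallb => i; case: eqP.
by apply: eq_map => U; rewrite IH.
Qed.

Fixpoint condA D (c : seq {ffun I -> {vspace V}}) : bool :=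
  match D, c with
  | d :: D', U :: c' => (\dim (img sr tg a A U) <= d a)%N && condA D' c'
  | _, _ => true
  end.

Fixpoint condB D (c : seq {ffun I -> {vspace V}}) (T : {vspace V'}) : bool :=
  match D, c with
  | d :: D', U :: c' => (d a <= \dim (T :&: rf U a))%N && condB D' c' T
  | _, _ => true
  end.

Definition off sp : {ffun I -> {vspace V}} := [ffun i => if i == a then 0%VS else sp i].
Definition ins O (T : {vspace V}) : {ffun I -> {vspace V}} := [ffun i => if i == a then T else O i].

Lemma grass_count (W : vectType F) (S X : {vspace W}) n : (S <= X)%VS ->
  \sum_(T : {vspace W} | [&& (S <= T)%VS, (T <= X)%VS & \dim T == n]) 1 =
  ((\dim S <= n) && (n <= \dim X))%N %[mod q].
Proof.
move=> SX; case: (boolP ((\dim S <= n) && (n <= \dim X))%N) => [/andP[h1 h2]|h].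
  by have [|||||||U [_ _ _ _ ->]] := @grass_adapted F W S X n [::] (fun=> 1%N).
rewrite big1 // => T /and3P[ST TX /eqP dT]; case/negP: h.
by rewrite -dT !dimvS.
Qed.

Lemma img_off sp : img sr tg a A (off sp) = img sr tg a A sp.
Proof. by apply: eq_bigr => x _; rewrite ffunE (negPf (sr_neq sa x)). Qed.

(** Given the part away from [a], the space at [a] is any subspace of the right dimension between
    the image of the incoming arrows and [sp a]. Modulo q there is one such subspace, or none. *)
Lemma cnt_offchains D sp : stable sr tg A sp ->
  cnt sr tg A D sp = dec a (\dim (sp a)) D * \sum_(c <- ochains D (off sp)) condA D c %[mod q].
Proof.
elim: D sp => [|d D IH] sp ssp; first by rewrite /= big_seq1.
rewrite sum_ochains /=.
transitivity ((\sum_(U | [&& fle U sp, stable sr tg A U & [forall i, \dim (U i) == d i]])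
   dec a (d a) D * \sum_(c <- ochains D (off U)) condA D c) %% q)%N.
  by apply: eq_sum_mod => U /and3P[_ sU /forallP dU]; rewrite IH // (eqP (dU a)).
rewrite (partition_big off (pO d (off sp))) /=; last first.
  move=> U /and3P[/fleP Usp /stableP sU /forallP dU]; apply/and4P; split.
  - by apply/fleP => i v; rewrite !ffunE; case: eqP => // _; exact: Usp.
  - by rewrite ffunE eqxx.
  - apply/forallP => x; apply/implyP => nt; apply/subvP => w /memv_imgP[v + ->].
    by rewrite !ffunE (negPf (sr_neq sa x)) (negPf nt); exact: sU.
  - by apply/forallP => i; apply/implyP => /negPf ia; rewrite ffunE ia.
rewrite big_distrr /=; apply: eq_sum_mod => O /and4P[OW /eqP Oa /forallP sO /forallP dO].
rewrite (eq_bigr (fun=> dec a (d a) D * (\sum_(c <- ochains D O) condA D c) * 1)%N); last first.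
  by move=> U /andP[_ /eqP ->]; rewrite muln1.
rewrite -big_distrr /=.
have imO : (img sr tg a A O <= sp a)%VS.
  rewrite (subv_trans _ (img_stable a ssp)) // -[X in (_ <= X)%VS]img_off; exact: img_mono.
have -> : (\sum_(U | [&& fle U sp, stable sr tg A U & [forall i, \dim (U i) == d i]]
     && (off U == O)) 1 = \sum_(T : {vspace V} | [&& (img sr tg a A O <= T)%VS, (T <= sp a)%VS & \dim T == d a]) 1)%N.
  rewrite (reindex_onto (ins O) (fun U => U a)) /=; last first.
    by move=> U /andP[_ /eqP <-]; apply/ffunP => i; rewrite !ffunE; case: eqP => [->|].
  apply: eq_bigl => T.
  have -> : ins O T a = T by rewrite ffunE eqxx.
  have -> : off (ins O T) = O.
    by apply/ffunP => i; rewrite !ffunE; case: eqP => [->|].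
  rewrite !eqxx !andbT; apply/and3P/and3P => -[h1 h2 h3]; split.
  - apply/subv_sumP => x /eqP tx; apply/subvP => w /memv_imgP[v vx ->].
    have /stableP/(_ x v) := h2; rewrite !ffunE (negPf (sr_neq sa x)) tx eqxx; exact.
  - by have := forallP h1 a; rewrite ffunE eqxx.
  - by have := forallP h3 a; rewrite ffunE eqxx.
  - apply/fleP => i v; rewrite ffunE; case: eqP => [->|/eqP ia]; first exact: (subvP h2).
    by move=> /(fleP _ _ OW); rewrite ffunE (negPf ia).
  - apply/stableP => x v; rewrite !ffunE (negPf (sr_neq sa x)); case: eqP => [tx|/eqP nt] vx.
      by apply: (subvP h1); rewrite memvE (sumv_sup x) ?tx // -memvE memv_img.
    by have /implyP/(_ nt)/subvP := sO x; apply; exact: memv_img.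
  - apply/forallP => i; rewrite ffunE; case: (eqVneq i a) => [->//|ia].
    by have /implyP/(_ ia) := dO i.
rewrite -modnMmr grass_count // modnMmr; congr (_ %% q)%N.
have -> : (\sum_(c <- ochains D O) condA (d :: D) (O :: c) =
   (\dim (img sr tg a A O) <= d a) * \sum_(c <- ochains D O) condA D c)%N.
  by rewrite big_distrr; apply: eq_bigr => c _; rewrite /= mulnb.
by case: (_ <= d a)%N; case: (d a <= _)%N; case: (dec _ _ _); rewrite /= ?mul0n ?mul1n ?muln0 ?muln1.
Qed.

Lemma fle_psp O sp : fle O (off sp) -> (rf O a <= rf sp a)%VS.
Proof.
move=> /forallP h; apply: refl_off => // i ia.
by have := h i; rewrite ffunE (negPf ia).
Qed.

Lemma ochains_below D O c : c \in ochains D O -> {in c, forall U, fle U O}.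
Proof.
elim: D O c => [|d D IH] O c; first by rewrite inE => /eqP ->.
move=> /mem_ochains[U [c' [-> /and4P[UO _ _ _] /IH h]]] W; rewrite inE => /predU1P[->//|/h].
by move/fle_trans; apply.
Qed.

Lemma ochains_comp D O c : c \in ochains D O -> {in c &, forall U W, fle U W || fle W U}.
Proof.
elim: D O c => [|d D IH] O c; first by rewrite inE => /eqP ->.
move=> /mem_ochains[U [c' [-> _ cU]]] X Y; rewrite !inE.
have hb := ochains_below cU.
move=> /predU1P[->|Xc] /predU1P[->|Yc]; rewrite ?fle_refl ?(hb _ Xc) ?(hb _ Yc) ?orbT //.
exact: IH cU _ _ Xc Yc.
Qed.

Lemma condB_cap D c (T : {vspace V'}) X : {in c, forall U, (rf U a <= X)%VS} ->
  condB D c (T :&: X) = condB D c T.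
Proof.
elim: D c => [|d D IH] [|U c] //= h; rewrite IH => [|W Wc]; last by rewrite h // inE Wc orbT.
by rewrite -capvA (capv_idPr (h U (mem_head _ _))).
Qed.

(** Modulo q only an adapted [T] remains. It meets each space of the chain in the largest dimension
    allowed by [n], and [n] bounds all required dimensions, so its condition is the condition for
    [X]. *)
Lemma grass_condB D n c (X : {vspace V'}) : dec a n D -> {in c &, forall U W, fle U W || fle W U} ->
  \sum_(T : {vspace V'} | [&& (0 <= T)%VS, (T <= X)%VS & \dim T == n]) condB D c T =
  (n <= \dim X)%N && condB D c X %[mod q].
Proof.
move=> dD cc; case: (boolP (n <= \dim X)%N) => [le|]; last first.
  move=> gt; rewrite big1 // => T /and3P[_ TX /eqP dT]; case/negP: gt.
  by rewrite -dT dimvS.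
pose Cs := [seq (X :&: rf U a)%VS | U <- c].

have [||||||T0 T0' _ T0X _ T0X' dT0 dT0' eqd|U [_ UX dU cU ->]] :=
   @grass_adapted F _ 0%VS X n Cs (fun T => condB D c T); rewrite ?sub0v ?dimv0 //.
- by move=> C _; rewrite sub0v.
- move=> C C' /mapP[U Uc ->] /mapP[W Wc ->]; rewrite /compv.
  case/orP: (cc _ _ Uc Wc) => h; apply/orP; [left|right];
    exact: capvS (subvv _) (forallP (refl_mono sr tg a A h) a).
- by move=> C /mapP[U _ ->]; rewrite /compv capvSl orbT.
- congr nat_of_bool.
  have e W : W \in c -> \dim (T0 :&: rf W a) = \dim (T0' :&: rf W a).
    move=> Wc; have := eqd _ (map_f _ Wc).
    by rewrite !capvA (capv_idPl T0X) (capv_idPl T0X').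
  clear -e; elim: D c e => [|d' D IH] [|W c] //= e; rewrite e ?mem_head // (IH c) // => Y Yc.
  by apply: e; rewrite inE Yc orbT.
congr (_ %% q)%N; congr nat_of_bool.
have step W : W \in c -> forall m, (m <= n)%N ->
    (m <= \dim (U :&: rf W a))%N = (m <= \dim (X :&: rf W a))%N.
  move=> Wc m mn; have /orP[h|h] := cU _ (map_f _ Wc).
    have -> : (U :&: rf W a = U)%VS by apply/capv_idPl; exact: subv_trans h (capvSr _ _).
    by rewrite dU mn (leq_trans mn) // -dU dimvS.
  have -> // : (U :&: rf W a = X :&: rf W a)%VS.
  apply/eqP; rewrite eqEsubv capvS //= subv_cap h; exact: capvSr.
elim: D dD c step {cU cc Cs} => [|d D IH] //= /andP[dn dD] [|W c] //= step.
rewrite step ?mem_head // IH // => [|Y Yc m mn]; last by apply: step; rewrite // inE Yc orbT.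
by case: D dD {IH} => //= d2 D2 /andP[h ->]; rewrite (leq_trans h dn).
Qed.

Definition lowo (S' : {ffun I -> {vspace V'}}) : {ffun I -> {vspace V}} :=
  [ffun i => if i == a then 0%VS else (cmp V None @: S' i)%VS].

Definition ins' O (T : {vspace V'}) : {ffun I -> {vspace V'}} :=
  [ffun i => if i == a then T else (inj V None @: O i)%VS].

Lemma mem_lowo sp (S' : {ffun I -> {vspace V'}}) i u : i != a -> fle S' (rf sp) ->
  (u \in lowo S' i) = (inj V None u \in S' i).
Proof.
move=> ia S'sp; rewrite -(mem_low _ ia S'sp) /low /lowo !ffunE (negPf ia) //.
Qed.

Lemma mem_inj o (X : {vspace V}) u : (inj V (o : option E) u \in (inj V o @: X)%VS) = (u \in X).
Proof.
apply/memv_imgP/idP => [[w wX /(congr1 (cmp V o))]|uX]; first by rewrite !cmp_inj => ->.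
by exists u.
Qed.

Lemma dim_inj (X : {vspace V}) (o : option E) : \dim (inj V o @: X) = \dim X.
Proof.
apply: limg_dim_eq; apply/eqP; rewrite -subv0; apply/subvP => u.
by rewrite memv_cap memv_ker memv0 => /andP[_ /eqP/(congr1 (cmp V o))]; rewrite cmp_inj lf0 => ->.
Qed.

(** On the reflected side the space at [a] bounds the later members from above, so the sum over a
    fibre carries the weight [condB] and is not a plain count of subspaces. *)
Lemma cnt_refl_offchains D sp (S' : {ffun I -> {vspace V'}}) n : fle S' (rf sp) ->
  stable sr' tg' (reflA tg a A) S' -> dec a n D ->
  cnt sr' tg' (reflA tg a A) D S' = \sum_(c <- ochains D (lowo S')) condB D c (S' a) %[mod q].
Proof.
elim: D n S' => [|d D IH] n S' S'sp sS'; first by rewrite /= big_seq1.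
move=> /= /andP[_ dD]; rewrite sum_ochains.
pose P' (U' : {ffun I -> {vspace V'}}) :=
  [&& fle U' S', stable sr' tg' (reflA tg a A) U' & [forall i, \dim (U' i) == d i]].
transitivity ((\sum_(U' | P' U') \sum_(c <- ochains D (lowo U')) condB D c (U' a)) %% q)%N.
  apply: eq_sum_mod => U' /and3P[U'S sU' _]; apply: IH dD => //; exact: fle_trans S'sp.
have inS' i (v : V') : i != a -> v \in S' i -> v = inj V None (v None).
  by move=> ia vi; exact: refl_out ia (fleP _ _ S'sp _ _ vi).
rewrite (partition_big lowo (pO d (lowo S'))) /=; last first.
  move=> U' /and3P[U'S sU' /forallP dU']; have U'sp := fle_trans U'S S'sp; apply/and4P; split.
  - apply/fleP => i v; have [->|ia] := eqVneq i a; first by rewrite !ffunE eqxx.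
    by rewrite (mem_lowo _ ia U'sp) (mem_lowo _ ia S'sp); exact: (fleP _ _ U'S).
  - by rewrite ffunE eqxx.
  - apply/forallP => x; apply/implyP => nt; apply/subvP => w /memv_imgP[v + ->].
    rewrite (mem_lowo _ (sr_neq sa x) U'sp) (mem_lowo _ nt U'sp) => vx.
    have /stableP/(_ x (inj V None v)) := sU'.
    by rewrite /flip_s /flip_t /reflA (negPf nt) !comp_lfunE cmp_inj; exact.
  - apply/forallP => i; apply/implyP => ia; rewrite -(eqP (dU' i)) -(dim_low ia U'sp).
    by rewrite /lowo /low !ffunE (negPf ia).
apply: eq_sum_mod => O /and4P[OS /eqP Oa /forallP sO /forallP dO].
rewrite (eq_bigr (fun U' : {ffun I -> {vspace V'}} => \sum_(c <- ochains D O) condB D c (U' a))%N);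
  last by move=> U' /andP[_ /eqP ->].
rewrite exchange_big /=; apply: eq_sum_mod_seq => c cO.
have cb := ochains_below cO; have cc := ochains_comp cO.
have sub U : U \in c -> (rf U a <= rf O a)%VS by move/cb => h; exact: (forallP (refl_mono sr tg a A h)).
have -> : (\sum_(U' : {ffun I -> {vspace V'}} | P' U' && (lowo U' == O)) condB D c (U' a) =
   \sum_(T : {vspace V'} | [&& (0 <= T)%VS, (T <= S' a :&: rf O a)%VS & \dim T == d a]) condB D c T)%N.
  rewrite (reindex_onto (ins' O) (fun U' : {ffun I -> {vspace V'}} => U' a)) /=; last first.
    move=> U' /andP[/and3P[U'S _ _] /eqP <-]; apply/ffunP => i; rewrite !ffunE.
    case: eqP => [->//|/eqP ia]; apply/vspaceP => v; apply/memv_imgP/idP => [[u]|vi].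
      move=> /memv_imgP[w wi ->] ->.
      by rewrite cmpE -(inS' i) // (fleP _ _ U'S).
    have e := inS' i v ia (fleP _ _ U'S _ _ vi).
    by exists (v None); rewrite // -(cmpE None v) memv_img.
  apply: eq_big => T; last by move=> _; rewrite ffunE eqxx.
  have -> : ins' O T a = T by rewrite ffunE eqxx.
  have -> : lowo (ins' O T) = O.
    apply/ffunP => i; rewrite !ffunE; case: eqP => [->//|_]; apply/vspaceP => u.
    apply/memv_imgP/idP => [[w /memv_imgP[z zi ->] ->]|ui]; first by rewrite cmp_inj.
    by exists (inj V None u); rewrite ?cmp_inj // memv_img.
  rewrite !eqxx !andbT sub0v /= subv_cap; apply/and3P/andP => [[h1 h2 h3]|[/andP[h1 h2] h3]].
    split; last by have := forallP h3 a; rewrite ffunE eqxx.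
    apply/andP; split; first by have := forallP h1 a; rewrite ffunE eqxx.
    apply/subvP => v vT; have vS : v \in S' a by have := fleP _ _ h1 a v; rewrite ffunE eqxx; apply.
    have vr := fleP _ _ S'sp _ _ vS; apply: refl_intro; last exact: refl_ker vr.
    have /mem_psp hp := refl_psp vr; apply: psp_intro => [|x tx|x /negPf nt].
    - by have := hp None; rewrite /= eqxx memv0 => /eqP.
    - have /stableP/(_ x v) := h2; rewrite /flip_s /flip_t tx eqxx !ffunE eqxx => /(_ vT).
      by rewrite (negPf (sr_neq sa x)) /reflA tx eqxx comp_lfunE cmpE mem_inj.
    - by have := hp (Some x); rewrite /= nt andbF memv0 => /eqP.
  split.
  - apply/fleP => i v; rewrite ffunE; case: eqP => [->|/eqP ia]; first exact: (subvP h1).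
    by move=> /memv_imgP[u ui ->]; rewrite -(mem_lowo _ ia S'sp); exact: (fleP _ _ OS).
  - apply/stableP => x v; rewrite /flip_s /flip_t !ffunE; case: (eqVneq (tg x) a) => [tx|nt].
      rewrite eqxx (negPf (sr_neq sa x)) => vT; rewrite /reflA tx eqxx comp_lfunE cmpE mem_inj.
      by apply: mem_psp_some (refl_psp (subvP h2 _ vT)) tx.
    rewrite (negPf (sr_neq sa x)) (negPf nt) => /memv_imgP[u ui ->].
    rewrite /reflA (negPf nt) !comp_lfunE cmp_inj mem_inj.
    by have /implyP/(_ nt)/subvP := sO x; apply; exact: memv_img.
  - apply/forallP => i; rewrite ffunE; case: (eqVneq i a) => [->//|ia]; rewrite dim_inj.
    by have /implyP/(_ ia) := dO i.
rewrite grass_condB //; congr (_ %% q)%N; congr nat_of_bool => /=.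
by rewrite -[in RHS](condB_cap D (S' a) sub).
Qed.

(** Rank-nullity converts an upper bound for the image at the sink into a lower bound for the
    kernel. The maximum in [Dref] asks only for what the inclusion of the next member already
    forces. *)
Lemma condAB D O c : c \in ochains D O ->
  condA D c = condB (Dref sr tg a D) c (rf O a).
Proof.
move=> cO.
have h D' O' c' : c' \in ochains D' O' -> (rf O' a <= rf O a)%VS ->
  [/\ condA D' c' = condB (Dref sr tg a D') c' (rf O a) &
      condA D' c' -> (head (fun=> 0%N) (Dref sr tg a D') a <= \dim (rf O' a))%N].
  elim: D' O' c' => [|d D' IH] O' c'; first by rewrite inE => /eqP ->.
  move=> /mem_ochains[U [c2 [-> /and4P[UO' _ _ /forallP dU] c2U]]] le /=.
  have leU : (rf U a <= rf O' a)%VS := forallP (refl_mono sr tg a A UO') a.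
  have [e1 e2] := IH U c2 c2U (subv_trans leU le).
  have dref := dim_refl sr tg a A U.
  have dsum : (\sum_(x | tg x == a) \dim (U (sr x)) = \sum_(x | tg x == a) d (sr x))%N.
    by apply: eq_bigr => x _; have /implyP/(_ (sr_neq sa x))/eqP := dU (sr x).
  have dk := dimvS leU; rewrite dsum in dref.
  have k1 : (\dim (img sr tg a A U) <= d a)%N =
      (\sum_(x | tg x == a) d (sr x) - d a <= \dim (rf U a))%N.
    by apply/idP/idP; lia.
  rewrite eqxx (capv_idPr (subv_trans leU le)) -e1; split.
    case: (boolP (condA D' c2)) => [/e2 h2|_]; last by rewrite !andbF.
    by rewrite !andbT geq_max h2 andbT; exact: k1.
  case/andP=> h1 /e2 h2; rewrite geq_max; apply/andP; split; last exact: leq_trans h2 dk.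
  by apply: leq_trans dk; rewrite -k1.
by have [] := h D O c cO (subvv _).
Qed.

Theorem cnt_refl D sp : stable sr tg A sp ->
  cnt sr tg A D sp = dec a (\dim (sp a)) D *
    cnt sr' tg' (reflA tg a A) (Dref sr tg a D) (rf sp) %[mod q].
Proof.
move=> ssp; rewrite cnt_offchains // -[in RHS]modnMmr.
rewrite (cnt_refl_offchains (fle_refl _) (refl_stable sa ssp) (dec_Dref sr tg a D)) modnMmr.
have -> : lowo (rf sp) = off sp.
  apply/ffunP => i; rewrite [lowo _ i]ffunE [off _ i]ffunE; case: (eqVneq i a) => // ia.
  apply/vspaceP => u; apply/memv_imgP/idP => [[v vi ->]|ui].
    by rewrite cmpE -(refl_in sr tg A _ _ ia) -(refl_out ia vi).
  by exists (inj V None u); rewrite ?cmp_inj // refl_in.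
rewrite ochains_Dref; congr (_ * _ %% _)%N; apply: eq_big_seq => c cO.
rewrite (condAB cO) -(condB_cap _ (rf sp a) (X := rf (off sp) a)).
  have -> : rf (off sp) a = rf sp a.
    apply/eqP; rewrite eqEsubv fle_psp ?fle_refl //; apply: refl_off => // i ia.
    by rewrite ffunE (negPf ia).
  by rewrite capvv.
by move=> U Uc; exact: (forallP (refl_mono sr tg a A (ochains_below cO Uc))).
Qed.

End ChainCount.

(** * The flag test of a Dynkin quiver *)

Section FiniteClasses.
Variables (Q : quiver) (S : parametrisation Q).
Hypothesis cdim : forall (F : fieldType) d (M : rep F d) (g : S), pclass M g -> d = pdim g.
Hypothesis cex : forall (F : fieldType) (g : S), exists d (M : rep F d), pclass M g.
Hypothesis ciso : forall (F : fieldType) d e (M : rep F d) (N : rep F e) (g g' : S),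
  pclass M g -> pclass N g' -> (iso M N <-> g = g').

(* Over the field with two elements there are only finitely many
   representations of a given dimension vector. *)
Lemma finite_classes d : exists s : seq S, forall g : S, pdim g = d -> g \in s.
Proof.
pose R : finType := {dffun forall a : arrow Q, 'M['F_2]_(d (src a), d (tgt a))}.
pose toR (M : rep 'F_2 d) : R := [ffun a => M a].
have toRK M : (fun a => toR M a) = M by apply: functional_extensionality_dep => a; rewrite ffunE.
pose cl (M : R) : option S :=
  if pselect (exists g : S, pclass (fun a => M a : 'M_(_, _)) g) is left h then Some (projT1 (cid h)) else None.
exists (pmap cl (enum R)) => g gd; rewrite mem_pmap.
have [e [M Mg]] := cex 'F_2 g; have ed := cdim Mg; rewrite gd in ed; subst e.
apply/mapP; exists (toR M); first by rewrite mem_enum.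
rewrite /cl; case: pselect => [h|nh]; last by case: nh; exists g; rewrite toRK.
case: cid => g' /=; rewrite toRK => Mg'; congr Some.
by apply/(ciso Mg Mg'); exact: iso_refl.
Qed.

End FiniteClasses.

Section WordDims.
Variable Q : quiver.

Fixpoint Dl (w : seq (dimvec Q)) : seq (vert Q -> nat) :=
  if w is d :: w' then wdim w' :: Dl w' else [::].

Lemma aflag_ach (F : fieldType) (V : vectType F) (A : arrow Q -> 'End(V)) w sp :
  aflag (@src Q) (@tgt Q) A false w sp fam0 <->
  (forall i, \dim (sp i) = wdim w i) /\ ach (@src Q) (@tgt Q) A (Dl w) sp.
Proof.
elim: w sp => [|d w IH] sp /=.
  split=> [->|[d0 _]]; first by split=> // i; rewrite ffunE dimv0.
  by apply/eqP/fam0_dimP.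
split=> [[U [/and4P[sU Usp /forallP dU _] /IH[dw aU]]]|[dsp [U [Usp sU dU aU]]]].
  split=> [i|]; first by rewrite (eqP (dU i)) dw /dimD addnC.
  by exists U.
exists U; split; last exact/IH.
apply/and4P; split=> //; apply/forallP => i; by rewrite dsp dU /dimD addnC.
Qed.

Lemma nfl_cnt (F : finFieldType) (V : vectType F) (A : arrow Q -> 'End(V)) w sp :
  nfl (@src Q) (@tgt Q) A false w sp =
  ([forall i, \dim (sp i) == wdim w i] * cnt (@src Q) (@tgt Q) A (Dl w) sp)%N.
Proof.
elim: w sp => [|d w IH] sp /=.
  rewrite muln1; congr nat_of_bool; apply/fam0_dimP/forallP => h i; first by rewrite h.
  exact/eqP.
transitivity (\sum_(U | step (@src Q) (@tgt Q) A false d sp U)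
   [forall i, \dim (U i) == wdim w i] * cnt (@src Q) (@tgt Q) A (Dl w) U)%N.
  by apply: eq_bigr => U _; exact: IH.
case: (boolP [forall i, \dim (sp i) == dimD d (wdim w) i]) => [/forallP dsp|nd]; last first.
  rewrite mul0n big1 // => U /and4P[_ _ /forallP dU _].
  case: (boolP [forall i, _]) => [/forallP h|]; last by rewrite mul0n.
  case/negP: nd; apply/forallP => i; by rewrite (eqP (dU i)) (eqP (h i)) /dimD addnC.
rewrite mul1n big_mkcond [RHS]big_mkcond; apply: eq_bigr => U _.
rewrite /step /= andbT.
case: (boolP [forall i, \dim (U i) == wdim w i]) => [/forallP h|]; last first.
  by rewrite mul0n !andbF if_same.
have -> : [forall i, \dim (sp i) == (\dim (U i) + d i)%N].
  by apply/forallP => i; rewrite (eqP (dsp i)) (eqP (h i)) /dimD addnC.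
by rewrite mul1n !andbT andbC.
Qed.

End WordDims.

(** * The test along a sequence of reflections *)

Section ReflectionTest.
Variables (I E : finType).
Implicit Types (sr tg : E -> I) (s : seq I) (D : seq (I -> nat)) (V : nat -> I -> nat).

(** Recorded at every stage of [rtest], this yields the lower bounds of [rtest_om_ge]. *)
Definition top (v : I -> nat) D := if D is d :: _ then [forall i, (d i <= v i)%N] else true.

Fixpoint rtest sr tg s D V : bool := top (V 0%N) D &&
  match s with
  | a :: s' => dec a (V 0%N a) D &&
      rtest (flip_s sr tg a) (flip_t sr tg a) s' (Dref sr tg a D) (fun k => V k.+1)
  | [::] => all (fun d => [forall i, d i == 0%N]) D
  end.

Lemma inv0E (F : fieldType) sr tg s (V : vectType F) (A : E -> 'End(V))
    (sp : {ffun I -> {vspace V}}) : rinv sr tg s A sp 0 = dimf sp.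
Proof. by case: s. Qed.

Lemma top_ach (F : fieldType) sr tg (V : vectType F) (A : E -> 'End(V))
    (sp : {ffun I -> {vspace V}}) D : ach sr tg A D sp -> top (dimf sp) D.
Proof.
case: D => //= d D [U [Usp _ dU _]]; apply/forallP => i.
by rewrite -dU; exact: dimvS (forallP Usp i).
Qed.

Lemma ach_fam0 (F : fieldType) sr tg (V : vectType F) (A : E -> 'End(V)) D :
  ach sr tg A D (fam0 : {ffun I -> {vspace V}}) <-> all (fun d => [forall i, d i == 0%N]) D.
Proof.
elim: D => //= d D IH; split=> [[U [U0 sU dU aU]]|/andP[/forallP d0 /IH aD]].
  have U0' : U = fam0 by apply: fle_anti U0 _; exact: fle0.
  move: dU aU; rewrite U0' => dU /IH ->; rewrite andbT; apply/forallP => i.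
  by rewrite -dU ffunE dimv0.
exists fam0; split=> //; [exact: fle_refl|exact: fam0_stable|].
by move=> i; rewrite ffunE dimv0 (eqP (d0 i)).
Qed.

Lemma rtest_ach (F : fieldType) sr tg s (V : vectType F) (A : E -> 'End(V))
    (sp : {ffun I -> {vspace V}}) D : adm sr tg s -> stable sr tg A sp ->
  (forall i, rinv sr tg s A sp (size s) i = 0%N) ->
  ach sr tg A D sp <-> rtest sr tg s D (rinv sr tg s A sp).
Proof.
elim: s sr tg V A sp D => [|a s IH] sr tg V A sp D /=.
  move=> _ _ d0; have {d0} -> : sp = fam0 by exact: dimf_eq0.
  rewrite ach_fam0; split=> [h|/andP[]//]; rewrite h andbT.
  by apply: (@top_ach _ sr tg _ A); exact/ach_fam0.
move=> /andP[sa as_] ssp d0; have rP := ach_reflP sa D ssp; have iP := IH _ _ _ _ _ (Dref sr tg a D) as_ (refl_stable sa ssp) d0.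
split=> [h|/and3P[_ dD rD]]; last by apply/rP; split=> //; exact/iP.
by have /rP[dD /iP rD] := h; rewrite dD rD !andbT; exact: top_ach h.
Qed.

Lemma cnt_top (F : finFieldType) sr tg (V : vectType F) (A : E -> 'End(V))
    (sp : {ffun I -> {vspace V}}) D : ~~ top (dimf sp) D -> cnt sr tg A D sp = 0%N.
Proof.
case: D => //= d D nt; rewrite big1 // => U /and3P[Usp _ /forallP dU].
case/negP: nt; apply/forallP => i; rewrite -(eqP (dU i)); exact: dimvS (forallP Usp i).
Qed.

Lemma cnt_fam0 (F : finFieldType) sr tg (V : vectType F) (A : E -> 'End(V)) D :
  cnt sr tg A D (fam0 : {ffun I -> {vspace V}}) = all (fun d => [forall i, d i == 0%N]) D.
Proof.
elim: D => //= d D IH.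
rewrite (eq_bigl (fun U => (U == fam0) && [forall i, d i == 0%N])); last first.
  move=> U; apply/and3P/andP => [[U0 sU /forallP dU]|[/eqP -> /forallP d0]].
    have -> : U = fam0 by apply: fle_anti U0 _; exact: fle0.
    split=> //; apply/forallP => i; rewrite -(eqP (dU i)).
    by have -> : U = fam0 by [apply: fle_anti U0 _; exact: fle0]; rewrite ffunE dimv0.
  split; [exact: fle_refl|exact: fam0_stable|].
  by apply/forallP => i; rewrite ffunE dimv0 eq_sym d0.
case: (boolP [forall i, d i == 0%N]) => _ /=; last by rewrite big_pred0 // => U; rewrite andbF.
by under eq_bigl => U do rewrite andbT; rewrite big_pred1_eq IH.
Qed.

Lemma rtest_cnt (F : finFieldType) sr tg s (V : vectType F) (A : E -> 'End(V))
    (sp : {ffun I -> {vspace V}}) D : adm sr tg s -> stable sr tg A sp ->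
  (forall i, rinv sr tg s A sp (size s) i = 0%N) ->
  cnt sr tg A D sp = rtest sr tg s D (rinv sr tg s A sp) %[mod #|F|].
Proof.
move=> + + +; elim: s sr tg V A sp D => [|a s IH] sr tg V A sp D as_ ssp d0;
  (have [tD|nt] := boolP (top (dimf sp) D); last by rewrite cnt_top //= (negPf nt)).
  rewrite /= tD; have -> : sp = fam0 by exact: dimf_eq0.
  by rewrite cnt_fam0.
move: as_ => /= /andP[sa as_]; rewrite tD (cnt_refl sa D ssp) -modnMmr.
rewrite (IH _ _ _ _ _ _ as_ (refl_stable sa ssp) d0) modnMmr.
by case: (dec _ _ _); rewrite ?mul1n ?mul0n.
Qed.

Lemma eq_rtest sr tg s D V V' : (forall k i, V k i = V' k i) ->
  rtest sr tg s D V = rtest sr tg s D V'.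
Proof.
move=> VV'; have -> // : V = V'.
by apply/funext => k; apply/funext => i.
Qed.

Lemma vinv_size sr tg s v i : vinv sr tg s v (size s) i = rss sr tg s v i.
Proof. by elim: s sr tg v => //= a s IH sr tg v. Qed.

Lemma vinv_big sr tg s v k : (size s <= k)%N -> vinv sr tg s v k = vinv sr tg s v (size s).
Proof. by elim: s sr tg v k => [|a s IH] sr tg v [|k] //= h; exact: IH. Qed.

Lemma vinv0E sr tg s v : vinv sr tg s v 0 = v.
Proof. by case: s. Qed.

Section RootWords.
Variable T : eqType.
Implicit Types (f g : T -> I -> nat) (bs : seq T).

Definition killed a f : pred T := fun b => [forall i, f b i == (i == a)].

(* The word filtering a sum of roots by the order in which they are killed. *)
Fixpoint om sr tg s f g bs : seq (I -> nat) :=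
  if s is a :: s' then
    (fun i => \sum_(b <- bs | killed a f b) g b i)%N ::
      om (flip_s sr tg a) (flip_t sr tg a) s' (fun b => rs sr tg a (f b)) g
        [seq b <- bs | ~~ killed a f b]
  else [::].

Fixpoint DL sr tg s f g bs : seq (I -> nat) :=
  if s is a :: s' then
    (fun i => \sum_(b <- bs | ~~ killed a f b) g b i)%N ::
      DL (flip_s sr tg a) (flip_t sr tg a) s' (fun b => rs sr tg a (f b)) g
        [seq b <- bs | ~~ killed a f b]
  else [::].

Lemma head_DL sr tg s f g bs i : (head (fun=> 0%N) (DL sr tg s f g bs) i <= \sum_(b <- bs) g b i)%N.
Proof.
case: s => //= a s; rewrite [leqRHS](bigID (killed a f)) /=; exact: leq_addl.
Qed.

(** No single root is truncated, so the differences add up without loss, and [h] stays below their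
    sum. *)
Lemma Dref_sum sr tg a g bs (h : nat) : sink sr a ->
  {in bs, forall b, (g b a <= \sum_(x | tg x == a) g b (sr x))%N} ->
  (h <= \sum_(b <- bs) rs sr tg a (g b) a)%N ->
  (fun i => if i == a then maxn (\sum_(x | tg x == a) (\sum_(b <- bs) g b (sr x)) -
      \sum_(b <- bs) g b a) h else \sum_(b <- bs) g b i)%N =
  (fun i => \sum_(b <- bs) rs sr tg a (g b) i)%N.
Proof.
move=> sa gb hb; apply/funext => i; case: (eqVneq i a) => [->|ia]; last first.
  by apply: eq_bigr => b _; rewrite /rs (negPf ia).
suff -> : (\sum_(x | tg x == a) (\sum_(b <- bs) g b (sr x)) - \sum_(b <- bs) g b a =
    \sum_(b <- bs) rs sr tg a (g b) a)%N by exact/maxn_idPl.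
rewrite exchange_big /=; apply/eqP; rewrite -(eqn_add2r (\sum_(b <- bs) g b a)) subnK.
  rewrite -big_split /=; apply/eqP; apply: eq_big_seq => b bb.
  by rewrite /rs eqxx subnK ?gb.
rewrite big_seq [leqRHS]big_seq; apply: leq_sum => b; exact: gb.
Qed.

Lemma Dref_DL sr0 tg0 sr tg a s f g bs : sink sr0 a ->
  {in bs, forall b, (g b a <= \sum_(x | tg0 x == a) g b (sr0 x))%N} ->
  Dref sr0 tg0 a (DL sr tg s f g bs) = DL sr tg s f (fun b => rs sr0 tg0 a (g b)) bs.
Proof.
move=> sa; elim: s sr tg f bs => //= c s IH sr tg f bs gb.
have gb' : {in [seq b <- bs | ~~ killed c f b],
    forall b, (g b a <= \sum_(x | tg0 x == a) g b (sr0 x))%N}.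
  by move=> b; rewrite mem_filter => /andP[_ /gb].
rewrite IH //; congr (_ :: _).
have hd := head_DL (flip_s sr tg c) (flip_t sr tg c) s (fun b => rs sr tg c (f b))
  (fun b => rs sr0 tg0 a (g b)) [seq b <- bs | ~~ killed c f b] a.
have Es := Dref_sum sa gb' hd.
transitivity (fun i => \sum_(b <- [seq b <- bs | ~~ killed c f b]) rs sr0 tg0 a (g b) i)%N;
  last by apply/funext => i; rewrite big_filter.
rewrite -Es; apply/funext => i; case: eqP => _; rewrite ?big_filter //.
by congr (maxn (_ - _) _); apply: eq_bigr => x _; rewrite big_filter.
Qed.

Lemma dec_DL sr tg s f g bs c (a : I) : c \in [:: a] ->
  dec a (\sum_(b <- bs) g b a) (DL sr tg s f g bs).
Proof.
move=> _; elim: s sr tg f bs => //= d s IH sr tg f bs.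
by rewrite -big_filter IH andbT big_filter [leqRHS](bigID (killed d f)) /= leq_addl.
Qed.

Lemma dec_nseq a m v n D : (v a <= n)%N -> dec a (v a) D -> dec a n (nseq m v ++ D).
Proof.
elim: m n => [|m IH] n /= vn dD; last by rewrite vn IH.
by case: D dD => //= d D /andP[h ->]; rewrite (leq_trans h vn).
Qed.

Variable B : nat.

Section Step.
Variables (sr tg : E -> I) (a : I) (s : seq I) (f : T -> I -> nat) (bs : seq T).
Hypothesis pB : pdb sr tg B.
Hypothesis sa : sink sr a.
Hypothesis q1 : {in bs, forall b, tq sr tg (zv (f b)) = 1}.
Local Notation bs1 := [seq b <- bs | ~~ killed a f b].
Local Notation f' := (fun b => rs sr tg a (f b)).

Lemma alive_le : {in bs1, forall b, (f b a <= \sum_(x | tg x == a) f b (sr x))%N}.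
Proof.
move=> b; rewrite mem_filter => /andP[nk bb]; rewrite leqNgt; apply: contra nk => lt.
by apply/forallP => i; rewrite (simple_root pB sa (q1 bb) lt).
Qed.

Lemma alive_root : {in bs1, forall b, tq (flip_s sr tg a) (flip_t sr tg a) (zv (f' b)) = 1}.
Proof.
move=> b b1; rewrite tq_flip zv_rs ?alive_le // (tq_zs pB) q1 //.
by move: b1; rewrite mem_filter => /andP[].
Qed.

Lemma killed_rs b : killed a f b -> rs sr tg a (f b) = fun=> 0%N.
Proof.
move=> /forallP k; have -> : f b = fun i => (i == a) : nat.
  by apply/funext => i; exact/eqP.
exact: rs_simple.
Qed.

Lemma sum_alive k i : (\sum_(b <- bs) vinv (flip_s sr tg a) (flip_t sr tg a) s (f' b) k i =
  \sum_(b <- bs1) vinv (flip_s sr tg a) (flip_t sr tg a) s (f' b) k i)%N.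
Proof.
rewrite big_filter [LHS](bigID (killed a f)) /= big1 // => b /killed_rs ->.
exact: vinv0.
Qed.

(** Once the roots simple at [a] are killed, the first proper member of the flag is the whole
    family. Each reflection thus produces one more full member, and the induction has to allow [m]
    of them in front. *)
Lemma Dref_nseq m :
  Dref sr tg a (nseq m (fun i => \sum_(b <- bs) f b i)%N ++ DL sr tg (a :: s) f f bs) =
  nseq m.+1 (fun i => \sum_(b <- bs1) f' b i)%N ++
    DL (flip_s sr tg a) (flip_t sr tg a) s f' f' bs1.
Proof.
elim: m => [|m IH] /=; rewrite ?cat0s.
  rewrite (Dref_DL _ _ _ _ sa alive_le); congr (_ :: _).
  have Es := Dref_sum sa alive_le (head_DL (flip_s sr tg a) (flip_t sr tg a) s f' f' bs1 a).
  rewrite -Es; apply/funext => i; case: eqP => _; rewrite ?big_filter //.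
  by congr (maxn (_ - _) _); apply: eq_bigr => x _; rewrite big_filter.
have h : Dref sr tg a (nseq m (fun i => (\sum_(b <- bs) f b i)%N) ++ DL sr tg (a :: s) f f bs) =
   nseq m.+1 (fun i => \sum_(b <- bs1) f' b i)%N ++
    DL (flip_s sr tg a) (flip_t sr tg a) s f' f' bs1 by exact: IH.
rewrite /= in h; rewrite h; congr (_ :: _); apply/funext => i /=.
have split j : (\sum_(b <- bs) f b j = count (killed a f) bs * (j == a) + \sum_(b <- bs1) f b j)%N.
  rewrite (bigID (killed a f)) /= big_filter; congr (_ + _)%N.
  rewrite (eq_bigr (fun=> (j == a) : nat)); last by move=> b /forallP/(_ j)/eqP.
  by rewrite big_const_seq iter_addn_0 mulnC.
rewrite -[RHS](congr1 (@^~ i) (Dref_sum sa alive_le (leqnn _))).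
case: (eqVneq i a) => [_|ia]; last by rewrite split (negPf ia) muln0.
have e : (\sum_(x | tg x == a) (\sum_(b <- bs) f b (sr x)) =
    \sum_(x | tg x == a) (\sum_(b <- bs1) f b (sr x)))%N.
  by apply: eq_bigr => x _; rewrite split (negPf (forallP sa x)) muln0.
rewrite e split; set X := (\sum_(x | _) _)%N; set Y := (\sum_(b <- bs1) f b a)%N.
have := congr1 (@^~ a) (Dref_sum sa alive_le (leqnn _)); rewrite /= eqxx -/X -/Y.
by clear; set Z := (\sum_(b <- _) _)%N; lia.
Qed.

End Step.

Lemma rtest_om m sr tg s f bs : pdb sr tg B -> adm sr tg s ->
  {in bs, forall b, tq sr tg (zv (f b)) = 1} ->
  {in bs, forall b i, rss sr tg s (f b) i = 0%N} ->
  rtest sr tg s (nseq m (fun i => \sum_(b <- bs) f b i)%N ++ DL sr tg s f f bs)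
    (fun k i => \sum_(b <- bs) vinv sr tg s (f b) k i)%N.
Proof.
elim: s m sr tg f bs => [|a s IH] m sr tg f bs pB.
  move=> _ q1 kl; case: bs q1 kl => [|b bs] q1 kl.
    rewrite /= cats0; apply/andP; split; last first.
      by apply/allP => d /nseqP[-> _]; apply/forallP => i; rewrite big_nil.
    by case: m => //= m; apply/forallP => i; rewrite !big_nil.
  have := q1 b (mem_head _ _); have k0 i := kl b (mem_head _ _) i; rewrite /= in k0.
  by rewrite /tq !big1 // => x _; rewrite /zv !k0.
move=> /= /andP[sa as_] q1 kl; apply/and3P; split.
- case: m => [|m] /=; apply/forallP => i //.
  by rewrite [leqRHS](bigID (killed a f)) /= leq_addl.
- apply: dec_nseq => //; exact: (dec_DL sr tg (a :: s) f f bs (mem_head a [::])).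
have := Dref_nseq s pB sa q1 m; rewrite /= => ->.
rewrite (@eq_rtest _ _ _ _ _ (fun k i => \sum_(b <- [seq b <- bs | ~~ killed a f b])
  vinv (flip_s sr tg a) (flip_t sr tg a) s (rs sr tg a (f b)) k i)%N); last first.
  by move=> k i; exact: sum_alive.
apply: (IH m.+1 _ _ (fun b => rs sr tg a (f b)) _ (pdb_flip a pB) as_ (alive_root pB sa q1)).
by move=> b; rewrite mem_filter => /andP[_ bb]; exact: kl.
Qed.

(** After each reflection the flag begins with a full member, the sum of the surviving roots, and
    [top] makes it fit into the dimensions of that stage. *)
Lemma rtest_om_ge m sr tg s f bs V : pdb sr tg B -> adm sr tg s ->
  {in bs, forall b, tq sr tg (zv (f b)) = 1} ->
  (forall i, \sum_(b <- bs) f b i <= V 0 i)%N ->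
  rtest sr tg s (nseq m (fun i => \sum_(b <- bs) f b i)%N ++ DL sr tg s f f bs) V ->
  forall k i, (k <= size s)%N -> (\sum_(b <- bs) vinv sr tg s (f b) k i <= V k i)%N.
Proof.
elim: s m sr tg f bs V => [|a s IH] m sr tg f bs V pB.
  by move=> _ _ V0 _ [|k] i // _; exact: V0.
move=> /= /andP[sa as_] q1 V0 /and3P[_ _]; have := Dref_nseq s pB sa q1 m; rewrite /= => ->.
move=> rt [|k] i; first by move=> _; exact: V0.
rewrite ltnS => ks; rewrite sum_alive //.
apply: (IH m.+1 _ _ (fun b => rs sr tg a (f b)) _ (fun k => V k.+1) (pdb_flip a pB) as_
  (alive_root pB sa q1) _ rt k i ks).
move=> j; case: (s) rt => [|c s'] /= /andP[/forallP/(_ j)]; exact.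
Qed.

End RootWords.
End ReflectionTest.

Section RootWordDims.
Variables (Q : quiver) (T : eqType).

Variable B : nat.

Lemma wdim_om sr tg s (f g : T -> vert Q -> nat) bs i : pdb (E := arrow Q) sr tg B -> adm sr tg s ->
  {in bs, forall b, tq sr tg (zv (f b)) = 1} ->
  {in bs, forall b i, rss sr tg s (f b) i = 0%N} ->
  @wdim Q (om sr tg s f g bs) i = (\sum_(b <- bs) g b i)%N.
Proof.
elim: s sr tg f bs => [|a s IH] sr tg f bs pB.
  move=> _ q1 kl; case: bs q1 kl => [|b bs] q1 kl; first by rewrite big_nil.
  have k0 j : f b j = 0%N := kl b (mem_head _ _) j.
  have : tq sr tg (zv (f b)) = 0 by rewrite /tq !big1 // => x _; rewrite /zv !k0.
  by rewrite (q1 b (mem_head _ _)).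
move=> /= /andP[sa as_] q1 kl.
have kl' : {in [seq b <- bs | ~~ killed a f b], forall b i,
    rss (flip_s sr tg a) (flip_t sr tg a) s (rs sr tg a (f b)) i = 0%N}.
  by move=> b; rewrite mem_filter => /andP[_ bb]; exact: kl.
rewrite /dimD (IH _ _ _ _ (pdb_flip a pB) as_ (alive_root pB sa q1) kl').
by rewrite big_filter [RHS](bigID (killed a f)).
Qed.

Lemma Dl_om sr tg s (f g : T -> vert Q -> nat) bs : pdb (E := arrow Q) sr tg B -> adm sr tg s ->
  {in bs, forall b, tq sr tg (zv (f b)) = 1} ->
  {in bs, forall b i, rss sr tg s (f b) i = 0%N} ->
  @Dl Q (om sr tg s f g bs) = DL sr tg s f g bs.
Proof.
elim: s sr tg f bs => //= a s IH sr tg f bs pB /andP[sa as_] q1 kl.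
have kl' : {in [seq b <- bs | ~~ killed a f b], forall b i,
    rss (flip_s sr tg a) (flip_t sr tg a) s (rs sr tg a (f b)) i = 0%N}.
  by move=> b; rewrite mem_filter => /andP[_ bb]; exact: kl.
rewrite (IH _ _ _ _ (pdb_flip a pB) as_ (alive_root pB sa q1) kl').
congr (_ :: _); apply/funext => i.
by rewrite (@wdim_om _ _ s _ g _ i (pdb_flip a pB) as_ (alive_root pB sa q1) kl') big_filter.
Qed.

End RootWordDims.

(** * Dynkin quivers *)

Section ReflectionClosed.
Variables (Q : quiver) (K : fieldType) (d : dimvec Q).
Local Notation rp := (@rep Q K d).
Variables (I E : finType).

Lemma zclosed_const (P : Prop) : zclosed [set X : rp | P].
Proof.
have [h|nh] := pselect P.
  by rewrite (_ : [set X : rp | P] = setT)%classic; [exact: zclosedT|apply/seteqP; split].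
by rewrite (_ : [set X : rp | P] = set0)%classic; [exact: zclosed0|apply/seteqP; split].
Qed.

Lemma zclosed_and (Z1 Z2 : set rp) : zclosed Z1 -> zclosed Z2 ->
  zclosed [set X | Z1 X /\ Z2 X]%classic.
Proof.
move=> c1 c2; have -> : [set X | Z1 X /\ Z2 X]%classic =
    [set X | forall b : bool, (if b then Z1 else Z2) X]%classic.
  by apply/seteqP; split=> X => [[h1 h2] []//|h]; split; [exact: (h true)|exact: (h false)].
by apply: (@zclosedI Q K d bool (fun b => if b then Z1 else Z2)) => -[].
Qed.

Lemma kerfam_zero (V : vectType K) : kerfam (fun _ : rp => 0%VS : {vspace V}).
Proof.
apply: kerfam_eq (kerfam_lker (lfpoly_const d (\1%VF : 'End(V)))) _ => X v.
by rewrite memv_ker id_lfunE memv0.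
Qed.

Section OneReflection.
Variables (sr tg : E -> I) (a : I) (V : vectType K) (A : rp -> E -> 'End(V)).
Variable sp : rp -> {ffun I -> {vspace V}}.
Hypothesis pA : forall x, lfpoly (fun X => A X x).
Hypothesis ksp : forall i, kerfam (fun X => sp X i).

Lemma lfpoly_reflA x : lfpoly (fun X => reflA tg a (A X) x).
Proof.
rewrite /reflA; case: (tg x == a); first exact: lfpoly_const.
apply: lfpoly_comp; first exact: lfpoly_const.
by apply: lfpoly_comp; [exact: pA|exact: lfpoly_const].
Qed.

Lemma lfpoly_sumA : lfpoly (fun X => sumA tg a (A X)).
Proof.
apply: lfpoly_sum => x; apply: lfpoly_comp; [exact: pA|exact: lfpoly_const].
Qed.

Lemma kerfam_refl i : kerfam (fun X => refl sr tg a (A X) (sp X) i).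
Proof.
have k1 : kerfam (fun X => psp sr tg a (sp X) i).
  apply: kerfam_bigcap => o; apply: kerfam_preim; first exact: lfpoly_const.
  rewrite /tsp; case: o => [x|].
    by case: ((i == a) && (tg x == a)); [exact: (ksp (sr x))|exact: (kerfam_zero V)].
  by case: (i == a); [exact: (kerfam_zero V)|exact: (ksp i)].
have k2 : kerfam (fun X => if i == a then lker (sumA tg a (A X)) else fullv).
  case: (i == a); [exact: kerfam_lker lfpoly_sumA|exact: kerfam_full].
by apply: kerfam_eq (kerfam_cap k1 k2) _ => X v; rewrite ffunE.
Qed.

End OneReflection.

Lemma zclosed_dec a (V : vectType K) (S : rp -> {vspace V}) D : kerfam S ->
  zclosed [set X | dec (I := I) a (\dim (S X)) D]%classic.
Proof.
move=> kS; case: D => [|c D] /=; first exact: zclosed_const.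
have -> : [set X | (c a <= \dim (S X))%N && dec a (c a) D]%classic =
   [set X | (c a <= \dim (S X))%N /\ dec a (c a) D]%classic.
  by apply/seteqP; split=> X /= /andP.
by apply: zclosed_and; [exact: zclosed_kerfam|exact: zclosed_const].
Qed.

(** Reflection is a kernel construction and stays among the families [kerfam], whose dimensions are
    upper semicontinuous; each step of [ach_reflP] only asks for a dimension to be large enough. *)
Lemma zclosed_ach s (sr tg : E -> I) (V : vectType K) (A : rp -> E -> 'End(V))
    (sp : rp -> {ffun I -> {vspace V}}) D : adm sr tg s ->
  (forall x, lfpoly (fun X => A X x)) -> (forall i, kerfam (fun X => sp X i)) ->
  (forall X, stable sr tg (A X) (sp X)) ->
  (forall X i, rinv sr tg s (A X) (sp X) (size s) i = 0%N) ->
  zclosed [set X | ach sr tg (A X) D (sp X)]%classic.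
Proof.
elim: s sr tg V A sp D => [|a s IH] sr tg V A sp D.
  move=> _ _ _ _ d0; rewrite (_ : [set X | _]%classic =
    [set X : rp | all (fun d => [forall i, d i == 0%N]) D]%classic); first exact: zclosed_const.
  have sp0 X : sp X = fam0 by exact: (dimf_eq0 (d0 X)).
  apply/seteqP; split=> X /=; rewrite sp0; first by move/ach_fam0.
  by move=> h; exact/ach_fam0.
move=> /= /andP[sa as_] pA ksp ssp d0.
rewrite (_ : [set X | _]%classic = [set X | dec a (\dim (sp X a)) D /\
    ach (flip_s sr tg a) (flip_t sr tg a) (reflA tg a (A X)) (Dref sr tg a D)
      (refl sr tg a (A X) (sp X))]%classic); last first.
  by apply/seteqP; split=> X /= h; exact/(ach_reflP sa D (ssp X)).
apply: zclosed_and; first exact: zclosed_dec.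
apply: IH as_ _ _ _ d0 => [x|i|X]; [exact: lfpoly_reflA|exact: kerfam_refl|].
exact: refl_stable.
Qed.

End ReflectionClosed.

Lemma sum_leq_eq (J : finType) (f g : J -> nat) : (forall j, (f j <= g j)%N) ->
  (\sum_j f j = \sum_j g j)%N -> forall j, f j = g j.
Proof.
move=> h e j.
have [_] : (\sum_j f j <= \sum_j g j ?= iff [forall (j | true), f j == g j])%N.
  by apply: leqif_sum => i _; split.
by rewrite e eqxx => /esym/forallP/(_ j)/eqP.
Qed.

(** * From multisets of indecomposables to a parametrisation *)

Section ListCase.
Variables (Q : quiver) (S : parametrisation Q) (T : eqType).
Variables (good : forall F : fieldType, T -> packed_rep Q F -> Prop).
Variables (J : Type) (d0 : T -> J -> nat).
Variable inv : forall (F : fieldType) (V : vectType F), (arrow Q -> 'End(V)) ->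
  {ffun vert Q -> {vspace V}} -> J -> nat.
Arguments inv {F V}.
Local Notation stab := (stable (@src Q) (@tgt Q)).
Hypothesis good_iso : forall (F : fieldType) b (M N : packed_rep Q F),
  good b M -> good b N -> iso (tagged M) (tagged N).
Hypothesis good_ex : forall (F : fieldType) b, exists M : packed_rep Q F, good b M.
Hypothesis good_ind : forall (F : fieldType) (V : vectType F) (A : arrow Q -> 'End(V)) U,
  stab A U -> nilA A U fam0 -> aindec A U ->
  exists b M, good b M /\ qreal A U fam0 (tagged M).
Hypothesis good_inv : forall (F : fieldType) (V : vectType F) (A : arrow Q -> 'End(V)) U
    b (M : packed_rep Q F) j,
  stab A U -> good b M -> qreal A U fam0 (tagged M) -> inv A U j = d0 b j.
Hypothesis inv_add : forall (F : fieldType) (V : vectType F) (A : arrow Q -> 'End(V)) sp U R j,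
  dsumf A sp U R -> inv A sp j = (inv A U j + inv A R j)%N.
Hypothesis inv0 : forall (F : fieldType) (V : vectType F) (A : arrow Q -> 'End(V)) j,
  inv A fam0 j = 0%N.
Hypothesis d0_inj : forall bs bs' : seq T,
  (forall j, \sum_(b <- bs) d0 b j = \sum_(b <- bs') d0 b j)%N -> perm_eq bs bs'.
Variable enc : S -> seq T.
Hypothesis enc_class : forall (F : fieldType) d (M : rep F d) (g : S),
  pclass M g <-> lcl good M (enc g).
Hypothesis enc_inj : forall g g', perm_eq (enc g) (enc g') -> g = g'.
Hypothesis enc_surj : forall bs, exists g, perm_eq bs (enc g).

Lemma list_inv (F : fieldType) (V : vectType F) (A : arrow Q -> 'End(V)) sp d (M : rep F d) (g : S) j :
  stab A sp -> qreal A sp fam0 M -> pclass M g -> inv A sp j = (\sum_(b <- enc g) d0 b j)%N.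
Proof. by move=> ssp qM /enc_class; exact: (lcl_inv good_inv inv_add inv0). Qed.

Lemma list_ex (F : fieldType) (g : S) : exists d (M : rep F d), pclass M g.
Proof. by have [d [M h]] := lcl_ex good_ex F (enc g); exists d, M; exact/enc_class. Qed.

Lemma list_iso (F : fieldType) d e (M : rep F d) (N : rep F e) (g g' : S) :
  pclass M g -> pclass N g' -> (iso M N <-> g = g').
Proof.
move=> /enc_class lM /enc_class lN.
have h := lcl_iso good_iso good_inv inv_add inv0 d0_inj lM lN.
by split=> [/h/enc_inj//|e0]; apply/h; rewrite e0.
Qed.

Lemma list_class (F : fieldType) d (M : rep F d) : nilpotent M -> exists g : S, pclass M g.
Proof.
move=> /(lcl_class good_iso good_ex good_ind)[bs lM].
have [g pg] := enc_surj bs; exists g; apply/enc_class.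
exact: lcl_perm pg lM.
Qed.

End ListCase.

Section DynkinCase.
Variables (I E : finType) (sr tg : E -> I).
Local Notation Q := (@Quiver I E sr tg).
Variable B : nat.
Hypothesis pB : pdb sr tg B.
Local Notation root := (posroot Q).

Lemma tits_tq (b : {ffun I -> nat}) : @tits_form Q b = tq sr tg (zv b).
Proof. by []. Qed.

Lemma root_tq (b : root) : tq sr tg (zv (root_dim b)) = 1.
Proof. by rewrite /root_dim -[LHS]tits_tq; exact/eqP/(valP b). Qed.

Lemma root_dim_inj : injective (@root_dim Q).
Proof.
move=> b c e; apply: val_inj; apply/ffunP => i.
exact: (congr1 (@^~ i) e).
Qed.

Definition dgood (F : fieldType) (b : root) (M : packed_rep Q F) :=
  projT1 M = root_dim b /\ indecomposable (tagged M).

Lemma amb_dimf (F : fieldType) (V : vectType F) (A : E -> 'End(V)) (U : {ffun I -> {vspace V}})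
    (d : dimvec Q) (M : @rep Q F d) : @qreal Q F V A U fam0 d M -> dimf U = d.
Proof.
move=> qM; apply/funext => i; have := qreal_dim (i : vert Q) qM.
by rewrite ffunE dimv0.
Qed.

Variable s : seq I.
Hypothesis as_ : adm sr tg s.
Hypothesis kill : forall v, tq sr tg (zv v) = 1 -> forall i, rss sr tg s v i = 0%N.
Variable so : seq I.
Hypothesis aso : adm tg sr so.
Hypothesis kill_op : forall v, tq tg sr (zv v) = 1 -> forall i, rss tg sr so v i = 0%N.

Definition dinv (F : fieldType) (V : vectType F) (A : E -> 'End(V)) (U : {ffun I -> {vspace V}})
  (j : nat * I) : nat := rinv sr tg s A U j.1 j.2.

Definition dinv0 (b : root) (j : nat * I) : nat := vinv sr tg s (root_dim b) j.1 j.2.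

Lemma dgood_iso (F : fieldType) b (M N : packed_rep Q F) :
  dgood b M -> dgood b N -> iso (tagged M) (tagged N).
Proof.
case: M N => [d M] [e N] [/= dE iM] [/= eE iN].
have sM := amb_stable M; have qM := amb_real M; have sN := amb_stable N; have qN := amb_real N.
have aM : aindec (amb_map M) (amb_sp F d) by apply/(aindecP sM qM).
have aN : aindec (amb_map N) (amb_sp F e) by apply/(aindecP sN qN).
have dM : dimf (I := I) (amb_sp F d) = d := amb_dimf qM.
have dN : dimf (I := I) (amb_sp F e) = e := amb_dimf qN.
have e1 : dimf (I := I) (amb_sp F d) = dimf (I := I) (amb_sp F e) by rewrite dM dN dE eE.
have k1 i : rss sr tg s (dimf (I := I) (amb_sp F d)) i = 0%N.
  by rewrite dM dE; exact: kill (root_tq b) i.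
have ai := @indecomposable_unique I E F s sr tg B _ _ (amb_map M) (amb_map N) (amb_sp F d)
  (amb_sp F e) pB as_ sM sN aM aN e1 k1.
exact: qreal_uniq sM qM (aiso_qreal ai qN).
Qed.

Lemma dgood_ex (F : fieldType) b : exists M : packed_rep Q F, dgood b M.
Proof.
have q1 := root_tq b; have q1' : tq tg sr (zv (root_dim b)) = 1 by rewrite tq_op.
have [V [A [sp [ssp ai dE]]]] := indecomposable_exists F pB aso q1 (kill_op q1').
have [|M qM] := @qreal_ex Q F V A sp fam0 (root_dim b) ssp (fam0_stable _ _ _) (fle0 _).
  by move=> i; rewrite ffunE dimv0 add0n; exact: (congr1 (@^~ i) dE).
by exists (existT _ _ M); split=> //=; exact: (proj2 (@aindecP Q F V A sp _ M ssp qM) ai).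
Qed.

Lemma dgood_ind (F : fieldType) (V : vectType F) (A : arrow Q -> 'End(V)) U :
  stable (@src Q) (@tgt Q) A U -> nilA A U fam0 -> aindec A U ->
  exists b M, dgood b M /\ qreal A U fam0 (tagged M).
Proof.
move=> sU _ aU.
have q1 : tq sr tg (zv (dimf (I := I) U)) = 1 := indecomposable_root pB sU aU.
pose b0 : {ffun vert Q -> nat} := [ffun i => \dim (U i)].
have b1 : tits_form b0 == 1.
  rewrite tits_tq -q1; apply/eqP; congr tq; apply/funext => i; by rewrite /zv ffunE.
pose b : root := exist _ b0 b1.
have [|M qM] := @qreal_ex Q F V A U fam0 (root_dim b) sU (fam0_stable _ _ _) (fle0 _).
  by move=> i; rewrite ffunE dimv0 add0n /root_dim /= ffunE.
by exists b, (existT _ _ M); split=> //; split=> //=; exact: (proj2 (aindecP sU qM) aU).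
Qed.

Lemma dgood_inv (F : fieldType) (V : vectType F) (A : arrow Q -> 'End(V)) U
    b (M : packed_rep Q F) j :
  stable (@src Q) (@tgt Q) A U -> dgood b M -> qreal A U fam0 (tagged M) -> dinv A U j = dinv0 b j.
Proof.
case: M => d M sU [/= dE iM] qM; have aU : aindec A U by apply/(aindecP sU qM).
rewrite /dinv (inv_aindec _ _ as_ sU aU) /dinv0 -dE; congr (vinv _ _ _ _ _ _).
exact: amb_dimf qM.
Qed.

Lemma dinv_add (F : fieldType) (V : vectType F) (A : arrow Q -> 'End(V)) sp U R j :
  dsumf A sp U R -> dinv A sp j = (dinv A U j + dinv A R j)%N.
Proof. by move=> d; exact: inv_dsumf as_ d. Qed.

Lemma dinv_fam0 (F : fieldType) (V : vectType F) (A : arrow Q -> 'End(V)) j :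
  dinv A fam0 j = 0%N.
Proof. exact: inv_fam0. Qed.

Lemma dinv0_inj (bs bs' : seq root) :
  (forall j, \sum_(b <- bs) dinv0 b j = \sum_(b <- bs') dinv0 b j)%N -> perm_eq bs bs'.
Proof.
move=> h; apply: (vinv_inj (f := @root_dim Q) pB as_) => [b _|b c _ _|b _|k i].
- exact: root_tq.
- exact: root_dim_inj.
- exact: kill (root_tq b).
- exact: (h (k, i)).
Qed.

(** Arrows lower the height [rho], so a power of the arrow ideal beyond the largest height is 0. *)
Lemma all_nilpotent (F : fieldType) d (M : @rep Q F d) : nilpotent M.
Proof.
have sX := amb_stable M; have qX := amb_real M.
apply/(nilpotentP sX (fam0_stable _ _ _) qX).
have [rho hr] := height_exists pB; pose n := (\max_i rho i).+1; exists n.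
suff h : forall m i, (rho i + m >= n)%N -> iter m (radf (amb_map M)) (amb_sp F d) i = 0%VS.
  by apply/fleP => i v; rewrite h ?leq_addl // ffunE.
elim=> [|m IH] i; first by rewrite addn0 ltnNge (leq_bigmax (F := rho) i).
move=> le; rewrite iterS ffunE big1 // => x /eqP tx; rewrite IH ?limg0 //.
by have := hr x; rewrite -[tg x]/(@tgt Q x) tx -[sr x]/(@src Q x); lia.
Qed.

Definition denc (al : dynkin_class Q) : seq root :=
  flatten [seq nseq (al b) b | b <- finsupp al].

Lemma count_denc al b : count_mem b (denc al) = al b.
Proof.
rewrite /denc count_flatten -map_comp sumnE big_map.
rewrite (eq_bigr (fun c => if c == b then al b else 0%N)); last first.
  by move=> c _; rewrite /= count_nseq /=; case: eqP => [->|_]; rewrite ?mul1n ?mul0n.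
have [bf|nb] := boolP (b \in finsupp al).
  by rewrite (bigD1_seq b bf (fset_uniq _)) /= eqxx big1 ?addn0 // => c /negPf ->.
have -> : al b = 0%N by move: nb; rewrite mem_finsupp negbK => /eqP.
by rewrite big1 // => c _; rewrite if_same.
Qed.

Lemma denc_inj al al' : perm_eq (denc al) (denc al') -> al = al'.
Proof. by move=> /permP p; apply/fsfunP => b; rewrite -!count_denc p. Qed.

Lemma denc_surj bs : exists al, perm_eq bs (denc al).
Proof.
pose al : dynkin_class Q := [fsfun b in seq_fset tt bs => count_mem b bs | 0%N].
exists al; rewrite /perm_eq; apply/allP => b _; apply/eqP; rewrite count_denc fsfunE seq_fsetE.
by case: ifP => // /negbT/count_memPn.
Qed.

Lemma sum_denc al (h : root -> nat) : (\sum_(b <- denc al) h b = \sum_(b <- finsupp al) al b * h b)%N.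
Proof.
rewrite /denc big_flatten big_map; apply: eq_bigr => b _.
by rewrite big_nseq iter_addn_0 mulnC.
Qed.

Lemma denc_class (F : fieldType) d (M : @rep Q F d) (al : dynkin_param Q) :
  pclass M al <-> lcl dgood M (denc al).
Proof.
have mE (N : forall b : root, @rep Q F (root_dim b)) : flatten
    [seq nseq (al b) (existT (@rep Q F) _ (N b)) | b <- finsupp (al : dynkin_class Q)] =
    [seq existT (@rep Q F) _ (N b) | b <- denc al].
  by rewrite /denc map_flatten -map_comp; congr flatten; apply: eq_map => b /=; rewrite map_nseq.
split=> [[N [iN isoM]]|lM].
  exists (fun b => existT _ _ (N b)); split; last by rewrite -mE.
  by move=> b _; split=> //; exact: iN.
(* [dynkin_has_class] asks for an indecomposable at every root, also outside the support, so a full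
   family is chosen anew and compared with [M] by [lcl_iso]. *)
have /boolp.choice[N0 hN0] : forall b, exists M : packed_rep Q F, dgood b M by move=> b; exact: dgood_ex.
have ex (b : root) : exists N : @rep Q F (root_dim b), indecomposable N.
  by have := hN0 b; case: (N0 b) => e R [/= ee iR]; subst e; exists R.
pose N b := projT1 (cid (ex b)).
have iN b : indecomposable (N b) := projT2 (cid (ex b)).
exists N; split=> //; rewrite mE.
have lN : lcl dgood (tagged (dsum [seq existT (@rep Q F) _ (N b) | b <- denc al])) (denc al).
  exists (fun b => existT _ _ (N b)); split; last exact: iso_refl.
  by move=> b _; split=> //; exact: iN.
by apply/(lcl_iso dgood_iso dgood_inv dinv_add dinv_fam0 dinv0_inj lM lN).
Qed.

Definition dvec (al : dynkin_class Q) k i := (\sum_(b <- denc al) dinv0 b (k, i))%N.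

Definition dtest (w : seq (dimvec Q)) (al : dynkin_param Q) : bool :=
  [forall i, wdim w i == dynkin_dim al i] && rtest sr tg s (Dl w) (dvec al).

Lemma dvec0 al i : dvec al 0 i = dynkin_dim al i.
Proof.
rewrite /dvec /dynkin_dim -sum_denc; apply: eq_bigr => b _.
by rewrite /dinv0 vinv0E.
Qed.

Lemma dclass_inv (F : fieldType) (V : vectType F) (A : E -> 'End(V)) (sp : {ffun I -> {vspace V}})
    d (M : @rep Q F d) (al : dynkin_param Q) k i : stable sr tg A sp ->
  @qreal Q F V A sp fam0 d M -> pclass M al -> rinv sr tg s A sp k i = dvec al k i.
Proof.
move=> ssp qM cM.
exact: (list_inv dgood_inv dinv_add dinv_fam0 denc_class (k, i) ssp qM cM).
Qed.

Lemma dclass_dim (F : fieldType) d (M : @rep Q F d) (al : dynkin_param Q) :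
  pclass M al -> d = dynkin_dim al.
Proof.
move=> cM; have qX := amb_real M; rewrite -{1}(amb_dimf qX); apply/funext => i.
rewrite -dvec0 -(dclass_inv 0 i (amb_stable M) qX cM) inv0E //.
Qed.

(** The family is a sum of roots and [s] kills every root; this is what lets the test end at the
    zero family. *)
Lemma dfinal (F : fieldType) (V : vectType F) (A : E -> 'End(V)) (sp : {ffun I -> {vspace V}}) i :
  stable sr tg A sp -> rinv sr tg s A sp (size s) i = 0%N.
Proof.
move=> ssp; have [M qM] := @qreal_self Q F V A sp ssp.
have [al cM] := list_class dgood_iso dgood_ex dgood_ind denc_class denc_surj (all_nilpotent M).
rewrite (dclass_inv _ _ ssp qM cM) /dvec big1 // => b _; rewrite /dinv0 /= vinv_size.
exact: kill (root_tq b) i.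
Qed.

Lemma rtest_dvec D (F : fieldType) (V : vectType F) (A : E -> 'End(V)) (sp : {ffun I -> {vspace V}})
    d (M : @rep Q F d) (al : dynkin_param Q) : stable sr tg A sp ->
  @qreal Q F V A sp fam0 d M -> pclass M al ->
  rtest sr tg s D (rinv sr tg s A sp) = rtest sr tg s D (dvec al).
Proof. by move=> ssp qM cM; apply: eq_rtest => k i; exact: dclass_inv qM cM. Qed.

Lemma dflag (F : fieldType) (V : vectType F) (A : arrow Q -> 'End(V)) sp
    d (X : rep F d) (al : dynkin_param Q) w :
  stable (@src Q) (@tgt Q) A sp -> qreal A sp fam0 X -> pclass X al ->
  aflag (@src Q) (@tgt Q) A false w sp fam0 <-> dtest w al.
Proof.
move=> ssp qX cX; have dX i : \dim (sp i) = dynkin_dim al i.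
  by rewrite -(dclass_dim cX) -(amb_dimf qX).
have rE := rtest_ach (Dl w) as_ ssp (fun i => dfinal i ssp).
rewrite (rtest_dvec _ ssp qX cX) in rE.
split=> [/aflag_ach[dw /rE rt]|/andP[/forallP dw /rE aw]].
  by rewrite /dtest rt andbT; apply/forallP => i; rewrite -dX dw.
by apply/aflag_ach; split=> // i; rewrite dX (eqP (dw i)).
Qed.

Lemma dcount p : prime p -> forall (V : vectType 'F_p)
    (A : arrow Q -> 'End(V)) sp d (X : rep 'F_p d) (al : dynkin_param Q) w,
  stable (@src Q) (@tgt Q) A sp -> qreal A sp fam0 X -> pclass X al ->
  nfl (@src Q) (@tgt Q) A false w sp = dtest w al %[mod p].
Proof.
move=> pp V A sp d X al w ssp qX cX; have dX i : \dim (sp i) = dynkin_dim al i.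
  by rewrite -(dclass_dim cX) -(amb_dimf qX).
have rE := rtest_cnt (Dl w) as_ ssp (fun i => dfinal i ssp).
rewrite (rtest_dvec _ ssp qX cX) card_Fp // in rE.
rewrite nfl_cnt -modnMmr rE modnMmr mulnb /dtest; congr (_ && _ %% _)%N.
by apply: eq_forallb => i; rewrite dX eq_sym.
Qed.

Lemma dword : exists (o : dynkin_param Q -> seq (dimvec Q)) (h : dynkin_param Q -> nat), forall al,
  dtest (o al) al /\ forall be, dtest (o al) be -> be <> al -> (h al < h be)%N.
Proof.
have q1 (al : dynkin_class Q) : {in denc al, forall b : root, tq sr tg (zv (root_dim b)) = 1}.
  by move=> b _; exact: root_tq.
have kl (al : dynkin_class Q) : {in denc al, forall (b : root) i, rss sr tg s (root_dim b) i = 0%N}.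
  by move=> b _; exact: kill (root_tq b).
exists (fun al => om sr tg s (@root_dim Q) (@root_dim Q) (denc al)).
(* The height adds up the dimensions at all stages: passing the test of [al] makes each of them at
   least as large as for [al]. *)
exists (fun al => \sum_(k < (size s).+1) \sum_i dvec al k i)%N => al.
have wE i : wdim (om sr tg s (@root_dim Q) (@root_dim Q) (denc al) : seq (dimvec Q)) i = dynkin_dim al i.
  by rewrite (wdim_om _ i pB as_ (q1 al) (kl al)) /dynkin_dim -sum_denc.
have DE := Dl_om (@root_dim Q) pB as_ (q1 al) (kl al).
split.
  rewrite /dtest DE; apply/andP; split; first by apply/forallP => i; rewrite wE.
  exact: (rtest_om 0 pB as_ (q1 al) (kl al)).
move=> be /andP[/forallP dw]; rewrite DE => rt nab.
have ge : forall k i, (k <= size s)%N -> (dvec al k i <= dvec be k i)%N.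
  apply: (rtest_om_ge (m := 0) pB as_ (q1 al) _ rt) => i.
  have -> : (\sum_(b <- denc al) root_dim b i = dynkin_dim al i)%N by rewrite sum_denc.
  by rewrite dvec0 -(eqP (dw i)) wE.
rewrite ltn_neqAle leq_sum ?andbT; last first.
  by move=> k _; apply: leq_sum => i _; apply: ge; rewrite -ltnS.
(* Equal heights force equal dimensions at all stages, and these determine the class. *)
apply/eqP => e; apply: nab; apply: esym; apply: denc_inj; apply: dinv0_inj => -[k i].
have eqk : forall (k : 'I_(size s).+1) i, dvec al k i = dvec be k i.
  move=> k' i'; have lek (k'' : 'I_(size s).+1) j : (dvec al k'' j <= dvec be k'' j)%N.
    by apply: ge; rewrite -ltnS.
  apply: (sum_leq_eq (lek k')).
  have les (k'' : 'I_(size s).+1) : (\sum_i dvec al k'' i <= \sum_i dvec be k'' i)%N.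
    by apply: leq_sum => j _; exact: lek.
  exact: (sum_leq_eq les e k').
case: (ltnP k (size s).+1) => [lt|ge_]; first exact: (eqk (Ordinal lt) i).
have big0 al' : (\sum_(b <- denc al') dinv0 b (k, i) = 0)%N.
  rewrite big1 // => b _; rewrite /dinv0 /= vinv_big ?vinv_size; last exact: ltnW.
  exact: kill (root_tq b) i.
by rewrite !big0.
Qed.

Lemma dclosed (F : fieldType) w : zclosed (@Rset Q F false w).
Proof.
have -> : @Rset Q F false w =
  [set X : @rep Q F (wdim w) | ach sr tg (@amb_map Q F _ X) (Dl w) (amb_sp F (wdim w))]%classic.
  apply/seteqP; split=> X /=; have sX := amb_stable X; have qX := amb_real X;
    have h := Rset_flag false sX (fam0_stable _ _ _) qX.
    by move/h/aflag_ach => [].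
  move=> aw; apply/h/aflag_ach; split=> // i.
  by have := congr1 (@^~ i) (amb_dimf qX).
apply: zclosed_ach as_ _ _ _ _ => [x|i|X|X i].
- apply: lfpoly_mxlf => j k.
  have PA := polyfn_alg F (wdim w).
  apply: (funmx_mul PA); last exact: (funmx_const PA).
  apply: (funmx_mul PA); first exact: (funmx_const PA).
  by move=> j' k'; exact: polyfn_entry.
- have kl := @kerfam_lker Q F (wdim w) _ _ _ (@lfpoly_const Q F (wdim w) _ _
    (mxlf (cokermx (amb_in F (wdim w) i)))).
  apply: (kerfam_eq kl) => X v; rewrite memv_ker mxlfE ffunE mem_rowsp; exact: submxE.
- exact: (@amb_stable Q F _ X).
- exact: dfinal (amb_stable X).
Qed.

Theorem dynkin_hall_case : @hall_case Q (dynkin_param Q) false dtest.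
Proof.
have cex := list_ex dgood_ex denc_class.
have ciso := list_iso dgood_iso dgood_inv dinv_add dinv_fam0 dinv0_inj denc_class denc_inj.
split=> //.
- exact: dclass_dim.
- by move=> F d M; exact: (list_class dgood_iso dgood_ex dgood_ind denc_class denc_surj).
- by move=> F d M g _; exact: all_nilpotent.
- move=> F; apply/denc_class; rewrite /denc finsupp0; exists (fun=> existT _ _ (@rep0 Q F)).
  by split=> //; exact: iso_refl.
- apply: finite_classes => //; exact: dclass_dim.
- exact: dflag.
- exact: dcount.
- exact: dword.
- exact: dclosed.
- by move=> F w X _; exact: all_nilpotent.
Qed.

End DynkinCase.

Lemma dynkin_case (Q : quiver) : is_dynkin Q -> exists t, @hall_case Q (dynkin_param Q) false t.
Proof.
case: Q => I E sr tg hQ; have [B pB'] := dynkin_pdb hQ.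
have pB : pdb sr tg B := pB'.
have [s [as_ kl]] := killing_sequence pB.
have [so [aso klo]] := killing_sequence (pdb_op pB).
by exists (dtest s); exact: (dynkin_hall_case pB as_ kl aso klo).
Qed.

(** * Strings of the cyclic quiver *)

Definition comb (F : fieldType) (V : vectType F) l (y : 'I_l -> V) (c : 'rV[F]_l) : V :=
  \sum_m c 0 m *: y m.

Fact comb_is_linear (F : fieldType) (V : vectType F) l (y : 'I_l -> V) : linear (comb y).
Proof.
move=> a u v; rewrite /comb scaler_sumr -big_split /=; apply: eq_bigr => m _.
by rewrite !mxE scalerDl scalerA.
Qed.

HB.instance Definition _ (F : fieldType) (V : vectType F) l (y : 'I_l -> V) :=
  GRing.isLinear.Build F 'rV[F]_l V _ (comb y) (comb_is_linear y).

Section CyclicQuiver.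
Variables (n : nat) (F : fieldType).
Local Notation I := 'I_n.+1.
Local Notation CQ := (cyclic_quiver n).
Local Notation vt tau m := (iter m (@ordS n.+1) tau).
Local Notation st k j := (iter k (@ord_pred n.+1) j).

Lemma ordS_inj : injective (@ordS n.+1).
Proof. exact: (can_inj (@ordSK n.+1)). Qed.

Lemma vt_inj m : injective (fun i : I => vt i m).
Proof. by elim: m => //= m IH i j /ordS_inj/IH. Qed.

Lemma vt_st k (j : I) : vt (st k j) k = j.
Proof. by elim: k j => //= k IH j; rewrite -iterS iterSr ord_predK IH. Qed.

Lemma vt_val (i : I) m : (vt i m : nat) = ((i + m) %% n.+1)%N.
Proof.
elim: m => [|m IH] /=; first by rewrite addn0 modn_small.
by rewrite IH -addn1 modnDml addn1 addnS.
Qed.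

Section Paths.
Variables (V : vectType F) (A : I -> 'End(V)).
Implicit Types (sp U R : {ffun I -> {vspace V}}).
Local Notation stab := (stable (@src CQ) (@tgt CQ) A).
Local Notation rd := (@radf CQ F V A).

Fixpoint pf (i : I) k : 'End(V) := if k is k'.+1 then (pf (ordS i) k' \o A i)%VF else \1%VF.

Lemma pfS i k v : pf i k.+1 v = pf (ordS i) k (A i v).
Proof. by rewrite /= comp_lfunE. Qed.

Lemma pf_add i m k v : pf (vt i m) k (pf i m v) = pf i (m + k) v.
Proof.
elim: m i v => [|m IH] i v; first by rewrite /= id_lfunE.
by rewrite addSn !pfS -IH -iterSr.
Qed.

Lemma pfSr i k v : A (vt i k) (pf i k v) = pf i k.+1 v.
Proof. by have := pf_add i k 1 v; rewrite addn1 pfS /= id_lfunE. Qed.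

Lemma radE sp j : rd sp j = (A (ord_pred j) @: sp (ord_pred j))%VS.
Proof.
rewrite ffunE (big_pred1 (ord_pred j)) // => x.
by apply/eqP/eqP => [<-|->] /=; rewrite ?ordSK ?ord_predK.
Qed.

Lemma iter_radE k sp j : iter k rd sp j = (pf (st k j) k @: sp (st k j))%VS.
Proof.
elim: k j => [|k IH] j; first by rewrite /= lim1g.
rewrite [LHS]/= radE IH -limg_comp iterSr; congr (_ @: _)%VS.
apply/lfunP => v; rewrite comp_lfunE.
by rewrite -[X in A X _](vt_st k (ord_pred j)) pfSr.
Qed.

Lemma pf_in sp i k v : stab sp -> v \in sp i -> pf i k v \in sp (vt i k).
Proof.
move=> /stableP ssp; elim: k i v => [|k IH] i v vi; first by rewrite /= id_lfunE.
rewrite pfS iterSr; apply: IH; exact: (ssp i).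
Qed.

Lemma pf_iter_rad sp i k v : v \in sp i -> pf i k v \in iter k rd sp (vt i k).
Proof.
move=> vi; rewrite iter_radE.
have -> : st k (vt i k) = i by apply: (@vt_inj k); rewrite vt_st.
exact: memv_img.
Qed.

(* A nonzero vector at the end of the path from [x] makes the vectors along
   the path that lie at one vertex linearly independent. *)
Lemma path_independent tau x l i (P : pred 'I_l) : (0 < l)%N -> pf tau l.-1 x != 0 ->
  pf tau l x = 0 -> (forall m, P m -> vt tau m = i) ->
  directv (\sum_(m < l | P m) <[pf tau m x]>)%VS.
Proof.
move=> l0 nz z Pi; apply/directv_sum_independent => us usP us0.
suff h : forall M (m : 'I_l), (m < M)%N -> P m -> us m = 0 by move=> m; exact: (h l).
have zk k : (l <= k)%N -> pf tau k x = 0.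
  by move=> lk; rewrite -(subnKC lk) -pf_add z lf0.
elim=> // M IH m; rewrite ltnS leq_eqVlt => /predU1P[mM Pm|]; last exact: IH.
have /vlineP[c cE] := usP m Pm.
have : pf i (l.-1 - m) (\sum_(m' | P m') us m') = 0 by rewrite us0 lf0.
rewrite (bigD1 m) //= lfD linear_sum /= big1 ?addr0.
  rewrite cE -(Pi m Pm) lfZ pf_add subnKC; last by rewrite -ltnS prednK.
  by move/eqP; rewrite scaler_eq0 (negPf nz) orbF => /eqP ->; rewrite scale0r.
move=> m' /andP[Pm' nm]; have [lt|ge] := ltnP m' M; first by rewrite (IH m' lt Pm') lf0.
have /vlineP[c' ->] := usP m' Pm'.
rewrite -(Pi m' Pm') lfZ pf_add zk ?scaler0 //.
have : (m : nat) != m' by rewrite eq_sym; exact: nm.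
by have := ltn_ord m; lia.
Qed.

Lemma dim_path tau x l i (P : pred 'I_l) : (0 < l)%N -> pf tau l.-1 x != 0 ->
  pf tau l x = 0 -> (forall m, P m -> vt tau m = i) ->
  \dim (\sum_(m < l | P m) <[pf tau m x]>)%VS = (\sum_(m < l | P m) 1)%N.
Proof.
move=> l0 nz z Pi; have /directvP -> := path_independent l0 nz z Pi.
apply: eq_bigr => m _; rewrite /= dim_vline; case: eqP => // x0; case/eqP: nz.
have ml : (m <= l.-1)%N by rewrite -ltnS prednK.
by rewrite -(subnKC ml) -pf_add x0 lf0.
Qed.

(** The subrepresentation generated by [x], provided the path of length [l] kills [x]. *)
Definition strand tau x l : {ffun I -> {vspace V}} :=
  [ffun i => (\sum_(m < l | vt tau m == i) <[pf tau m x]>)%VS].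

Lemma strandP tau x l m : (m < l)%N -> pf tau m x \in strand tau x l (vt tau m).
Proof.
by move=> ml; rewrite ffunE memvE (sumv_sup (Ordinal ml)) //=.
Qed.

Lemma strand_stable tau x l : pf tau l x = 0 -> stab (strand tau x l).
Proof.
move=> z; apply/stableP => i v; rewrite [strand _ _ _ _]ffunE => /memv_sumP[u uP ->].
rewrite linear_sum /=; apply: memv_suml => m /eqP vm.
have vm' : vt tau m = i := vm.
have /vlineP[c ->] := uP m (introT eqP vm); rewrite lfZ memvZ //.
have -> : A i (pf tau m x) = pf tau m.+1 x by rewrite -[X in A X]vm' pfSr.
have [->|nm] := eqVneq m.+1 l; first by rewrite z mem0v.
suff : pf tau m.+1 x \in strand tau x l (vt tau m.+1) by rewrite iterS vm'.
by apply: strandP; have := ltn_ord m; lia.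
Qed.

Lemma strand_fle sp tau x l : stab sp -> x \in sp tau -> fle (strand tau x l) sp.
Proof.
move=> ssp xt; apply/fleP => i v; rewrite ffunE => /memv_sumP[u uP ->].
apply: memv_suml => m vm; have /vlineP[c ->] := uP m vm.
by rewrite memvZ // -(eqP vm) pf_in.
Qed.

Lemma dim_strand tau x l i : (0 < l)%N -> pf tau l.-1 x != 0 -> pf tau l x = 0 ->
  \dim (strand tau x l i) = (\sum_(m < l | vt tau m == i) 1)%N.
Proof.
by move=> l0 nz z; rewrite ffunE; apply: (dim_path (i := i) l0 nz z) => m /eqP.
Qed.

(* The complement of a strand of maximal length, cut out by a functional that
   does not vanish at the end of the strand. *)
Lemma strand_splits sp l tau x : stab sp -> (0 < l)%N ->
  iter l rd sp = fam0 -> x \in sp tau -> pf tau l.-1 x != 0 ->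
  exists R, @dsumf CQ F V A sp (strand tau x l) R.
Proof.
move=> ssp l0 rl xt nz.
have zl i v : v \in sp i -> pf i l v = 0.
  by move=> vi; apply/eqP; rewrite -memv0; have := pf_iter_rad l vi; rewrite rl ffunE.
have z := zl _ _ xt.
have zk k : (l <= k)%N -> pf tau k x = 0.
  by move=> lk; rewrite -(subnKC lk) -pf_add z lf0.
have [lam lam1] : exists lam : 'Hom(V, 'rV[F]_1), lam (pf tau l.-1 x) != 0.
  have [|lam [_ kl]] := @lcoord F V <[pf tau l.-1 x]>%VS 0%VS 1 (sub0v _).
    by rewrite dim_vline nz dimv0.
  exists lam; apply/eqP => l0'; case/eqP: nz; apply/eqP; rewrite -memv0 -kl memv_cap memv_line.
  by rewrite memv_ker l0' eqxx.
(* [R] consists of the vectors that [lam] does not see after the paths leading to the end of the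
   strand. It is stable because paths of length [l] vanish. *)
pose R : {ffun I -> {vspace V}} := [ffun i =>
  (sp i :&: \bigcap_(m < l | vt tau m == i) lker (lam \o pf i (l.-1 - m)))%VS].
have mR i v : reflect (v \in sp i /\ forall m : nat, (m < l)%N -> vt tau m = i ->
    lam (pf i (l.-1 - m) v) = 0) (v \in R i).
  rewrite ffunE memv_cap; apply: (iffP andP) => -[vi h]; split=> //.
    move=> m ml vm; move: h; rewrite memvE => /subv_bigcapP/(_ (Ordinal ml)).
    by rewrite vm eqxx -memvE memv_ker comp_lfunE => /(_ isT)/eqP.
  rewrite memvE; apply/subv_bigcapP => m /eqP vm; rewrite -memvE memv_ker comp_lfunE.
  by rewrite h.
have sR : stab R.
  apply/stableP => i v /mR[vi h]; apply/mR; split; first by move/stableP: ssp; apply.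
  move=> [|m] ml vm.
    rewrite subn0; have := zl _ _ vi; rewrite -(prednK l0) pfS.
    rewrite -[@tgt CQ i]/(ordS i) => ->; exact: lf0.
  have vm' : vt tau m = i by apply: ordS_inj; rewrite -iterS.
  have := h m (ltnW ml) vm'.
  have -> : (l.-1 - m = (l.-1 - m.+1).+1)%N by lia.
  by rewrite pfS.
exists R; split=> [||i|i]; [exact: strand_stable|exact: sR| |].
  have Rsp : (R i <= sp i)%VS by apply/subvP => v /mR[].
  apply/eqP; rewrite eqEsubv subv_add (forallP (strand_fle l ssp xt) i) Rsp /=.
  apply/subvP => v vi.
  (* The strand coordinates of [v] are removed in the order of the position [M]. The correction at
     [M] leaves the earlier conditions intact, since the paths involved there have total length at
     least [l]. *)
  have h M : (M <= l)%N -> exists2 u, u \in strand tau x l i & forall m : nat, (m < M)%N ->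
      vt tau m = i -> lam (pf i (l.-1 - m) (v - u)) = 0.
    elim: M => [_|M IH lM]; first by exists 0; rewrite ?mem0v.
    have [u us hu] := IH (ltnW lM).
    have [vM|nM] := eqVneq (vt tau M) i; last first.
      exists u => // m; rewrite ltnS leq_eqVlt => /predU1P[->|]; last exact: hu.
      by move/eqP; rewrite (negPf nM).
    pose c := lam (pf i (l.-1 - M) (v - u)) 0 0 / lam (pf tau l.-1 x) 0 0.
    have lam0 : lam (pf tau l.-1 x) 0 0 != 0.
      by apply: contra lam1 => /eqP e; apply/eqP/rowP => j; rewrite [j]ord1 e mxE.
    exists (u + c *: pf tau M x).
      by rewrite memvD // memvZ // -vM strandP.
    move=> m mM vm; rewrite opprD addrA lfB [in X in _ - X]lfZ lfB lfZ.
    rewrite -[X in pf X _ (pf tau M x)]vM pf_add.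
    move: mM; rewrite ltnS leq_eqVlt => /predU1P[->|mM]; last first.
      by rewrite hu // zk ?lf0 ?scaler0 ?subr0 //; lia.
    rewrite subnKC; last by lia.
    by apply/rowP => j; rewrite [j]ord1 !mxE /c mulfVK ?subrr.
  have [u us hu] := h l (leqnn l).
  have -> : v = u + (v - u) by rewrite addrC subrK.
  apply: memv_add => //; apply/mR; split; last exact: hu.
  by apply: memvB => //; exact: (subvP (forallP (strand_fle l ssp xt) i)).
apply/eqP; rewrite -subv0; apply/subvP => v; rewrite memv_cap memv0 => /andP[vs /mR[_ h]].
move: vs; rewrite ffunE => /memv_sumP[u uP vE].
suff u0 : forall M (m : 'I_l), (m < M)%N -> vt tau m == i -> u m = 0.
  by rewrite vE big1 // => m; exact: (u0 l).
elim=> // M IH m; rewrite ltnS leq_eqVlt => /predU1P[mM vm|]; last exact: IH.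
have /vlineP[c cE] := uP m vm.
have := h m (ltn_ord m) (eqP vm); rewrite vE (bigD1 m) //= lfD linear_sum /= big1 ?addr0.
  rewrite cE -[X in pf X]((eqP vm)) lfZ pf_add subnKC; last by rewrite -ltnS prednK.
  by rewrite lfZ => /eqP; rewrite scaler_eq0 (negPf lam1) orbF => /eqP ->; rewrite scale0r.
move=> m' /andP[vm' nm]; have [lt|ge] := ltnP m' M; first by rewrite (IH m' lt vm') lf0.
have /vlineP[c' ->] := uP m' vm'.
rewrite -[X in pf X](eqP vm') lfZ pf_add zk ?scaler0 //.
have : (m : nat) != m' by rewrite eq_sym; exact: nm.
by have := ltn_ord m; lia.
Qed.

(* [U] is uniserial of length [l], generated by [x] at the vertex [tau]. *)
Definition unis U tau x l := [/\ (0 < l)%N, pf tau l.-1 x != 0, pf tau l x = 0 & U = strand tau x l].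

(** A vector with a nonzero path of the maximal length [N.-1] generates a strand that splits off,
    and indecomposability makes this strand everything. *)
Lemma aindec_unis sp : stab sp -> @nilA CQ F V A sp fam0 -> @aindec CQ F V A sp ->
  exists tau x l, unis sp tau x l.
Proof.
move=> ssp [N0 nN0] [nz ind].
have ex : exists N, iter N rd sp == fam0.
  by exists N0; apply/eqP/fle_anti; [exact: nN0|exact: fle0].
pose N := ex_minn ex.
have rN : iter N rd sp = fam0 by rewrite /N; case: ex_minnP => m /eqP.
have minN m : iter m rd sp == fam0 -> (N <= m)%N by rewrite /N; case: ex_minnP => k _; apply.
have N1 : (0 < N)%N by rewrite lt0n; apply/eqP => N0'; apply: nz; move: rN; rewrite N0'.
have : iter N.-1 rd sp != fam0 by apply/negP => /minN; lia.
move=> /eqP ne; have [j jP] : exists j, iter N.-1 rd sp j != 0%VS.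
  apply: contrapT => h; apply: ne; apply/ffunP => j; rewrite ffunE; apply/eqP/negPn/negP => hj.
  by apply: h; exists j.
have /subvPn[y yj] : ~~ (iter N.-1 rd sp j <= 0)%VS by rewrite subv0.
move: yj; rewrite iter_radE => /memv_imgP[x xt ->]; rewrite memv0 => x0.
have [R d] := strand_splits ssp N1 rN xt x0.
have z : pf (st N.-1 j) N x = 0.
  by apply/eqP; rewrite -memv0; have := pf_iter_rad N xt; rewrite rN ffunE.
exists (st N.-1 j), x, N; split=> //.
have [s0|R0] := ind _ _ d.
  have := strandP (st N.-1 j) x (_ : (N.-1 < N)%N); rewrite s0 ffunE memv0 (negPf x0).
  by rewrite prednK // => /(_ (leqnn _)).
have [_ _ UR _] := d; apply/ffunP => i; by rewrite -UR R0 [fam0 _]ffunE addv0.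
Qed.

Lemma unis_nil U tau x l : unis U tau x l -> iter l rd U = fam0.
Proof.
move=> [l0 nz z ->]; apply/ffunP => j; rewrite iter_radE [fam0 _]ffunE; apply/eqP; rewrite -subv0.
apply/subvP => w /memv_imgP[v + ->]; rewrite ffunE => /memv_sumP[u uP ->].
rewrite linear_sum memv0 big1 //= => m vm; have /vlineP[c ->] := uP m vm.
by rewrite -(eqP vm) lfZ pf_add addnC -pf_add z lf0 scaler0.
Qed.

Lemma unis_gen U tau x l : unis U tau x l -> x \in U tau.
Proof.
by move=> [l0 _ _ ->]; have := strandP tau x l0; rewrite /= id_lfunE.
Qed.

Lemma unis_stable U tau x l : unis U tau x l -> stab U.
Proof. by move=> [_ _ z ->]; exact: strand_stable. Qed.

(** One of the two components of the generator [x] has a nonzero path of length [l.-1]. Its strand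
    has the dimensions of all of [U], which leaves 0 for the other summand. *)
Lemma unis_aindec U tau x l : unis U tau x l -> @aindec CQ F V A U.
Proof.
move=> un; have [l0 nz z UE] := un; have xU := unis_gen un.
split=> [U0|P P' d].
  by move: xU nz; rewrite U0 ffunE memv0 => /eqP ->; rewrite lf0 eqxx.
have rl := unis_nil un.
have main P1 P2 p : @dsumf CQ F V A U P1 P2 -> p \in P1 tau -> pf tau l.-1 p != 0 -> P2 = fam0.
  move=> d1 pP nzp; have [s1 _ _ _] := d1; have [P1U _] := dsumf_fle d1.
  have zp : pf tau l p = 0.
    apply/eqP; rewrite -memv0; have := pf_iter_rad l (fleP _ _ P1U _ _ pP); by rewrite rl ffunE.
  have le (i : I) : (\dim (strand tau p l i) <= \dim (P1 i))%N.
    exact: dimvS (forallP (strand_fle l s1 pP) i).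
  apply/ffunP => i; rewrite ffunE; apply/eqP; rewrite -dimv_eq0.
  have := le i; rewrite (dim_strand i l0 nzp zp) -(dim_strand i l0 nz z) -UE.
  have e : (\dim (U i) = \dim (P1 i) + \dim (P2 i))%N := dsumf_dim (i : vert CQ) d1.
  by rewrite e; lia.
have [sP sP' PP _] := d.
move: xU; rewrite -[U tau](PP tau) => /memv_addP[p pP [p' pP' xE]].
have [p0|np] := eqVneq (pf tau l.-1 p) 0; last by right; exact: main d pP np.
left; apply: (main _ _ p' (dsumf_sym d) pP').
by move: nz; rewrite xE lfD p0 add0r.
Qed.

Lemma unis_rank U tau x l k j : unis U tau x l ->
  \dim (iter k rd U j) = (\sum_(m < l - k) (vt tau (m + k) == j))%N.
Proof.
move=> [l0 nz z ->]; rewrite iter_radE.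
have zk k' : (l <= k')%N -> pf tau k' x = 0.
  by move=> lk; rewrite -(subnKC lk) -pf_add z lf0.
have -> : (pf (st k j) k @: strand tau x l (st k j))%VS =
    (\sum_(0 <= m < l | vt tau (m + k) == j) <[pf tau (m + k) x]>)%VS.
  rewrite ffunE limg_sum big_mkord; apply: eq_big => m.
    rewrite -[in RHS](vt_st k j) addnC iterD.
    by apply/eqP/eqP => [->//|/vt_inj].
  by move=> /eqP vm; rewrite limg_line -[X in pf X k]vm pf_add.
have [lk|kl] := leqP l k.
  have -> : (l - k = 0)%N by apply/eqP.
  by rewrite big_ord0 big1 ?dimv0 // => m _; rewrite zk ?(leq_trans lk) ?leq_addl //; apply/eqP;
    rewrite -dimv_eq0 dim_vline eqxx.
rewrite (big_cat_nat _ (n := l - k)) ?leq_subr //= [X in (_ + X)%VS]big_nat_cond.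
rewrite [X in (_ + X)%VS]big1 ?addv0; last first.
  move=> m /andP[/andP[lm _] _]; rewrite zk; last by lia.
  by apply/eqP; rewrite -dimv_eq0 dim_vline eqxx.
rewrite big_mkord.
have -> : (\sum_(m < l - k | vt tau (m + k) == j) <[pf tau (m + k) x]>)%VS =
    (\sum_(m < l - k | vt tau (m + k) == j) <[pf (vt tau k) m (pf tau k x)]>)%VS.
  by apply: eq_bigr => m _; rewrite pf_add addnC.
rewrite (@dim_path (vt tau k) (pf tau k x) (l - k) j); rewrite ?subn_gt0 ?pf_add //.
- by rewrite big_mkcond; apply: eq_bigr => m _; case: eqP.
- by have -> : (k + (l - k).-1 = l.-1)%N by lia.
- by rewrite subnKC ?(ltnW kl).
- by move=> m /eqP <-; rewrite -iterD.
Qed.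

End Paths.

(* Independence makes the assignment of corresponding path vectors well defined. *)
Lemma unis_aiso (V1 V2 : vectType F) (A1 : I -> 'End(V1)) (A2 : I -> 'End(V2))
    (U1 : {ffun I -> {vspace V1}}) (U2 : {ffun I -> {vspace V2}}) tau x1 x2 l :
  unis A1 U1 tau x1 l -> unis A2 U2 tau x2 l ->
  aiso (@src CQ) (@tgt CQ) A1 A2 U1 U2.
Proof.
move=> [l0 nz1 z1 ->] [_ nz2 z2 ->].
pose W i : {vspace 'rV[F]_l} := (\sum_(m < l | vt tau m == i) <[delta_mx 0%R m]>)%VS.
have evd (V : vectType F) (y : 'I_l -> V) m : linfun (comb y) (delta_mx 0 m) = y m.
  rewrite lfunE /= /comb (bigD1 m) //= mxE !eqxx scale1r big1 ?addr0 // => m' /negPf nm.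
  by rewrite mxE eqxx nm scale0r.
have evW (V : vectType F) (A : I -> 'End(V)) x i :
    (linfun (comb (fun m : 'I_l => pf A tau m x)) @: W i = strand A tau x l i)%VS.
  by rewrite ffunE limg_sum; apply: eq_bigr => m _; rewrite limg_line evd.
have evK (V : vectType F) (A : I -> 'End(V)) x i : pf A tau l.-1 x != 0 -> pf A tau l x = 0 ->
    (W i :&: lker (linfun (comb (fun m : 'I_l => pf A tau m x))) = 0)%VS.
  move=> nz z; apply/eqP; rewrite -dimv_eq0.
  have := limg_ker_dim (linfun (comb (fun m : 'I_l => pf A tau m x))) (W i).
  rewrite evW dim_strand //; have : (\dim (W i) <= \sum_(m < l | vt tau m == i) 1)%N.
    apply: leq_trans (dimv_leq_sum _ _ _) _; apply: leq_sum => m _.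
    by rewrite dim_vline leq_b1.
  by move=> le e; move: le; rewrite -e -[leqRHS]add0n leq_add2r leqn0.
have /boolp.choice[h hP] : forall i, exists h : 'Hom(V1, V2), {in W i, forall c,
    linfun (comb (fun m : 'I_l => pf A2 tau m x2)) c =
    h (linfun (comb (fun m : 'I_l => pf A1 tau m x1)) c)}.
  by move=> i; apply: lfactor; rewrite evK // sub0v.
have dW (m : 'I_l) : delta_mx 0 m \in W (vt tau m) by rewrite memvE (sumv_sup m).
have hm m : (m < l)%N -> h (vt tau m) (pf A1 tau m x1) = pf A2 tau m x2.
  by move=> ml; have := hP _ _ (dW (Ordinal ml)); rewrite !evd.
exists h; split=> [i|i v|i v].
- rewrite -!evW -limg_comp; apply/vspaceP => w.
  have e c : c \in W i -> (h i \o linfun (comb (fun m : 'I_l => pf A1 tau m x1)))%VF c =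
      linfun (comb (fun m : 'I_l => pf A2 tau m x2)) c by move=> ci; rewrite comp_lfunE; exact: esym (hP i c ci).
  by apply/memv_imgP/memv_imgP => -[c ci ->]; exists c; rewrite // e.
- rewrite -evW => /memv_imgP[c ci ->]; rewrite -(hP i c ci) => c0.
  have : c \in (W i :&: lker (linfun (comb (fun m : 'I_l => pf A2 tau m x2))))%VS.
    by rewrite memv_cap ci memv_ker c0 eqxx.
  by rewrite evK // memv0 => /eqP ->; rewrite lf0.
- rewrite ffunE => /memv_sumP[u uP ->]; rewrite !linear_sum /=; apply: eq_bigr => m vm.
  have vm' : vt tau m = i by apply/eqP.
  have /vlineP[c ->] := uP m vm; rewrite !lfZ; congr (_ *: _).
  have -> : A1 i (pf A1 tau m x1) = pf A1 tau m.+1 x1 by rewrite -[X in A1 X]vm' pfSr.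
  have -> : h i (pf A1 tau m x1) = pf A2 tau m x2 by rewrite -[X in h X]vm' hm.
  have -> : A2 i (pf A2 tau m x2) = pf A2 tau m.+1 x2 by rewrite -[X in A2 X]vm' pfSr.
  have [->|nm] := eqVneq m.+1 l; first by rewrite z1 z2 lf0.
  have -> : h (ordS i) (pf A1 tau m.+1 x1) = h (vt tau m.+1) (pf A1 tau m.+1 x1) by rewrite iterS vm'.
  by apply: hm; have := ltn_ord m; lia.
Qed.

(** One nilpotent Jordan block acts as every arrow, and [strand] distributes its basis over the
    vertices. *)
Lemma unis_exists tau l : (0 < l)%N ->
  exists (V : vectType F) (A : I -> 'End(V)) U x, unis A U tau x l.
Proof.
move=> l0; pose sh : 'End('rV[F]_l) := mxlf (\matrix_(i < l, j < l) (j == i.+1 :> nat)%:R).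
have shd (m : 'I_l) : sh (delta_mx 0 m) = \row_j (j == m.+1 :> nat)%:R.
  by apply/rowP => j; rewrite mxlfE -rowE !mxE.
pose x : 'rV[F]_l := \row_j (j == 0 :> nat)%:R.
have px i k : pf (fun _ : I => sh) i k x = \row_j (j == k :> nat)%:R.
  elim: k i => [|k IH] i; first by rewrite /= id_lfunE.
  rewrite -pfSr IH; have [kl|lk] := ltnP k l.
    have -> : \row_j (j == k :> nat)%:R = delta_mx 0 (Ordinal kl) :> 'rV[F]_l.
      by apply/rowP => j; rewrite !mxE eqxx.
    by rewrite shd.
  have -> : \row_j (j == k :> nat)%:R = 0 :> 'rV[F]_l.
    by apply/rowP => j; rewrite !mxE; case: eqP => // e; have := ltn_ord j; lia.
  rewrite lf0; apply/rowP => j; rewrite !mxE; case: eqP => // e; have := ltn_ord j; lia.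
exists 'rV[F]_l, (fun=> sh), (strand (fun=> sh) tau x l), x; split=> //; rewrite px.
  have ll : (l.-1 < l)%N by rewrite prednK.
  apply/eqP => /rowP/(_ (Ordinal ll)); rewrite !mxE eqxx => /eqP; by rewrite oner_eq0.
by apply/rowP => j; rewrite !mxE; case: eqP => // e; have := ltn_ord j; lia.
Qed.

End CyclicQuiver.

(** * The flag test of the cyclic quiver *)

Section RelativeRank.
Variables (F : fieldType) (V W' : vectType F) (f : 'Hom(V, W')).
Implicit Types S T X : {vspace V}.

(** For [T] of given dimension, its rank and its intersection with [S + (X :&: lker f)] determine
    each other's dimensions. This puts ranks into the form required by [grass_adapted]. *)
Lemma rank_cap S T X : (S <= T)%VS -> (T <= X)%VS ->
  (\dim (f @: T) + \dim (T :&: (S + (X :&: lker f))) = \dim T + \dim (f @: S))%N.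
Proof.
move=> ST TX.
have -> : (T :&: (S + (X :&: lker f)) = S + (T :&: lker f))%VS.
  apply/eqP; rewrite eqEsubv; apply/andP; split; apply/subvP => v.
    rewrite memv_cap => /andP[vT /memv_addP[u uS [w]]]; rewrite memv_cap => /andP[wX wk] vE.
    rewrite vE memv_add // memv_cap wk andbT.
    have -> : w = v - u by rewrite vE addrC addKr.
    by apply: memvB => //; exact: (subvP ST).
  move=> /memv_addP[u uS [w]]; rewrite memv_cap => /andP[wT wk] ->.
  rewrite memv_cap; apply/andP; split; first by apply: memvD => //; exact: (subvP ST).
  by apply: memv_add => //; rewrite memv_cap wk andbT; exact: (subvP TX).
have h1 := limg_ker_dim f T; have h2 := limg_ker_dim f S.
have h3 := dimv_add_leqif S (T :&: lker f).
have h4 := dimv_sum_cap S (T :&: lker f).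
have e : (S :&: (T :&: lker f) = S :&: lker f)%VS by rewrite capvA (capv_idPl ST).
by rewrite e in h4; lia.
Qed.

Lemma rank_ge S T X : (S <= T)%VS -> (T <= X)%VS ->
  (maxn (\dim (f @: S)) (\dim (f @: X) - (\dim X - \dim T)) <= \dim (f @: T))%N.
Proof.
move=> ST TX; rewrite geq_max dimvS ?limgS //=.
have h1 := limg_ker_dim f T; have h2 := limg_ker_dim f X.
have h3 := dimvS (capvS TX (subvv (lker f))); have h4 := dimvS TX; lia.
Qed.

(** A comparable [T] attains the bound of [rank_ge]: inside [S + (X :&: lker f)] it has the image of
    [S], and otherwise it contains the whole kernel. *)
Lemma rank_adapted S T X : (S <= T)%VS -> (T <= X)%VS ->
  compv T (S + (X :&: lker f))%VS ->
  \dim (f @: T) = maxn (\dim (f @: S)) (\dim (f @: X) - (\dim X - \dim T)).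
Proof.
move=> ST TX /orP[TC|CT]; apply/eqP; rewrite eqn_leq rank_ge // andbT leq_max.
  have := rank_cap ST TX; rewrite (capv_idPl TC); have := dimvS TX; by lia.
have h1 := limg_ker_dim f T; have h2 := limg_ker_dim f X.
have h5 : (X :&: lker f <= T)%VS := subv_trans (addvSr _ _) CT.
have e : (T :&: lker f = X :&: lker f)%VS.
  by apply/eqP; rewrite eqEsubv capvS //= subv_cap h5 capvSr.
by rewrite e in h1; have h4 := dimvS TX; apply/orP; right; lia.
Qed.

End RelativeRank.

Section CycleTest.
Variable n : nat.
Local Notation I := 'I_n.+1.
Local Notation CQ := (cyclic_quiver n).
Local Notation vt tau m := (iter m (@ordS n.+1) tau).
Local Notation st k j := (iter k (@ord_pred n.+1) j).
Implicit Types (d : I -> nat) (r : nat -> I -> nat) (w : seq (I -> nat)).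

(* [r k j] is the rank of the path of length [k] ending at [j]; [nx d r] are the
   least ranks on a subrepresentation of codimension [d] containing the radical. *)
Definition nx d r : nat -> I -> nat := fun k j =>
  if k is k'.+1 then maxn (r k.+1 j) (r k j - d (st k j)) else (r 0%N j - d j)%N.

Fixpoint ctest w r : bool :=
  if w is d :: w' then [forall j, (d j + r 1%N j <= r 0%N j)%N] && ctest w' (nx d r)
  else [forall j, r 0%N j == 0%N].

Lemma eq_ctest w r r' : (forall k j, (k <= size w)%N -> r k j = r' k j) -> ctest w r = ctest w r'.
Proof.
elim: w r r' => [|d w IH] r r' h /=; first by apply: eq_forallb => j; rewrite h.
congr (_ && _); first by apply: eq_forallb => j; rewrite !h.
by apply: IH => -[|k] j kw; rewrite /nx !h //= ltnW.
Qed.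

Lemma ctest_mono w r r' : (forall j, r 0%N j = r' 0%N j) -> (forall k j, (r k j <= r' k j)%N) ->
  ctest w r' -> ctest w r.
Proof.
elim: w r r' => [|d w IH] r r' h0 h /=.
  by move=> /forallP hr; apply/forallP => j; rewrite h0.
move=> /andP[/forallP hd hw]; apply/andP; split.
  by apply/forallP => j; have := hd j; have := h 1%N j; rewrite h0; lia.
apply: IH hw => [j|[|k] j]; rewrite /nx ?h0 //.
by have := h k.+2 j; have := h k.+1 j; lia.
Qed.

Section Ranks.
Variables (F : fieldType) (V : vectType F) (A : I -> 'End(V)).
Implicit Types (sp U O : {ffun I -> {vspace V}}).
Local Notation stab := (stable (@src CQ) (@tgt CQ) A).
Local Notation rd := (@radf CQ F V A).

Definition rho sp k j := \dim (iter k rd sp j).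

(** At a fixed vertex these spaces increase with [k], so one subspace adapted to the chain minimises
    the ranks of all paths from there at once. *)
Definition link sp i k : {vspace V} := (rd sp i + (sp i :&: lker (pf A i k)))%VS.

Lemma rho_step sp U d : (forall i, (rd sp i <= U i)%VS) -> (forall i, (U i <= sp i)%VS) ->
  (forall i, \dim (sp i) = \dim (U i) + d i)%N ->
  (forall j, rho U 0 j = nx d (rho sp) 0 j) /\ (forall k j, nx d (rho sp) k j <= rho U k j)%N.
Proof.
move=> rU Us dU; have e0 j : rho U 0 j = nx d (rho sp) 0 j by rewrite /nx /rho /= dU addnK.
split=> // -[|k] j; first by rewrite e0.
have := rank_ge (pf A (st k.+1 j) k.+1) (rU (st k.+1 j)) (Us (st k.+1 j)).
by rewrite /nx /rho [iter k.+2 _ _]iterSr !iter_radE dU addKn.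
Qed.

Lemma rho_adapted sp U d N : (forall i, (rd sp i <= U i)%VS) -> (forall i, (U i <= sp i)%VS) ->
  (forall i, \dim (sp i) = \dim (U i) + d i)%N ->
  (forall i k, (k < N)%N -> compv (U i) (link sp i k)) ->
  forall k j, (k < N)%N -> rho U k j = nx d (rho sp) k j.
Proof.
move=> rU Us dU cU [|k] j kN; first by rewrite (rho_step rU Us dU).1.
have := rank_adapted (rU (st k.+1 j)) (Us (st k.+1 j)) (cU (st k.+1 j) k.+1 kN).
by rewrite /nx /rho [iter k.+2 _ _]iterSr !iter_radE dU addKn.
Qed.

Lemma link_mono sp i k k' : (k <= k')%N -> (link sp i k <= link sp i k')%VS.
Proof.
move=> kk; apply: addvS => //; apply: capvS => //; apply/subvP => v.
by rewrite !memv_ker -(subnKC kk) -pf_add => /eqP ->; rewrite lf0.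
Qed.

Lemma rad_fle sp : stab sp -> fle (rd sp) sp.
Proof. by move=> ssp; rewrite rad_stable. Qed.

Lemma links_chain sp i N : stab sp -> [/\ (rd sp i <= sp i)%VS,
  {in [seq link sp i k | k <- iota 0 N], forall C, (rd sp i <= C)%VS},
  {in [seq link sp i k | k <- iota 0 N] &, forall C C', compv C C'} &
  {in [seq link sp i k | k <- iota 0 N], forall C, compv (sp i) C}].
Proof.
move=> ssp; have rs_ := forallP (rad_fle ssp) i; split=> //.
- by move=> C /mapP[k _ ->]; exact: addvSl.
- move=> C C' /mapP[k _ ->] /mapP[k' _ ->]; rewrite /compv.
  by case: (leqP k k') => [h|/ltnW h]; apply/orP; [left|right]; exact: link_mono.
- by move=> C /mapP[k _ ->]; rewrite /compv subv_add rs_ capvSl orbT.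
Qed.

Lemma cstepP sp U d : stab sp -> step (@src CQ) (@tgt CQ) A true d sp U <->
  (forall i, [/\ (rd sp i <= U i)%VS, (U i <= sp i)%VS & \dim (sp i) = (\dim (U i) + d i)%N]).
Proof.
move=> ssp; split=> [/and4P[sU /forallP Us /forallP dU]|h].
  by rewrite rad_strict => /forallP rU i; split; [exact: rU|exact: Us|exact/eqP].
have rU : fle (rd sp) U by apply/forallP => i; have [] := h i.
have Us : fle U sp by apply/forallP => i; have [] := h i.
apply/and4P; split=> //; last by rewrite rad_strict.
  by rewrite -rad_stable; apply: fle_trans rU; exact: rad_mono.
by apply/forallP => i; have [_ _ ->] := h i.
Qed.

(** Every family between the radical and [sp] is stable, so the spaces at the vertices are chosen
    independently, each adapted to its links. By [ctest_mono] smaller ranks only help, so this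
    choice is optimal. *)
Lemma caflagP w sp : stab sp -> aflag (@src CQ) (@tgt CQ) A true w sp fam0 <-> ctest w (rho sp).
Proof.
elim: w sp => [|d w IH] sp ssp /=.
  split=> [->|/forallP h]; first by apply/forallP => j; rewrite /rho /= ffunE dimv0.
  by apply: dimf_eq0 => j; exact/eqP/h.
split=> [[U [sU aU]]|/andP[/forallP fe cw]].
  have /(cstepP U d ssp) h := sU; have sU' : stab U by case/and4P: sU.
  have [e0 le] := rho_step (fun i => let: And3 a _ _ := h i in a)
    (fun i => let: And3 _ a _ := h i in a) (fun i => let: And3 _ _ a := h i in a).
  apply/andP; split; last by apply: ctest_mono le _ => [j|]; [rewrite e0|exact/(IH _ sU')].
  apply/forallP => j; have [rU _ dU] := h j; rewrite /rho /= dU addnC leq_add2r.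
  exact: dimvS.
have /boolp.choice[f fP] : forall i, exists T : {vspace V}, [/\ (rd sp i <= T)%VS, (T <= sp i)%VS,
    \dim T = (\dim (sp i) - d i)%N & {in [seq link sp i k | k <- iota 0 (size w).+1],
      forall C, compv T C}].
  move=> i; have [h1 h2 h3 h4] := links_chain i (size w).+1 ssp.
  have := fe i; rewrite /rho /= => fi.
  apply: adapted_subspace => //; last exact: leq_subr.
  by rewrite leq_subRL ?fi // (leq_trans (leq_addr _ _) fi).
pose U : {ffun I -> {vspace V}} := [ffun i => f i].
have UE i : U i = f i by rewrite ffunE.
have h i : [/\ (rd sp i <= U i)%VS, (U i <= sp i)%VS & \dim (sp i) = (\dim (U i) + d i)%N].
  rewrite UE; have [h1 h2 h3 _] := fP i; split=> //; rewrite h3 subnK //.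
  exact: leq_trans (leq_addr _ _) (fe i).
have sU : step (@src CQ) (@tgt CQ) A true d sp U by apply/(cstepP U d ssp).
exists U; split=> //; have sU' : stab U by case/and4P: sU.
apply/(IH _ sU'); rewrite (@eq_ctest _ _ (nx d (rho sp))) // => k j kw.
apply: (@rho_adapted _ _ _ (size w).+1) => // [i|i|i|i k' k'w]; try by have [] := h i.
rewrite UE; have [_ _ _] := fP i; apply; apply/mapP; exists k' => //.
by rewrite mem_iota.
Qed.

End Ranks.

Section Count.
Variables (F : finFieldType) (V : vectType F) (A : I -> 'End(V)).
Implicit Types (sp U O : {ffun I -> {vspace V}}).
Local Notation stab := (stable (@src CQ) (@tgt CQ) A).
Local Notation rd := (@radf CQ F V A).
Local Notation q := #|F|.

Section OneStep.
Variables (sp : {ffun I -> {vspace V}}) (d : I -> nat) (w : seq (I -> nat)).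
Hypothesis ssp : stab sp.
Hypothesis fe : forall j, (d j + rho A sp 1 j <= rho A sp 0 j)%N.

Definition inG i (T : {vspace V}) := [&& (rd sp i <= T)%VS, (T <= sp i)%VS
  & \dim T == (\dim (sp i) - d i)%N].

(* The vertices in [S] have been summed over; the ranks of the paths starting
   there have been replaced by their generic values. *)
Definition hyb (S : seq I) U : nat -> I -> nat := fun k j =>
  if st k j \in S then nx d (rho A sp) k j else \dim (pf A (st k j) k @: U (st k j)).

(** Vertices already summed over carry 0 as a placeholder. *)
Definition inS (S : seq I) U := [forall i, if i \in S then U i == 0%VS else inG i (U i)].

(** One vertex is summed out at a time: the ranks of the paths starting at [a] depend only on the
    position of [U a] relative to the links there, and [grass_adapted] replaces them by their least
    values. *)
Lemma hyb_step (S : seq I) : uniq S ->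
  \sum_(U : {ffun I -> {vspace V}} | inS [::] U) ctest w (hyb [::] U) =
  \sum_(U : {ffun I -> {vspace V}} | inS S U) ctest w (hyb S U) %[mod q].
Proof.
elim: S => [//|a S IH] /= /andP[aS uS]; rewrite IH //.
rewrite (partition_big (@off _ a F V) (inS (a :: S))) /=; last first.
  move=> U /forallP h; apply/forallP => i; rewrite ffunE inE; have := h i.
  by case: (eqVneq i a) => [_ _|]; rewrite ?eqxx.
apply: eq_sum_mod => O /forallP hO.
have Oa : O a = 0%VS by have := hO a; rewrite inE eqxx => /eqP.
have -> : (\sum_(U : {ffun I -> {vspace V}} | inS S U && (@off _ a F V U == O)) ctest w (hyb S U) =
   \sum_(T : {vspace V} | inG a T) ctest w (hyb S (ins a O T)))%N.
  rewrite (reindex_onto (ins a O) (fun U : {ffun I -> {vspace V}} => U a)) /=; last first.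
    move=> U /andP[_ /eqP <-]; apply/ffunP => i; rewrite !ffunE; by case: eqP => [->|].
  apply: eq_bigl => T.
  have -> : ins a O T a = T by rewrite ffunE eqxx.
  have -> : @off _ a F V (ins a O T) = O by apply/ffunP => i; rewrite !ffunE; case: eqP => [->|].
  rewrite !eqxx !andbT; apply/forallP/idP => [h|GT i].
    by have := h a; rewrite (negPf aS) ffunE eqxx.
  have := hO i; rewrite ffunE inE; case: (eqVneq i a) => [-> _|//].
  by rewrite (negPf aS).
have [h1 h2 h3 h4] := links_chain a (size w).+1 ssp.
have fa := fe a; rewrite /rho /= in fa.
have [|||T [rT Ts dT cT E]] := @grass_adapted F V (rd sp a) (sp a) (\dim (sp a) - d a)
  [seq link A sp a k | k <- iota 0 (size w).+1] (fun T => ctest w (hyb S (ins a O T))) h1 _ _ h2 h3 h4.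
- by rewrite leq_subRL ?fa // (leq_trans (leq_addr _ _) fa).
- exact: leq_subr.
- move=> T T' rT Ts rT' Ts' dT dT' eqd; congr nat_of_bool; apply: eq_ctest => k j kw.
  rewrite /hyb; case: ifP => // _; rewrite !ffunE; case: (eqVneq (st k j) a) => // ->.
  have := eqd _ (map_f (link A sp a) (_ : k \in iota 0 (size w).+1)).
  rewrite mem_iota ltnS kw => /(_ isT).
  have := rank_cap (pf A a k) rT Ts; have := rank_cap (pf A a k) rT' Ts'.
  rewrite -/(link A sp a k) dT dT'; lia.
apply: (etrans E); congr (_ %% q)%N; congr nat_of_bool.
apply: eq_ctest => k j kw; rewrite /hyb inE ffunE.
case: (eqVneq (st k j) a) => [sj|//]; rewrite sj (negPf aS) /=.
have ck := cT _ (map_f (link A sp a) (_ : k \in iota 0 (size w).+1)).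
have {}ck : compv T (link A sp a k) by apply: ck; rewrite mem_iota.
case: k kw sj ck => [|k] kw sj ck; first by rewrite /nx /rho /= lim1g dT -sj.
rewrite (rank_adapted rT Ts ck) /nx /rho [iter k.+2 _ _]iterSr !iter_radE !sj dT subKn //.
exact: leq_trans (leq_addr _ _) fa.
Qed.

Lemma count_step : \sum_(U | step (@src CQ) (@tgt CQ) A true d sp U) ctest w (rho A U) =
  ctest w (nx d (rho A sp)) %[mod q].
Proof.
transitivity ((\sum_(U : {ffun I -> {vspace V}} | inS [::] U) ctest w (hyb [::] U)) %% q)%N.
  congr (_ %% q)%N; apply: eq_big => [U|U _].
    apply/idP/forallP => [/(cstepP U d ssp) h i|h].
      by have [h1 h2 h3] := h i; rewrite /= /inG h1 h2 h3 addnK eqxx.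
    apply/(cstepP U d ssp) => i; have /and3P[h1 h2 /eqP h3] := h i; split=> //.
    by rewrite h3 subnK //; exact: leq_trans (leq_addr _ _) (fe i).
  congr nat_of_bool; apply: eq_ctest => k j _.
  by rewrite /hyb /= /rho iter_radE.
rewrite (hyb_step (enum_uniq I)) (big_pred1 fam0).
  congr (_ %% q)%N; congr nat_of_bool; apply: eq_ctest => k j _.
  by rewrite /hyb mem_enum.
move=> U; apply/forallP/eqP => [h|-> i]; last by rewrite mem_enum ffunE eqxx.
by apply/ffunP => i; have := h i; rewrite mem_enum ffunE => /eqP.
Qed.

End OneStep.

Lemma ccount w sp : stab sp ->
  nfl (@src CQ) (@tgt CQ) A true w sp = ctest w (rho A sp) %[mod q].
Proof.
elim: w sp => [|d w IH] sp ssp /=.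
  congr (_ %% q)%N; congr nat_of_bool; apply/eqP/forallP => [-> j|h].
    by rewrite /rho /= ffunE dimv0.
  by apply: dimf_eq0 => j; exact/eqP/h.
transitivity ((\sum_(U | step (@src CQ) (@tgt CQ) A true d sp U) ctest w (rho A U)) %% q)%N.
  by apply: eq_sum_mod => U /and4P[sU _ _ _]; exact: IH.
case: (boolP [forall j, (d j + rho A sp 1 j <= rho A sp 0 j)%N]) => [/forallP fe|nf].
  by rewrite count_step.
rewrite big1 ?mod0n // => U /(cstepP U d ssp) h; case/negP: nf; apply/forallP => j.
by have [rU _ dU] := h j; rewrite /rho /= dU addnC leq_add2r dimvS.
Qed.

End Count.
End CycleTest.

(** * Cyclic quivers *)

Section NilpotentLength.
Variables (Q : quiver) (F : fieldType).

(** Each filtration step adds one to a single coordinate, so the length in [is_string] is the total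
    dimension. *)
Lemma nilp_length_dim d (M : @rep Q F d) l : nilp_length M l -> l = (\sum_i d i)%N.
Proof.
elim=> {d M l} [d M z|d e M N i l s _ ->]; first by rewrite big1.
have [U [_ _ sU qN qM]] := (ses_qreal N _ (amb_stable M) (amb_real M)).1 s.
have dE j : d j = (e j + (j == i))%N.
  have := qreal_dim j (amb_real M); have := qreal_dim j qN; have := qreal_dim j qM.
  by rewrite ![fam0 j]ffunE !dimv0 !add0n => -> -> <-.
rewrite (eq_bigr _ (fun j _ => dE j)) big_split /= (bigD1 (P := xpredT) (F := fun j => nat_of_bool (j == i)) i) //=.
by rewrite eqxx [X in (_ + (_ + X))%N]big1 ?addn0 ?addn1 // => j /negPf ->.
Qed.

Lemma nilpotent_length d (M : @rep Q F d) l : nilpotent M -> l = (\sum_i d i)%N -> nilp_length M l.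
Proof. by move=> [l' h] ->; rewrite -(nilp_length_dim h). Qed.

Lemma radf_dsumf (V : vectType F) (A : arrow Q -> 'End(V)) (sp U R : {ffun vert Q -> {vspace V}}) :
  dsumf A sp U R -> dsumf A (radf A sp) (radf A U) (radf A R).
Proof.
move=> [sU sR UR UR0].
have rU : fle (radf A U) U by rewrite rad_stable.
have rR : fle (radf A R) R by rewrite rad_stable.
split=> [||i|i].
- by rewrite -rad_stable; exact: rad_mono.
- by rewrite -rad_stable; exact: rad_mono.
- by rewrite !ffunE -big_split /=; apply: eq_bigr => x _; rewrite -limgD UR.
apply/eqP; rewrite -subv0 -(UR0 i); by apply: capvS; [exact: (forallP rU i)|exact: (forallP rR i)].
Qed.

Lemma iter_radf_dsumf k (V : vectType F) (A : arrow Q -> 'End(V)) (sp U R : {ffun vert Q -> {vspace V}}) :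
  dsumf A sp U R -> dsumf A (iter k (radf A) sp) (iter k (radf A) U) (iter k (radf A) R).
Proof. by move=> d; elim: k => //= k; exact: radf_dsumf. Qed.

Lemma radf_fam0 (V : vectType F) (A : arrow Q -> 'End(V)) : radf A fam0 = fam0.
Proof. by apply/ffunP => i; rewrite !ffunE big1 // => x _; rewrite ffunE limg0. Qed.

End NilpotentLength.

Section Strings.
Variable n : nat.
Local Notation I := 'I_n.+1.
Local Notation CQ := (cyclic_quiver n).
Local Notation vt tau m := (iter m (@ordS n.+1) tau).
Local Notation st k j := (iter k (@ord_pred n.+1) j).

(** The matrices of maps from [simple_rep] have a boolean number of rows; this handles their
    indices. *)
Lemma bool_ord (b : bool) (a : 'I_b) : b /\ forall a' : 'I_b, a' = a.
Proof.
have := ltn_ord a; case: b a => // -[[|//] h] _; split=> // -[[|//] h'].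
exact: val_inj.
Qed.

Section Socle.
Variables (F : fieldType) (d : dimvec CQ) (M : @rep CQ F d) (e : I) (S : forall k : I, 'rV[F]_(d k)).
Hypothesis Se : S e != 0.
Hypothesis SM : S e *m M e = 0.
Hypothesis MS : forall (k : I) (v : 'rV[F]_(d k)), v *m M k = 0 -> if k == e then (v <= S k)%MS else v == 0.

Lemma simple_row (i k : I) (g : forall k : vert CQ, 'M[F]_((k == i : nat), d k)) a :
  is_hom (@simple_rep CQ F i) M g -> row a (g k) *m M k = 0.
Proof. by move=> h; rewrite -row_mul -(h k) /simple_rep mul0mx row0. Qed.

(** The rows of a homomorphism from a simple representation lie in the kernels of the arrows, which
    by hypothesis reduce to a line at the vertex [e]. *)
Lemma socle_line (i : I) : @socle_is CQ F d M i <-> i = e.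
Proof.
split=> [[f [[hf ff] _]]|->].
  have := ff i; have := @simple_row i i f; move: (f i); rewrite eqxx => fi h fr.
  have := MS (h ord0 hf); case: eqP => // _ /eqP r0.
  have : row_free fi by [].
  rewrite /row_free; have -> : fi = 0 by apply/row_matrixP => a; rewrite ord1 r0 row0.
  by rewrite mxrank0.
pose f (k : vert CQ) : 'M[F]_((k == e : nat), d k) := \matrix_(a, b) S k 0 b.
have fE k a : row a (f k) = S k by apply/rowP => b; rewrite !mxE.
have fS (k : I) (a : 'I_(k == e)) : k = e by apply/eqP; have [] := bool_ord a.
exists f; split; first split.
- move=> k; rewrite /simple_rep mul0mx; apply/row_matrixP => a; rewrite row0 row_mul fE /=.
  by have := fS k a; move: a => _ ->; rewrite SM.
- move=> k; apply: inj_row_free => v vf; apply/rowP => a; rewrite mxE.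
  have ke := fS k a; have [_ au] := bool_ord a.
  have : v *m f k = v 0 a *: S k.
    apply/rowP => b; rewrite !mxE (bigD1 a) //= big1 ?addr0 ?mxE // => a' /eqP; by rewrite (au a').
  have Sk : S k != 0 by rewrite ke.
  by rewrite vf => /esym/eqP; rewrite scaler_eq0 (negPf Sk) orbF => /eqP.
move=> j g [hg _] k; apply/row_subP => a.
have [le r0] : (k = e -> row a (g k) <= S k)%MS /\ (k <> e -> row a (g k) = 0).
  by have := MS (simple_row a hg); case: eqP => [ke h|ke /eqP h]; split.
have [ke|ke] := pselect (k = e); last by rewrite r0 ?sub0mx.
have [a0 _] : exists a0 : 'I_(k == e), true.
  have h : (0 < (k == e : nat))%N by rewrite ke eqxx.
  by exists (Ordinal h).
by apply: submx_trans (le ke) _; rewrite -(fE k a0) row_sub.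
Qed.

End Socle.

Section Uniserial.
Variables (F : fieldType) (V : vectType F) (A : I -> 'End(V)) (U : {ffun I -> {vspace V}}).
Variables (tau : I) (x : V) (l : nat).
Hypothesis un : unis A U tau x l.
Variables (d : dimvec CQ) (M : @rep CQ F d).
Hypothesis qM : @qreal CQ F V A U fam0 d M.
Local Notation e := (vt tau l.-1).

(** Rank-nullity with the ranks of the paths of lengths 0 and 1: only the last vector of the strand
    is lost. *)
Lemma unis_ker (k : I) : (U k :&: lker (A k) = if k == e then <[pf A tau l.-1 x]> else 0)%VS.
Proof.
have [l0 nz z UE] := un.
have dk : \dim (U k :&: lker (A k)) = (k == e).
  have := limg_ker_dim (A k) (U k).
  have := unis_rank 0 k un; have := unis_rank 1 (ordS k) un.
  rewrite /= radE ordSK => -> ->; rewrite subn0 subn1.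
  rewrite -[in X in _ = X -> _](prednK l0) big_ord_recr /= addn0.
  have -> : (\sum_(m < l.-1) (vt tau (m + 1) == ordS k) = \sum_(m < l.-1) (vt tau (m + 0) == k))%N.
    apply: eq_bigr => m _; rewrite addn1 addn0 /=; congr nat_of_bool.
    by apply/eqP/eqP => [/ordS_inj|->].
  by rewrite (eq_sym k) => h; apply/eqP; rewrite -(eqn_add2r (\sum_(m < l.-1) (vt tau (m + 0) == k))) h addnC.
case: eqP => [ke|/eqP ke]; last by apply/eqP; rewrite -dimv_eq0 dk (negPf ke).
apply/esym/eqP; rewrite eqEdim dk ke eqxx dim_vline nz andbT -memvE memv_cap memv_ker.
rewrite UE pfSr prednK // z eqxx andbT; apply: strandP.
by rewrite prednK.
Qed.

Lemma unis_socle i : @socle_is CQ F d M i <-> i = e.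
Proof.
have [l0 nz z UE] := un; have [g gP] := qM; have [on ke gA] := gP.
have pU : pf A tau l.-1 x \in U e by rewrite UE; apply: strandP; rewrite prednK.
have gi (k : I) u : u \in U k -> g k u = 0 -> u = 0.
  by move=> uU /eqP; rewrite (qrealg_ker gP uU) ffunE memv0 => /eqP.
apply: (@socle_line F d M e (fun k => g k (pf A tau l.-1 x))).
- by apply/eqP => h; move: nz; rewrite (gi e _ pU h) eqxx.
- by rewrite -(gA e _ pU) /= pfSr prednK // z lf0.
move=> k v; have [u uU ->] := qrealg_onto (i := k : vert CQ) v gP.
rewrite -(gA k _ uU) => Au0.
have Aku : A k u \in U (ordS k).
  by have /stableP := unis_stable un; apply.
have Ak : A k u = 0 by exact: gi Aku Au0.
have : u \in (U k :&: lker (A k))%VS by rewrite memv_cap uU memv_ker Ak eqxx.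
rewrite unis_ker; case: eqP => [_ /vlineP[c ->]|_]; first by rewrite linearZ scalemx_sub.
by rewrite memv0 => /eqP ->; rewrite lf0.
Qed.

Lemma unis_dims : (\sum_i d i = l)%N.
Proof.
have dE (i : I) : d i = (\sum_(m < l) (vt tau m == i))%N.
  have := qreal_dim (i : vert CQ) qM; rewrite ffunE dimv0 add0n => <-.
  have := unis_rank 0 i un; rewrite /= subn0 => ->.
  by apply: eq_bigr => m _; rewrite addn0.
rewrite (eq_bigr _ (fun i _ => dE i)) exchange_big /=.
rewrite (eq_bigr (fun=> 1%N)) ?sum1_card ?card_ord // => m _.
by rewrite (bigD1 (vt tau m)) //= eqxx big1 ?addn0 // => i /negPf h; rewrite eq_sym h.
Qed.

Lemma unis_nilpotent : nilpotent M.
Proof.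
apply/(nilpotentP (unis_stable un) (fam0_stable _ _ _) qM); exists l.
by rewrite (unis_nil un) fle_refl.
Qed.

Lemma unis_string : is_string (existT _ d M) e l.
Proof.
split=> /=.
- by apply/(aindecP (unis_stable un) qM); exact: unis_aindec un.
- by apply: nilpotent_length unis_nilpotent _; rewrite unis_dims.
- exact/unis_socle.
Qed.

End Uniserial.

Lemma string_unis (F : fieldType) (V : vectType F) (A : I -> 'End(V)) (U : {ffun I -> {vspace V}})
    (M : packed_rep CQ F) i l : stable (@src CQ) (@tgt CQ) A U -> @qreal CQ F V A U fam0 _ (tagged M) ->
  is_string M i l -> exists tau x, unis A U tau x l /\ i = vt tau l.-1.
Proof.
case: M => d M sU qM [/= iM nM sM].
have aU := (aindecP sU qM).1 iM.
have nU : @nilA CQ F V A U fam0 by apply/(nilpotentP sU (fam0_stable _ _ _) qM); exists l.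
have [tau [x [l' un]]] := aindec_unis sU nU aU.
have ll : l = l' by rewrite (nilp_length_dim nM) (unis_dims un qM).
by exists tau, x; rewrite ll; split=> //; exact/(unis_socle un qM).
Qed.

Local Notation T := ('I_n.+1 * nat)%type.

(** The label [(i, m)] stands for the string with socle [i] and length [m.+1], so that every label
    is valid. *)
Definition cgood (F : fieldType) (b : T) (M : packed_rep CQ F) := is_string M b.1 b.2.+1.

Definition cinv (F : fieldType) (V : vectType F) (A : arrow CQ -> 'End(V))
  (sp : {ffun vert CQ -> {vspace V}}) (kj : nat * I) : nat := rho A sp kj.1 kj.2.

(** The rank of the path of length [kj.1] ending at [kj.2] on the string with label [b]; [c] is the
    distance from a basis vector of the image to the socle. *)
Definition cd0 (b : T) (kj : nat * I) : nat := \sum_(c < b.2.+1 - kj.1) (vt kj.2 c == b.1).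

Lemma cgood_iso (F : fieldType) b (M N : packed_rep CQ F) :
  cgood b M -> cgood b N -> iso (tagged M) (tagged N).
Proof.
move=> sM sN; have aM := amb_stable (tagged M); have aN := amb_stable (tagged N).
have qM := amb_real (tagged M); have qN := amb_real (tagged N).
have [tau [x [un e]]] := string_unis aM qM sM.
have [tau' [x' [un' e']]] := string_unis aN qN sN.
have tt : tau' = tau by apply: (@vt_inj n b.2); rewrite -e'.
rewrite tt in un'; have ai := unis_aiso un un'.
exact: qreal_uniq aM qM (aiso_qreal ai qN).
Qed.

Lemma cgood_ex (F : fieldType) b : exists M : packed_rep CQ F, cgood b M.
Proof.
have [V [A [U [x un]]]] := @unis_exists n F (st b.2 b.1) b.2.+1 isT.
have [M qM] := @qreal_self CQ F V A U (unis_stable un).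
exists (existT _ _ M); have := unis_string un qM.
by rewrite /cgood /= vt_st.
Qed.

Lemma cgood_ind (F : fieldType) (V : vectType F) (A : arrow CQ -> 'End(V)) U :
  stable (@src CQ) (@tgt CQ) A U -> nilA A U fam0 -> aindec A U ->
  exists b M, cgood b M /\ qreal A U fam0 (tagged M).
Proof.
move=> sU nU aU; have [tau [x [l un]]] := aindec_unis sU nU aU.
have [M qM] := @qreal_self CQ F V A U sU.
have [l0 _ _ _] := un.
exists (vt tau l.-1, l.-1), (existT _ _ M); split=> //.
by have := unis_string un qM; rewrite /cgood /= prednK.
Qed.

Lemma cgood_inv (F : fieldType) (V : vectType F) (A : arrow CQ -> 'End(V)) U
    b (M : packed_rep CQ F) j :
  stable (@src CQ) (@tgt CQ) A U -> cgood b M -> qreal A U fam0 (tagged M) -> cinv A U j = cd0 b j.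
Proof.
move=> sU gM qM; have [tau [x [un e]]] := string_unis sU qM gM.
rewrite /cinv /rho (unis_rank _ _ un) /cd0 (reindex_inj rev_ord_inj) /=.
apply: eq_bigr => c _; congr nat_of_bool; have cl := ltn_ord c.
have -> : b.1 = vt (vt tau (b.2.+1 - j.1 - c.+1 + j.1)) c.
  by rewrite e /= -iterD; congr (iter _ _ _); lia.
by apply/eqP/eqP => [->//|/vt_inj].
Qed.

Lemma cinv_add (F : fieldType) (V : vectType F) (A : arrow CQ -> 'End(V)) sp U R j :
  dsumf A sp U R -> cinv A sp j = (cinv A U j + cinv A R j)%N.
Proof.
move=> d; have e := dsumf_dim (j.2 : vert CQ) (iter_radf_dsumf j.1 d); exact: e.
Qed.

Lemma cinv_fam0 (F : fieldType) (V : vectType F) (A : arrow CQ -> 'End(V)) j :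
  cinv A fam0 j = 0%N.
Proof.
rewrite /cinv /rho; have -> : iter j.1 (radf A) fam0 = fam0.
  by elim: j.1 => // k IH; rewrite iterS IH; exact: (@radf_fam0 CQ F V A).
by rewrite ffunE dimv0.
Qed.

(** The analogue of reading Jordan block sizes from ranks of powers: a mixed second difference of
    path ranks is the indicator of one label. *)
Lemma cd0_second_difference (b' : T) (i : I) m :
  (cd0 b' (m, i) + cd0 b' (m.+2, ordS i) =
   cd0 b' (m.+1, i) + cd0 b' (m.+1, ordS i) + (b' == (i, m)))%N.
Proof.
case: b' => [i' p]; rewrite /cd0 /= xpair_eqE.
have [pm|mp|->] := ltngtP p m; first 2 last.
- have -> : (m.+1 - m = 1)%N by lia.
  have -> : (m.+1 - m.+2 = 0)%N by lia.
  by rewrite subnn !big_ord0 big_ord1 /= andbT addn0 !add0n eq_sym.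
- have -> : (p.+1 - m = 0)%N by lia.
  have -> : (p.+1 - m.+1 = 0)%N by lia.
  have -> : (p.+1 - m.+2 = 0)%N by lia.
  by rewrite !big_ord0 andbF.
have [r ->] : exists r, p = (m + r).+1 by exists (p - m.+1)%N; lia.
have -> : ((m + r).+2 - m = r.+2)%N by lia.
have -> : ((m + r).+2 - m.+1 = r.+1)%N by lia.
have -> : ((m + r).+2 - m.+2 = r)%N by lia.
rewrite andbF addn0 big_ord_recr /= -addnA; congr (_ + _)%N.
by rewrite [RHS]big_ord_recr /= -iterSr addnC.
Qed.

Lemma cd0_inj (bs bs' : seq T) :
  (forall j, \sum_(b <- bs) cd0 b j = \sum_(b <- bs') cd0 b j)%N -> perm_eq bs bs'.
Proof.
move=> h; have cE (b : T) r : count_mem b r = (\sum_(b' <- r) (b' == b))%N.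
  by rewrite -sum1_count big_mkcond; apply: eq_bigr => c _ /=; case: eqP.
rewrite /perm_eq; apply/allP => -[i m] _; apply/eqP; rewrite !cE.
have E r : (\sum_(b' <- r) cd0 b' (m, i) + \sum_(b' <- r) cd0 b' (m.+2, ordS i) =
    \sum_(b' <- r) cd0 b' (m.+1, i) + \sum_(b' <- r) cd0 b' (m.+1, ordS i) +
    \sum_(b' <- r) (b' == (i, m)))%N.
  by rewrite -!big_split /=; apply: eq_bigr => b' _; exact: cd0_second_difference.
by have := E bs; rewrite !h (E bs') => /addnI/esym.
Qed.

Definition cenc (g : cycle_class n) : seq T :=
  [seq (i, (nth 0%N (val (g i)) k).-1) | i <- enum 'I_n.+1, k <- iota 0 (size (val (g i)))].

Lemma partition_pos (g : int_partition) l : l \in val g -> (0 < l)%N.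
Proof.
by case: g => p /= /andP[_ p0]; rewrite lt0n; apply: contraTneq => ->.
Qed.

Lemma sum_cenc g (h : T -> nat) :
  (\sum_(b <- cenc g) h b = \sum_(i < n.+1) \sum_(l <- val (g i)) h (i, l.-1))%N.
Proof.
rewrite /cenc big_allpairs_dep /= big_enum /=; apply: eq_bigr => i _.
by rewrite [RHS](big_nth 0%N) /index_iota subn0.
Qed.

Lemma count_cenc g i m : count_mem (i, m) (cenc g) = count_mem m.+1 (val (g i)).
Proof.
rewrite -sum1_count big_mkcond /= (eq_bigr (fun b => nat_of_bool (b == (i, m)))); last first.
  by move=> b _; case: eqP.
rewrite sum_cenc (bigD1 i) //= [X in (_ + X)%N]big1 ?addn0; last first.
  by move=> j /negPf ji; rewrite big1 // => l _; rewrite xpair_eqE ji.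
rewrite -sum1_count [RHS]big_mkcond big_seq [RHS]big_seq; apply: eq_bigr => l /partition_pos l0.
by rewrite xpair_eqE eqxx /= -(prednK l0) /= eqSS; case: eqP.
Qed.

Lemma cenc_inj g g' : perm_eq (cenc g) (cenc g') -> g = g'.
Proof.
move=> /permP p; apply/ffunP => i; apply: val_inj.
have so (q : int_partition) : sorted geq (val q) by case: q => q /= /andP[].
apply: (sorted_eq (leT := geq)) => //.
- by move=> a b c /= ab bc; exact: leq_trans bc ab.
- by move=> a b /= h; apply/eqP; rewrite eqn_leq andbC.
rewrite /perm_eq; apply/allP => -[|l] _; last by rewrite /= -!count_cenc p.
have z (q : int_partition) : count_mem 0%N (val q) = 0%N.
  by apply/count_memPn; apply/negP => /partition_pos.
by rewrite /= !z.
Qed.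

Lemma cenc_surj bs : exists g, perm_eq bs (cenc g).
Proof.
have ip (i : I) : is_int_partition (sort geq [seq b.2.+1 | b <- bs & b.1 == i]).
  rewrite /is_int_partition sort_sorted; last by move=> a b; exact: leq_total.
  by rewrite mem_sort; apply/mapP => -[].
pose g : cycle_class n := [ffun i => exist (fun p => is_int_partition p) _ (ip i)].
exists g; rewrite /perm_eq; apply/allP => -[i m] _; apply/eqP; rewrite count_cenc ffunE /=.
rewrite count_sort count_map count_filter; apply: eq_count => -[j p] /=.
by rewrite xpair_eqE eqSS andbC.
Qed.

Lemma cenc_class (F : fieldType) d (M : @rep CQ F d) (g : cycle_param n) :
  pclass M g <-> lcl cgood M (cenc g).
Proof.
pose P := [seq (i, k) | i <- enum 'I_n.+1, k <- iota 0 (size (val (g i)))].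
have inP ik : ik \in P -> (ik.2 < size (val (g ik.1)))%N.
  by move=> /allpairsPdep[i [k [_ + ->]]]; rewrite mem_iota.
have eP (f : I -> nat -> packed_rep CQ F) : [seq f i k | i <- enum 'I_n.+1, k <- iota 0 (size (val (g i)))] =
    [seq f ik.1 ik.2 | ik <- P] by rewrite map_allpairs.
have encP (f : T -> packed_rep CQ F) : map f (cenc g) = [seq f (ik.1, (nth 0%N (val (g ik.1)) ik.2).-1) | ik <- P].
  by rewrite /cenc !map_allpairs.
have pk (i : I) k : (k < size (val (g i)))%N -> (nth 0%N (val (g i)) k).-1.+1 = nth 0%N (val (g i)) k.
  by move=> h; rewrite prednK //; apply: (@partition_pos (g i)); exact: mem_nth.
have cencE b : b \in cenc g -> exists2 ik, ik \in P & b = (ik.1, (nth 0%N (val (g ik.1)) ik.2).-1).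
  move=> /allpairsPdep[i [k [ie ki ->]]]; exists (i, k) => //.
  by apply/allpairsPdep; exists i, k.
split=> [[N [gN isoM]]|[N [gN isoM]]].
  (* In [cycle_has_class] a string may depend on its position in the partition, in [lcl] only on its
     label. The first position of the given part is used, and equal labels are compared by
     [cgood_iso]. *)
  pose N' (b : T) := N b.1 (index b.2.+1 (val (g b.1))).
  have gN' ik : ik \in P -> cgood (ik.1, (nth 0%N (val (g ik.1)) ik.2).-1) (N' (ik.1, (nth 0%N (val (g ik.1)) ik.2).-1)).
    move=> /inP h; rewrite /cgood /N' /= pk //.
    have mi := mem_nth 0%N h.
    by have := gN ik.1 _ (_ : (index (nth 0%N (val (g ik.1)) ik.2) (val (g ik.1)) < _)%N);
      rewrite nth_index // index_mem; apply.
  exists N'; split; first by move=> b /cencE[ik ikP ->]; exact: gN'.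
  rewrite encP; apply/(adecP _ (amb_stable M) (amb_real M)).
  move/(adecP _ (amb_stable M) (amb_real M)): isoM; rewrite eP.
  apply: adec_iso => ik ikP; apply: cgood_iso (gN' _ ikP).
  by rewrite /cgood /= pk; [apply: gN|]; exact: inP.
exists (fun i k => N (i, (nth 0%N (val (g i)) k).-1)); split; last by rewrite eP; rewrite encP in isoM.
move=> i k ki; have := gN (i, (nth 0%N (val (g i)) k).-1); rewrite /cgood /= pk //; apply.
by apply/allpairsPdep; exists i, k; rewrite mem_enum mem_iota.
Qed.

Definition crho (g : cycle_class n) k j := (\sum_(b <- cenc g) cd0 b (k, j))%N.

(** The indicator that the simple layer of the string between its k-th and (k+1)-st radical powers
    lies at [j]. *)
Definition cdel (b : T) k j : bool := (k <= b.2)%N && (vt j (b.2 - k) == b.1).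

Lemma cd0S b k j : cd0 b (k, j) = (cd0 b (k.+1, j) + cdel b k j)%N.
Proof.
rewrite /cd0 /cdel /=; case: leqP => [h|h].
  by rewrite subSS subSn // big_ord_recr.
have -> : (b.2.+1 - k = 0)%N by lia.
have -> : (b.2.+1 - k.+1 = 0)%N by lia.
by rewrite big_ord0.
Qed.

Lemma cdel_mono b m k j : (cdel b (m + k) j <= cdel b m (st k j))%N.
Proof.
rewrite /cdel; case: (leqP (m + k) b.2) => //= h.
rewrite (leq_trans (leq_addr k m) h) /=.
have -> : (b.2 - m = (b.2 - (m + k)) + k)%N by lia.
by rewrite iterD vt_st.
Qed.

Lemma crhoS g k j : crho g k j = (crho g k.+1 j + \sum_(b <- cenc g) cdel b k j)%N.
Proof. by rewrite /crho -big_split /=; apply: eq_bigr => b _; exact: cd0S. Qed.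

Lemma crho_anti g k k' j : (k <= k')%N -> (crho g k' j <= crho g k j)%N.
Proof.
move=> /subnKC <-; elim: (k' - k)%N => [|r IH]; first by rewrite addn0.
by apply: leq_trans IH; rewrite addnS [X in (_ <= X)%N]crhoS leq_addr.
Qed.

Lemma crho0 g j : crho g 0 j = @cycle_dim n g j.
Proof.
rewrite /crho sum_cenc /cycle_dim; apply: eq_bigr => i _.
rewrite big_seq [RHS]big_seq; apply: eq_bigr => l /partition_pos l0.
rewrite /cd0 /= prednK // subn0 -sum1_count big_mkcond /=.
have -> : iota 0 l = index_iota 0 l by rewrite /index_iota subn0.
rewrite big_mkord [RHS]big_mkcond; apply: eq_bigr => c _.
rewrite -(inj_eq val_inj) /= vt_val addnC (modn_small (ltn_ord i)).
by case: eqP.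
Qed.

Definition cN g := (\sum_j crho g 0 j)%N.

Lemma crho_big g k j : (cN g <= k)%N -> crho g k j = 0%N.
Proof.
move=> Nk; rewrite /crho big_seq big1 // => b bg; rewrite /cd0 /=.
suff h : (b.2.+1 <= k)%N by have -> : (b.2.+1 - k = 0)%N by [apply/eqP]; rewrite big_ord0.
apply: leq_trans Nk; rewrite /cN /crho exchange_big /= (big_rem b) //=.
apply: leq_trans (leq_addr _ _); rewrite /cd0 /= subn0 exchange_big /=.
rewrite -[X in (X <= _)%N]card_ord -sum1_card; apply: leq_sum => c _.
by rewrite (bigD1 (st c b.1)) //= vt_st eqxx.
Qed.

(** For [r = crho g] these are the dimension vectors of the radical layers, and the radical
    filtration is the distinguished flag of the class [g]. *)
Definition layers (r : nat -> I -> nat) m N : seq (dimvec CQ) :=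
  [seq (fun j : I => (r k j - r k.+1 j)%N) | k <- iota m N].

Lemma ctest_layers g m N : (forall j, crho g (m + N) j = 0%N) ->
  ctest (layers (crho g) m N) (fun k => crho g (m + k)).
Proof.
elim: N m => [|N IH] m h /=; first by apply/forallP => j; rewrite h.
apply/andP; split.
  by apply/forallP => j; rewrite addn0 addn1 subnK // crho_anti.
rewrite -(@eq_ctest n _ (fun k => crho g (m.+1 + k))); first by apply: IH => j; rewrite addSnnS.
move=> [|k] j _ /=; first by rewrite addn0 addn0 subKn // crho_anti.
(* By [cdel_mono] a layer at [j] comes from an earlier layer at the start of the path, so the
   maximum in [nx] is its first term: the least ranks are those of the radical. *)
have e1 := crhoS g (m + k.+1) j; have e2 := crhoS g m (st k.+1 j).
have : (\sum_(b <- cenc g) cdel b (m + k.+1) j <= \sum_(b <- cenc g) cdel b m (st k.+1 j))%N.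
  by apply: leq_sum => b _; exact: cdel_mono.
have e3 : crho g (m.+1 + k.+1) j = crho g (m + k.+2) j by rewrite addSnnS.
by rewrite -[(m + k.+1).+1]addnS in e1; rewrite e3; move: e1 e2 => /=; lia.
Qed.

Lemma ctest_total (w : seq (I -> nat)) r (j : I) : ctest w r -> r 0%N j = (\sum_(d <- w) d j)%N.
Proof.
elim: w r => [|d w IH] r /=; first by move=> /forallP/(_ j)/eqP ->; rewrite big_nil.
move=> /andP[/forallP/(_ j) h /IH]; rewrite /= big_cons => <-; lia.
Qed.

(** The numerical form of the fact that the m-th power of the radical lies in the m-th member of the
    flag. *)
Lemma ctest_bound (w : seq (I -> nat)) r m (j : I) : ctest w r -> (m <= size w)%N ->
  (r m j + \sum_(d <- take m w) d j <= r 0 j)%N.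
Proof.
elim: w r m => [|d w IH] r [|m] //=; rewrite ?big_nil ?addn0 //.
move=> /andP[/forallP/(_ j) h /IH{}IH]; rewrite ltnS => /IH /=; rewrite big_cons.
by case: m {IH} => [|m] /=; rewrite ?take0 ?big_nil; lia.
Qed.

Lemma sum_layers (r : nat -> I -> nat) N m j : (forall k, r k.+1 j <= r k j)%N -> (m <= N)%N ->
  (\sum_(d <- take m (layers r 0 N)) d j = r 0 j - r m j)%N.
Proof.
move=> anti mN; rewrite /layers -map_take big_map take_iota (minn_idPl mN).
elim: m {mN} => [|m IH]; first by rewrite big_nil subnn.
rewrite -addn1 iotaD big_cat /= IH big_cons big_nil add0n.
have : (r m j <= r 0 j)%N by elim: m {IH} => // m IH; exact: leq_trans (anti m) IH.
by rewrite addn1; have := anti m; lia.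
Qed.

Definition ct (w : seq (dimvec CQ)) (g : cycle_param n) : bool := ctest w (crho g).

Lemma cword : exists (o : cycle_param n -> seq (dimvec CQ)) (h : cycle_param n -> nat), forall al,
  ct (o al) al /\ forall be, ct (o al) be -> be <> al -> (h al < h be)%N.
Proof.
exists (fun al => layers (crho al) 0 (cN al)).
(* Classes passing the test of [al] have path ranks at most those of [al], so the height measures
   how far ranks fall below dimensions; paths of length at least [cN al] vanish. *)
exists (fun al => \sum_(k < cN al) \sum_j (crho al 0 j - crho al k j))%N => al.
have anti (g : cycle_class n) j k : (crho g k.+1 j <= crho g k j)%N by exact: crho_anti.
split; first by apply: (ctest_layers (m := 0)) => j; exact: crho_big.
move=> be t nab; have sz : size (layers (crho al) 0 (cN al)) = cN al by rewrite size_map size_iota.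
have r0 j : crho be 0 j = crho al 0 j.
  rewrite (ctest_total j t) -[layers _ _ _]take_size sz sum_layers //.
  by rewrite (crho_big j (leqnn _)) subn0.
have NN : cN be = cN al by apply: eq_bigr => j _.
have le k j : (crho be k j <= crho al k j)%N.
  case: (leqP k (cN al)) => [kN|/ltnW kN]; last by rewrite crho_big ?NN.
  have := ctest_bound j t; rewrite sz => /(_ _ kN); rewrite sum_layers // r0.
  by have := crho_anti al j (leq0n k); lia.
rewrite NN; have le1 k j : (crho al 0 j - crho al k j <= crho be 0 j - crho be k j)%N.
  by rewrite r0; have := le k j; lia.
have le2 (k : 'I_(cN al)) : (\sum_j (crho al 0 j - crho al k j) <= \sum_j (crho be 0 j - crho be k j))%N.
  by apply: leq_sum => j _; exact: le1.
rewrite ltn_neqAle leq_sum ?andbT => [|k _]; last exact: le2.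
apply/eqP => e; apply: nab; apply: cenc_inj; apply: cd0_inj => -[k j].
rewrite -/(crho be k j) -/(crho al k j).
case: (ltnP k (cN al)) => [lt|kN]; last by rewrite !crho_big ?NN.
have := sum_leq_eq (le1 k) (sum_leq_eq le2 e (Ordinal lt)) j.
rewrite r0; have := crho_anti al j (leq0n k); have := le k j; lia.
Qed.

Lemma cclass_inv (F : fieldType) (V : vectType F) (A : arrow CQ -> 'End(V)) sp
    d (M : @rep CQ F d) (g : cycle_param n) k j : stable (@src CQ) (@tgt CQ) A sp ->
  qreal A sp fam0 M -> pclass M g -> rho A sp k j = crho g k j.
Proof.
move=> ssp qM cM.
exact: (list_inv cgood_inv cinv_add cinv_fam0 cenc_class (k, j) ssp qM cM).
Qed.

Lemma cclass_dim (F : fieldType) d (M : @rep CQ F d) (g : cycle_param n) :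
  pclass M g -> d = @cycle_dim n g.
Proof.
move=> cM; apply/funext => j.
rewrite -crho0 -(cclass_inv 0 j (amb_stable M) (amb_real M) cM).
by have := qreal_dim j (amb_real M); rewrite [fam0 j]ffunE dimv0 add0n.
Qed.

Lemma cnilpotent (F : fieldType) d (M : @rep CQ F d) (g : cycle_param n) : pclass M g -> nilpotent M.
Proof.
move=> cM; apply/(nilpotentP (amb_stable M) (fam0_stable _ _ _) (amb_real M)); exists (cN g).
suff -> : iter (cN g) (radf (amb_map M)) (amb_sp F d) = fam0 by exact: fle_refl.
apply: dimf_eq0 => j; have := cclass_inv (cN g) j (amb_stable M) (amb_real M) cM.
by rewrite crho_big.
Qed.

Lemma cclass_zero (F : fieldType) : pclass (@rep0 CQ F) (pzero (cycle_param n)).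
Proof.
apply/cenc_class; have -> : cenc (pzero (cycle_param n)) = [::].
  case E : (cenc _) => [|b s] //; have : b \in cenc (pzero (cycle_param n)) by rewrite E mem_head.
  by move=> /allpairsPdep[i [k [_ + _]]]; rewrite mem_iota /= ffunE.
by exists (fun=> existT _ _ (@rep0 CQ F)); split=> //; exact: iso_refl.
Qed.

Section Closed.
Variables (K : fieldType) (d : dimvec CQ).
Local Notation rp := (@rep CQ K d).

(** Beyond the constant ranks at length 0, only upper bounds on ranks of paths occur, and an upper
    bound on [nx] is a pair of such bounds; the induction stays among closed conditions. *)
Lemma zclosed_ctest w (f : rp -> nat -> I -> nat) (c : I -> nat) :
  (forall X j, f X 0%N j = c j) ->
  (forall k m j, zclosed [set X : rp | (f X k.+1 j <= m)%N]) ->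
  zclosed [set X : rp | ctest w (f X)].
Proof.
elim: w f c => [|v w IH] f c f0 fk.
  have -> : [set X : rp | ctest [::] (f X)]%classic = [set X : rp | [forall j, c j == 0%N]]%classic.
    have e X : [forall j, f X 0%N j == 0%N] = [forall j, c j == 0%N].
      by apply: eq_forallb => j; rewrite f0.
    by apply/seteqP; split=> X /=; rewrite e.
  exact: zclosed_const.
have -> : [set X : rp | ctest (v :: w) (f X)]%classic =
    [set X | (forall j, (v j + f X 1%N j <= c j)%N) /\ ctest w (nx v (f X))]%classic.
  apply/seteqP; split=> X /=.
    by move=> /andP[/forallP h ?]; split=> // j; rewrite -(f0 X).
  by move=> [h ->]; rewrite andbT; apply/forallP => j; rewrite f0.
apply: zclosed_and.
  apply: (@zclosedI CQ K d I (fun j => [set X : rp | (v j + f X 1%N j <= c j)%N]%classic)) => j.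
  have [h|h] := leqP (v j) (c j).
    by have := fk 0%N (c j - v j)%N j; congr zclosed; apply/seteqP; split=> X /=; lia.
  by have := @zclosed_const CQ K d False; congr zclosed; apply/seteqP; split=> X //=; lia.
apply: (IH _ (fun j => c j - v j)%N) => [X j|k m j]; first by rewrite /= f0.
have -> : [set X : rp | (nx v (f X) k.+1 j <= m)%N]%classic =
    [set X : rp | (f X k.+2 j <= m)%N /\ (f X k.+1 j <= m + v (st k.+1 j))%N]%classic.
  apply/seteqP; split=> X /=; rewrite geq_max leq_subLR addnC; first by move/andP.
  by move=> [-> ->].
by apply: zclosed_and; exact: fk.
Qed.

Lemma lfpoly_amb (x : arrow CQ) : lfpoly (fun X : rp => amb_map X x).
Proof.
apply: lfpoly_mxlf => j k.
have PA := polyfn_alg K d.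
apply: (funmx_mul PA); last exact: (funmx_const PA).
apply: (funmx_mul PA); first exact: (funmx_const PA).
by move=> j' k'; exact: polyfn_entry.
Qed.

Lemma lfpoly_pf i k : lfpoly (fun X : rp => pf (amb_map X) i k).
Proof.
elim: k i => [|k IH] i; first exact: lfpoly_const.
by apply: lfpoly_comp; [exact: IH|exact: lfpoly_amb].
Qed.

Lemma kerfam_amb i : kerfam (fun _ : rp => amb_sp K d i).
Proof.
have kl := @kerfam_lker CQ K d _ _ _ (@lfpoly_const CQ K d _ _
    (mxlf (cokermx (amb_in K d i)))).
apply: (kerfam_eq kl) => X v; rewrite memv_ker mxlfE ffunE mem_rowsp; exact: submxE.
Qed.

Lemma amb_sp_dim (X : rp) j : \dim (amb_sp K d j) = d j.
Proof. by have := qreal_dim j (amb_real X); rewrite [fam0 j]ffunE dimv0 add0n. Qed.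

Lemma zclosed_rho k m j : zclosed [set X : rp | (rho (amb_map X) (amb_sp K d) k j <= m)%N].
Proof.
have kc := kerfam_cap (kerfam_amb (st k j)) (kerfam_lker (lfpoly_pf (st k j) k)).
have := zclosed_kerfam (d (st k j) - m)%N kc; congr zclosed; apply/seteqP; split=> X /=;
  have := limg_ker_dim (pf (amb_map X) (st k j) k) (amb_sp K d (st k j));
  by rewrite /rho iter_radE (amb_sp_dim X) => <-; rewrite leq_subLR (addnC m) leq_add2l.
Qed.

End Closed.

Lemma cclosed (F : fieldType) w : zclosed (@Rset CQ F true w).
Proof.
have -> : @Rset CQ F true w =
    [set X : @rep CQ F (wdim w) | ctest w (rho (amb_map X) (amb_sp F (wdim w)))]%classic.
  apply/seteqP; split=> X /=; have sX := amb_stable X; have qX := amb_real X;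
    have h := Rset_flag true sX (fam0_stable _ _ _) qX.
    by move/h/(caflagP _ sX).
  by move/(caflagP _ sX)/h.
apply: (@zclosed_ctest F (wdim w) w _ (wdim w)) => [X j|k m j]; first exact: amb_sp_dim X j.
exact: zclosed_rho.
Qed.

Lemma cflag (F : fieldType) (V : vectType F) (A : arrow CQ -> 'End(V)) sp
    d (X : rep F d) (al : cycle_param n) w :
  stable (@src CQ) (@tgt CQ) A sp -> qreal A sp fam0 X -> pclass X al ->
  aflag (@src CQ) (@tgt CQ) A true w sp fam0 <-> ct w al.
Proof.
move=> ssp qX cX; rewrite /ct -(@eq_ctest n w (rho A sp)); first exact: caflagP.
by move=> k j _; exact: cclass_inv cX.
Qed.

Lemma ccount_p p : prime p -> forall (V : vectType 'F_p)
    (A : arrow CQ -> 'End(V)) sp d (X : rep 'F_p d) (al : cycle_param n) w,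
  stable (@src CQ) (@tgt CQ) A sp -> qreal A sp fam0 X -> pclass X al ->
  nfl (@src CQ) (@tgt CQ) A true w sp = ct w al %[mod p].
Proof.
move=> pp V A sp d X al w ssp qX cX; rewrite /ct -(@eq_ctest n w (rho A sp)).
  by have := ccount w ssp; rewrite card_Fp.
by move=> k j _; exact: cclass_inv cX.
Qed.

Theorem cycle_hall_case : @hall_case CQ (cycle_param n) true ct.
Proof.
have cex := list_ex cgood_ex cenc_class.
have ciso := list_iso cgood_iso cgood_inv cinv_add cinv_fam0 cd0_inj cenc_class cenc_inj.
split=> //.
- exact: cclass_dim.
- by move=> F d M; exact: (list_class cgood_iso cgood_ex cgood_ind cenc_class cenc_surj).
- exact: cnilpotent.
- exact: cclass_zero.
- apply: finite_classes => //; exact: cclass_dim.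
- exact: cflag.
- exact: ccount_p.
- exact: cword.
- exact: cclosed.
- move=> F w X RX; have sX := amb_stable X; have qX := amb_real X.
  apply/(nilpotentP sX (fam0_stable _ _ _) qX).
  exact: aflag_nilA ((Rset_flag true sX (fam0_stable _ _ _) qX).1 RX).
Qed.

End Strings.

Lemma cycle_case n : exists t, @hall_case (cyclic_quiver n) (cycle_param n) true t.
Proof. by exists (@ct n); exact: cycle_hall_case. Qed.

Theorem theorem1 (Q : quiver) (S : parametrisation Q) (HQ : dynkin_or_cycle S)
    (K : closedFieldType) (f : S -> S -> S -> {poly rat})
    (Hf : hall_polynomials f) :
  [/\ ext_closed Q K,
      graded_algebra (@gdim Q K) (@QM_mul Q K) (QM_one Q K),
      graded_algebra (@pdim Q S) (H0_mul f) (H0_one S)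
    & graded_algebra_iso (@gdim Q K) (@pdim Q S) (@QM_mul Q K) (H0_mul f)
        (QM_one Q K) (H0_one S) (@Psi Q S K)].
Proof.
case: HQ f Hf => [Q' hQ|n] f Hf.
  by have [t HC] := dynkin_case hQ; exact: hall_case_theorem HC K f Hf.
by have [t HC] := cycle_case n; exact: hall_case_theorem HC K f Hf.
Qed.
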